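(* Let $n,r\ge1$, let $W_r$ be the Weyl group of type $B_r$, let $\mathcal S^\jmath(n,r)$ and $\mathcal S^\imath(n,r)$ be the $q$-Schur algebras of types $B$ and $C$ over $\mathcal Z=\mathbb Z[t,t^{-1}]$ (defined in the context), let $\mathcal Z^\natural$ be the localization of $\mathcal Z$ inverting the bad primes for $W_r$, and put $\mathcal S^*(n,r)^\natural=\mathcal Z^\natural\otimes_{\mathcal Z}\mathcal S^*(n,r)$ for $*\in\{\jmath,\imath\}$. The algebras $\mathcal S^{\jmath}(n,r)^\natural$ and $\mathcal S^{\imath}(n,r)^\natural$ are standardly based algebras. In particular, their decomposition matrices (with respect to any local triple $(R,Q,F)$ with $R$ a $\mathcal Z^\natural$-algebra which is a regular local domain of Krull dimension $\le2$ and such that the base change of the algebra to $Q$ is semisimple) are unitriangular for suitable orderings of rows and columns.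
   Context: $q$-Schur algebras of type $B/C$. $W_r$ has Coxeter generators $S=\{s_1,\dots,s_r\}$ with Dynkin diagram of type $B_r$, $s_1,\dots,s_{r-1}$ generating the symmetric group $\mathfrak S_r$ in the usual way and $s_{r-1}s_r$ of order 4. $\mathcal H(W_r)$ is the Hecke algebra over $\mathcal Z$ with equal parameters: basis $\{T_w\}_{w\in W_r}$, $T_sT_w=T_{sw}$ if $sw>w$, $T_sT_w=t^2T_{sw}+(t^2-1)T_w$ if $sw<w$. $\Lambda(m,r)$ is the set of $(a_1,\dots,a_m)\in\mathbb N^m$ with sum $r$; $\Lambda_\jmath(n,r)=\Lambda(n+1,r)$ and $\Lambda_\imath(n,r)=\Lambda(n,r)$. For $\lambda\in\Lambda_*(n,r)$, $W_\lambda$ is the parabolic subgroup generated by $S\setminus\{s_{\lambda_1+\cdots+\lambda_i}:1\le i\le n\}$ (where $s_0$, if it appears, is ignored; in the case $*=\imath$ one always removes $s_r$), and $x_\lambda=\sum_{w\in W_\lambda}T_w$. Then $\mathcal S^*(n,r)=\mathrm{End}_{\mathcal H(W_r)}\big(\bigoplus_{\lambda\in\Lambda_*(n,r)}x_\lambda\mathcal H(W_r)\big)$. Bad primes. For an irreducible character $\chi$ of $\mathcal H(W_r)_{\mathbb Q(t)}$ the generic degree $\chi(1)\big(\sum_wt^{2\ell(w)}\big)\big/\sum_wt^{-2\ell(w)}\chi(T_w)\chi(T_{w^{-1}})$ has the form $\frac1mt^a\times$ (product of cyclotomic polynomials), $m$ a positive integer; bad primes are those dividing some $m$. Standardly based algebras.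 An algebra $\mathcal A$ over a commutative ring $\mathscr K$ is standardly based with respect to a poset $(\Lambda,\le)$ if: (a) for each $\lambda\in\Lambda$ there are index sets $I(\lambda),J(\lambda)$ and $\mathsf B^\lambda=\{a^\lambda_{i,j}:(i,j)\in I(\lambda)\times J(\lambda)\}\subseteq\mathcal A$ such that $\bigcup_\lambda\mathsf B^\lambda$ is a disjoint union and a $\mathscr K$-basis of $\mathcal A$; (b) for all $a\in\mathcal A$ and all $a^\lambda_{i,j}$, $a\,a^\lambda_{i,j}\equiv\sum_{i'}f_{i',\lambda}(a,i)a^\lambda_{i',j}$ and $a^\lambda_{i,j}a\equiv\sum_{j'}f^{o}_{\lambda,j'}(a,j)a^\lambda_{i,j'}$ modulo the span $\mathcal A^{>\lambda}$ of all $\mathsf B^\mu$, $\mu>\lambda$, with $f_{i',\lambda}(a,i),f^o_{\lambda,j'}(a,j)\in\mathscr K$ independent of $j$ and $i$ respectively. Decomposition matrices. A local triple $(R,Q,F)$ is a Noetherian local domain with its fraction field and residue field. For $R$ regular of Krull dimension $\le2$ and an $R$-free finite $R$-algebra $B$, every irreducible $B_Q$-module is $X_Q$ for an $R$-free finite $B$-module $X$, and for an irreducible $B_F$-module $N$ the multiplicity $[X_F:N]$ depends only on $X_Q$, $N$; these are the entries of the decomposition matrix (rows: irreducible $B_F$-modules; columns: irreducible $B_Q$-modules). A matrix $(d_{ij})$ is unitriangular if it has at least as many columns as rows, $d_{ij}=0$ for $i>j$, and $d_{ii}=1$ for each row index $i$. *)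

(* Defs.v *)
Set Warnings "-all".
From HB Require Import structures.
From mathcomp Require Import all_boot all_order all_algebra all_fingroup all_field.
From mathcomp Require Import boolp classical_sets functions.

Set Implicit Arguments.
Unset Strict Implicit.
Unset Printing Implicit Defensive.

Import GRing.Theory.
Local Open Scope ring_scope.
Notation "x %:F" := (tofrac x) : ring_scope.

Section WeylB.
Variable r : nat.

(* Signed permutations of {1, .., r}: (k, false) and (k, true) stand for
   k+1 and -(k+1).  The index k : 'I_r stands for s_{k+1}; thus the last
   index gives the sign change s_r, the only one without successor in 'I_r. *)
Definition signed_refl (k : 'I_r) : {perm 'I_r * bool} :=
  if (insub k.+1 : option 'I_r) is Some l then
    (tperm (k, false) (l, false) * tperm (k, true) (l, true))%g
  else tperm (k, false) (k, true).

Definition weylB : {group {perm 'I_r * bool}} :=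
  <<[set signed_refl k | k : 'I_r]>>%G.

Definition W : finGroupType := subg_of weylB.

Definition srefl (k : 'I_r) : W := subg weylB (signed_refl k).

(* Least length of an expression in the generators; every element of W has an
   expression of length less than #|W|. *)
Definition len (w : W) : nat :=
  find (fun k => [exists u : k.-tuple 'I_r, w == (\prod_(i <- u) srefl i)%g])
       (iota 0 #|W|).

End WeylB.

Definition is_basis (R : pzRingType) (V : lmodType R) (I : finType)
    (b : I -> V) : Prop :=
  forall x : V, exists! c : {ffun I -> R}, x = \sum_i c i *: b i.

Definition hecke_rule (r : nat) (R : comNzRingType) (t : R) (A : algType R)
    (T : W r -> A) : Prop :=
  forall (k : 'I_r) (w : W r),
    T (srefl k) * T w =
      if (len w < len (srefl k * w)%g)%N then T (srefl k * w)%g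
      else t ^+ 2 *: T (srefl k * w)%g + (t ^+ 2 - 1) *: T w.

Notation Qt := {fraction {poly int}}.

Definition tQ : Qt := ('X : {poly int})%:F.

Section BadPrimes.
Variable r : nat.

(* A matrix representation, of degree d + 1, of the Hecke algebra over Q(t),
   given by its values on the basis (T_w). *)
Definition hecke_repr (d : nat) (rho : W r -> 'M[Qt]_d.+1) : Prop :=
  rho 1%g = 1 /\ hecke_rule tQ rho.

(* The row vectors are the representation space, as in mxrepresentation. *)
Definition irreducible_repr (d : nat) (rho : W r -> 'M[Qt]_d.+1) : Prop :=
  hecke_repr rho /\
  forall U : 'M[Qt]_d.+1, (forall w, (U *m rho w <= U)%MS) ->
    U = 0 \/ row_full U.

Definition generic_degree (d : nat) (rho : W r -> 'M[Qt]_d.+1) : Qt :=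
  let chi w := \tr (rho w) in
  chi 1%g * (\sum_(w : W r) tQ ^+ (2 * len w)%N)
    / (\sum_(w : W r) tQ ^- (2 * len w)%N * chi w * chi (w^-1)%g).

Definition bad_prime (p : nat) : Prop :=
  prime p /\
  exists (d : nat) (rho : W r -> 'M[Qt]_d.+1) (m : nat) (a : int) (ks : seq nat),
    [/\ irreducible_repr rho, (0 < m)%N,
        generic_degree rho =
          m%:R^-1 * tQ ^ a * \prod_(k <- ks) ('Phi_k)%:F
      & (p %| m)%N].

Definition bad_primes : nat_pred := [pred p | `[< bad_prime p >]].

End BadPrimes.

Fact subf_div (F : fieldType) (a b d e : F) :
  d != 0 -> e != 0 -> (a * e - b * d) / (d * e) = a / d - b / e.
Proof. by move=> d0 e0; rewrite -(mulNr b e^-1) addf_div // mulNr. Qed.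

Section Laurent.
Variable pi : nat_pred.

(* The fractions f(t) / (m t^k) with f in Z[t] and all the prime factors of m
   in pi. *)
Definition laurent_pred : {pred Qt} := fun x =>
  `[< exists (f : {poly int}) (m k : nat),
        pi.-nat m /\ x = f%:F / (m%:R * tQ ^+ k) >].

Lemma tQ_neq0 : tQ != 0.
Proof. by rewrite /tQ tofrac_eq0 polyX_eq0. Qed.

Lemma natQt_neq0 m : (0 < m)%N -> m%:R != 0 :> Qt.
Proof.
move=> m0; rewrite -tofrac1 -tofracMn tofrac_eq0 -polyC1 -polyCMn polyC_eq0.
by rewrite natz; case: m m0.
Qed.

Lemma laurent_subring : subring_closed laurent_pred.
Proof.
split.
- by apply/asboolP; exists 1, 1%N, 0%N; rewrite tofrac1 mul1r expr0 mulr1 invr1.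
- move=> x y /asboolP [f [m [k [pm ->]]]] /asboolP [g [n [l [pn ->]]]].
  have [m0 n0] : (0 < m)%N /\ (0 < n)%N.
    by split; [case/andP: pm|case/andP: pn].
  apply/asboolP.
  exists (f * (n%:R * 'X^l) - g * (m%:R * 'X^k)), (m * n)%N, (k + l)%N.
  split; first by rewrite pnatM pm pn.
  have dm : (m%:R * tQ ^+ k : Qt) != 0.
    by rewrite mulf_neq0 ?natQt_neq0 ?expf_neq0 ?tQ_neq0.
  have dn : (n%:R * tQ ^+ l : Qt) != 0.
    by rewrite mulf_neq0 ?natQt_neq0 ?expf_neq0 ?tQ_neq0.
  have hX i j : (i%:R * 'X^j : {poly int})%:F = i%:R * tQ ^+ j.
    by rewrite tofracM tofracXn -tofrac1 -tofracMn.
  rewrite -(subf_div _ _ dm dn) tofracB (tofracM f) (tofracM g) !hX.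
  by congr (_ / _); rewrite natrM exprD mulrACA.
- move=> x y /asboolP [f [m [k [pm ->]]]] /asboolP [g [n [l [pn ->]]]].
  apply/asboolP; exists (f * g), (m * n)%N, (k + l)%N.
  split; first by rewrite pnatM pm pn.
  by rewrite (tofracM f) mulf_div; congr (_ / _); rewrite natrM exprD mulrACA.
Qed.

HB.instance Definition _ :=
  GRing.isSubringClosed.Build Qt laurent_pred laurent_subring.

Record laurent_loc :=
  LaurentLoc { laurent_val :> Qt; _ : laurent_val \in laurent_pred }.
HB.instance Definition _ := [isSub for laurent_val].
HB.instance Definition _ := [Choice of laurent_loc by <:].
HB.instance Definition _ := [SubChoice_isSubComNzRing of laurent_loc by <:].

End Laurent.

Definition laurent : comNzRingType := laurent_loc pred0.

Definition Znat (r : nat) : comNzRingType := laurent_loc (bad_primes r).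

Fact tZ_subproof : laurent_pred pred0 tQ.
Proof.
by apply/asboolP; exists 'X, 1%N, 0%N; split=> //; rewrite expr0 mulr1 divr1.
Qed.

Definition tZ : laurent := LaurentLoc tZ_subproof.

Section LaurentInclusion.
Variable pi : nat_pred.

Fact laurent_incl_subproof (x : laurent) : laurent_pred pi (laurent_val x).
Proof.
case: x => x /= /asboolP [f [m [k [pm ->]]]]; apply/asboolP; exists f, m, k.
by split=> //; apply: sub_in_pnat pm => p _; rewrite !inE.
Qed.

Definition laurent_incl (x : laurent) : laurent_loc pi :=
  LaurentLoc (laurent_incl_subproof x).

Fact laurent_incl_is_zmod_morphism : zmod_morphism laurent_incl.
Proof. by move=> x y; apply: val_inj; rewrite rmorphB. Qed.

Fact laurent_incl_is_monoid_morphism : monoid_morphism laurent_incl.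
Proof.
by split=> [|x y]; apply: val_inj; rewrite ?rmorph1 ?rmorphM.
Qed.

HB.instance Definition _ := GRing.isZmodMorphism.Build laurent (laurent_loc pi)
  laurent_incl laurent_incl_is_zmod_morphism.
HB.instance Definition _ := GRing.isMonoidMorphism.Build laurent (laurent_loc pi)
  laurent_incl laurent_incl_is_monoid_morphism.

End LaurentInclusion.

(* These two properties determine the algebra and the T_w uniquely up to a
   unique isomorphism; they imply T 1 = 1. *)
Record heckeAlg (r : nat) := HeckeAlg {
  hecke_sort :> algType laurent;
  heckeT : W r -> hecke_sort;
  heckeT_basis : is_basis heckeT;
  heckeT_mul : hecke_rule tZ heckeT }.

Variant schur_type := TypeJ | TypeI.

Section Schur.
Variables (st : schur_type) (n r : nat) (n_gt0 : (0 < n)%N) (H : heckeAlg r).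

Definition nparts : nat := if st is TypeJ then n.+1 else n.

Definition comps : predArgType :=
  {a : {ffun 'I_nparts -> 'I_r.+1} | \sum_(i < nparts) a i == r :> nat}.
HB.instance Definition _ := Finite.on comps.

(* The indices of the generators s_{a_1 + .. + a_i}, 1 <= i <= n; generators
   are numbered from 0 in the code, whence k.+1. *)
Definition removed (a : comps) : {set 'I_r} :=
  [set k : 'I_r | [exists i : 'I_n,
     k.+1 == \sum_(j < nparts | (j <= i)%N) val a j :> nat]].

Definition parabolic (a : comps) : {group W r} :=
  <<[set srefl k | k in ~: removed a]>>%G.

Definition xelt (a : comps) : H := \sum_(w in parabolic a) heckeT H w.

(* The right H-module given by the direct sum of the right ideals x_a H. *)
Definition tens_pred : {pred {ffun comps -> H}} := fun v =>
  `[< forall a, exists h : H, v a = xelt a * h >].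

Fact tens_submod : submod_closed tens_pred.
Proof.
split; first by apply/asboolP => a; exists 0; rewrite ffunE mulr0.
move=> z u v /asboolP hu /asboolP hv; apply/asboolP => a.
have [h eu] := hu a; have [h' ev] := hv a.
by exists (z *: h + h'); rewrite !ffunE eu ev mulrDr scalerAr.
Qed.

HB.instance Definition _ :=
  GRing.isSubmodClosed.Build laurent {ffun comps -> H} tens_pred tens_submod.

Record tens := Tens { tens_val :> {ffun comps -> H}; _ : tens_val \in tens_pred }.
HB.instance Definition _ := [isSub for tens_val].
HB.instance Definition _ := [Choice of tens by <:].
HB.instance Definition _ := [SubChoice_isSubLmodule of tens by <:].

Fact tens_act_subproof (v : tens) (h : H) :
  [ffun a => tens_val v a * h] \in tens_pred.
Proof.
case: v => v /= /asboolP hv; apply/asboolP => a; have [g eg] := hv a.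
by exists (g * h); rewrite ffunE eg mulrA.
Qed.

Definition tens_act (v : tens) (h : H) : tens := Tens (tens_act_subproof v h).

(* Additive maps commuting with H; they commute with Z[t, t^-1], which acts
   through H. *)
Definition schur_pred : {pred tens -> tens} := fun f =>
  `[< (forall u v, f (u + v) = f u + f v) /\
      (forall v h, f (tens_act v h) = tens_act (f v) h) >].

Lemma tens_actE v h a : tens_act v h a = v a * h.
Proof. by rewrite ffunE. Qed.

Lemma tens_valD u v a : (u + v : tens) a = u a + v a.
Proof. by rewrite -[tens_val _]/(val (u + v)) raddfD ffunE. Qed.

Lemma tens_valZ z v a : (z *: v : tens) a = z *: v a.
Proof. by rewrite -[tens_val _]/(val (z *: v)) linearZ ffunE. Qed.

Lemma tensP (u v : tens) : (forall a, u a = v a) -> u = v.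
Proof. by move=> e; apply/val_inj/ffunP. Qed.

Lemma tens_actDl u v h : tens_act (u + v) h = tens_act u h + tens_act v h.
Proof. by apply: tensP => a; rewrite tens_valD !tens_actE tens_valD mulrDl. Qed.

Lemma tens_actZl z v h : tens_act (z *: v) h = z *: tens_act v h.
Proof. by apply: tensP => a; rewrite tens_valZ !tens_actE tens_valZ scalerAl. Qed.

Lemma tens_act_scalar z v : tens_act v (z%:A) = z *: v.
Proof. by apply: tensP => a; rewrite tens_valZ tens_actE -scalerAr mulr1. Qed.

Lemma tens_act0 h : tens_act 0 h = 0.
Proof.
apply: tensP => a; rewrite tens_actE -[tens_val 0]/(val (0 : tens)) raddf0.
by rewrite ffunE mul0r.
Qed.

Fact schur_submod : submod_closed schur_pred.
Proof.
split.
  by apply/asboolP; split=> [u v|v h]; rewrite ?tens_act0 // addr0.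
move=> z f g /asboolP [fD fH] /asboolP [gD gH]; apply/asboolP; split=> [u v|v h].
  rewrite -[LHS]/(z *: f (u + v) + g (u + v)) fD gD scalerDr addrACA.
  by [].
by rewrite -[LHS]/(z *: f (tens_act v h) + g (tens_act v h)) fH gH
           -tens_actZl -tens_actDl.
Qed.

HB.instance Definition _ :=
  GRing.isSubmodClosed.Build laurent (tens -> tens) schur_pred schur_submod.

(* The bound on n makes the algebra nonzero, as required by nzRingType. *)
Record schur_alg (n_pos : (0 < n)%N) :=
  SchurAlg { schur_fun :> tens -> tens; _ : schur_fun \in schur_pred }.
HB.instance Definition _ n_pos := [isSub for @schur_fun n_pos].
HB.instance Definition _ n_pos := [Choice of schur_alg n_pos by <:].
HB.instance Definition _ n_pos := [SubChoice_isSubLmodule of schur_alg n_pos by <:].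
Local Notation schurAlg := (schur_alg n_gt0).

Lemma schurD (f : schurAlg) : {morph f : u v / u + v}.
Proof. by case: f => f /= /asboolP []. Qed.

Lemma schur_act (f : schurAlg) v h : f (tens_act v h) = tens_act (f v) h.
Proof. by case: f => f /= /asboolP []. Qed.

Lemma schurZ (f : schurAlg) z v : f (z *: v) = z *: f v.
Proof. by rewrite -tens_act_scalar schur_act tens_act_scalar. Qed.

Lemma schurP (f g : schurAlg) : f =1 g -> f = g.
Proof. by move=> e; apply/val_inj/funext. Qed.

Lemma schur_addE (f g : schurAlg) v : (f + g : schurAlg) v = f v + g v.
Proof. by []. Qed.

Lemma schur_scaleE z (f : schurAlg) v : (z *: f : schurAlg) v = z *: f v.
Proof. by []. Qed.

Fact schur_one_subproof : (id : tens -> tens) \in schur_pred.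
Proof. by apply/asboolP. Qed.

Fact schur_mul_subproof (f g : schurAlg) : (f \o g : tens -> tens) \in schur_pred.
Proof. by apply/asboolP; split=> *; rewrite /= ?schurD ?schur_act. Qed.

Definition schur_one : schurAlg := SchurAlg n_gt0 schur_one_subproof.
Definition schur_mul (f g : schurAlg) : schurAlg :=
  SchurAlg n_gt0 (schur_mul_subproof f g).

Fact schur_mulA : associative schur_mul.
Proof. by move=> f g h; apply: schurP. Qed.
Fact schur_mul1 : left_id schur_one schur_mul.
Proof. by move=> f; apply: schurP. Qed.
Fact schur_mulr1 : right_id schur_one schur_mul.
Proof. by move=> f; apply: schurP. Qed.
Fact schur_mulDl : left_distributive schur_mul +%R.
Proof. by move=> f g h; apply: schurP. Qed.
Fact schur_mulDr : right_distributive schur_mul +%R.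
Proof. by move=> f g h; apply: schurP => v; rewrite /= schurD. Qed.

Lemma nparts_gt0 : (0 < nparts)%N.
Proof. by rewrite /nparts; case: st. Qed.

Lemma comps_inhabited : comps.
Proof.
exists [ffun i : 'I_nparts => if i == 0 :> nat then ord_max else ord0].
rewrite (bigD1 (Ordinal nparts_gt0)) //= big1 ?ffunE ?addn0 /= ?modn_small // => i.
by rewrite ffunE -val_eqE /=; case: ifP.
Qed.

Lemma xelt_neq0 a : xelt a != 0.
Proof.
apply/eqP => e0; have [c [_ uc]] := heckeT_basis (0 : H).
have e (c' : {ffun W r -> laurent}) : 0 = \sum_i c' i *: heckeT H i -> c = c' by apply: uc.
have : [ffun=> 0] = [ffun x => (x \in parabolic a)%:R] :> {ffun W r -> laurent}.
  rewrite -(e [ffun=> 0]); last first.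
    by rewrite big1 // => w _; rewrite ffunE scale0r.
  apply: e; transitivity (xelt a); first by rewrite e0.
  rewrite /xelt big_mkcond; apply: eq_bigr => w _.
  by rewrite ffunE; case: ifP; rewrite ?scale1r ?scale0r.
move/ffunP/(_ 1%g).
by rewrite !ffunE group1 => /eqP; rewrite eq_sym oner_eq0.
Qed.

Fact schur_one_neq0 : schur_one != 0.
Proof.
have a := comps_inhabited.
have vP : [ffun b => xelt b] \in tens_pred.
  by apply/asboolP => b; exists 1; rewrite ffunE mulr1.
have z0 : (0 : schurAlg) (Tens vP) a = 0.
  by rewrite -[LHS]/(val (0 : tens) a) raddf0 ffunE.
apply/eqP => /(congr1 (fun f : schurAlg => f (Tens vP) a)).
by rewrite z0 /= ffunE => /eqP; apply/negP/xelt_neq0.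
Qed.

HB.instance Definition _ := GRing.Zmodule_isNzRing.Build schurAlg
  schur_mulA schur_mul1 schur_mulr1 schur_mulDl schur_mulDr schur_one_neq0.

Fact schur_scaleAl (z : laurent) (f g : schurAlg) : z *: (f * g) = (z *: f) * g.
Proof. by apply: schurP. Qed.
Fact schur_scaleAr (z : laurent) (f g : schurAlg) : z *: (f * g) = f * (z *: g).
Proof. by apply: schurP => v; rewrite /= schurZ. Qed.

HB.instance Definition _ :=
  GRing.Lmodule_isLalgebra.Build laurent schurAlg schur_scaleAl.
HB.instance Definition _ :=
  GRing.Lalgebra_isAlgebra.Build laurent schurAlg schur_scaleAr.

End Schur.

Section StandardBasis.
Variables (K : comNzRingType) (A : algType K).
Variables (d : Order.disp_t) (L : finPOrderType d) (I J : L -> finType).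
Variable b : forall l, I l -> J l -> A.

Definition std_index : finType := {l : L & (I l * J l)%type}.

Definition std_elt (u : std_index) : A := b (tagged u).1 (tagged u).2.

Definition in_above (l : L) (x : A) : Prop :=
  exists c : std_index -> K,
    x = \sum_(u : std_index | (l < tag u)%O) c u *: std_elt u.

Definition standard_basis : Prop :=
  [/\ is_basis std_elt,
      forall l, exists f : A -> I l -> I l -> K, forall a i j,
        in_above l (a * b i j - \sum_(i' : I l) f a i' i *: b i' j)
    & forall l, exists f : A -> J l -> J l -> K, forall a i j,
        in_above l (b i j * a - \sum_(j' : J l) f a j j' *: b i j')].

End StandardBasis.

(* The algebras considered have finite rank, so only finite index sets and
   finite posets occur. *)
Definition standardly_based (K : comNzRingType) (A : algType K) : Prop :=
  exists (d : Order.disp_t) (L : finPOrderType d) (I J : L -> finType)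
    (b : forall l, I l -> J l -> A), standard_basis b.

Section Modules.
Variable A : pzRingType.

Definition submodule (M : lmodType A) (P : set M) : Prop :=
  P 0 /\ forall (a : A) (x y : M), P x -> P y -> P (a *: x + y).

Definition irreducible_module (M : lmodType A) : Prop :=
  (exists x : M, x != 0) /\
  forall P : set M, submodule P -> P = [set 0]%classic \/ P = setT.

Definition semisimple_module (M : lmodType A) : Prop :=
  forall P : set M, submodule P ->
    exists P' : set M, [/\ submodule P', (P `&` P' = [set 0])%classic
      & forall x, exists y z, [/\ P y, P' z & x = y + z]].

Definition module_iso (M N : lmodType A) : Prop :=
  exists f : {linear M -> N}, bijective f.

(* P'/P is isomorphic to N: a map inducing a linear surjection P' -> N with
   kernel P; its values outside P' are irrelevant. *)
Definition subquotient_iso (M : lmodType A) (P P' : set M) (N : lmodType A) :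
    Prop :=
  exists g : M -> N,
    [/\ forall (a : A) (x y : M), P' x -> P' y ->
          g (a *: x + y) = a *: g x + g y,
        forall z, exists2 x, P' x & g x = z
      & forall x, P' x -> (g x = 0 <-> P x)].

Definition composition_series (M : lmodType A) (k : nat) (c : nat -> set M) :
    Prop :=
  [/\ c 0%N = [set 0]%classic, c k = setT,
      forall i, (i <= k)%N -> submodule (c i)
    & forall i, (i < k)%N ->
        [/\ (c i `<=` c i.+1)%classic, c i <> c i.+1
          & forall P, submodule P ->
              (c i `<=` P)%classic -> (P `<=` c i.+1)%classic ->
              P = c i \/ P = c i.+1]].

Definition multiplicity (M N : lmodType A) (m : nat) : Prop :=
  exists (k : nat) (c : nat -> set M), composition_series k c /\
    m = #|[set i : 'I_k | `[< subquotient_iso (c i) (c i.+1) N >]]|.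

Definition irreducibles (p : nat) (N : 'I_p -> lmodType A) : Prop :=
  [/\ forall i, irreducible_module (N i),
      forall i j, module_iso (N i) (N j) -> i = j
    & forall M : lmodType A, irreducible_module M ->
        exists i, module_iso M (N i)].

End Modules.

Definition semisimple_ring (A : pzRingType) : Prop := semisimple_module A^o.

(* i : M -> M' exhibits M' as the tensor product of A' and M over A. *)
Definition extension_of_scalars (A A' : pzRingType) (f : {rmorphism A -> A'})
    (M : lmodType A) (M' : lmodType A') (i : M -> M') : Prop :=
  linear_for (f \; *:%R) i /\
  forall (N : lmodType A') (g : M -> N), linear_for (f \; *:%R) g ->
    exists! h : M' -> N, linear h /\ forall x, h (i x) = g x.

Definition algebra_base_change (K K' : comNzRingType) (f : {rmorphism K -> K'})
    (A : algType K) (A' : algType K') (i : {rmorphism A -> A'}) : Prop :=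
  extension_of_scalars f (i : A -> A').

Section CommutativeAlgebra.
Variable R : comNzRingType.

Definition ideal (P : set R) : Prop :=
  P 0 /\ forall a x y : R, P x -> P y -> P (a * x + y).

Definition generates (k : nat) (g : 'I_k -> R) (P : set R) : Prop :=
  forall x, P x <-> exists c : 'I_k -> R, x = \sum_i c i * g i.

Definition noetherian : Prop :=
  forall P, ideal P -> exists (k : nat) (g : 'I_k -> R), generates g P.

Definition prime_ideal (P : set R) : Prop :=
  [/\ ideal P, ~ P 1 & forall x y, P (x * y) -> P x \/ P y].

Definition maximal_ideal (P : set R) : Prop :=
  [/\ ideal P, ~ P 1
    & forall P', ideal P' -> (P `<=` P')%classic -> P' = P \/ P' = setT].

Definition prime_chain (k : nat) : Prop :=
  exists P : 'I_k.+1 -> set R, (forall i, prime_ideal (P i)) /\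
    forall i j : 'I_k.+1, (i < j)%N -> (P i `<=` P j)%classic /\ P i <> P j.

Definition krull_dim (k : nat) : Prop := prime_chain k /\ ~ prime_chain k.+1.

Definition local_ring_at (m : set R) : Prop :=
  maximal_ideal m /\ forall m', maximal_ideal m' -> m' = m.

Definition regular_local (m : set R) (k : nat) : Prop :=
  [/\ noetherian, local_ring_at m, krull_dim k
    & exists g : 'I_k -> R, generates g m].

Definition residue_field (m : set R) (F : fieldType) (pi : {rmorphism R -> F}) :
    Prop :=
  (forall y, exists x, pi x = y) /\ forall x, pi x = 0 <-> m x.

End CommutativeAlgebra.

(* As a B-module, X is free of finite rank over R; R acts through B. *)
Definition free_over_base (R : comNzRingType) (B : algType R) (X : lmodType B) :
    Prop :=
  exists (k : nat) (e : 'I_k -> X),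
    forall x, exists! c : {ffun 'I_k -> R}, x = \sum_i (c i)%:A *: e i.

(* Here BQ and BF are the base changes of B to Q and F.  For an R-free B-module
   X one has Q (x)_R X = BQ (x)_B X, whence the scalar extensions along
   B -> BQ, and similarly for F. *)
Definition decomposition_number (R : comNzRingType) (B : algType R)
    (BQ BF : pzRingType) (jQ : {rmorphism B -> BQ}) (jF : {rmorphism B -> BF})
    (N : lmodType BF) (V : lmodType BQ) (m : nat) : Prop :=
  (exists (X : lmodType B) (i : X -> V),
      free_over_base X /\ extension_of_scalars jQ i) /\
  forall (X : lmodType B) (i : X -> V) (XF : lmodType BF) (j : X -> XF),
    free_over_base X -> extension_of_scalars jQ i ->
    extension_of_scalars jF j -> multiplicity XF N m.

Definition decomposition_matrix (R : comNzRingType) (B : algType R)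
    (BQ BF : pzRingType) (jQ : {rmorphism B -> BQ}) (jF : {rmorphism B -> BF})
    (p q : nat) (D : 'M[nat]_(p, q)) : Prop :=
  exists (N : 'I_p -> lmodType BF) (V : 'I_q -> lmodType BQ),
    [/\ irreducibles N, irreducibles V
      & forall i j, decomposition_number jQ jF (N i) (V j) (D i j)].

Definition unitriangular (p q : nat) (D : 'M[nat]_(p, q)) : Prop :=
  (p <= q)%N /\
  forall (i : 'I_p) (j : 'I_q), ((j < i)%N -> D i j = 0%N) /\ (i = j :> nat -> D i j = 1%N).

(* Main.v *)
(* The bad primes play no role: the algebra is standardly based over Z[t, t^-1]
   already, and standard bases survive base change.  As for the (Q, q)-Schur
   algebras of Dipper, James and Mathas, the Hecke algebra has a Murphy basis
   m_st = X_s m_lambda X_t^*, with s and t standard bitableaux of shape lambda,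
   coded by ballot words: straightening by Garnir relations in the ideals of the
   products M_f u_a of a q-permutation element by Jucys-Murphy factors shows that
   the m_st span, and going up and down in Young's lattice that they are 2^r r!.  A homomorphism
   x_mu H -> x_nu H is an element z of H with T_k z = q z for k in J_nu and
   T_k z^* = q z^* for k in J_mu; the sums of the m_st over the orbits of
   semistandard s and t form a basis of these, and give the standard basis.

   Over a field, each simple module is the quotient of a cell module by the
   radical of its bilinear form beta, and b^lambda_ij / beta acts on it with the
   simple eigenvalue 1.  The multiplicity of the eigenvalue 1 is additive in exact
   sequences, and, being read off characteristic polynomials, does not depend on
   the lattice chosen in a module over the fraction field.  Hence it determines
   the composition multiplicities through a unitriangular system. *)

Require Import Defs.
From HB Require Import structures.
From mathcomp Require Import all_boot all_order all_algebra all_fingroup all_field.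
From mathcomp Require Import boolp classical_sets functions.
From mathcomp Require Import zify ring.

Set Implicit Arguments.
Unset Strict Implicit.
Unset Printing Implicit Defensive.
Import GRing.Theory.

(** * Lengths of signed permutations *)

(** A word f stands for the coset sum [M f], on which every generator but the sign change acts by
    exchanging neighbouring letters. The obstacle is the sign change T_0: its effect depends on the
    last letter. If that letter is in the second component, it is moved to the left of the a letters
    of the first, where T_0 becomes the Jucys-Murphy element JM_a up to invertible factors; then
    uu_a JM_a = uu_(a+1) - q^a uu_a separates a term of a higher ideal.

    Instead of dominance, two integers guide the inductions: [key], which depends on the content,
    and [phi], which compares words of one content.

    Independence of the Murphy elements comes from counting: over a commutative ring a spanning
    family no longer than a basis is a basis. For the semistandard sums, the lowest coefficient z of
    an invariant element at a word that is not semistandard satisfies q z = 0 or (1 + q) z = 0; with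
    q = t^2 both force z = 0.

    The eigenvalue 1 is counted as a root of the characteristic polynomial because a trace would
    show multiplicities only modulo the characteristic of the residue field. *)

Section Coxeter.
Local Open Scope nat_scope.
Variable r : nat.
Implicit Types (w v d : W r) (i j k : 'I_r).

Definition flipx (x : 'I_r * bool) : 'I_r * bool := (x.1, ~~ x.2).

Lemma flipxK : involutive flipx.
Proof. by case=> i b; rewrite /flipx /= negbK. Qed.

Lemma signed_refl_A k k1 x : k1 = k.+1 :> nat ->
  signed_refl k x = (tperm k k1 x.1, x.2).
Proof.
move=> hk; rewrite /signed_refl; case: insubP => [l _ hl|]; last by rewrite -hk ltn_ord.
have -> : l = k1 by apply: val_inj; rewrite /= hl hk.
have E c (j j' i : 'I_r) b : tperm (j, c) (j', c) (i, b) =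
    (if b == c then tperm j j' i else i, b) :> 'I_r * bool.
  case: (eqVneq b c) => [->|bc].
    by case: (tpermP j j' i) => [->|->|/eqP h1 /eqP h2];
      rewrite ?tpermL ?tpermR // tpermD // xpair_eqE eqxx andbT eq_sym.
  by rewrite tpermD // xpair_eqE eq_sym [c == b]eq_sym (negbTE bc) andbF.
by case: x => i []; rewrite permM !E /=.
Qed.

Lemma signed_refl_B k x : k.+1 = r ->
  signed_refl k x = (x.1, (x.1 == k) (+) x.2).
Proof.
move=> hk; rewrite /signed_refl; case: insubP => [l|_]; first by rewrite hk ltnn.
case: x => i b /=; case: tpermP => [[-> ->]|[-> ->]|] /=; rewrite ?eqxx //.
by case: eqP => [->|]; case: b.
Qed.

Lemma next_ord k : {k1 : 'I_r | k1 = k.+1 :> nat} + {k.+1 = r}.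
Proof.
case: (ltnP k.+1 r) => h; first by left; exists (Ordinal h).
by right; apply/eqP; rewrite eqn_leq h ltn_ord.
Qed.

Lemma weyl_flip w x : sgval w (flipx x) = flipx (sgval w x).
Proof.
have flip_inj : injective flipx by exact: inv_inj flipxK.
suff /fintype.subsetP sub : weylB r \subset 'C[perm flip_inj]%g.
  have /cent1P /permP/(_ x) := sub _ (subgP w).
  by rewrite !permM !permE.
rewrite gen_subG; apply/fintype.subsetP => _ /imsetP[k _ ->].
apply/cent1P/permP => -[i b]; rewrite !permM !permE.
case: (next_ord k) => [[k1 hk]|hk]; first by rewrite !(signed_refl_A _ hk).
by rewrite !(signed_refl_B _ hk) /= addbN.
Qed.

(** In this order every generator, the sign change included, exchanges neighbouring positions (and
    their mirror images). *)
Definition pos (x : 'I_r * bool) : nat := if x.2 then (r.*2 - x.1).-1 else x.1.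

Lemma pos_lt x : pos x < r.*2.
Proof. by case: x => -[i hi] []; rewrite /pos /=; lia. Qed.

Lemma pos_flip x : pos (flipx x) = (r.*2 - pos x).-1.
Proof. by case: x => -[i hi] []; rewrite /pos /=; lia. Qed.

Lemma pos_inj : injective pos.
Proof.
case=> [[i hi] b] [[j hj] c]; rewrite /pos /= => h.
have e : b = c by case: b c h => [] [] /= h //; lia.
by subst c; congr (_, _); apply: val_inj; case: b h => /= h; lia.
Qed.

(* The place of w (i + 1) in the sequence 1, .., r, -r, .., -1. *)
Definition P w i : nat := pos (sgval w (i, false)).

Lemma P_lt w i : P w i < r.*2. Proof. exact: pos_lt. Qed.

Lemma P_inj w : injective (P w).
Proof. by move=> i j /pos_inj /perm_inj []. Qed.

(** Places with sum [r.*2.-1] carry opposite letters, and w(i) = -w(j) is impossible for letters of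
    positive index. *)
Lemma P_neq w i j : P w i + P w j != r.*2.-1.
Proof.
apply/eqP => h.
have e : pos (sgval w (i, false)) = pos (sgval w (j, true)).
  rewrite (_ : (j, true) = flipx (j, false)) // weyl_flip pos_flip.
  by have := P_lt w j; rewrite /P in h *; lia.
by move/pos_inj/perm_inj: e.
Qed.

Lemma eq_P w v : P w =1 P v -> w = v.
Proof.
move=> h; apply: val_inj; apply/permP => -[i b].
have e : sgval w (i, false) = sgval v (i, false) by apply: pos_inj; exact: h.
by case: b => //; rewrite -[(i, true)]/(flipx (i, false)) !weyl_flip e.
Qed.

Lemma P1 i : P 1%g i = i.
Proof. by rewrite /P /= perm1. Qed.

Lemma sgval_mul w v : sgval (w * v)%g = (sgval w * sgval v)%g.
Proof. by []. Qed.

Lemma P_srefl_A k k1 w i : k1 = k.+1 :> nat -> P (srefl k * w)%g i = P w (tperm k k1 i).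
Proof. by move=> hk; rewrite /P sgval_mul permM subgK ?mem_gen ?imset_f // (signed_refl_A _ hk). Qed.

Lemma P_srefl_B k w i : k.+1 = r ->
  P (srefl k * w)%g i = if i == k then (r.*2 - P w k).-1 else P w i.
Proof.
move=> hk; rewrite /P sgval_mul permM subgK ?mem_gen ?imset_f // (signed_refl_B _ hk) /=.
case: eqP => [->|] //=; rewrite -[(k, true)]/(flipx (k, false)).
by rewrite weyl_flip pos_flip.
Qed.

Definition Up k w : bool :=
  if insub k.+1 is Some k1 then P w k < P w k1 else P w k < r.

Lemma UpA k k1 w : k1 = k.+1 :> nat -> Up k w = (P w k < P w k1).
Proof.
move=> hk; rewrite /Up; case: insubP => [l _ hl|]; last by rewrite -hk ltn_ord.
by congr (_ < P w _); apply: val_inj; rewrite /= hl hk.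
Qed.

Lemma UpB k w : k.+1 = r -> Up k w = (P w k < r).
Proof. by move=> hk; rewrite /Up; case: insubP => [l|//]; rewrite hk ltnn. Qed.

Lemma srefl2 k : (srefl k * srefl k = 1)%g.
Proof.
apply: eq_P => i; rewrite P1.
case: (next_ord k) => [[k1 hk]|hk].
  by rewrite (P_srefl_A _ _ hk) -[srefl k]mulg1 (P_srefl_A _ _ hk) tpermK P1.
rewrite (P_srefl_B _ _ hk) -[srefl k]mulg1 !(P_srefl_B _ _ hk) eqxx !P1; case: eqP => // ->.
by have := ltn_ord k; lia.
Qed.

Lemma sreflK k w : (srefl k * (srefl k * w) = w)%g.
Proof. by rewrite mulgA srefl2 mul1g. Qed.

Lemma sreflV k : ((srefl k)^-1 = srefl k)%g.
Proof. by apply/eqP; rewrite eq_invg_mul srefl2. Qed.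

Lemma Up_srefl k w : Up k (srefl k * w)%g = ~~ Up k w.
Proof.
case: (next_ord k) => [[k1 hk]|hk].
  rewrite !(UpA _ hk) !(P_srefl_A _ _ hk) tpermL tpermR.
  have : P w k != P w k1 by apply/eqP => /P_inj e; move: hk; rewrite e; lia.
  by lia.
by rewrite !(UpB _ hk) (P_srefl_B _ _ hk) eqxx; have := P_lt w k; lia.
Qed.

(** An exchange of neighbours preserves the order of all pairs of indices except the pair exchanged.
    All inversion counts of the proof change according to this identity. *)
Lemma sum_lt_tperm (F : 'I_r -> 'I_r -> nat) k k1 : k1 = k.+1 :> nat ->
  \sum_(i < r) \sum_(j < r) (i < j) * F (tperm k k1 i) (tperm k k1 j) + F k k1 =
  \sum_(i < r) \sum_(j < r) (i < j) * F i j + F k1 k.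
Proof.
move=> hk; pose t := tperm k k1.
have tinv : involutive t by exact: tpermK.
rewrite (reindex_inj (inv_inj tinv)) /=.
under eq_bigr do rewrite (reindex_inj (inv_inj tinv)) /=.
under eq_bigr => i _ do under eq_bigr => j _ do rewrite !tinv.
rewrite !pair_bigA /=.
have kk1 : k != k1 by apply/eqP => e; move: hk; rewrite e; lia.
rewrite (bigD1 (k, k1)) //= (bigD1 (k1, k)) /=; last by rewrite xpair_eqE negb_and eq_sym kk1.
rewrite [in RHS](bigD1 (k, k1)) //= [in RHS](bigD1 (k1, k)) /=;
  last by rewrite xpair_eqE negb_and eq_sym kk1.
rewrite tpermL tpermR.
have -> : (k < k1) by rewrite hk.
have -> : (k1 < k) = false by rewrite hk; lia.
rewrite (eq_bigr (fun p : 'I_r * 'I_r => (p.1 < p.2) * F p.1 p.2)); first by lia.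
case=> [i j] /=; rewrite !xpair_eqE => hij; congr (nat_of_bool _ * _).
have vE (x y : 'I_r) : (x == y) = (x == y :> nat) by [].
rewrite /t; case: tpermP => [ei|ei|/eqP ei1 /eqP ei2]; case: tpermP => [ej|ej|/eqP ej1 /eqP ej2];
  move: hij; rewrite ?ei ?ej ?hk !vE ?hk; try (move: ei1 ei2; rewrite !vE hk);
  try (move: ej1 ej2; rewrite !vE hk); lia.
Qed.

(** The inversions of type B: since [r.*2.-1 - P w j] is the place of -w(j), the second term counts
    the inversions of i with -j, and the last sum those of i with -i. *)
Definition ell w : nat :=
  \sum_(i < r) \sum_(j < r) (i < j) * ((P w j < P w i) + (r.*2 <= P w i + P w j))
  + \sum_(i < r) (r <= P w i).

Lemma ell_srefl k w : ell (srefl k * w)%g + ~~ Up k w = ell w + Up k w.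
Proof.
case: (next_ord k) => [[k1 hk]|hk].
  rewrite (UpA _ hk) /ell.
  pose F (i j : 'I_r) : nat := (P w j < P w i) + (r.*2 <= P w i + P w j).
  have -> : \sum_i (r <= P (srefl k * w)%g i) = \sum_i (r <= P w i).
    by rewrite [RHS](reindex_inj (@perm_inj _ (tperm k k1))); apply: eq_bigr => i _;
      rewrite (P_srefl_A _ _ hk).
  have E := sum_lt_tperm F hk.
  rewrite (eq_bigr (fun i => \sum_(j < r) (i < j) * F (tperm k k1 i) (tperm k k1 j))); last first.
    by move=> i _; apply: eq_bigr => j _; rewrite !(P_srefl_A _ _ hk).
  rewrite -/(\sum_(i < r) \sum_(j < r) (i < j) * F i j).
  move: E; set S1 := \sum_(i < r) \sum_(j < r) (i < j) * F (tperm k k1 i) _.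
  set S2 := \sum_(i < r) \sum_(j < r) (i < j) * F i j; move: S1 S2 (\sum_(i < r) _) => S1 S2 S3.
  rewrite /F [P w k1 + P w k]addnC.
  have : P w k != P w k1 by apply/eqP => /P_inj e; move: hk; rewrite e; lia.
  lia.
rewrite (UpB _ hk) /ell.
have E : \sum_(i < r) \sum_(j < r) (i < j) *
   ((P (srefl k * w)%g j < P (srefl k * w)%g i) + (r.*2 <= P (srefl k * w)%g i + P (srefl k * w)%g j))
  = \sum_(i < r) \sum_(j < r) (i < j) * ((P w j < P w i) + (r.*2 <= P w i + P w j)).
  apply: eq_bigr => i _; apply: eq_bigr => j _; rewrite !(P_srefl_B _ _ hk).
  case: (ltnP i j) => //= hij.
  have /negPf-> : i != k by rewrite -val_eqE /=; have := ltn_ord j; lia.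
  by case: eqP => [->|//]; have := P_lt w k; have := P_lt w i; have := P_neq w i k; lia.
rewrite {}E -!addnA; congr (_ + _); rewrite (bigD1 k) //= [in RHS](bigD1 k) //= (P_srefl_B _ _ hk) eqxx.
under eq_bigr => i /negPf ik do rewrite (P_srefl_B _ _ hk) ik.
by have := P_lt w k; case: (ltnP (P w k) r) => h1 h2 /=; lia.
Qed.

Lemma ell1 : ell 1%g = 0.
Proof.
rewrite /ell !big1 // => i _; first by rewrite P1 leqNgt ltn_ord.
rewrite big1 // => j _; rewrite !P1.
by case: ltnP => //=; have := ltn_ord i; have := ltn_ord j; lia.
Qed.

(** Without descents the places [P w i] increase strictly and end below r, which squeezes each of
    them to i from both sides. *)
Lemma Up_all w : (forall k, Up k w) -> w = 1%g.
Proof.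
move=> h; apply: eq_P => i; rewrite P1.
have h1 (n : nat) (j : 'I_r) : j + n = r.-1 -> P w j + n < r.
  elim: n j => [|n IH] j hj.
    by have := h j; rewrite UpB ?addn0 //; have := ltn_ord j; lia.
  have hj1 : j.+1 < r by have := ltn_ord j; lia.
  have := IH (Ordinal hj1); have := h j; rewrite (@UpA j (Ordinal hj1)) //= => a b.
  have := b (ltac:(lia)); lia.
have h2 (n : nat) (j : 'I_r) : j = n :> nat -> n <= P w j.
  elim: n j => [|n IH] j hj //.
  have hj1 : n < r by have := ltn_ord j; lia.
  have := IH (Ordinal hj1) erefl; have := h (Ordinal hj1); rewrite (@UpA _ j) //=; lia.
have := h2 i i erefl; have := @h1 (r.-1 - i) i; have := ltn_ord i; lia.
Qed.

Lemma exists_down w : w != 1%g -> exists k, ~~ Up k w.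
Proof.
move=> w1; apply/existsP; rewrite -negb_forall; apply: contraNN w1 => /forallP h.
by apply/eqP/Up_all.
Qed.

Lemma ell_word n w : ell w = n ->
  exists u : n.-tuple 'I_r, w = (\prod_(i <- u) srefl i)%g.
Proof.
elim: n w => [|n IH] w hn.
  exists [tuple]; rewrite big_nil; apply: Up_all => k; apply/negPn/negP => hk.
  by have := ell_srefl k w; rewrite hn (negbTE hk) /=; lia.
have w1 : w != 1%g by apply/eqP => e; move: hn; rewrite e ell1.
have [k hk] := exists_down w1.
have hn' : ell (srefl k * w)%g = n by have := ell_srefl k w; rewrite (negbTE hk) /=; lia.
have [u hu] := IH _ hn'; exists [tuple of k :: u].
by rewrite big_cons -hu sreflK.
Qed.

Lemma ell_le_word (u : seq 'I_r) : ell (\prod_(i <- u) srefl i)%g <= size u.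
Proof.
elim: u => [|k u IH]; first by rewrite big_nil ell1.
rewrite big_cons /=; move: (bigop _ _ _) IH => v IH.
by have := ell_srefl k v; case: Up => /=; lia.
Qed.

(** [len] searches only below the order of the group. A descent lowers [ell] by exactly one, so all
    values up to [ell w] are attained, by distinct elements. *)
Lemma ell_lt_card w : ell w < #|W r|.
Proof.
have h n : n <= ell w -> exists v, ell v == n.
  move=> hn; have e : ell w = (ell w - n) + n by lia.
  move: e; move: (ell w - n) => m; elim: m (w) => [|m IH] v e; first by exists v; apply/eqP.
  have v1 : v != 1%g by apply/eqP => e1; move: e; rewrite e1 ell1.
  have [k hk] := exists_down v1; apply: (IH (srefl k * v)%g).
  by have := ell_srefl k v; rewrite (negbTE hk) /=; lia.
pose g (n : 'I_(ell w).+1) : W r := xchoose (h n (ltn_ord n)).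
have gK n : ell (g n) = n by apply/eqP; exact: (xchooseP (h n (ltn_ord n))).
have ginj : injective g by move=> n m e; apply: val_inj; rewrite /= -!gK e.
by have := leq_card g ginj; rewrite card_ord.
Qed.

Lemma len_ell w : len w = ell w.
Proof.
rewrite /len; set p := (X in find X _).
have pell : p (ell w).
  by have [u hu] := ell_word (erefl (ell w)); apply/existsP; exists u; rewrite -hu.
have hp n : p n -> ell w <= n.
  by case/existsP => u /eqP ->; rewrite -{2}(size_tuple u) ell_le_word.
have lt := ell_lt_card w.
have hh : has p (iota 0 #|W r|) by apply/hasP; exists (ell w); rewrite ?mem_iota.
have f1 := hh; rewrite has_find size_iota in f1.
have := nth_find 0 hh; rewrite nth_iota // add0n => /hp h1.
apply/eqP; rewrite eqn_leq h1 andbT leqNgt; apply/negP => h2.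
by have := before_find 0 h2; rewrite nth_iota // add0n pell.
Qed.

Lemma len_Up k w : (len w < len (srefl k * w)%g) = Up k w.
Proof. by rewrite !len_ell; have := ell_srefl k w; case: Up => /=; lia. Qed.

Lemma len_up k w : Up k w -> len (srefl k * w)%g = (len w).+1.
Proof. by rewrite !len_ell => h; have := ell_srefl k w; rewrite h /=; lia. Qed.

Lemma len_down k w : ~~ Up k w -> len w = (len (srefl k * w)%g).+1.
Proof. by rewrite !len_ell => h; have := ell_srefl k w; rewrite (negbTE h) /=; lia. Qed.

Lemma len1 : len (1%g : W r) = 0. Proof. by rewrite len_ell ell1. Qed.

Lemma len_gt0 w : w != 1%g -> 0 < len w.
Proof. by move/exists_down => [k /len_down ->]. Qed.

Lemma Up1 k : Up k 1%g.
Proof.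
case: (next_ord k) => [[k1 hk]|hk]; first by rewrite (UpA _ hk) !P1 hk.
by rewrite (UpB _ hk) P1.
Qed.

Lemma srefl_ind (Q : W r -> Prop) : Q 1%g ->
  (forall k w, Up k w -> Q w -> Q (srefl k * w)%g) -> forall w, Q w.
Proof.
move=> Q1 QS w; move: {2}(len w) (erefl (len w)) => n; elim: n w => [|n IH] w hn.
  by case: (eqVneq w 1%g) => [->|/len_gt0] //; rewrite hn.
have w1 : w != 1%g by apply/eqP => e; move: hn; rewrite e len1.
have [k hk] := exists_down w1; rewrite -(sreflK k w); apply: QS; first by rewrite Up_srefl.
by apply: IH; have := len_down hk; lia.
Qed.

Lemma prod_srefl_inv (u : seq 'I_r) :
  ((\prod_(i <- u) srefl i)^-1 = \prod_(i <- rev u) srefl i)%g.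
Proof.
elim: u => [|k u IH]; first by rewrite !big_nil invg1.
by rewrite big_cons invMg sreflV IH rev_cons -cats1 big_cat big_seq1.
Qed.

Lemma len_inv w : len (w^-1)%g = len w.
Proof.
have h v : len (v^-1)%g <= len v.
  have [u hu] := ell_word (erefl (ell v)).
  rewrite {1}hu prod_srefl_inv len_ell; apply: leq_trans (ell_le_word _) _.
  by rewrite size_rev size_tuple len_ell.
by apply/eqP; rewrite eqn_leq h -{1}(invgK w) h.
Qed.

End Coxeter.

(** * Parabolic subgroups and shortest coset representatives *)

Section Parabolic.
Local Open Scope nat_scope.
Variable r : nat.
Implicit Types (w v d : W r) (i j k : 'I_r) (J : {set 'I_r}).

Definition WJ J : {group W r} := <<[set srefl k | k in J]>>%G.

Lemma srefl_WJ J k : k \in J -> srefl k \in WJ J.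
Proof. by move=> kJ; rewrite mem_gen // imset_f. Qed.

Lemma WJ_ind J (Q : W r -> Prop) : Q 1%g ->
  (forall k v, k \in J -> v \in WJ J -> Q v -> Q (srefl k * v)%g) ->
  forall v, v \in WJ J -> Q v.
Proof.
move=> Q1 QS v /gen_prodgP[n [c hc ->]].
elim: n c hc => [|n IH] c hc; first by rewrite big_ord0.
rewrite big_ord_recl; have [k kJ ->] := imsetP (hc ord0).
apply: QS => //; last by apply: IH => i; apply: hc.
by apply: group_prod => i _; rewrite mem_gen.
Qed.

(** A gap lies between positions p and p + 1 when no generator of J exchanges them; [r.*2 - 2 - k]
    is the mirror image of k. Counting gaps, [blk] numbers the blocks of positions, which [WJ J]
    preserves. *)
Definition gapJ J (p : nat) : bool := ~~ [exists k in J, (p == k :> nat) || (p == r.*2 - 2 - k)].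
Definition blk J (n : nat) : nat := \sum_(0 <= p < n) gapJ J p.

Lemma blkS J n : blk J n.+1 = blk J n + gapJ J n.
Proof. by rewrite /blk big_nat_recr. Qed.

Lemma leq_blk J : {homo blk J : m n / m <= n}.
Proof. by apply: homo_leq => [//|? ? ?|n]; [exact: leq_trans|rewrite blkS leq_addr]. Qed.

Lemma blk_refl J k x : k \in J -> blk J (pos (signed_refl k x)) = blk J (pos x).
Proof.
move=> kJ.
have b1 : blk J k.+1 = blk J k.
  rewrite blkS /gapJ; have -> : [exists k0 in J, (k == k0 :> nat) || (k == r.*2 - 2 - k0 :> nat)].
    by apply/existsP; exists k; rewrite kJ eqxx.
  by rewrite addn0.
have b2 : blk J (r.*2 - 2 - k).+1 = blk J (r.*2 - 2 - k).
  rewrite blkS /gapJ; have -> : [exists k0 in J, (r.*2 - 2 - k == k0 :> nat) || (r.*2 - 2 - k == r.*2 - 2 - k0 :> nat)].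
    by apply/existsP; exists k; rewrite kJ eqxx orbT.
  by rewrite addn0.
have hr := ltn_ord k.
case: (next_ord k) => [[k1 hk]|hk].
  rewrite (signed_refl_A _ hk); case: x => i b /=; have hr1 := ltn_ord k1.
  case: tpermP => [->|->|_ _] //; rewrite /pos /=; case: b; rewrite ?hk //.
    by rewrite (_ : (r.*2 - k.+1).-1 = r.*2 - 2 - k) -?b2 //; [congr blk|]; lia.
  by rewrite (_ : (r.*2 - k.+1).-1 = r.*2 - 2 - k) -?b2 //; [congr blk|]; lia.
rewrite (signed_refl_B _ hk); case: x => i b /=; case: eqP => [->|_] //; rewrite /pos /=.
by case: b => /=; rewrite (_ : (r.*2 - k).-1 = k.+1) ?b1 //; lia.
Qed.

Lemma sgval_srefl k w x : sgval (srefl k * w)%g x = sgval w (signed_refl k x).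
Proof. by rewrite sgval_mul permM subgK ?mem_gen ?imset_f. Qed.

Lemma blk_WJ J v x : v \in WJ J -> blk J (pos (sgval v x)) = blk J (pos x).
Proof.
move=> vJ; move: v vJ x; apply: WJ_ind => [x|k v kJ _ IH x]; first by rewrite /= perm1.
by rewrite sgval_srefl IH blk_refl.
Qed.

Lemma pos_surj p : p < r.*2 -> exists x : 'I_r * bool, pos x = p.
Proof.
move=> hp; case: (ltnP p r) => h; first by exists (Ordinal h, false).
have h2 : r.*2.-1 - p < r by lia.
by exists (Ordinal h2, true); rewrite /pos /=; lia.
Qed.

(** The successor of the letter k in the order of [pos], which is its own negative for the last k;
    with it the sign change needs no separate treatment in [UpX]. *)
Definition nx k : 'I_r * bool := if insub k.+1 is Some k1 then (k1, false) else (k, true).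

Lemma nx_refl k : nx k = signed_refl k (k, false).
Proof.
case: (next_ord k) => [[k1 hk]|hk].
  rewrite (signed_refl_A _ hk) /= tpermL /nx; case: insubP => [l _ hl|]; last by rewrite -hk ltn_ord.
  by congr (_, _); apply: val_inj; rewrite /= hl hk.
by rewrite (signed_refl_B _ hk) /= eqxx /nx; case: insubP => [l|//]; rewrite hk ltnn.
Qed.

Lemma pos_nx k : pos (nx k) = k.+1.
Proof.
rewrite nx_refl; case: (next_ord k) => [[k1 hk]|hk].
  by rewrite (signed_refl_A _ hk) /= tpermL -hk.
by rewrite (signed_refl_B _ hk) /= eqxx /pos /=; lia.
Qed.

Lemma UpX k w : Up k w = (pos (sgval w (k, false)) < pos (sgval w (nx k))).
Proof.
case: (next_ord k) => [[k1 hk]|hk].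
  by rewrite (UpA _ hk) nx_refl (signed_refl_A _ hk) /= tpermL.
rewrite (UpB _ hk) nx_refl (signed_refl_B _ hk) /= eqxx.
rewrite -[(k, true)]/(flipx (k, false)) weyl_flip pos_flip -/(P w k).
by have := P_lt w k; lia.
Qed.

Definition DJ J d := forall k, k \in J -> Up k d.

(** One position at a time: two neighbours in a block are exchanged by some k in J, directly or as
    mirror images, and [Up k d] orders their images. *)
Lemma DJ_incr J d x y : DJ J d -> pos x < pos y -> blk J (pos x) = blk J (pos y) ->
  pos (sgval d x) < pos (sgval d y).
Proof.
move=> dJ; move: {2}(pos y - pos x) (erefl (pos y - pos x)) => n.
elim: n x => [|n IH] x hn lt e; first by lia.
have [z hz] : exists z : 'I_r * bool, pos z = (pos x).+1.
  by apply: pos_surj; have := pos_lt y; lia.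
have st : pos (sgval d x) < pos (sgval d z).
  have : ~~ gapJ J (pos x).
    apply/negP => g; have := leq_blk J (_ : pos z <= pos y).
    by rewrite hz blkS g -e => /(_ lt); lia.
  rewrite negbK => /existsP[k /andP[kJ /orP[/eqP hk|/eqP hk]]].
    have -> : x = (k, false) by apply: pos_inj; rewrite hk.
    have -> : z = nx k by apply: pos_inj; rewrite hz pos_nx hk.
    by rewrite -UpX dJ.
  have hk2 := ltn_ord k.
  have -> : x = flipx (nx k) by apply: pos_inj; rewrite pos_flip pos_nx hk; lia.
  have -> : z = flipx (k, false) by apply: pos_inj; rewrite pos_flip hz hk /pos /=; lia.
  rewrite !weyl_flip !pos_flip; have := dJ _ kJ; rewrite UpX.
  have := pos_lt (sgval d (nx k)); have := pos_lt (sgval d (k, false)).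
  move: (pos (sgval d (nx k))) (pos (sgval d (k, false))) => m1 m2; clear; move: r.*2 => R; lia.
case: (ltngtP (pos z) (pos y)) => [lt2|gt|/pos_inj <- //].
  apply: ltn_trans st _; apply: IH => //; first by lia.
  apply/eqP; rewrite eqn_leq (leq_blk J (ltnW lt2)) -e; apply: leq_blk.
  by rewrite hz leqnSn.
by move: gt; rewrite hz ltnS leqNgt lt.
Qed.

(** The images under v of the letter k and of its successor stay in one block, and there d is
    increasing by [DJ_incr], so d cannot reverse them. *)
Lemma Up_mul J d v k : DJ J d -> v \in WJ J -> k \in J -> Up k (v * d)%g = Up k v.
Proof.
move=> dJ vJ kJ; rewrite !UpX !sgval_mul !permM.
set x := sgval v _; set y := sgval v _.
have bxy : blk J (pos x) = blk J (pos y).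
  by rewrite !blk_WJ // nx_refl blk_refl.
have xy : pos x != pos y.
  apply/eqP => /pos_inj /perm_inj e.
  by have := pos_nx k; rewrite -e /pos /=; lia.
case: (ltngtP (pos x) (pos y)) xy => // lt _; first by rewrite (DJ_incr dJ lt bxy).
by have := DJ_incr dJ lt (esym bxy); lia.
Qed.

(** By [Up_mul] lengths add in u * v for u in [WJ J]; the choice u = v^-1 leaves length 0 for v. *)
Lemma DJ_WJ J v : DJ J v -> v \in WJ J -> v = 1%g.
Proof.
move=> vJ vW.
suff h u : u \in WJ J -> len (u * v)%g = len u + len v.
  have := h _ (groupVr vW); rewrite mulVg len1 => e.
  by apply/eqP; apply/negPn/negP => /len_gt0; lia.
move: u; apply: WJ_ind => [|k u kJ uJ IH]; first by rewrite mul1g len1.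
have e := Up_mul vJ uJ kJ; rewrite -mulgA; case: (boolP (Up k u)) e => hu e.
  by rewrite (len_up hu) (len_up e) IH.
have A := len_down hu; have B := len_down (negbT e); by apply: succn_inj; rewrite -addSn -A -B.
Qed.

Lemma WJ_down J v : v \in WJ J -> v != 1%g -> exists2 k, k \in J & ~~ Up k v.
Proof.
move=> vJ v1; apply/exists_inP; rewrite -[X in is_true X]negbK negb_exists_in.
apply: contraNN v1 => /forall_inP h; apply/eqP/(DJ_WJ _ vJ) => k kJ.
by have := h k kJ; rewrite negbK.
Qed.

Lemma WJ_len_ind J (Q : W r -> Prop) : Q 1%g ->
  (forall k v, k \in J -> v \in WJ J -> Up k v -> Q v -> Q (srefl k * v)%g) ->
  forall v, v \in WJ J -> Q v.
Proof.
move=> Q1 QS v; move: {2}(len v) (erefl (len v)) => n; elim: n v => [|n IH] v hn vJ.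
  by case: (eqVneq v 1%g) => [->|/len_gt0] //; rewrite hn.
have v1 : v != 1%g by apply/eqP => e; move: hn; rewrite e len1.
have [k kJ hk] := WJ_down vJ v1; rewrite -(sreflK k v); apply: QS => //.
- by rewrite groupM ?srefl_WJ.
- by rewrite Up_srefl.
by apply: IH; [have := len_down hk; lia|rewrite groupM ?srefl_WJ].
Qed.

Lemma coset_DJ J w : exists d v, [/\ DJ J d, v \in WJ J & w = (v * d)%g].
Proof.
move: {2}(len w) (leqnn (len w)) => n; elim: n w => [|n IH] w hn.
  exists w, 1%g; rewrite group1 mul1g; split=> // k _; apply/negPn/negP => /len_down.
  by lia.
case: (boolP [exists k in J, ~~ Up k w]) => [/exists_inP[k kJ hk]|].
  have [|d [v [dJ vJ e]]] := IH (srefl k * w)%g; first by have := len_down hk; lia.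
  exists d, (srefl k * v)%g; split=> //; first by rewrite groupM ?srefl_WJ.
  by rewrite -mulgA -e sreflK.
rewrite negb_exists_in => /forall_inP h; exists w, 1%g; rewrite group1 mul1g; split=> // k kJ.
by have := h k kJ; rewrite negbK.
Qed.

Definition sw k (f : 'I_r -> nat) : 'I_r -> nat :=
  if insub k.+1 is Some k1 then f \o tperm k k1 else f.

Lemma swE k k1 f : k1 = k.+1 :> nat -> sw k f = f \o tperm k k1.
Proof.
move=> hk; rewrite /sw; case: insubP => [l _ hl|]; last by rewrite -hk ltn_ord.
by congr (_ \o tperm _ _); apply: val_inj; rewrite /= hl hk.
Qed.

(** The unsigned permutations that sort f weakly. For sorted f this is the Young subgroup of its
    blocks of equal letters ([U_sorted]), and an exchange of letters translates the set ([U_sw]), so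
    it is always a coset. *)
Definition U (f : 'I_r -> nat) : {set W r} :=
  [set w | [forall i, P w i < r] && [forall i, forall j, (f i < f j) ==> (P w i < P w j)]].

Lemma UP f w : reflect ((forall i, P w i < r) /\ (forall i j, f i < f j -> P w i < P w j))
  (w \in U f).
Proof.
rewrite inE; apply: (iffP andP) => -[h1 h2]; split.
- by move/forallP: h1.
- by move=> i j; move/forallP: h2 => /(_ i)/forallP/(_ j)/implyP.
- exact/forallP.
- by apply/forallP => i; apply/forallP => j; apply/implyP; apply: h2.
Qed.

Lemma U_sw k k1 f w : k1 = k.+1 :> nat -> (srefl k * w \in U (sw k f))%g = (w \in U f).
Proof.
move=> hk.
have h g v : v \in U g -> (srefl k * v \in U (sw k g))%g.
  move=> /UP[h1 h2]; apply/UP; split=> [i|i j]; rewrite ?(swE _ hk) !(P_srefl_A _ _ hk) //.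
  exact: h2.
apply/idP/idP => [/h|]; last exact: h.
rewrite sreflK (swE _ hk) (swE _ hk) -compA; congr (_ \in U _); apply: funext => i /=.
by rewrite tpermK.
Qed.

Definition sorted_word (f : 'I_r -> nat) := forall i j, i <= j -> f i <= f j.

Lemma sorted_adj f : (forall k k1 : 'I_r, k1 = k.+1 :> nat -> f k <= f k1) -> sorted_word f.
Proof.
move=> h i j; move: {2}(j - i) (erefl (j - i)) => n; elim: n j => [|n IH] j hn lij.
  by have -> : i = j by apply: val_inj => /=; lia.
have hj : j.-1 < r by have := ltn_ord j; lia.
apply: leq_trans (IH (Ordinal hj) _ _) (h _ _ _); rewrite /=; lia.
Qed.

Definition eqJ (f : 'I_r -> nat) : {set 'I_r} :=
  [set k : 'I_r | (k.+1 < r) && [exists k1 : 'I_r, (k1 == k.+1 :> nat) && (f k == f k1)]].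

Lemma eqJP f k : reflect (exists k1 : 'I_r, k1 = k.+1 :> nat /\ f k = f k1) (k \in eqJ f).
Proof.
rewrite inE; apply: (iffP andP) => [[_ /existsP[k1 /andP[/eqP a /eqP b]]]|[k1 [a b]]].
  by exists k1.
by rewrite -a ltn_ord; split=> //; apply/existsP; exists k1; rewrite a b !eqxx.
Qed.

Lemma sw_eq k f : k \in eqJ f -> sw k f = f.
Proof.
case/eqJP => k1 [hk e]; rewrite (swE _ hk); apply: funext => i /=.
by case: tpermP => [->|->|].
Qed.

Lemma U_sorted f : sorted_word f -> U f = [set w in WJ (eqJ f)].
Proof.
move=> sf; apply/setP => w; rewrite [in RHS]inE; apply/idP/idP.
  move: {2}(len w) (erefl (len w)) => n; elim: n w => [|n IH] w hn wU.
    by case: (eqVneq w 1%g) => [->|/len_gt0]; rewrite ?group1 ?hn.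
  have w1 : w != 1%g by apply/eqP => e; move: hn; rewrite e len1.
  have [k hk] := exists_down w1; have /UP[h1 h2] := wU.
  have kJ : k \in eqJ f.
    case: (next_ord k) => [[k1 hk1]|hk1]; last by move: hk; rewrite (UpB _ hk1) h1.
    apply/eqJP; exists k1; split=> //; apply/eqP; rewrite eqn_leq sf ?hk1 //= leqNgt.
    by apply: contraNN hk => lt; rewrite (UpA _ hk1) h2.
  have /eqJP[k1 [hk1 _]] := kJ.
  rewrite -(sreflK k w) groupM ?srefl_WJ ?IH //; first by have := len_down hk; lia.
  by rewrite -(sw_eq kJ) (U_sw _ _ hk1).
move: w; apply: WJ_ind => [|k v kJ _ vU].
  by apply/UP; split=> [i|i j]; rewrite !P1 // => lt; rewrite ltnNge; apply/negP => /sf; lia.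
by have /eqJP[k1 [hk1 _]] := kJ; rewrite -(sw_eq kJ) (U_sw _ _ hk1).
Qed.

(* The Young-type parabolic of the last a places and the first r - a places. *)
Definition splitJ (a : nat) : {set 'I_r} := [set k : 'I_r | (k.+1 < r) && (k.+1 != r - a)].

Definition split_word a (f : 'I_r -> nat) := forall i j, i < r - a <= j -> f i < f j.

Lemma split_sw a k f : k \in splitJ a -> split_word a f -> split_word a (sw k f).
Proof.
rewrite inE => /andP[lt ne] sf.
have hk : Ordinal lt = k.+1 :> nat by [].
rewrite (swE _ hk) => i j /= /andP[hi hj]; apply: sf.
have ki : k != Ordinal lt by apply/eqP => /(congr1 val) /=; lia.
case: tpermP => [ei|ei|_ _]; case: tpermP => [ej|ej|_ _] //=;
  rewrite ?ei ?ej /= in hi hj *; lia.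
Qed.

Lemma U_split a f w : split_word a f -> w \in U f -> w \in WJ (splitJ a).
Proof.
move: {2}(len w) (erefl (len w)) => n; elim: n w f => [|n IH] w f hn sf wU.
  by case: (eqVneq w 1%g) => [->|/len_gt0]; rewrite ?group1 ?hn.
have w1 : w != 1%g by apply/eqP => e; move: hn; rewrite e len1.
have [k hk] := exists_down w1; have /UP[h1 h2] := wU.
case: (next_ord k) => [[k1 hk1]|hk1]; last by move: hk; rewrite (UpB _ hk1) h1.
have kJ : k \in splitJ a.
  rewrite inE -hk1 ltn_ord /=; apply: contraNN hk => /eqP e.
  by rewrite (UpA _ hk1) h2 // sf //; lia.
rewrite -(sreflK k w) groupM ?srefl_WJ //; apply: (IH _ (sw k f)).
- by have := len_down hk; lia.
- exact: split_sw.
- by rewrite (U_sw _ _ hk1).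
Qed.

(* The subgroup of the generators of index >= m acts on the first place it moves with 2 (r - m) images. *)
Lemma card_weyl : 2 ^ r * r`! <= #|W r|.
Proof.
pose G m := WJ [set k : 'I_r | m <= k].
suff h n m : m + n = r -> 2 ^ n * n`! <= #|G m|.
  by apply: leq_trans (h r 0 erefl) (max_card _).
elim: n m => [|n IH] m hm; first by rewrite cardG_gt0.
have mr : m < r by lia.
pose im := Ordinal mr.
have Gfix v : v \in G m.+1 -> sgval v (im, false) = (im, false).
  move: v; apply: WJ_ind => [|k v kJ _ IHv]; first by rewrite /= perm1.
  rewrite sgval_srefl; rewrite inE in kJ; case: (next_ord k) => [[k1 hk]|hk].
    by rewrite (signed_refl_A _ hk) /= tpermD //; apply/eqP => /(congr1 val) /=; lia.
  rewrite (signed_refl_B _ hk) /= (_ : im == k = false) //.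
  by apply/negbTE/eqP => /(congr1 val) /=; lia.
have Gsub v : v \in G m.+1 -> v \in G m.
  move=> vG; suff : G m.+1 \subset G m by move/fintype.subsetP; apply.
  by rewrite genS // imsetS //; apply/fintype.subsetP => k; rewrite !inE; apply: ltnW.
have img p : p < (n.+1).*2 -> exists2 w, w \in G m & P w im == m + p.
  elim: p => [|p IHp] hp; first by exists 1%g; rewrite ?group1 ?P1 ?addn0.
  have [|w wG /eqP hw] := IHp; first by lia.
  have [k km hk] : exists2 k : 'I_r, m <= k & (k : nat) = m + p \/ k = r.*2 - 2 - (m + p) :> nat.
    case: (ltnP (m + p) r) => h; first by exists (Ordinal h) => /=; [lia|left].
    have h2 : r.*2 - 2 - (m + p) < r by lia.
    by exists (Ordinal h2) => /=; [lia|right].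
  exists (w * srefl k)%g; first by rewrite groupM ?srefl_WJ ?inE.
  rewrite /P sgval_mul permM -[srefl k]mulg1 sgval_srefl /= perm1.
  have hkr := ltn_ord k.
  case: hk => hk.
    have -> : sgval w (im, false) = (k, false) by apply: pos_inj; rewrite -/(P w im) hw /pos /= hk.
    by rewrite -nx_refl pos_nx hk addnS.
  have -> : sgval w (im, false) = flipx (nx k).
    by apply: pos_inj; rewrite -/(P w im) hw pos_flip pos_nx hk; lia.
  rewrite nx_refl.
  have -> x : signed_refl k (flipx x) = flipx (signed_refl k x).
    by have := weyl_flip (srefl k) x; rewrite /= subgK ?mem_gen ?imset_f.
  have -> : signed_refl k (signed_refl k (k, false)) = (k, false).
    by have := congr1 (fun w : W r => sgval w (k, false)) (srefl2 k);
      rewrite sgval_mul permM /= !subgK ?mem_gen ?imset_f // perm1.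
  by rewrite pos_flip /pos /= hk; apply/eqP; lia.
have [w wG wP'] := fin_all_exists2 (fun p : 'I_(n.+1).*2 => img p (ltn_ord p)).
have wP p : P (w p) im = m + p by apply/eqP.
pose A := finset.setX [set: 'I_(n.+1).*2] (G m.+1).
have inj : {in A &, injective (fun x : 'I_(n.+1).*2 * W r => (x.2 * w x.1)%g)}.
  move=> [p v] [p' v']; rewrite !inE /= => vG v'G e.
  have e1 : p = p'.
    apply: val_inj; have := congr1 (fun u => P u im) e.
    rewrite /= /P !sgval_mul !permM (Gfix _ vG) (Gfix _ v'G) => e2.
    by have := wP p; have := wP p'; rewrite /P -e2 => -> /addnI.
  by subst p'; move/mulIg: e => ->.
have : #|A| <= #|G m|.
  rewrite -(card_in_imset inj); apply: subset_leq_card.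
  apply/fintype.subsetP => u /imsetP[[p v]]; rewrite !inE /= => vG ->.
  by apply: groupM; [exact: Gsub|exact: wG].
rewrite cardsX cardsT card_ord; apply: leq_trans.
have := IH m.+1 (ltac:(lia)); rewrite expnS factS => h.
apply: leq_trans (_ : (n.+1).*2 * (2 ^ n * n`!) <= _); first by rewrite -mul2n; nia.
by rewrite leq_mul2l h orbT.
Qed.

End Parabolic.

Local Open Scope ring_scope.

(** * The Hecke algebra *)

Section Basis.
Variables (R : pzRingType) (V : lmodType R) (I : finType) (b : I -> V).
Hypothesis hb : is_basis b.

Definition bco (x : V) : {ffun I -> R} := sval (cid (hb x)).

Lemma bcoE x : x = \sum_i bco x i *: b i.
Proof. by rewrite /bco; case: cid => c [/= h _]. Qed.

Lemma bco_uniq x (c : I -> R) : x = \sum_i c i *: b i -> forall i, bco x i = c i.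
Proof.
move=> e i; rewrite /bco; case: cid => c' [/= _ h]; rewrite (h [ffun i => c i]) ?ffunE //.
by rewrite {1}e; apply: eq_bigr => j _; rewrite ffunE.
Qed.

Lemma bcoD x y i : bco (x + y) i = bco x i + bco y i.
Proof.
apply: (bco_uniq (c := fun i => _ + _)); rewrite {1}(bcoE x) {1}(bcoE y) -big_split.
by apply: eq_bigr => j _; rewrite scalerDl.
Qed.

Lemma bco_b i j : bco (b i) j = (i == j)%:R.
Proof.
apply: (bco_uniq (c := fun j => _)); rewrite (bigD1 i) //= eqxx scale1r big1 ?addr0 // => k.
by rewrite eq_sym => /negPf ->; rewrite scale0r.
Qed.

Lemma bco0 i : bco 0 i = 0.
Proof.
by apply: (bco_uniq (c := fun=> 0)); rewrite big1 // => j _; rewrite scale0r.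
Qed.

Lemma bco_sum (S : Type) (s : seq S) (Q : pred S) (F : S -> V) i :
  bco (\sum_(x <- s | Q x) F x) i = \sum_(x <- s | Q x) bco (F x) i.
Proof. by apply: (big_morph (fun x => bco x i)) => [x y|]; rewrite ?bcoD ?bco0. Qed.

Lemma bco_inj x y : (forall i, bco x i = bco y i) -> x = y.
Proof. by move=> e; rewrite (bcoE x) (bcoE y); apply: eq_bigr => i _; rewrite e. Qed.

Lemma bcoZ c x i : bco (c *: x) i = c * bco x i.
Proof.
apply: (bco_uniq (c := fun i => _ * _)); rewrite {1}(bcoE x) scaler_sumr.
by apply: eq_bigr => j _; rewrite scalerA.
Qed.

End Basis.

(** An abstract setting that hides the Laurent polynomials: q is invertible, and 1 + q is not a zero
    divisor ([h_reg]), which decides the question of invariants in [Linv_sst]. *)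
Record hecke_data (r : nat) := HeckeData {
  hK : comNzRingType; h_q : hK; h_qi : hK;
  hA :> algType hK; hT : W r -> hA;
  h_qqi : h_q * h_qi = 1;
  h_reg : forall x : hK, x + h_q * x = 0 -> x = 0;
  hTb : is_basis hT;
  hTrule : forall (k : 'I_r) (w : W r),
    hT (srefl k) * hT w =
      if (len w < len (srefl k * w)%g)%N then hT (srefl k * w)%g
      else h_q *: hT (srefl k * w)%g + (h_q - 1) *: hT w;
  h_r : (0 < r)%N }.

Section Hecke.
Variables (r : nat) (D : hecke_data r).
Local Notation K := (hK D).
Local Notation q := (h_q D).
Local Notation qi := (h_qi D).
Local Notation T := (@hT r D).
Local Notation Tb := (@hTb r D).
Implicit Types (w v d : W r) (i j k : 'I_r) (J : {set 'I_r}) (x y h : D) (c : K).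

Let Trule := @hTrule r D.
Let r_gt0 : (0 < r)%N := h_r D.
Let hq : q * qi = 1 := h_qqi D.
Let qiq : qi * q = 1. Proof. by rewrite mulrC. Qed.

Definition tk k : D := T (srefl k).

Lemma tk_up k w : Up k w -> tk k * T w = T (srefl k * w)%g.
Proof. by move=> h; rewrite /tk Trule len_Up h. Qed.

Lemma tk_down k w : ~~ Up k w -> tk k * T w = q *: T (srefl k * w)%g + (q - 1) *: T w.
Proof. by move=> h; rewrite /tk Trule len_Up (negbTE h). Qed.

(** For a generator s, multiply T_s T_s = q T_1 + (q - 1) T_s on the right by T_1: as T_s T_1 = T_s
    and q is invertible, T_1 is idempotent. By induction on length T_w T_1 = T_w, and the expansion
    of 1 on the basis gives T_1 = 1 T_1 = 1. *)
Lemma T_one : T 1%g = 1.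
Proof.
pose k := Ordinal r_gt0.
have e1 : tk k * T 1%g = tk k by rewrite (tk_up (Up1 k)) mulg1.
have e2 : tk k * tk k = q *: T 1%g + (q - 1) *: tk k.
  rewrite {2}/tk tk_down; last by rewrite -[srefl k]mulg1 Up_srefl Up1.
  by rewrite srefl2.
have ee : T 1%g * T 1%g = T 1%g.
  have : tk k * tk k * T 1%g = tk k * tk k by rewrite -mulrA e1.
  rewrite e2 mulrDl -!scalerAl e1 => /addIr /(congr1 (fun x => qi *: x)).
  by rewrite !scalerA qiq !scale1r.
have h w : T w * T 1%g = T w.
  by move: w; apply: srefl_ind => [//|k' w hk IH]; rewrite -(tk_up hk) -mulrA IH.
rewrite -[LHS]mul1r [X in X * _](bcoE Tb) mulr_suml [RHS](bcoE Tb).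
by apply: eq_bigr => w _; rewrite -scalerAl h.
Qed.

Lemma tk2 k : tk k * tk k = q%:A + (q - 1) *: tk k.
Proof.
rewrite {2}/tk tk_down; last by rewrite -[srefl k]mulg1 Up_srefl Up1.
by rewrite srefl2 T_one.
Qed.

Definition tki k : D := qi *: (tk k - (q - 1)%:A).

Lemma tkiK k : tki k * tk k = 1.
Proof.
by rewrite /tki -scalerAl mulrBl tk2 -scalerAl mul1r addrK scalerA qiq scale1r.
Qed.

Lemma T_mul w v : len (w * v)%g = (len w + len v)%N -> T w * T v = T (w * v)%g.
Proof.
move: w v; apply: srefl_ind => [v _|k w hk IH v]; first by rewrite T_one // mul1r mul1g.
rewrite (len_up hk) -mulgA => e.
have le (x y : W r) : (len (x * y)%g <= len x + len y)%N.
  have [u hu] := ell_word (erefl (ell x)); have [u' hu'] := ell_word (erefl (ell y)).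
  rewrite !len_ell {1}hu {1}hu' -big_cat; apply: leq_trans (ell_le_word _) _.
  by rewrite size_cat !size_tuple.
have hU : Up k (w * v)%g.
  apply/negPn/negP => /len_down e2; have := le w v; rewrite e2 => h.
  by move: (leq_trans (leqnSn _) h); rewrite e addSn ltnn.
have e3 : len (w * v)%g = (len w + len v)%N.
  by apply: succn_inj; rewrite -(len_up hU) e addSn.
by rewrite -(tk_up hk) -mulrA (IH _ e3) (tk_up hU).
Qed.

Lemma hecke_ind (Q : D -> Prop) : (forall x y, Q x -> Q y -> Q (x + y)) ->
  (forall c x, Q x -> Q (c *: x)) -> Q 1 -> (forall k x, Q x -> Q (tk k * x)) ->
  forall x, Q x.
Proof.
move=> QD QZ Q1 QT x; rewrite (bcoE Tb x); elim/big_ind: _ => [|//|w _].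
  by rewrite -(scale0r (1 : D)); exact: QZ.
apply: QZ; move: w; apply: srefl_ind => [|k w hk IH]; first by rewrite T_one.
by rewrite -(tk_up hk); apply: QT.
Qed.

Definition star x : D := \sum_w bco Tb x w *: T (w^-1)%g.

Lemma starD x y : star (x + y) = star x + star y.
Proof. by rewrite /star -big_split; apply: eq_bigr => w _; rewrite bcoD scalerDl. Qed.

Lemma starZ c x : star (c *: x) = c *: star x.
Proof. by rewrite /star scaler_sumr; apply: eq_bigr => w _; rewrite bcoZ scalerA. Qed.

Lemma star_T w : star (T w) = T (w^-1)%g.
Proof.
rewrite /star (bigD1 w) //= bco_b eqxx scale1r big1 ?addr0 // => v.
by rewrite bco_b eq_sym => /negPf ->; rewrite scale0r.
Qed.

Lemma star0 : star 0 = 0.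
Proof. by have := starZ 0 0; rewrite !scale0r. Qed.

Lemma starN x : star (- x) = - star x. Proof. by rewrite -scaleN1r starZ scaleN1r. Qed.

Lemma star_sum (S : Type) (s : seq S) (Q : pred S) (F : S -> D) :
  star (\sum_(x <- s | Q x) F x) = \sum_(x <- s | Q x) star (F x).
Proof. by apply: (big_morph star) => [x y|]; rewrite ?starD ?star0. Qed.

Lemma star1 : star 1 = 1. Proof. by rewrite -T_one // star_T invg1. Qed.

Lemma star_tk k : star (tk k) = tk k. Proof. by rewrite star_T sreflV. Qed.

Lemma starK : involutive star.
Proof.
move=> x; rewrite [X in star X]/star star_sum [RHS](bcoE Tb); apply: eq_bigr => w _.
by rewrite starZ star_T invgK.
Qed.

(** For an ascent both sides are a single basis element. A descent is reduced to this by T_w = T_s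
    T_sw and the quadratic relation. *)
Lemma star_tkM k x : star (tk k * x) = star x * tk k.
Proof.
have h w : Up k w -> star (tk k * T w) = star (T w) * tk k.
  move=> hk; rewrite (tk_up hk) !star_T /tk T_mul ?invMg ?sreflV //.
  rewrite -len_inv invMg sreflV invgK (len_up hk) len_inv -(len_inv (srefl k)) -addn1.
  by congr addn; rewrite -(mulg1 (srefl k)) invMg sreflV invg1 mul1g -[srefl k]mulg1 (len_up (Up1 k)) len1.
rewrite (bcoE Tb x) mulr_sumr !star_sum mulr_suml; apply: eq_bigr => w _.
rewrite -scalerAr !starZ -scalerAl; congr (_ *: _).
case: (boolP (Up k w)) => [|hk]; first exact: h.
have hk' : Up k (srefl k * w)%g by rewrite Up_srefl.
have e : T w = tk k * T (srefl k * w)%g by rewrite (tk_up hk') sreflK.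
by rewrite e mulrA tk2 mulrDl -scalerAl mul1r -scalerAl starD !starZ (h _ hk') -mulrA tk2
  mulrDr -!scalerAr mulr1.
Qed.

Lemma starM x y : star (x * y) = star y * star x.
Proof.
move: x; apply: hecke_ind => [a b ha hb|c a ha||k a ha].
- by rewrite mulrDl !starD ha hb mulrDr.
- by rewrite -scalerAl !starZ ha scalerAr.
- by rewrite mul1r star1 mulr1.
by rewrite -mulrA !star_tkM ha mulrA.
Qed.

Definition Linv J y := forall k, k \in J -> tk k * y = q *: y.

Lemma tk_bco k y w : bco Tb (tk k * y) w =
  if Up k w then q * bco Tb y (srefl k * w)%g
  else bco Tb y (srefl k * w)%g + (q - 1) * bco Tb y w.
Proof.
rewrite {1}(bcoE Tb y) mulr_sumr bco_sum.
have E v : bco Tb (tk k * T v) w =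
    if Up k v then ((srefl k * v)%g == w)%:R else q * ((srefl k * v)%g == w)%:R + (q - 1) * (v == w)%:R.
  case: ifP => hv; first by rewrite (tk_up hv) bco_b.
  by rewrite (tk_down (negbT hv)) bcoD !bcoZ !bco_b.
have swE v : ((srefl k * v)%g == w) = (v == (srefl k * w)%g).
  by apply/eqP/eqP => [<-|->]; rewrite sreflK.
have ws : (w == srefl k * w)%g = false.
  by apply/negbTE/eqP => e; have := Up_srefl k w; rewrite -e; case: (Up k w).
under eq_bigr => v _ do rewrite -scalerAr bcoZ E swE.
rewrite (bigD1 (srefl k * w)%g) //= eqxx Up_srefl (bigD1 w) /=; last by rewrite ws.
rewrite eqxx ws big1 ?addr0 => [|v /andP[/negPf v1 /negPf v2]]; last first.
  by rewrite v1 v2 !mulr0 addr0 if_same mulr0.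
have -> : (srefl k * w == w)%g = false by rewrite eq_sym.
by case: (Up k w) => /=; rewrite !(mulr0, addr0, mulr1, add0r) // mulrC // [_ * bco _ _ _]mulrC.
Qed.

(** The coefficients of T_k y at w and at s_k w, compared with those of q y, give q a = q b with q
    invertible. Invariance thus means that the coefficients are constant on the cosets [WJ J] w. *)
Lemma LinvP J y : Linv J y <->
  (forall k w, k \in J -> bco Tb y (srefl k * w)%g = bco Tb y w).
Proof.
have qinj (a b : K) : q * a = q * b -> a = b.
  by move=> /(congr1 ( *%R qi)); rewrite !mulrA qiq !mul1r.
split=> [h k w kJ|h k kJ].
  have := congr1 (fun x => bco Tb x w) (h k kJ).
  have := congr1 (fun x => bco Tb x (srefl k * w)%g) (h k kJ).
  rewrite /= !tk_bco !bcoZ Up_srefl sreflK; case: (Up k w) => /=.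
    by move=> _ /qinj.
  by move=> /qinj ->.
apply: (@bco_inj _ _ _ _ Tb) => w; rewrite tk_bco bcoZ !h //; case: ifP => // _.
by rewrite mulrBl mul1r addrC subrK.
Qed.

Lemma Linv0 J : Linv J 0. Proof. by move=> k _; rewrite mulr0 scaler0. Qed.
Lemma LinvD J x y : Linv J x -> Linv J y -> Linv J (x + y).
Proof. by move=> hx hy k kJ; rewrite mulrDr hx // hy // scalerDr. Qed.
Lemma LinvZ J c x : Linv J x -> Linv J (c *: x).
Proof. by move=> hx k kJ; rewrite -scalerAr hx // !scalerA mulrC. Qed.
Lemma LinvM J x y : Linv J x -> Linv J (x * y).
Proof. by move=> hx k kJ; rewrite mulrA hx // scalerAl. Qed.
Lemma Linv_sum J (S : Type) (s : seq S) (Q : pred S) (F : S -> D) :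
  (forall z, Q z -> Linv J (F z)) -> Linv J (\sum_(x <- s | Q x) F x).
Proof. by move=> h; elim/big_ind: _ => //; [exact: Linv0|exact: LinvD]. Qed.

Definition xJ J : D := \sum_(v in WJ J) T v.

Lemma bco_indic (S : {pred W r}) w : bco Tb (\sum_(v in S) T v) w = (w \in S)%:R.
Proof.
rewrite bco_sum; under eq_bigr do rewrite bco_b.
case: (boolP (w \in S)) => hw; last first.
  by rewrite big1 // => v hv; case: eqP hw => // <-; rewrite hv.
by rewrite (bigD1 w) //= eqxx big1 ?addr0 // => v /andP[_ /negPf ->].
Qed.

Lemma Linv_xJ J : Linv J (xJ J).
Proof. by apply/LinvP => k w kJ; rewrite !bco_indic groupMl ?srefl_WJ. Qed.

Lemma T_WJ_DJ J v d : DJ J d -> v \in WJ J -> T v * T d = T (v * d)%g.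
Proof.
move=> dJ; move: v; apply: WJ_len_ind => [|k v kJ vJ hk IH]; first by rewrite T_one // mul1r mul1g.
by rewrite -(tk_up hk) -mulrA IH tk_up ?mulgA // (Up_mul dJ vJ kJ).
Qed.

Lemma Linv_coset J y v w : Linv J y -> v \in WJ J -> bco Tb y (v * w)%g = bco Tb y w.
Proof.
move=> /LinvP h; move: v; apply: WJ_ind => [|k v kJ _ IH]; first by rewrite mul1g.
by rewrite -mulgA h.
Qed.

(** Since T_v T_d = T_vd for the shortest d of a coset, and the coefficients of y are constant on
    cosets, the quotient is the part of y supported on the shortest representatives. *)
Lemma Linv_div J y : Linv J y -> exists h, y = xJ J * h.
Proof.
move=> hy.
pose DV w := cid (coset_DJ J w).
pose rep w := sval (DV w).
have repP w : DJ J (rep w) /\ exists2 v, v \in WJ J & w = (v * rep w)%g.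
  by rewrite /rep; case: (DV w) => d /= [v [h1 h2 h3]]; split=> //; exists v.
have rep_uniq d v : DJ J d -> v \in WJ J -> rep (v * d)%g = d.
  move=> dJ vJ; have [d'J [v' v'J e]] := repP (v * d)%g.
  set d' := rep _ in d'J e *.
  have uJ : (v'^-1 * v)%g \in WJ J by rewrite groupM ?groupV.
  have e2 : d' = (v'^-1 * v * d)%g by rewrite -mulgA e mulKg.
  have u1 : (v'^-1 * v = 1)%g.
    by apply: (@DJ_WJ _ J) => // k kJ; rewrite -(Up_mul dJ uJ kJ) -e2 d'J.
  by rewrite e2 u1 mul1g.
exists (\sum_(d | rep d == d) bco Tb y d *: T d).
rewrite {1}(bcoE Tb y) (partition_big rep (fun d => rep d == d)) /=; last first.
  by move=> w _; have [dJ _] := repP w; rewrite -{1}(mul1g (rep w)) rep_uniq.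
rewrite mulr_sumr; apply: eq_bigr => d /eqP ed.
have dJ : DJ J d by have [h _] := repP d; rewrite ed in h.
rewrite -scalerAr /xJ mulr_suml scaler_sumr.
rewrite (reindex_onto (fun v => v * d)%g (fun w => w * d^-1)%g) /=; last by move=> w _; rewrite mulgKV.
apply: eq_big => [v|v /andP[/eqP hv _]].
  rewrite mulgK eqxx andbT; apply/eqP/idP => [h|vJ]; last exact: rep_uniq.
  have [_ [u uJ e]] := repP (v * d)%g; rewrite h in e.
  by move/mulIg: e => ->.
have [_ [u uJ e]] := repP (v * d)%g; rewrite hv in e; move/mulIg: e => e; subst u.
by rewrite (T_WJ_DJ dJ uJ) (Linv_coset _ hy uJ).
Qed.

End Hecke.

(** * Jucys-Murphy elements *)

Section JucysMurphy.
Variables (r : nat) (D : hecke_data r).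
Local Notation K := (hK D).
Local Notation q := (h_q D).
Local Notation T := (@hT r D).
Local Notation Tb := (@hTb r D).
Local Notation tk := (tk D).
Implicit Types (w v d : W r) (i j k : 'I_r) (J : {set 'I_r}) (x y h : D) (c : K) (a b m n : nat).

Let r_gt0 : (0 < r)%N := h_r D.
Local Notation comm := GRing.comm.

Lemma P_srefl k i : P (srefl k : W r) i =
  if k.+1 == r then (if i == k then (r.*2 - k).-1 else i) else
  if insub k.+1 is Some k1 then tperm k k1 i : nat else i.
Proof.
rewrite -[srefl k]mulg1; case: (next_ord k) => [[k1 hk]|hk].
  rewrite (P_srefl_A _ _ hk) P1 -hk; case: eqP => [e|_]; first by have := ltn_ord k1; rewrite e ltnn.
  case: insubP => [l _ hl|]; last by rewrite ltn_ord.
  by congr (nat_of_ord (tperm _ _ _)); apply: val_inj; rewrite /= hl.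
by rewrite (P_srefl_B _ _ hk) !P1 hk eqxx.
Qed.

Lemma tperm_comm (i1 i2 i3 i4 j : 'I_r) : i1 != i3 -> i1 != i4 -> i2 != i3 -> i2 != i4 ->
  tperm i1 i2 (tperm i3 i4 j) = tperm i3 i4 (tperm i1 i2 j).
Proof.
move=> h13 h14 h23 h24.
case: (tpermP i3 i4 j) => [->|->|/eqP h3 /eqP h4].
- by rewrite (tpermD h14 h24) (tpermD h13 h23) tpermL.
- by rewrite (tpermD h14 h24) (tpermD h13 h23) tpermR.
case: (tpermP i1 i2 j) => [_|_|_ _].
- by rewrite tpermD // eq_sym.
- by rewrite tpermD // eq_sym.
by rewrite tpermD // eq_sym.
Qed.

Lemma tk_comm k (l : 'I_r) : (k.+1 < l)%N -> comm (tk k) (tk l).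
Proof.
move=> hkl.
have kr : (k.+1 < r)%N by apply: leq_trans hkl (ltnW (ltn_ord l)).
pose k1 := Ordinal kr; have hk : k1 = k.+1 :> nat by [].
have lk : k != l by apply/eqP => /(congr1 val) /=; lia.
have lk1 : k1 != l by apply/eqP => /(congr1 val) /=; lia.
have e : (srefl k * srefl l = srefl l * srefl k :> W r)%g.
  apply: eq_P => i; rewrite (P_srefl_A _ _ hk).
  case: (next_ord l) => [[l1 hl]|hl].
    rewrite (P_srefl_A _ _ hl) -[srefl k]mulg1 -[srefl l]mulg1 (P_srefl_A _ _ hl) (P_srefl_A _ _ hk) !P1.
    by rewrite tperm_comm //; apply/eqP => /(congr1 val) /=; lia.
  rewrite (P_srefl_B _ _ hl) -[srefl k]mulg1 -[srefl l]mulg1 (P_srefl_B _ _ hl) !(P_srefl_A _ _ hk) !P1.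
  have e1 j : (tperm k k1 j == l) = (j == l).
    by rewrite -(inj_eq (@perm_inj _ (tperm k k1)) j) (tpermD lk lk1).
  by rewrite e1 (tpermD lk lk1).
rewrite /comm /tk -[T (srefl l)]/(T (srefl l)).
have u1 : Up k (srefl l : W r).
  rewrite (UpA _ hk) !P_srefl; case: ifP => _; first by rewrite (negbTE lk) (negbTE lk1) hk.
  case: insubP => [l1 _ hl1|_] //; rewrite /= in hl1.
  by rewrite !tpermD ?hk 1?eq_sym //; apply/eqP => /(congr1 val) /=; lia.
have u2 : Up l (srefl k : W r).
  have kk (i : 'I_r) : (k.+1 < i)%N -> P (srefl k : W r) i = i.
    move=> h; rewrite P_srefl (ltn_eqF kr); case: insubP => [l1 _ /= hl1|_] //.
    by rewrite tpermD //; apply/eqP => /(congr1 val) /=; lia.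
  case: (next_ord l) => [[l1 hl]|hl]; first by rewrite (UpA _ hl) !kk // hl //; lia.
  by rewrite (UpB _ hl) kk.
by have := tk_up D u1; have := tk_up D u2; rewrite /tk => -> ->; rewrite e.
Qed.

Lemma braid3 k k1 k2 : k1 = k.+1 :> nat -> k2 = k1.+1 :> nat ->
  tk k * tk k1 * tk k = tk k1 * tk k * tk k1.
Proof.
move=> hk hk1.
have n1 : k != k1 by apply/eqP => /(congr1 val) /=; lia.
have n2 : k != k2 by apply/eqP => /(congr1 val) /=; lia.
have n3 : k1 != k2 by apply/eqP => /(congr1 val) /=; lia.
have E1 : tperm k k1 k2 = k2 by rewrite tpermD.
have E2 : tperm k1 k2 k = k by rewrite tpermD // eq_sym.
have hh j : tperm k k1 (tperm k1 k2 (tperm k k1 j)) = tperm k1 k2 (tperm k k1 (tperm k1 k2 j)).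
  case: (tpermP k k1 j) => [->|->|/eqP h1 /eqP h2]; rewrite ?(tpermL, tpermR, E1, E2) //.
  case: (tpermP k1 k2 j) => [e|e|/eqP h3 /eqP h4]; rewrite ?(tpermL, tpermR, E1, E2) //.
    by rewrite e eqxx in h2.
  by rewrite !tpermD // eq_sym.
have e : (srefl k * (srefl k1 * srefl k) = srefl k1 * (srefl k * srefl k1) :> W r)%g.
  apply: eq_P => i; rewrite (P_srefl_A _ _ hk) !(P_srefl_A _ _ hk1) (P_srefl_A _ _ hk).
  by rewrite -[srefl k]mulg1 -[srefl k1]mulg1 (P_srefl_A _ _ hk) (P_srefl_A _ _ hk1) !P1 hh.
have Pk i : P (srefl k : W r) i = tperm k k1 i by rewrite -[srefl k]mulg1 (P_srefl_A _ _ hk) P1.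
have Pk1 i : P (srefl k1 : W r) i = tperm k1 k2 i by rewrite -[srefl k1]mulg1 (P_srefl_A _ _ hk1) P1.
rewrite -!mulrA /tk.
have a1 : Up k1 (srefl k : W r) by rewrite (UpA _ hk1) !Pk ?(tpermL, tpermR, E1, E2); lia.
have a2 : Up k (srefl k1 * srefl k : W r)%g.
  by rewrite (UpA _ hk) !(P_srefl_A _ _ hk1) !Pk ?(tpermL, tpermR, E1, E2); lia.
have b1 : Up k (srefl k1 : W r) by rewrite (UpA _ hk) !Pk1 ?(tpermL, tpermR, E1, E2); lia.
have b2 : Up k1 (srefl k * srefl k1 : W r)%g.
  by rewrite (UpA _ hk1) !(P_srefl_A _ _ hk) !Pk1 ?(tpermL, tpermR, E1, E2); lia.
by have := (tk_up D a1, tk_up D a2, tk_up D b1, tk_up D b2);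
  rewrite /tk => -[[[-> ->] ->] ->]; rewrite e.
Qed.

Lemma braid4 k k1 : k1 = k.+1 :> nat -> k1.+1 = r ->
  tk k1 * tk k * tk k1 * tk k = tk k * tk k1 * tk k * tk k1.
Proof.
move=> hk hk1.
have n1 : (k == k1) = false by apply/negbTE/eqP => /(congr1 val) /=; lia.
have Pk i : P (srefl k : W r) i = tperm k k1 i by rewrite -[srefl k]mulg1 (P_srefl_A _ _ hk) P1.
have Pk1 i : P (srefl k1 : W r) i = if i == k1 then (r.*2 - k1).-1 else i.
  by rewrite -[srefl k1]mulg1 (P_srefl_B _ _ hk1) !P1.
have e : (srefl k1 * (srefl k * (srefl k1 * srefl k)) = srefl k * (srefl k1 * (srefl k * srefl k1)) :> W r)%g.
  apply: eq_P => i; have RA w j := P_srefl_A w j hk; have RB w j := P_srefl_B w j hk1.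
  rewrite !(RA, RB, Pk, Pk1).
  case: (eqVneq i k1) => [->|i1]; first by rewrite ?(tpermL, tpermR, eqxx, n1).
  case: (eqVneq i k) => [->|i2]; first by rewrite ?(tpermL, tpermR, eqxx, n1).
  have e3 : tperm k k1 i = i by rewrite tpermD // eq_sym.
  by rewrite ?(negbTE i1, negbTE i2, tpermL, tpermR, n1, e3).
rewrite -!mulrA /tk.
have a1 : Up k1 (srefl k : W r) by rewrite (UpB _ hk1) Pk tpermR.
have a2 : Up k (srefl k1 * srefl k : W r)%g.
  by rewrite (UpA _ hk) !(P_srefl_B _ _ hk1) n1 eqxx !Pk tpermL tpermR; lia.
have a3 : Up k1 (srefl k * (srefl k1 * srefl k) : W r)%g.
  by rewrite (UpB _ hk1) !(P_srefl_A _ _ hk) !(P_srefl_B _ _ hk1) tpermR n1 Pk tpermL.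
have b1 : Up k (srefl k1 : W r) by rewrite (UpA _ hk) !Pk1 n1 eqxx; lia.
have b2 : Up k1 (srefl k * srefl k1 : W r)%g.
  by rewrite (UpB _ hk1) !(P_srefl_A _ _ hk) !Pk1 tpermR n1.
have b3 : Up k (srefl k1 * (srefl k * srefl k1) : W r)%g.
  by rewrite (UpA _ hk) !(P_srefl_B _ _ hk1) n1 eqxx !(P_srefl_A _ _ hk) !Pk1 tpermL tpermR eqxx n1; lia.
by have := (tk_up D a1, tk_up D a2, tk_up D a3, tk_up D b1, tk_up D b2, tk_up D b3);
  rewrite /tk => -[[[[[-> ->] ->] ->] ->] ->]; rewrite e.
Qed.

(* The generator numbered from the end: [sg 0] is the sign change. *)
Definition sg a : D := if insub (r.-1 - a)%N is Some k then tk k else 1.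

Lemma sg_tk a k : (k + a = r.-1)%N -> sg a = tk k.
Proof.
move=> e; rewrite /sg; case: insubP => [l _ hl|]; last by rewrite -e addnK ltn_ord.
by congr (tk _); apply: val_inj; rewrite /= hl -e addnK.
Qed.

Lemma sg_ex a : (a < r)%N -> exists2 k : 'I_r, (k + a = r.-1)%N & sg a = tk k.
Proof.
move=> h; have h2 : (r.-1 - a < r)%N by lia.
have e : (Ordinal h2 + a = r.-1)%N by rewrite /=; lia.
by exists (Ordinal h2) => //; exact: sg_tk.
Qed.

Lemma sg_comm a b : (a.+1 < b < r)%N -> comm (sg b) (sg a).
Proof.
case/andP => ab br; have [k hk ->] := sg_ex br; have [l hl ->] := sg_ex (ltn_trans (ltnW ab) br).
by apply: tk_comm; lia.
Qed.

Lemma sg_braid a : (0 < a)%N -> (a.+1 < r)%N ->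
  sg a.+1 * sg a * sg a.+1 = sg a * sg a.+1 * sg a.
Proof.
move=> a0 ar; have [k hk ->] := sg_ex ar; have [l hl ->] := sg_ex (ltnW ar).
have h3 : (l.+1 < r)%N by lia.
by apply: (@braid3 k l (Ordinal h3)) => //=; lia.
Qed.

Lemma sg_braid4 : (1 < r)%N -> sg 0 * sg 1 * sg 0 * sg 1 = sg 1 * sg 0 * sg 1 * sg 0.
Proof.
move=> ar; have [k hk ->] := sg_ex r_gt0; have [l hl ->] := sg_ex ar.
by apply: braid4; lia.
Qed.

(** Without the usual normalization L_a = q^-a JM_a: the factor q^a + JM_a of [uu] is q^a (L_a + 1).
    As T_0 has eigenvalues q and -1, the first factor 1 + T_0 makes T_0 act on [uu] as q
    ([uu_sg0]). *)
Fixpoint JM a : D := if a is a'.+1 then sg a * JM a' * sg a else sg 0.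
Fixpoint uu a : D := if a is a'.+1 then uu a' * ((q ^+ a')%:A + JM a') else 1.

Lemma star_sg a : star (sg a) = sg a.
Proof. by rewrite /sg; case: insub => [k|]; rewrite ?star_tk ?star1. Qed.

Lemma star_JM a : star (JM a) = JM a.
Proof. by elim: a => [|a IH]; rewrite /= ?starM star_sg // IH mulrA. Qed.

Lemma sg_JM a b : (a.+1 < b < r)%N -> comm (sg b) (JM a).
Proof.
elim: a b => [|a IH] b h /=; first exact: sg_comm.
by do ?apply: commrM; try (apply: sg_comm; lia); apply: IH; lia.
Qed.

(** Only the case a = b + 1 is critical: there the relation of order four settles b = 0, and
    otherwise the braid relation is applied on both sides of the inner factor, which commutes with
    the outer generator. *)
Lemma sg_JM_lt a b : (b < a < r)%N -> comm (sg b) (JM a).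
Proof.
elim: a => [|a IH] // h; case: (ltngtP b a) => [ba|ba|e]; first last.
- rewrite {}e in h *; case: a h {IH} => [|a] h; first by rewrite /= /comm !mulrA sg_braid4.
  have c1 : comm (sg a.+2) (JM a) by apply: sg_JM; lia.
  rewrite [JM a.+2]/= /comm.
  set s := sg a.+1; set t := sg a.+2; set l := JM a.
  have br : t * s * t = s * t * s by apply: sg_braid; lia.
  rewrite -/t in c1; rewrite /comm -/l in c1.
  transitivity (t * s * (t * l) * s * t); first by rewrite !mulrA br.
  rewrite c1; transitivity (t * s * l * (t * s * t)); first by rewrite !mulrA.
  by rewrite br !mulrA.
- lia.
- by rewrite [JM a.+1]/=; do ?apply: commrM; try (apply/commr_sym/sg_comm; lia); apply: IH; lia.
Qed.

Lemma JM_comm a b : (b < a < r)%N -> comm (JM b) (JM a).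
Proof.
move=> h; apply: commr_sym; elim: b h => [|b IH] h /=; first by apply/commr_sym/sg_JM_lt.
by do ?apply: commrM; try (apply/commr_sym/sg_JM_lt; lia); apply: IH; lia.
Qed.

Lemma commr_scal x c : comm x c%:A.
Proof. by rewrite /comm -scalerAl -scalerAr mul1r mulr1. Qed.

Lemma uu_JM a b : (b <= a < r)%N -> comm (JM a) (uu b).
Proof.
elim: b => [|b IH] h /=; first exact: commr1.
apply: commrM; first by apply: IH; lia.
by apply: commrD; [exact: commr_scal|apply/commr_sym/JM_comm; lia].
Qed.

Lemma uu_sg_gt a b : (a < b < r)%N -> comm (sg b) (uu a).
Proof.
elim: a => [|a IH] h /=; first exact: commr1.
apply: commrM; first by apply: IH; lia.
by apply: commrD; [exact: commr_scal|apply: sg_JM; lia].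
Qed.

Lemma sg2 a : (a < r)%N -> sg a * sg a = q%:A + (q - 1) *: sg a.
Proof. by case/sg_ex => k _ ->; exact: tk2. Qed.

(** The critical factors are those with indices b - 1 and b. With s the generator and l = JM_(b-1),
    their product is a combination of 1, of q l + s l s and of l s l s; s commutes with the second
    by the quadratic relation, and with the third because l and s l s commute. *)
Lemma uu_sg_lt a b : (b < a <= r)%N -> comm (sg b) (uu a).
Proof.
elim: a => [|a IH] // h; case: (ltngtP b a) => [ba|ba|e]; last first.
- subst b; case: a h {IH} => [|a] h; first by rewrite /= expr0 scale1r mul1r; apply: commrD; [exact: commr1|].
  have c1 : comm (sg a.+1) (uu a) by apply: uu_sg_gt; lia.
  rewrite [uu a.+2]/= -mulrA; apply: commrM => //.
  have c2 : comm (JM a) (JM a.+1) by apply: JM_comm; lia.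
  have s2 : sg a.+1 * sg a.+1 = q%:A + (q - 1) *: sg a.+1 by apply: sg2; lia.
  rewrite /comm /= in c2; set s := sg a.+1 in c1 c2 s2 *; set l := JM a in c2 *.
  rewrite mulrDl !mulrDr -!scalerAl !mul1r -!scalerAr !mulr1.
  rewrite !addrA; apply: commrD; last first.
    rewrite /comm c2 -!mulrA; congr (s * _).
    by have := c2; rewrite -!mulrA => e; rewrite [in RHS]e.
  rewrite -addrA; apply: commrD; first by rewrite scalerA; exact: commr_scal.
  rewrite exprSr -scalerA -scalerDr /comm -scalerAr -scalerAl; congr (_ *: _).
  rewrite mulrDr mulrDl -scalerAr -scalerAl.
  rewrite -[s * l * s * s]mulrA s2 -[s * l * s]mulrA [s * (s * _)]mulrA s2.
  rewrite !mulrDl !mulrDr -!scalerAl -!scalerAr !mul1r !mulr1 -!mulrA.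
  by rewrite addrAC [in RHS]addrAC; congr (_ + _); rewrite addrC.
- lia.
rewrite [uu a.+1]/=; apply: commrM; first by apply: IH; lia.
by apply: commrD; [exact: commr_scal|apply: sg_JM_lt; lia].
Qed.

Lemma uu_sg0 a : (0 < a <= r)%N -> sg 0 * uu a = q *: uu a.
Proof.
case: a => [|a] // h; elim: a h => [|a IH] h.
  rewrite /= expr0 scale1r mul1r mulrDr sg2 // mulr1 addrCA.
  by rewrite -{1}[sg 0]scale1r -scalerDl addrCA subrr addr0 scalerDr.
rewrite [uu a.+2]/= mulrA -[uu a * _]/(uu a.+1) IH ?scalerAl //; lia.
Qed.

Lemma star_uu a : (a <= r)%N -> star (uu a) = uu a.
Proof.
elim: a => [|a IH] h /=; first exact: star1.
rewrite starM IH 1?ltnW // starD starZ star1 star_JM; apply/esym.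
have := uu_JM (a := a) (b := a); rewrite leqnn h => /(_ isT) e.
by apply: commrD; [exact: commr_scal|exact: commr_sym].
Qed.

Fixpoint Cup a : D := if a is a'.+1 then Cup a' * sg a else 1.
Fixpoint Cdn a : D := if a is a'.+1 then sg a * Cdn a' else 1.

Lemma JM_Cup a : JM a = Cdn a * sg 0 * Cup a.
Proof. by elim: a => [|a IH] /=; rewrite ?mul1r ?mulr1 // IH !mulrA. Qed.

End JucysMurphy.

(** * Words and the q-permutation elements *)

Section Words.
Variables (r : nat) (D : hecke_data r).
Local Notation K := (hK D).
Local Notation q := (h_q D).
Local Notation T := (@hT r D).
Local Notation Tb := (@hTb r D).
Local Notation tk := (tk D).
Local Notation uu := (uu D).
Implicit Types (w v d : W r) (i j k : 'I_r) (J : {set 'I_r}) (x y h : D) (a b m n : nat).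
Implicit Types (f g : 'I_r -> nat).

Let r_gt0 : (0 < r)%N := h_r D.
Local Notation comm := GRing.comm.

Definition swp k : {perm 'I_r} := if insub k.+1 is Some k1 then tperm k k1 else 1%g.

Lemma swpE k k1 : k1 = k.+1 :> nat -> swp k = tperm k k1.
Proof.
move=> hk; rewrite /swp; case: insubP => [l _ hl|]; last by rewrite -hk ltn_ord.
by congr (tperm _ _); apply: val_inj; rewrite /= hl hk.
Qed.

Lemma swp_inv k : involutive (swp k).
Proof. by rewrite /swp; case: insub => [k1|] i; rewrite ?tpermK ?perm1. Qed.

Lemma sw_perm k f : sw k f = f \o swp k.
Proof.
by rewrite /sw /swp; case: insub => [k1|] //; apply: funext => i /=; rewrite perm1.
Qed.

Lemma swK k f : sw k (sw k f) = f.
Proof. by rewrite !sw_perm; apply: funext => i /=; rewrite swp_inv. Qed.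

Lemma sw_comp (rho : nat -> nat) k f : sw k (rho \o f) = rho \o sw k f.
Proof. by rewrite !sw_perm. Qed.

Inductive rearr f : ('I_r -> nat) -> Prop :=
| rearr_refl : rearr f f
| rearr_sw k g : rearr f g -> rearr f (sw k g).

Lemma rearr_trans f g f' : rearr f g -> rearr g f' -> rearr f f'.
Proof. by move=> h; elim=> // k g' _; apply: rearr_sw. Qed.

Lemma rearr_sym f g : rearr f g -> rearr g f.
Proof.
elim=> [|k g' _]; first exact: rearr_refl.
by apply: rearr_trans; rewrite -{2}(swK k g'); apply/rearr_sw/rearr_refl.
Qed.

Lemma rearr_perm f g : rearr f g -> exists p : {perm 'I_r}, g = f \o p.
Proof.
elim=> [|k g' _ [p ->]]; first by exists 1%g; apply: funext => i /=; rewrite perm1.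
by exists (swp k * p)%g; rewrite sw_perm; apply: funext => i /=; rewrite permM.
Qed.

Lemma rearr_comp (rho : nat -> nat) f g : rearr f g -> rearr (rho \o f) (rho \o g).
Proof.
elim=> [|k g' _ IH]; first exact: rearr_refl.
by rewrite -sw_comp; apply: rearr_sw.
Qed.

Lemma rearr_sum (F : nat -> nat) f g : rearr f g ->
  (\sum_i F (g i) = \sum_i F (f i))%N.
Proof. by case/rearr_perm => p ->; rewrite [RHS](reindex_inj (@perm_inj _ p)). Qed.

Definition cnt f (l : nat) : nat := (\sum_i (f i == l))%N.

Lemma rearr_cnt f g l : rearr f g -> cnt g l = cnt f l.
Proof. by move=> h; exact: (rearr_sum (fun x : nat => nat_of_bool (x == l)) h). Qed.

Definition winv f : nat := (\sum_(i < r) \sum_(j < r) (i < j) * (f j < f i))%N.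

Lemma winv_sw k k1 f : k1 = k.+1 :> nat -> (f k1 < f k)%N -> (winv (sw k f)).+1 = winv f.
Proof.
move=> hk lt; have := sum_lt_tperm (fun i j => (f j < f i)%N : nat) hk.
rewrite lt (ltnNge (f k)) (ltnW lt) /= addn1 addn0 /winv => <-; congr S.
by apply: eq_bigr => i _; apply: eq_bigr => j _; rewrite (swE _ hk).
Qed.

Lemma unsorted_down f : ~ sorted_word f -> exists k k1, k1 = k.+1 :> nat /\ (f k1 < f k)%N.
Proof.
move=> ns; apply: contrapT => h; apply: ns; apply: sorted_adj => k k1 hk.
by rewrite leqNgt; apply/negP => lt; apply: h; exists k, k1.
Qed.

(** Builds up f from a sorted rearrangement by exchanges that create an inversion, the direction in
    which T_k carries [M g] to [M (sw k g)]. *)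
Lemma word_sort_ind f (Q : ('I_r -> nat) -> Prop) :
  (forall g, rearr f g -> sorted_word g -> Q g) ->
  (forall g k k1, rearr f g -> k1 = k.+1 :> nat -> (g k < g k1)%N -> Q g -> Q (sw k g)) ->
  Q f.
Proof.
move=> Qs Qsw; suff h g : rearr f g -> Q g by apply/h/rearr_refl.
move: {2}(winv g) (erefl (winv g)) => n; elim/ltn_ind: n g => n IH g hn fg.
case: (pselect (sorted_word g)) => [|/unsorted_down [k [k1 [hk lt]]]]; first exact: Qs.
rewrite -(swK k g); apply: (Qsw _ k k1) => //; first exact: rearr_sw.
  by rewrite (swE _ hk) /= tpermL tpermR.
by apply: (IH (winv (sw k g))) => //; [rewrite -hn -(winv_sw hk lt)|exact: rearr_sw].
Qed.

Lemma rearr_sorted (rho : nat -> nat) f : exists2 g, rearr f g & sorted_word (rho \o g).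
Proof.
pose Q g := forall f, g = rho \o f -> exists2 g', rearr f g' & sorted_word (rho \o g').
suff : Q (rho \o f) by apply.
apply: word_sort_ind => [g _ sg f' e|g k k1 _ hk lt IH f' e].
  by exists f'; [exact: rearr_refl|rewrite -e].
have [|g' h s] := IH (sw k f'); first by rewrite -sw_comp -e swK.
exists g' => //; apply: rearr_trans h; exact/rearr_sw/rearr_refl.
Qed.

(** The Young subgroup sum for sorted f, and otherwise its left translate by a shortest coset
    representative: the rearrangements of f index the standard basis of a q-permutation module. *)
Definition M f : D := \sum_(w in U f) T w.

Lemma M_bco f w : bco Tb (M f) w = (w \in U f)%:R.
Proof. exact: bco_indic. Qed.

Lemma M_sw k k1 f : k1 = k.+1 :> nat -> (f k < f k1)%N -> tk k * M f = M (sw k f).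
Proof.
move=> hk lt; rewrite /M mulr_sumr [RHS](reindex_inj (mulgI (srefl k))).
apply: eq_big => w; first by rewrite (U_sw _ _ hk).
by case/UP => _ h; rewrite tk_up // (UpA _ hk) h.
Qed.

Lemma M_Linv f : Linv (eqJ f) (M f).
Proof.
apply/LinvP => k w kJ; have /eqJP[k1 [hk _]] := kJ.
by rewrite !M_bco -{1}(sw_eq kJ) (U_sw _ _ hk).
Qed.

Lemma M_eq k k1 f : k1 = k.+1 :> nat -> f k = f k1 -> tk k * M f = q *: M f.
Proof. by move=> hk e; apply: M_Linv; apply/eqJP; exists k1. Qed.

Lemma M_gt k k1 f : k1 = k.+1 :> nat -> (f k1 < f k)%N ->
  tk k * M f = q *: M (sw k f) + (q - 1) *: M f.
Proof.
move=> hk lt; have e : M f = tk k * M (sw k f).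
  by rewrite (M_sw hk) ?swK // (swE _ hk) /= tpermL tpermR.
by rewrite e mulrA tk2 mulrDl -!scalerAl mul1r -e.
Qed.

Lemma sw_B k f : k.+1 = r -> sw k f = f.
Proof. by move=> hk; rewrite /sw; case: insubP => [l|//]; rewrite hk ltnn. Qed.

Lemma M_rearr f g : rearr f g -> exists h, M g = h * M f.
Proof.
elim=> [|k g' _ [h e]]; first by exists 1; rewrite mul1r.
case: (next_ord k) => [[k1 hk]|hk]; last by exists h; rewrite sw_B.
case: (ltngtP (g' k) (g' k1)) => [lt|lt|eq].
- by exists (tk k * h); rewrite -mulrA -e (M_sw hk).
- exists (tki D k * h); rewrite -mulrA -e.
  have <- : tk k * M (sw k g') = M g'.
    by rewrite (M_sw hk) ?swK // (swE _ hk) /= tpermL tpermR.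
  by rewrite mulrA tkiK mul1r.
by exists h; rewrite -e sw_eq //; apply/eqJP; exists k1.
Qed.

Lemma M_sorted f : sorted_word f -> M f = xJ D (eqJ f).
Proof. by move=> sf; rewrite /M U_sorted //; apply: eq_bigl => w; rewrite inE. Qed.

Lemma star_M f : sorted_word f -> star (M f) = M f.
Proof.
move=> sf; rewrite M_sorted // /xJ star_sum [RHS](reindex_inj invg_inj).
by apply: eq_big => w; rewrite ?groupV // => _; rewrite star_T.
Qed.

Lemma tk_uu a k : (a <= r)%N -> k \in splitJ r a -> comm (tk k) (uu a).
Proof.
rewrite inE => ar /andP[kr ka]; pose b := (r.-1 - k)%N.
have -> : tk k = sg D b by apply/esym/sg_tk; rewrite /b; have := ltn_ord k; lia.
case: (ltngtP b a) => ba; [apply: uu_sg_lt|apply: uu_sg_gt|]; rewrite /b in ba *; lia.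
Qed.

Lemma M_uu a f : (a <= r)%N -> split_word a f -> comm (M f) (uu a).
Proof.
move=> ar sf; apply/commr_sym; rewrite /M; apply: commr_sum => w /(U_split sf) wJ.
move: w wJ; apply: WJ_len_ind => [|k v kJ _ hk IH]; first by rewrite T_one; exact: commr1.
by rewrite -(tk_up D hk); apply: commrM => //; apply/commr_sym/tk_uu.
Qed.

(* Letters at or above the threshold [th] form the first component. *)
Definition na (th : nat) f : nat := (\sum_i (th <= f i))%N.

Definition resp th a f := forall i, (th <= f i)%N = (r - a <= i)%N.

Lemma resp_split th a f : resp th a f -> split_word a f.
Proof.
clear r_gt0; move=> rf i j /andP[h1 h2]; have := rf i; have := rf j; rewrite h2 leqNgt => h3.
by rewrite [in (r - a <= i)%N]leqNgt h1 /= => /negbT; rewrite -ltnNge => h4; apply: leq_trans h4 _; lia.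
Qed.

Lemma na_le th f : (na th f <= r)%N.
Proof.
apply: leq_trans (_ : \sum_(i < r) 1 <= r)%N; last by rewrite sum1_card card_ord.
by apply: leq_sum => i _; exact: leq_b1.
Qed.

Lemma na_rearr th f g : rearr f g -> na th g = na th f.
Proof. by move=> h; exact: (rearr_sum (fun x : nat => nat_of_bool (th <= x)%N) h). Qed.

Lemma sum_ord_geq m : (m <= r)%N -> (\sum_(i < r) (m <= i) = r - m)%N.
Proof.
clear r_gt0; move=> mr; rewrite -(big_mkord xpredT (fun z : nat => nat_of_bool (m <= z)%N)).
rewrite (@big_cat_nat _ _ _ m) //= big_nat_cond big1 ?add0n; last first.
  by move=> z /andP[/andP[_ h] _]; rewrite leqNgt h.
rewrite big_nat_cond (eq_bigr (fun=> 1%N)); last by move=> z /andP[/andP[-> _] _].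
by rewrite -big_nat_cond sum_nat_const_nat muln1.
Qed.

Lemma sorted_resp th f : sorted_word f -> resp th (na th f) f.
Proof.
clear r_gt0; move=> sf i; apply/idP/idP => h.
  have : (\sum_(j < r) (i <= j) <= na th f)%N.
    by apply: leq_sum => j _; case: (leqP i j) => // /sf /(leq_trans h) ->.
  rewrite (sum_ord_geq (ltnW (ltn_ord i))); have := ltn_ord i.
  by move: (na th f) (nat_of_ord i) => a b; clear; lia.
rewrite leqNgt; apply/negP => lt.
have : (na th f <= \sum_(j < r) (i.+1 <= j))%N.
  apply: leq_sum => j _; case: (leqP th (f j)) => // hj; rewrite lt0b ltnNge.
  by apply/negP => /sf; lia.
move: h; rewrite sum_ord_geq //; have := ltn_ord i.
by move: (na th f) (nat_of_ord i) => a b; clear; lia.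
Qed.

Definition mm th f : D := M f * uu (na th f).

Definition wt f : nat := (\sum_i 2 ^ cnt f (f i))%N.

Lemma wt_rearr f g : rearr f g -> wt g = wt f.
Proof.
move=> fg; rewrite /wt -(rearr_sum (fun z : nat => 2 ^ cnt f z)%N fg).
by apply: eq_bigr => i _; rewrite (rearr_cnt _ fg).
Qed.

Lemma cnt_le f l : (cnt f l <= r)%N.
Proof.
apply: leq_trans (_ : \sum_(i < r) 1 <= r)%N; last by rewrite sum1_card card_ord.
by apply: leq_sum => i _; exact: leq_b1.
Qed.

Lemma wt_le f : (wt f <= r * 2 ^ r)%N.
Proof.
apply: leq_trans (_ : \sum_(i < r) 2 ^ r <= _)%N; last by rewrite sum_nat_const card_ord.
by apply: leq_sum => i _; rewrite leq_exp2l // cnt_le.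
Qed.

(* Contents are compared by the size of the first component, then by [wt], which
   increases with the dominance order by convexity of the powers of 2. *)
Definition key th f : nat := (na th f * (r * 2 ^ r).+1 + wt f)%N.

Lemma key_rearr th f g : rearr f g -> key th g = key th f.
Proof. by move=> fg; rewrite /key (na_rearr _ fg) (wt_rearr fg). Qed.

(** The two-sided ideal generated by the [mm th f] of key at least c. Sorted generators suffice
    ([Hi_gen]) and are fixed by [star], so the ideal is stable under [star]. *)
Inductive Hi (c : nat) : D -> Prop :=
| Hi_0 : Hi c 0
| Hi_step x (a b : D) th f : Hi c x -> sorted_word f -> (c <= key th f)%N ->
    Hi c (x + a * mm th f * b).

Lemma Hi_add c x y : Hi c x -> Hi c y -> Hi c (x + y).
Proof.
move=> hx; elim=> [|y' a b th f _ IH sf le]; first by rewrite addr0.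
by rewrite addrA; apply: Hi_step.
Qed.

Lemma Hi_mulL c x (a : D) : Hi c x -> Hi c (a * x).
Proof.
elim=> [|y' a' b th f _ IH sf le]; first by rewrite mulr0; exact: Hi_0.
by rewrite mulrDr (mulrA a) (mulrA a a'); apply: Hi_step.
Qed.

Lemma Hi_mulR c x (b : D) : Hi c x -> Hi c (x * b).
Proof.
elim=> [|y' a' b' th f _ IH sf le]; first by rewrite mul0r; exact: Hi_0.
by rewrite mulrDl -[_ * b' * b]mulrA; apply: Hi_step.
Qed.

Lemma Hi_scale c x (z : K) : Hi c x -> Hi c (z *: x).
Proof. by move=> h; rewrite -[x]mul1r scalerAl; apply: Hi_mulL. Qed.

Lemma Hi_gen c th f (a b : D) : (c <= key th f)%N -> Hi c (a * mm th f * b).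
Proof.
move=> le; have [g fg sg] := rearr_sorted id f.
have [h e] := M_rearr (rearr_sym fg).
rewrite /mm e -(na_rearr th fg) -[h * _ * _]mulrA -/(mm th g) mulrA -[a * _ * _ * _]add0r.
by apply: Hi_step; [exact: Hi_0|exact: sg|rewrite (key_rearr _ fg)].
Qed.

Lemma mm_sorted th f : sorted_word f -> mm th f = uu (na th f) * M f.
Proof. by move=> sf; apply: M_uu (na_le _ _) _; apply/resp_split/sorted_resp. Qed.

Lemma star_mm th f : sorted_word f -> star (mm th f) = mm th f.
Proof. by move=> sf; rewrite {1}/mm starM star_uu ?na_le // star_M // mm_sorted. Qed.

Lemma Hi_star c x : Hi c x -> Hi c (star x).
Proof.
elim=> [|y' a b th f _ IH sf le]; first by rewrite star0; exact: Hi_0.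
by rewrite starD [star (_ * b)]starM [star (a * _)]starM star_mm // mulrA; apply: Hi_step.
Qed.

(** Rearrange f to f1 so that rho o f1 is sorted. Equal letters are then contiguous, and f1 and rho
    o f1 have the same blocks, so [M f1] is invariant under the Young subgroup of rho o f1 and
    [Linv_div] divides it by [M (rho o f1)]. *)
Lemma mm_rename th th' (rho : nat -> nat) f :
  (forall i j, rho (f i) = rho (f j) -> f i = f j) ->
  (forall i, (th <= f i)%N = (th' <= rho (f i))%N) ->
  exists g, [/\ sorted_word g, rearr (rho \o f) g & exists h h', mm th f = h * mm th' g * h'].
Proof.
move=> inj comp; have [f1 ff1 s1] := rearr_sorted rho f.
have [p ep] := rearr_perm ff1.
exists (rho \o f1); split=> //; first exact: rearr_comp.
have [h e] := M_rearr (rearr_sym ff1).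
have eJ : eqJ (rho \o f1) = eqJ f1.
  apply/setP => k; apply/eqJP/eqJP => -[k1 [hk ek]]; exists k1; split=> //; last by rewrite /= ek.
  by move: ek; rewrite ep /= => /inj.
have [h' e'] : exists h', M f1 = M (rho \o f1) * h'.
  by rewrite (M_sorted s1) eJ; apply: Linv_div; exact: M_Linv.
have en : na th' (rho \o f1) = na th f.
  rewrite -(na_rearr th ff1) /na; apply: eq_bigr => i _.
  by rewrite ep /= comp.
have sp : split_word (na th f) f1.
  have := sorted_resp th' s1; rewrite en => rs.
  by apply: (@resp_split th) => i; rewrite -rs ep /= comp.
exists h, h'; rewrite /mm e -[h * _ * _]mulrA (M_uu (na_le _ _) sp) e' mulrA en.
rewrite -/(mm th' (rho \o f1)) -[in RHS]en -/(mm th' (rho \o f1)) mm_sorted // en.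
by rewrite !mulrA.
Qed.

End Words.

(** * Straightening of words *)

Section Garnir.
Variables (r : nat) (D : hecke_data r).
Local Notation K := (hK D).
Local Notation q := (h_q D).
Local Notation T := (@hT r D).
Local Notation Tb := (@hTb r D).
Local Notation tk := (tk D).
Local Notation uu := (uu D).
Local Notation M := (M D).
Local Notation mm := (mm D).
Implicit Types (w v d : W r) (i j k p : 'I_r) (J : {set 'I_r}) (x y h : D) (a b m n l : nat).
Implicit Types (f g : 'I_r -> nat).

Local Notation comm := GRing.comm.

Definition wd m (e : {ffun 'I_r -> 'I_m}) : 'I_r -> nat := fun i => e i.
Definition swf m k (e : {ffun 'I_r -> 'I_m}) : {ffun 'I_r -> 'I_m} := [ffun i => e (swp k i)].

Lemma wd_swf m k (e : {ffun 'I_r -> 'I_m}) : wd (swf k e) = sw k (wd e).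
Proof. by rewrite sw_perm; apply: funext => i; rewrite /wd ffunE. Qed.

Lemma wd_inj m : injective (@wd m).
Proof. by move=> e e' h; apply/ffunP => i; apply: val_inj; exact: (congr1 (fun f => f i) h). Qed.

Lemma swfK m k : involutive (@swf m k).
Proof. by move=> e; apply/ffunP => i; rewrite !ffunE swp_inv. Qed.

Lemma rearr_swf m k (e : {ffun 'I_r -> 'I_m}) : rearr (wd e) (wd (swf k e)).
Proof. by rewrite wd_swf; apply/rearr_sw/rearr_refl. Qed.

Variables (m : nat) (al : nat -> nat -> bool) (c : nat -> nat).
Hypothesis chain : forall l l' n n', al l n -> al l' n' -> (l < l')%N -> (n <= n')%N.

(** [al l n] allows the letter l of g to become n. By [chain], replacements respect the order of the
    letters weakly; hence an exchange that ascends in g never descends in e, and T_k acts on the sum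
    [Z] as on [M] ([Z_sw]). *)
Definition EE g : {set {ffun 'I_r -> 'I_m}} :=
  [set e : {ffun 'I_r -> 'I_m} | [forall i, al (g i) (e i)] && [forall l : 'I_m, cnt (wd e) l == c l]].

Lemma EEP g (e : {ffun 'I_r -> 'I_m}) :
  reflect ((forall i, al (g i) (e i)) /\ (forall l : 'I_m, cnt (wd e) l = c l)) (e \in EE g).
Proof.
rewrite inE; apply: (iffP andP) => -[h1 h2]; split.
- by move=> i; move/forallP: h1.
- by move=> l; apply/eqP; move/forallP: h2.
- exact/forallP.
- by apply/forallP => l; apply/eqP.
Qed.

(** Pairs of letters inverted in g that have become equal in f: on such a pair T_k contributes a
    scalar q instead of an exchange. *)
Definition NN g f : nat := (\sum_(i < r) \sum_(j < r) (i < j) * ((f i == f j) && (g j < g i)))%N.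

Lemma NN_sw k k1 g f : k1 = k.+1 :> nat ->
  (NN (sw k g) (sw k f) + ((f k == f k1) && (g k1 < g k)) =
   NN g f + ((f k == f k1) && (g k < g k1)))%N.
Proof.
move=> hk; have := sum_lt_tperm (fun i j => (f i == f j) && (g j < g i)%N : nat) hk.
rewrite [f k1 == f k]eq_sym /NN => <-; congr (_ + _)%N.
by apply: eq_bigr => i _; apply: eq_bigr => j _; rewrite !(swE _ hk).
Qed.

Lemma EE_sw k g (e : {ffun 'I_r -> 'I_m}) : (swf k e \in EE (sw k g)) = (e \in EE g).
Proof.
have h g' (e' : {ffun 'I_r -> 'I_m}) : e' \in EE g' -> swf k e' \in EE (sw k g').
  move=> /EEP[h1 h2]; apply/EEP; split=> [i|l]; first by rewrite sw_perm ffunE /= h1.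
  by rewrite -h2; apply: rearr_cnt; exact: rearr_swf.
by apply/idP/idP => [/h|]; [rewrite swfK swK|exact: h].
Qed.

Definition Z g : D := \sum_(e in EE g) q ^+ NN g (wd e) *: M (wd e).

Lemma Z_sw k k1 g : k1 = k.+1 :> nat -> (g k < g k1)%N -> tk k * Z g = Z (sw k g).
Proof.
move=> hk lt; rewrite /Z mulr_sumr [RHS](reindex_inj (inv_inj (@swfK m k))) /=.
apply: eq_big => e; first by rewrite EE_sw.
move=> /EEP[h1 _]; rewrite wd_swf -scalerAr.
have := NN_sw g (wd e) hk; rewrite lt (ltnNge (g k1)) (ltnW lt) andbF andbT addn0 => ->.
have : (wd e k <= wd e k1)%N by apply: chain (h1 k) (h1 k1) lt.
case: (ltngtP (wd e k) (wd e k1)) => // [lt2|e2] _; first by rewrite addn0 (M_sw D hk).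
by rewrite (M_eq D hk) // addn1 exprSr -scalerA sw_eq //; apply/eqJP; exists k1.
Qed.

Lemma Z_Linv g : Linv (eqJ g) (Z g).
Proof.
apply/LinvP => k w kJ; have /eqJP[k1 [hk e1]] := kJ.
rewrite /Z !bco_sum [RHS](reindex_inj (inv_inj (@swfK m k))) /=.
apply: eq_big => e; first by rewrite -{2}(sw_eq kJ) EE_sw.
rewrite !bcoZ !M_bco wd_swf => _.
have := NN_sw g (wd e) hk; rewrite e1 ltnn !andbF !addn0 (sw_eq kJ) => ->.
by rewrite -[in RHS](U_sw _ _ hk) swK.
Qed.

(* [Z g] is invariant under the stabilizer of [g], hence divisible by [M g]: a
   combination of words lies in the ideal attached to the content of [g]. *)
Lemma garnir th th' g : (forall l n, al l n -> (th' <= l)%N = (th <= n)%N) ->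
  exists h, Z g * uu (na th' g) = mm th' g * h.
Proof.
move=> hth; pose a := na th' g; rewrite /mm -/a.
apply: (word_sort_ind (f := g) (Q := fun g' => exists h, Z g' * uu a = M g' * uu a * h)) => [g' gg' sg'|g' k k1 gg' hk lt [h e]]; last first.
  exists h; rewrite -(M_sw D hk lt) -(Z_sw hk lt) -(mulrA (tk k)) e.
  by rewrite !mulrA.
have rg : resp th' a g' by rewrite /a -(na_rearr th' gg'); exact: sorted_resp.
have [h eh] := Linv_div (@Z_Linv g').
have ar : (a <= r)%N by exact: na_le.
have zc : comm (Z g') (uu a).
  apply/commr_sym/commr_sum => e /EEP[h1 _]; rewrite /GRing.comm -scalerAl -scalerAr; congr (_ *: _).
  apply/esym/M_uu => //; apply: (@resp_split _ th) => i.
  by rewrite -rg; apply/esym/hth.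
have gc : comm (M g') (uu a) by apply: M_uu => //; exact: resp_split rg.
exists h; rewrite zc eh -(M_sorted D sg') mulrA; congr (_ * _).
by rewrite gc.
Qed.

End Garnir.

Section Straightening.
Variables (r : nat) (D : hecke_data r).
Local Notation K := (hK D).
Local Notation q := (h_q D).
Local Notation T := (@hT r D).
Local Notation Tb := (@hTb r D).
Local Notation tk := (tk D).
Local Notation uu := (uu D).
Local Notation M := (M D).
Local Notation mm := (mm D).
Implicit Types (w v d : W r) (i j k p : 'I_r) (J : {set 'I_r}) (x y h : D) (a b m n l : nat).
Implicit Types (f g : 'I_r -> nat).

Local Notation comm := GRing.comm.
Local Notation B := {ffun 'I_r -> 'I_(r.*2)}.
Implicit Types (e s t : B).

Definition vv e : D := mm r (wd e).

Inductive Sp (Q : B -> Prop) : D -> Prop :=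
| Sp_0 : Sp Q 0
| Sp_step x (z : K) s : Sp Q x -> Q s -> Sp Q (x + z *: vv s).

Lemma Sp_vv (Q : B -> Prop) s : Q s -> Sp Q (vv s).
Proof. by move=> h; rewrite -[vv s]add0r -[vv s]scale1r; apply: Sp_step => //; exact: Sp_0. Qed.

Lemma Sp_add (Q : B -> Prop) x y : Sp Q x -> Sp Q y -> Sp Q (x + y).
Proof.
move=> hx; elim=> [|y' z s _ IH hs]; first by rewrite addr0.
by rewrite addrA; apply: Sp_step.
Qed.

Lemma Sp_scale (Q : B -> Prop) (z : K) x : Sp Q x -> Sp Q (z *: x).
Proof.
elim=> [|y' z' s _ IH hs]; first by rewrite scaler0; exact: Sp_0.
by rewrite scalerDr scalerA; apply: Sp_step.
Qed.

Lemma Sp_opp (Q : B -> Prop) x : Sp Q x -> Sp Q (- x).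
Proof. by rewrite -scaleN1r; exact: Sp_scale. Qed.

Lemma Sp_mono (Q Q' : B -> Prop) x : (forall s, Q s -> Q' s) -> Sp Q x -> Sp Q' x.
Proof. by move=> h; elim=> [|y z s _ IH /h hs]; [exact: Sp_0|exact: Sp_step]. Qed.

Definition cong (n : nat) (Q : B -> Prop) x := exists2 y, Sp Q y & Hi n (x - y).

Lemma cong_Sp n (Q : B -> Prop) x : Sp Q x -> cong n Q x.
Proof. by move=> h; exists x => //; rewrite subrr; exact: Hi_0. Qed.

Lemma cong_Hi n (Q : B -> Prop) x : Hi n x -> cong n Q x.
Proof. by move=> h; exists 0; [exact: Sp_0|rewrite subr0]. Qed.

Lemma cong_add n (Q : B -> Prop) x y : cong n Q x -> cong n Q y -> cong n Q (x + y).
Proof.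
move=> [x' hx hx'] [y' hy hy']; exists (x' + y'); first exact: Sp_add.
by rewrite opprD addrACA; exact: Hi_add.
Qed.

Lemma cong_scale n (Q : B -> Prop) (z : K) x : cong n Q x -> cong n Q (z *: x).
Proof.
by move=> [x' hx hx']; exists (z *: x'); [exact: Sp_scale|rewrite -scalerBr; exact: Hi_scale].
Qed.

Lemma cong_opp n (Q : B -> Prop) x : cong n Q x -> cong n Q (- x).
Proof. by rewrite -scaleN1r; exact: cong_scale. Qed.

Lemma cong_sum n (Q : B -> Prop) (S : Type) (ss : seq S) (R : pred S) (F : S -> D) :
  (forall z, R z -> cong n Q (F z)) -> cong n Q (\sum_(z <- ss | R z) F z).
Proof. by move=> h; elim/big_ind: _ => //; [exact/cong_Sp/Sp_0|exact: cong_add]. Qed.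

Lemma cong_bind n (Q Q' : B -> Prop) x : cong n Q x ->
  (forall s, Q s -> cong n Q' (vv s)) -> cong n Q' x.
Proof.
move=> [y hy hxy] h; rewrite -[x](subrK y); apply: cong_add; first exact: cong_Hi.
elim: hy => [|y' z s _ IH hs]; first exact/cong_Sp/Sp_0.
by apply: cong_add => //; apply/cong_scale/h.
Qed.

Lemma cong_mono n (Q Q' : B -> Prop) x : (forall s, Q s -> Q' s) -> cong n Q x -> cong n Q' x.
Proof. by move=> h [y hy hxy]; exists y => //; apply: Sp_mono hy. Qed.

Lemma vv_sw k k1 e : k1 = k.+1 :> nat -> (e k < e k1)%N -> tk k * vv e = vv (swf k e).
Proof.
move=> hk lt; rewrite /vv /mm mulrA (M_sw D hk) // wd_swf; congr (_ * uu _).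
by apply/esym/na_rearr/rearr_sw/rearr_refl.
Qed.

Lemma vv_eq k k1 e : k1 = k.+1 :> nat -> e k = e k1 -> tk k * vv e = q *: vv e.
Proof. by move=> hk eq; rewrite /vv /mm mulrA (M_eq D hk) /wd ?eq // -scalerAl. Qed.

Lemma vv_gt k k1 e : k1 = k.+1 :> nat -> (e k1 < e k)%N ->
  tk k * vv e = q *: vv (swf k e) + (q - 1) *: vv e.
Proof.
move=> hk lt; rewrite /vv /mm mulrA (M_gt D hk) // mulrDl -!scalerAl wd_swf; congr (_ *: (_ * uu _) + _).
by apply/esym/na_rearr/rearr_sw/rearr_refl.
Qed.

Lemma Sp_tk k (Q : B -> Prop) x : (k.+1 < r)%N -> (forall s, Q s -> Q (swf k s)) ->
  Sp Q x -> Sp Q (tk k * x).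
Proof.
move=> kr hQ; elim=> [|y z s _ IH hs]; first by rewrite mulr0; exact: Sp_0.
rewrite mulrDr -scalerAr; apply: Sp_add => //; apply: Sp_scale.
have hk : Ordinal kr = k.+1 :> nat by [].
case: (ltngtP (s k) (s (Ordinal kr))) => [lt|lt|/val_inj eq].
- by rewrite (vv_sw hk lt); apply/Sp_vv/hQ.
- by rewrite (vv_gt hk lt); apply: Sp_add; apply/Sp_scale/Sp_vv => //; exact: hQ.
by rewrite (vv_eq hk eq); apply/Sp_scale/Sp_vv.
Qed.

Lemma cong_tk n k (Q : B -> Prop) x : (k.+1 < r)%N -> (forall s, Q s -> Q (swf k s)) ->
  cong n Q x -> cong n Q (tk k * x).
Proof.
move=> kr hQ [y hy hxy]; exists (tk k * y); first exact: Sp_tk.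
by rewrite -mulrBr; exact: Hi_mulL.
Qed.

Definition pc e (n : nat) (l : nat) : nat := (\sum_(i < r | i < n) (e i == l :> nat))%N.

(* The letters below [r] and those from [r] on number the rows of the two
   components, whence no condition at the letter [r]. *)
Definition viol e p : bool :=
  [&& e p != 0%N :> nat, e p != r :> nat & (pc e p (e p).-1 < pc e p.+1 (e p))%N].

Definition ballot e : bool := [forall p, ~~ viol e p].

(* The condition that the content of a word is a bipartition. *)
Definition pcont e := forall l, (l.+1 < r.*2)%N -> l.+1 != r -> (cnt (wd e) l.+1 <= cnt (wd e) l)%N.

(** Straightening moves larger letters to later places and so raises [phi], which serves as the
    measure of that induction. *)
Definition phi f : nat := (\sum_(i < r) i * f i)%N.

Definition simil e s := (forall l, cnt (wd s) l = cnt (wd e) l) /\ (forall i, (r <= s i)%N = (r <= e i)%N).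

Section Step.
Variables (e : B) (p : 'I_r).
Hypothesis he : viol e p.
Let l := (e p : nat).

(* The letters l - 1 from place [p] on and the letters l up to place [p] are
   identified: since [p] violates the ballot condition, this increases the weight. *)
Definition gword : 'I_r -> nat := fun i => (
  if e i == l.-1 :> nat then if (i < p)%N then 3 * l.-1 else (3 * l.-1).+1
  else if e i == l :> nat then if (i <= p)%N then (3 * l.-1).+1 else (3 * l.-1).+2
  else 3 * e i)%N.

(** The letter x of [gword] may become y. The factor 3 leaves room above [3 * l.-1] for the merged
    letter [(3 * l.-1).+1] and for the copies of l that are not merged. *)
Definition gok (x y : nat) : bool := (
  if y == l.-1 then (x == 3 * l.-1) || (x == (3 * l.-1).+1)
  else if y == l then (x == (3 * l.-1).+1) || (x == (3 * l.-1).+2)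
  else x == 3 * y)%N.

Let l0 : (0 < l)%N. Proof. by case/and3P: he => h _ _; rewrite lt0n. Qed.
Let lr : l != r. Proof. by case/and3P: he. Qed.

Lemma gok_chain n n' a a' : gok n a -> gok n' a' -> (n < n')%N -> (a <= a')%N.
Proof. by have := l0; rewrite /gok; move: l => l1; repeat (case: ifP => ?); lia. Qed.

(** As l differs from r, the letters l - 1 and l lie in the same component, so the merging does not
    mix components. *)
Lemma gok_th n a : gok n a -> (3 * r <= n)%N = (r <= a)%N.
Proof. by have := l0; have := lr; rewrite /gok; move: l => l1; repeat (case: ifP => ?); lia. Qed.

Lemma gword_al i : gok (gword i) (e i).
Proof.
rewrite /gword /gok; case: eqP => h; first by case: ifP; rewrite eqxx ?orbT.
by case: eqP => h2; rewrite ?eqxx //; case: ifP; rewrite eqxx ?orbT.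
Qed.

Local Notation ee := (@EE r r.*2 gok (cnt (wd e)) gword).

Lemma e_ee : e \in ee.
Proof. by apply/EEP; split=> // i; exact: gword_al. Qed.

(** On the places of any one letter of e, [gword] increases weakly; so e has coefficient 1 in the
    relation, and it can be solved for [vv e]. *)
Lemma NN_e : NN gword (wd e) = 0%N.
Proof.
rewrite /NN big1 // => i _; rewrite big1 // => j _; apply/eqP; rewrite muln_eq0.
case: (ltnP i j) => //= ij; rewrite eqb0 negb_and -implybE; apply/implyP => /eqP eij.
have {}eij : (e i : nat) = e j := eij.
by rewrite -leqNgt /gword -eij; move: (e i : nat) (l) => n1 l1; repeat (case: ifP => ?); lia.
Qed.

Lemma ee_simil s : s \in ee -> simil e s.
Proof.
case/EEP => h1 h2; split=> [n|i].
  case: (ltnP n r.*2) => hn; first exact: (h2 (Ordinal hn)).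
  have z t : cnt (wd t) n = 0%N.
    rewrite /cnt big1 // => i _; apply/eqP; rewrite eqb0; apply/eqP => ei.
    by have := ltn_ord (t i); rewrite /wd in ei; rewrite ei ltnNge hn.
  by rewrite !z.
by rewrite -(gok_th (h1 i)) -(gok_th (gword_al i)).
Qed.

Local Notation mid := (3 * l.-1).+1.

Lemma pcE e' n l' : pc e' n l' = (\sum_(i < r) ((i < n) && (e' i == l' :> nat)))%N.
Proof. by rewrite /pc big_mkcond; apply: eq_bigr => i _; case: ifP. Qed.

(** The merged letter replaces the copies of l - 1 from p on and those of l up to p; the violation
    says that the latter outnumber the copies of l - 1 before p. *)
Lemma cnt_mid : (cnt (wd e) l.-1 < cnt gword mid)%N.
Proof.
have E : (cnt gword mid + pc e p l.-1 = cnt (wd e) l.-1 + pc e p.+1 l)%N.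
  rewrite !pcE /cnt -!big_split; apply: eq_bigr => i _ /=.
  rewrite /gword /wd ltnS; have := l0; move: (e i : nat) (l) => n1 l1.
  by repeat (case: ifP => ?); lia.
by case/and3P: he => _ _; rewrite -/l; lia.
Qed.

Lemma cnt_gword i : e i != l.-1 :> nat -> e i != l :> nat -> cnt gword (gword i) = cnt (wd e) (e i).
Proof.
move=> h1 h2; rewrite /cnt; apply: eq_bigr => j _; congr nat_of_bool.
rewrite /gword /wd (negbTE h1) (negbTE h2); move: (e i : nat) (e j : nat) (l) h1 h2 => n1 n2 l1 h1 h2.
by repeat (case: ifP => ?); lia.
Qed.

(** Grouped by letters, [wt] is the sum of c 2^c over the multiplicities c. If l - 1 occurs c1
    times, then l occurs at most c1 times, and both contribute at most 2 c1 2^c1; the merged letter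
    alone, with c > c1, contributes c 2^c, which is larger. *)
Lemma wt_gword : pcont e -> (wt (wd e) < wt gword)%N.
Proof.
move=> pe; pose Q i := (e i == l.-1 :> nat) || (e i == l :> nat).
rewrite /wt (bigID Q) [in ltnRHS](bigID Q) /=.
have -> : (\sum_(i | ~~ Q i) 2 ^ cnt (wd e) (wd e i) = \sum_(i | ~~ Q i) 2 ^ cnt gword (gword i))%N.
  by apply: eq_bigr => i; rewrite negb_or => /andP[h1 h2]; rewrite cnt_gword.
rewrite ltn_add2r.
have l2 : (cnt (wd e) l <= cnt (wd e) l.-1)%N.
  have := pe l.-1; rewrite prednK ?l0 //; apply; last exact: lr.
  exact: ltn_ord.
set c1 := cnt (wd e) l.-1 in l2 *; set c := cnt gword mid.
have hc : (c1 < c)%N := cnt_mid.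
apply: (@leq_ltn_trans ((c1 + c1) * 2 ^ c1)).
  apply: (@leq_trans (\sum_(i | Q i) 2 ^ c1)).
    apply: leq_sum => i /orP[/eqP h|/eqP h]; rewrite leq_exp2l // /wd h //.
  rewrite sum_nat_const leq_mul2r; apply/orP; right.
  apply: (@leq_trans (c1 + cnt (wd e) l)); last by rewrite leq_add2l.
  rewrite -sum1_card big_mkcond /c1 /cnt -big_split; apply: leq_sum => i _.
  by rewrite unfold_in /Q /wd; case: eqP => //=; case: eqP.
apply: (@leq_trans (\sum_(i | gword i == mid) 2 ^ c)).
  rewrite sum_nat_const; have -> : #|[pred i | gword i == mid]| = c.
    by rewrite -sum1_card big_mkcond; apply: eq_bigr => i _; rewrite unfold_in /=; case: eqP.
  apply: (@leq_trans (c * 2 ^ c1.+1)); last by rewrite leq_mul2l leq_exp2l // hc orbT.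
  have h0 : (0 < 2 ^ c1)%N by rewrite expn_gt0.
  by rewrite expnS; move: (2 ^ c1)%N h0 => X h0; nia.
rewrite [X in (_ <= X)%N](bigID (fun i => gword i == mid)) /=; apply: leq_trans (leq_addr _ _).
rewrite [X in (X <= _)%N]big_mkcond [X in (_ <= X)%N]big_mkcond.
apply: leq_sum => i _; case: ifP => // /eqP h; rewrite h ?eqxx andbT.
have -> : Q i.
  move: h; rewrite /Q /gword; move: (e i : nat) (l) => n1 l1.
  by repeat (case: ifP => ?); lia.
by [].
Qed.

Lemma na_gword : na (3 * r) gword = na r (wd e).
Proof. by rewrite /na; apply: eq_bigr => i _; rewrite (gok_th (gword_al i)). Qed.

Lemma key_gword : pcont e -> (key r (wd e) < key (3 * r) gword)%N.
Proof. by move=> pe; rewrite /key na_gword ltn_add2l wt_gword. Qed.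

Section Phi.
Variable s : B.
Hypothesis hs : s \in ee.
Let X i := (s i == l :> nat).
Let Y i := (e i == l :> nat).

(** Up to p a letter l can only drop to l - 1, and beyond p a letter l - 1 can only rise to l:
    copies of l move to the right. *)
Lemma ee_XY i : [/\ (s i + Y i = e i + X i)%N, (i <= p)%N -> (X i <= Y i)%N & (p < i)%N -> (Y i <= X i)%N].
Proof.
have [/(_ i) h _] := EEP _ _ _ _ hs; move: h; rewrite /gword /gok /X /Y; have := l0.
case: (eqVneq i p) => [->|/eqP ip].
  by rewrite -/l; move: (s p : nat) (l) => n1 l1; repeat (case: ifP => ?); split; lia.
have {}ip : (i : nat) <> p by move=> h; apply: ip; exact: val_inj.
by move: (s i : nat) (e i : nat) (l) => n1 n2 l1; repeat (case: ifP => ?); split; lia.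
Qed.

Lemma ee_sumXY : (\sum_i X i = \sum_i Y i)%N.
Proof. by have [h _] := ee_simil hs; exact: (h l). Qed.

(** The contribution of the place i to the growth of [phi], with places measured from p; this shift
    of origin is harmless because l occurs equally often in s and e. *)
Definition dlt i : nat := (if i <= p then (p - i) * (Y i - X i) else (i - p) * (X i - Y i))%N.

Lemma phi_dlt : phi (wd s) = (phi (wd e) + \sum_i dlt i)%N.
Proof.
have E i : (i * s i + p * Y i = i * e i + p * X i + dlt i)%N.
  have [h1 h2 h3] := ee_XY i; rewrite /dlt; case: leqP => hip.
    by have := h2 hip; move: (X i : nat) (Y i : nat) h1 => x y h1 h; have := subnKC hip; nia.
  by have := h3 hip; move: (X i : nat) (Y i : nat) h1 => x y h1 h; have := subnKC (ltnW hip); nia.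
apply: (@addIn (\sum_(i < r) p * Y i)%N); rewrite /phi -big_split /=.
rewrite (eq_bigr _ (fun i _ => E i)) !big_split /= -!big_distrr /= ee_sumXY /wd.
by rewrite addnAC.
Qed.

Lemma ee_eq : (forall i, X i = Y i) -> s = e.
Proof.
move=> h; apply/ffunP => i; apply: val_inj; have [h1 _ _] := ee_XY i.
by move: h1; rewrite h => /addIn.
Qed.

Lemma dlt0 i : i != p -> dlt i = 0%N -> X i = Y i.
Proof.
rewrite -val_eqE /dlt /= => ip; have [_ h2 h3] := ee_XY i; case: leqP => hip /eqP.
  by rewrite muln_eq0 => /orP[|]; have := h2 hip; case: (X i) (Y i) => [] [] //=; lia.
by rewrite muln_eq0 => /orP[|]; have := h3 hip; case: (X i) (Y i) => [] [] //=; lia.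
Qed.

Lemma X_at_p : (forall i, i != p -> X i = Y i) -> s = e.
Proof.
move=> h; apply: ee_eq => i; case: (eqVneq i p) => [->|/h //].
have := ee_sumXY; rewrite (bigD1 p) // [in RHS](bigD1 p) //= (eq_bigr _ (fun i hi => congr1 nat_of_bool (h i hi))).
by move/addIn; case: (X p) (Y p) => [] [].
Qed.

Lemma phi_lt : s != e -> (phi (wd e) < phi (wd s))%N.
Proof.
rewrite phi_dlt => se; rewrite -[ltnLHS]addn0 ltn_add2l lt0n; apply: contraNN se.
rewrite sum_nat_eq0 => /forallP h; apply/eqP/X_at_p => i ip; apply: dlt0 => //.
exact/eqP/(implyP (h i)).
Qed.

(** A growth of exactly one means that a single copy of l moves one place away from p, which is the
    exchange [swf p e]. *)
Lemma phi_lt1 k1 : k1 = p.+1 :> nat -> e k1 = l.-1 :> nat -> s != e -> s != swf p e ->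
  ((phi (wd e)).+1 < phi (wd s))%N.
Proof.
move=> hk ek se ssw; rewrite ltn_neqAle phi_lt // andbT; apply: contraNN ssw => /eqP.
rewrite phi_dlt -addn1 => /addnI/esym h1.
have Yp : Y p by rewrite /Y /l.
have Yk : Y k1 = false by rewrite /Y ek; have := l0; case: (l) => // n _; apply/negbTE; rewrite /= neq_ltn ltnSn.
have dle i : (dlt i <= 1)%N by rewrite -h1 (bigD1 i) //= leq_addr.
(* A change on the left of p would lose a copy of l that only p could regain, but e already has l at
   p. *)
have off i : i != p -> i != k1 -> X i = Y i.
  move=> ip ik; apply: dlt0 => //; apply/eqP; rewrite -leqn0 leqNgt; apply/negP => d1.
  have {}d1 : dlt i = 1%N by have := dle i; lia.
  have lt : (i < p)%N.
    move: d1; rewrite /dlt; case: (leqP i p) => hip; first by rewrite -val_eqE /= in ip; lia.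
    have : (1 < i - p)%N by rewrite -val_eqE /= in ik; lia.
    by case: (X i - Y i)%N => [|n]; nia.
  have oth j : j != i -> j != p -> X j = Y j.
    move=> ji jp; apply: dlt0 => //; move: h1; rewrite (bigD1 i) //= d1 (bigD1 j) //=; lia.
  have [_ h2 _] := ee_XY i.
  have XYi : X i = false /\ Y i = true.
    move: d1; rewrite /dlt (ltnW lt); have := h2 (ltnW lt); case: (X i) (Y i) => [] [] //=; lia.
  have := ee_sumXY; rewrite (bigD1 i) // [in RHS](bigD1 i) //= (bigD1 p) 1?eq_sym // [in RHS](bigD1 p) 1?eq_sym //=.
  rewrite (eq_bigr (fun j => nat_of_bool (Y j))); last by move=> j /andP[ji jp]; rewrite oth.
  by rewrite XYi.1 XYi.2 Yp; case: (X p); lia.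
have pk : p != k1 by rewrite -val_eqE /= hk; lia.
have := ee_sumXY; rewrite (bigD1 p) // [in RHS](bigD1 p) //= (bigD1 k1) 1?eq_sym // [in RHS](bigD1 k1) 1?eq_sym //=.
rewrite (eq_bigr (fun j => nat_of_bool (Y j))); last by move=> j /andP[jp jk]; rewrite off.
rewrite Yp Yk; case Xp : (X p); case Xk : (X k1); rewrite /= ?addnA => hh; try lia.
  exfalso; move/eqP: se; apply; apply: ee_eq => i.
  by case: (eqVneq i p) => [->|ip]; rewrite ?Xp ?Yp //; case: (eqVneq i k1) => [->|ik]; rewrite ?Xk ?Yk ?off.
apply/eqP/ffunP => i; rewrite ffunE (swpE hk); apply: val_inj => /=.
have [h2 _ _] := ee_XY i; case: tpermP => [ei|ei|/eqP ip /eqP ik].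
- by move: h2; rewrite ei Xp Yp ek -/l; have := l0; lia.
- by move: h2; rewrite ei Xk Yk ek -/l; have := l0; lia.
by move: h2; rewrite off // => /addIn.
Qed.

End Phi.

Section Adjacent.
Variable k1 : 'I_r.
Hypotheses (hk : k1 = p.+1 :> nat) (ek : e k1 = l.-1 :> nat).

Lemma gword_sw : sw p gword = gword.
Proof.
apply: sw_eq; apply/eqJP; exists k1; split=> //; rewrite /gword ek eqxx hk.
by rewrite ltnn leqnn -/l eqxx (ltnNge p.+1) leqnSn /= (gtn_eqF (_ : l.-1 < l)%N) // prednK ?l0.
Qed.

Lemma swf_ee : swf p e \in ee.
Proof. by rewrite -gword_sw EE_sw e_ee. Qed.

Lemma NN_swf : NN gword (wd (swf p e)) = 0%N.
Proof.
have := NN_sw gword (wd e) hk; rewrite gword_sw -wd_swf NN_e.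
have -> : (gword k1 < gword p)%N = (gword p < gword k1)%N.
  have := congr1 (fun f => f p) gword_sw; rewrite (swE _ hk) /= tpermL => ->.
  by [].
by move/eqP; rewrite eqn_add2r => /eqP.
Qed.

End Adjacent.

End Step.

End Straightening.

Section Straighten.
Variables (r : nat) (D : hecke_data r).
Local Notation K := (hK D).
Local Notation q := (h_q D).
Local Notation T := (@hT r D).
Local Notation Tb := (@hTb r D).
Local Notation tk := (tk D).
Local Notation uu := (uu D).
Local Notation M := (M D).
Local Notation mm := (mm D).
Implicit Types (w v d : W r) (i j k p : 'I_r) (J : {set 'I_r}) (x y h : D) (a b m n l : nat).
Implicit Types (f g : 'I_r -> nat).

Local Notation comm := GRing.comm.
Local Notation vv := (vv D).
Local Notation Sp := (@Sp r D).
Local Notation cong := (@cong r D).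
Local Notation B := {ffun 'I_r -> 'I_(r.*2)}.
Implicit Types (e s t : B).

Lemma simil_trans e s t : simil e s -> simil s t -> simil e t.
Proof. by move=> [h1 h2] [h3 h4]; split=> *; rewrite ?h3 ?h4. Qed.

Lemma sum_cnt e (F : nat -> nat) : (\sum_i F (e i) = \sum_(l < r.*2) cnt (wd e) l * F l)%N.
Proof.
rewrite (partition_big e predT) //=; apply: eq_bigr => l _.
rewrite /cnt big_distrl /= [LHS]big_mkcond; apply: eq_bigr => i _; rewrite /wd val_eqE.
by case: eqP => [->|]; rewrite ?mul1n ?mul0n.
Qed.

Definition samecnt e s := forall l, cnt (wd s) l = cnt (wd e) l.

Lemma samecnt_na e s : samecnt e s -> na r (wd s) = na r (wd e).
Proof.
move=> h; rewrite /na /wd (sum_cnt s (fun l => r <= l)%N) (sum_cnt e (fun l => r <= l)%N).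
by apply: eq_bigr => l _; rewrite h.
Qed.

Lemma samecnt_key e s : samecnt e s -> key r (wd s) = key r (wd e).
Proof.
move=> h; rewrite /key (samecnt_na h); congr (_ + _)%N.
rewrite /wt /wd (sum_cnt s (fun l => 2 ^ cnt (wd s) l))%N (sum_cnt e (fun l => 2 ^ cnt (wd e) l))%N.
by apply: eq_bigr => l _; rewrite !h.
Qed.

Lemma samecnt_sw k e : samecnt e (swf k e).
Proof. by move=> l; apply: rearr_cnt; exact: rearr_swf. Qed.

Lemma samecnt_trans e s t : samecnt e s -> samecnt s t -> samecnt e t.
Proof. by move=> h1 h2 l; rewrite h2. Qed.

Lemma samecnt_pcont e s : samecnt e s -> pcont e -> pcont s.
Proof. by move=> h pe l h1 h2; rewrite !h; exact: pe. Qed.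

Section Rel.
Variables (e : B) (p : 'I_r).
Hypotheses (he : viol e p) (pe : pcont e).
Local Notation g := (gword e p).
Local Notation ee := (@EE r r.*2 (gok e p) (cnt (wd e)) g).
Local Notation n0 := (key r (wd e)).+1.

(** [garnir] puts the sum into the ideal of [gword], whose key exceeds that of e. *)
Lemma straight_rel : Hi n0 (\sum_(s in ee) q ^+ NN g (wd s) *: vv s).
Proof.
have [h eh] := @garnir r D r.*2 _ (cnt (wd e)) (gok_chain he) r (3 * r) g (gok_th he).
have -> : \sum_(s in ee) q ^+ NN g (wd s) *: vv s = Z D r.*2 (gok e p) (cnt (wd e)) g * uu (na (3 * r) g).
  rewrite /Z mulr_suml; apply: eq_bigr => s hs; rewrite -scalerAl /vv /mm.
  by rewrite (na_gword he) (samecnt_na (proj1 (ee_simil he hs))).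
rewrite eh -[mm _ _]mul1r; apply: Hi_gen; exact: key_gword.
Qed.
End Rel.

Lemma phi_bound e : (phi (wd e) <= r * (r * r.*2))%N.
Proof.
rewrite -[X in (_ <= X * _)%N]card_ord -sum_nat_const; apply: leq_sum => i _.
by apply: leq_mul; apply: ltnW; [exact: ltn_ord|exact: (ltn_ord (e i))].
Qed.

Definition stQ e s := [/\ ballot s, simil e s & (phi (wd e) <= phi (wd s))%N].

(** A violation is removed by solving [straight_rel] for [vv e]. The other words have the same
    content, hence the same key, and larger [phi], which is bounded; so the process ends. *)
Lemma straighten e : pcont e -> cong (key r (wd e)).+1 (stQ e) (vv e).
Proof.
move: {2}(r * (r * r.*2) - phi (wd e))%N (leqnn (r * (r * r.*2) - phi (wd e))) => n.
elim: n e => [|n IH] e hn pe.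
all: case: (boolP (ballot e)) => [be|]; first by (apply/cong_Sp/Sp_vv).
all: rewrite negb_forall => /existsP[p]; rewrite negbK => he.
all: have hrel := straight_rel he pe; rewrite (bigD1 e) ?e_ee //= (NN_e he) expr0 scale1r in hrel.
all: rewrite -[vv e](addrK (\sum_(s in @EE r r.*2 (gok e p) (cnt (wd e)) (gword e p) | s != e)
   q ^+ NN (gword e p) (wd s) *: vv s)).
all: apply: cong_add; first exact: cong_Hi.
all: apply: cong_opp; apply: cong_sum => s /andP[hs se]; apply: cong_scale.
all: have [sc sr] := ee_simil he hs; have lt := phi_lt he hs se.
all: have bs := phi_bound s; have be := phi_bound e.
  by exfalso; lia.
rewrite -(samecnt_key sc); apply: cong_mono (IH s _ (samecnt_pcont sc pe)); last by lia.
move=> t [bt st pt]; split=> //; first exact: simil_trans st.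
by apply: leq_trans pt; exact: ltnW.
Qed.

Lemma pcE' e n l : pc e n l = (\sum_(i < r) ((i < n) && (e i == l :> nat)))%N.
Proof. exact: pcE. Qed.

Lemma pcS e p l : pc e p.+1 l = (pc e p l + (e p == l :> nat))%N.
Proof.
rewrite !pcE' (bigD1 p) // [in RHS](bigD1 p) //= ltnSn ltnn /= add0n addnC; congr addn.
apply: eq_bigr => i ip; congr (nat_of_bool (_ && _)).
by rewrite ltnS leq_eqVlt val_eqE (negbTE ip).
Qed.

Lemma pc_cnt e n l : (r <= n)%N -> pc e n l = cnt (wd e) l.
Proof.
by move=> rn; rewrite pcE'; apply: eq_bigr => i _; rewrite (leq_trans (ltn_ord i) rn).
Qed.

Lemma pc_eq e s n l : (forall i, (i < n)%N -> e i = s i) -> pc e n l = pc s n l.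
Proof. by move=> h; apply: eq_bigr => i hi; rewrite h. Qed.

Lemma ballot_pcont e : ballot e -> pcont e.
Proof.
move=> /forallP be l hl lr.
have [n [nr hn]] : exists n, (n <= r)%N /\ (r <= n)%N by exists r.
rewrite -!(pc_cnt _ _ hn); elim: n {hn} nr => [|n IH] nr.
  by rewrite !pcE' !big1.
have e1 := pcS e (Ordinal nr); rewrite /= in e1.
rewrite !e1; case: eqP => [h|_]; last by apply: leq_trans (leq_addr _ _); rewrite addn0 IH // ltnW.
have := be (Ordinal nr); rewrite /viol h lr /= -leqNgt => h2.
by apply: leq_trans (leq_addr _ _); rewrite e1 h eqxx in h2.
Qed.

(** Prefix counts change only between the two places, so the new violation is at k; it arises
    because s k was the copy of l - 1 that made room for s k1 = l. *)
Lemma viol_swf s k k1 : k1 = k.+1 :> nat -> ballot s -> ~~ ballot (swf k s) ->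
  [/\ viol (swf k s) k, (s k : nat) = (s k1).-1 & s k1 != 0%N :> nat].
Proof.
move=> hk /forallP bs; rewrite negb_forall => /existsP[p]; rewrite negbK => vp.
set t := swf k s in vp *.
have tk : t k = s k1 by rewrite ffunE (swpE hk) tpermL.
have tk1 : t k1 = s k by rewrite ffunE (swpE hk) tpermR.
have td i : i != k -> i != k1 -> t i = s i by move=> h1 h2; rewrite ffunE (swpE hk) tpermD // eq_sym.
have pk l : pc t k l = pc s k l.
  by apply: pc_eq => i ik; apply: td; rewrite -val_eqE /= ?hk; lia.
have p1 l : pc t k1 l = (pc s k l + (s k1 == l :> nat))%N by rewrite hk pcS pk tk.
have p2 l : pc t k1.+1 l = (pc s k l + (s k1 == l :> nat) + (s k == l :> nat))%N.
  by rewrite pcS p1 tk1.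
have q1 l : pc s k1 l = (pc s k l + (s k == l :> nat))%N by rewrite hk pcS.
have q2 l : pc s k1.+1 l = (pc s k l + (s k == l :> nat) + (s k1 == l :> nat))%N.
  by rewrite pcS q1.
have pge n l : (k1 < n)%N -> pc t n l = pc s n l.
  move=> kn; rewrite !pcE' (reindex_inj (@perm_inj _ (swp k))) /=; apply: eq_bigr => i _.
  rewrite ffunE swp_inv; congr (nat_of_bool (_ && _)); rewrite (swpE hk).
  by case: tpermP => [->|->|//]; rewrite ?hk in kn *; lia.
have pE : p = k.
  apply/eqP; apply/negPn/negP => ne.
  have vs := bs p; case: (eqVneq p k1) => [e1|ne1]; last first.
    case/negP: vs; move: vp; rewrite /viol td // => /and3P[-> -> /=].
    have : (p < k)%N || (k1 < p)%N by rewrite -val_eqE /= in ne; rewrite -val_eqE /= hk in ne1; rewrite hk; lia.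
    case/orP => lt; last by rewrite !pge // ltnW.
    rewrite (pc_eq (s := s)) 1?(pc_eq (e := t) (s := s)) // => i ip; apply: td; rewrite -val_eqE /= ?hk; lia.
  move: vp; rewrite {}e1 /viol tk1 p1 p2 eqxx => /and3P[h1 h2 h3].
  have := bs k; rewrite /viol h1 h2 /= -leqNgt pcS eqxx => h4.
  have es : s k1 = s k.
    apply: val_inj; apply/eqP => /=; move: h3 h4.
    by case: (_ == (s k : nat)) => //; case: (_ == _); lia.
  case/negP: (bs k1); rewrite /viol es h1 h2 /= q1 q2 es eqxx.
  by move: h3; rewrite es eqxx.
rewrite {}pE in vp; split=> //.
  move: vp; rewrite /viol tk pcS tk eqxx !pk => /and3P[h1 h2 h3].
  have := bs k1; rewrite /viol h1 h2 /= -leqNgt q1 q2 eqxx => h4.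
  apply/eqP; move: h3 h4; case: (s k == (s k1).-1 :> nat) => //.
  by case: (_ == _); lia.
by move: vp; rewrite /viol tk => /and3P[].
Qed.

Definition swQ s s' := [/\ ballot s', simil s s' & (phi (wd s) < phi (wd s'))%N].

Lemma phi_sw s k k1 : k1 = k.+1 :> nat -> (phi (wd (swf k s)) + s k1 = phi (wd s) + s k)%N.
Proof.
move=> hk; rewrite /phi /wd.
have kk : k != k1 by rewrite -val_eqE /= hk; lia.
rewrite (bigD1 k) // [in RHS](bigD1 k) //= (bigD1 k1) 1?eq_sym // [in RHS](bigD1 k1) 1?eq_sym //=.
rewrite !ffunE (swpE hk) tpermL tpermR.
rewrite (eq_bigr (fun i => i * s i)%N); last first.
  by move=> i /andP[h1 h2]; rewrite ffunE (swpE hk) tpermD // eq_sym.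
by rewrite hk; move: (\sum_(i < r | _) _)%N (s k : nat) (s k1 : nat) => X n1 n2; lia.
Qed.

(** Apply the relation to t = [swf k s], which violates at k. Both t and s occur in it with
    coefficient 1; as [phi] of s is one more than that of t, all other words lie beyond s by
    [phi_lt1]. *)
Lemma straighten_swap s k k1 : k1 = k.+1 :> nat -> ballot s -> ~~ ballot (swf k s) ->
  cong (key r (wd s)).+1 (swQ s) (vv (swf k s) + vv s).
Proof.
move=> hk bs nbt; have [vk sk s0] := viol_swf hk bs nbt.
set t := swf k s in vk nbt *.
have st : samecnt s t by exact: samecnt_sw.
have pt : pcont t by apply: samecnt_pcont st _; exact: ballot_pcont.
have tk : t k = s k1 by rewrite ffunE (swpE hk) tpermL.
have tk1 : t k1 = (t k).-1 :> nat by rewrite tk -sk ffunE (swpE hk) tpermR.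
have tt : swf k t = s by exact: swfK.
have ht := phi_sw s hk; rewrite -/t in ht.
have sr : s k1 != r :> nat by move: vk; rewrite /viol tk => /and3P[].
have sims : simil t s.
  split=> [l|i]; first by rewrite st.
  rewrite ffunE (swpE hk); case: tpermP => [->|->|//]; rewrite sk; move: s0 sr; lia.
have sE : s != t by apply: contraNN nbt => /eqP <-.
have ee1 := e_ee t k; have ee2 := swf_ee vk hk tk1; rewrite tt in ee2.
have hrel := straight_rel vk pt.
rewrite (bigD1 t) //= (NN_e vk) (bigD1 s) /= in hrel; last by rewrite ee2 sE.
have ns := NN_swf vk hk tk1; rewrite tt in ns.
rewrite ns expr0 !scale1r addrA in hrel; rewrite (samecnt_key st) in hrel.
rewrite -[_ + _](addrK (\sum_(i in @EE r r.*2 (gok t k) (cnt (wd t)) (gword t k) | (i != t) && (i != s))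
    q ^+ NN (gword t k) (wd i) *: vv i)).
apply: cong_add; last first.
  apply: cong_opp; apply: cong_sum => u /and3P[hu ut us]; apply: cong_scale.
  have [uc ur] := ee_simil vk hu.
  have lt := phi_lt1 vk hu hk tk1 ut; rewrite tt in lt; have {}lt := lt us.
  rewrite -(samecnt_key st) -(samecnt_key uc).
  apply: cong_mono (straighten (samecnt_pcont uc pt)) => z [bz sz pz]; split=> //.
    apply: simil_trans sz; apply: simil_trans (conj uc ur).
    by split=> *; rewrite ?(proj1 sims) ?(proj2 sims).
  by apply: leq_trans pz; move: lt ht; rewrite sk; move: s0; lia.
apply: cong_Hi; move: hrel.
by under eq_bigl do rewrite -andbA.
Qed.

End Straighten.

(** * The sign change modulo higher ideals *)

Section SignGenerator.
Variables (r : nat) (D : hecke_data r).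
Local Notation K := (hK D).
Local Notation q := (h_q D).
Local Notation T := (@hT r D).
Local Notation Tb := (@hTb r D).
Local Notation tk := (tk D).
Local Notation uu := (uu D).
Local Notation M := (M D).
Local Notation mm := (mm D).
Implicit Types (w v d : W r) (i j k p : 'I_r) (J : {set 'I_r}) (x y h : D) (a b m n l : nat).
Implicit Types (f g : 'I_r -> nat).

Local Notation comm := GRing.comm.
Local Notation vv := (vv D).
Local Notation Sp := (@Sp r D).
Local Notation cong := (@cong r D).
Local Notation sg := (sg D).
Local Notation B := {ffun 'I_r -> 'I_(r.*2)}.
Implicit Types (e s t : B).

(* The word with its last letter made largest: it is sorted when the others are. *)
Definition capw k s : 'I_r -> nat := fun i => if i == k then r.*2 else s i.

(** Sorts all letters but the last. The exchanges used stay away from the last place, so their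
    generators commute with the sign change. *)
Lemma head_ind e k (Q : B -> Prop) : k.+1 = r ->
  (forall s, samecnt e s -> s k = e k -> sorted_word (capw k s) -> Q s) ->
  (forall s i j, j = i.+1 :> nat -> (j < k)%N -> (s i < s j)%N -> samecnt e s ->
     s k = e k -> Q s -> Q (swf i s)) -> Q e.
Proof.
move=> hkr Qb Qs.
suff h s : samecnt e s -> s k = e k -> Q s by exact: h.
move: {2}(winv (wd s)) (leqnn (winv (wd s))) => n.
elim: n s => [|n IH] s hn es esk.
all: case: (pselect (sorted_word (capw k s))) => [|/unsorted_down [i [j [hj]]]]; first by (exact: Qb).
all: rewrite /capw; case: eqP => [_|/eqP jk]; first by (case: ifP => _; rewrite ltnNge ?leqnn //= ltnW).
all: case: eqP => [ei|/eqP ik lt];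
  first by (move=> _; exfalso; have := ltn_ord j; rewrite hj ei; move: hkr; lia).
all: have := winv_sw (f := wd s) hj lt; rewrite -wd_swf => hw.
  by exfalso; rewrite -hw in hn.
rewrite -(swfK i s); have sik : swf i s k = s k by rewrite ffunE (swpE hj) tpermD.
have jlt : (j < k)%N by have := ltn_ord j; rewrite -val_eqE /= in jk; move: hkr; lia.
have es2 : samecnt e (swf i s) by apply: samecnt_trans es _; exact: samecnt_sw.
apply: (Qs _ i j) => //.
- by rewrite !ffunE (swpE hj) tpermL tpermR.
- by rewrite sik.
by apply: IH => //; [rewrite -hw in hn|rewrite sik].
Qed.

Lemma sg_last k : k.+1 = r -> tk k = sg 0.
Proof. by move=> hk; apply/esym/sg_tk; rewrite addn0; lia. Qed.

Lemma capw_na k s : (r <= s k)%N -> na r (capw k s) = na r (wd s).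
Proof.
move=> h; apply: eq_bigr => i _; rewrite /capw /wd; case: eqP => // ->.
by rewrite h; lia.
Qed.

Lemma capw_na_lt k s : (s k < r)%N -> na r (capw k s) = (na r (wd s)).+1.
Proof.
move=> h; rewrite /na (bigD1 k) // [in RHS](bigD1 k) //= /capw /wd eqxx.
have -> : (r <= r.*2)%N by rewrite -addnn leq_addr.
rewrite add1n (leqNgt r (s k)) h add0n.
by congr S; apply: eq_bigr => i /negPf ik; rewrite ik.
Qed.

(** When the other letters are sorted, the word splits at the first component, which contains the
    last place; [uu] then passes to the left of [M] and absorbs T_0. *)
Lemma T0_hi e k : k.+1 = r -> (r <= e k)%N -> tk k * vv e = q *: vv e.
Proof.
move=> hkr; apply: (head_ind (k := k) (e := e) (Q := fun s => (r <= e k)%N -> tk k * vv s = q *: vv s)) => //.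
  move=> s es esk ss hk; rewrite -esk in hk.
  have rs := sorted_resp r ss; rewrite (capw_na hk) in rs.
  have rs' : resp r (na r (wd s)) (wd s).
    move=> i; rewrite -rs /capw /wd; case: eqP => // ->.
    by rewrite hk -addnn leq_addr.
  have a0 : (0 < na r (wd s))%N by have := rs' k; rewrite /wd hk; have := ltn_ord k; lia.
  rewrite /vv /mm (M_uu D (na_le _ _) (resp_split rs')) mulrA (sg_last hkr) uu_sg0; last by rewrite a0 na_le.
  by rewrite scalerAl.
move=> s i j hj jk lt es esk IH hk.
rewrite -(vv_sw D hj lt) mulrA -(tk_comm D (k := i) (l := k)) -?mulrA ?IH ?scalerAr //.
by rewrite -hj.
Qed.

Definition sgi a : D := h_qi D *: (sg a - (q - 1)%:A).

Lemma sgi_sg a : (a < r)%N -> sgi a * sg a = 1.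
Proof. by case/(sg_ex D) => k hk e; rewrite /sgi e; exact: tkiK. Qed.

Lemma q_sgi a : q *: sgi a = sg a - (q - 1)%:A.
Proof. by rewrite /sgi scalerA (h_qqi D) scale1r. Qed.

Fixpoint Cdni a : D := if a is a'.+1 then Cdni a' * sgi a else 1.

Lemma CdniK a : (a < r)%N -> Cdni a * Cdn D a = 1.
Proof.
elim: a => [|a IH] ar /=; first by rewrite mulr1.
by rewrite -mulrA (mulrA (sgi _)) sgi_sg // mul1r IH // ltnW.
Qed.

(** For a word with distinct increasing letters [M] is 1, so [uu a.+1] is itself a generator, with a
    first component of a + 1 letters. *)
Lemma uu_Hi a n : (a < r)%N -> (n <= a.+1 * (r * 2 ^ r).+1)%N -> Hi n (uu a.+1).
Proof.
move=> ar hn; pose f i := (i : nat).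
have Uf w : (w \in U f) = (w == 1%g).
  apply/UP/eqP => [[h1 h2]|->].
    apply: Up_all => k; case: (next_ord k) => [[k1 hk]|hk]; last by rewrite (UpB _ hk) h1.
    by rewrite (UpA _ hk) h2 // /f hk.
  by split=> [i|i j]; rewrite !P1.
have Mf : M f = 1 by rewrite /M (eq_bigl _ _ Uf) big_pred1_eq T_one.
have nf : na (r - a.+1) f = a.+1.
  by rewrite /na /f sum_ord_geq; lia.
have -> : uu a.+1 = 1 * mm (r - a.+1) f * 1 by rewrite /mm Mf nf !mul1r mulr1.
by apply: Hi_gen; rewrite /key nf; apply: leq_trans hn (leq_addr _ _).
Qed.

Section Lo.
Variables (s : B) (k : 'I_r).
Hypotheses (hkr : k.+1 = r) (ss : sorted_word (capw k s)) (hk : (s k < r)%N).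
Local Notation a := (na r (wd s)).

Let ar : (a < r)%N. Proof. by have := na_le r (capw k s); rewrite capw_na_lt. Qed.

Let sresp i : i != k -> (r <= s i)%N = (r.-1 - a <= i)%N.
Proof.
move=> /negPf ik; have := sorted_resp r ss i; rewrite capw_na_lt // /capw ik => ->.
by rewrite -subn1 -subnDA add1n.
Qed.

(** The word s with its last letter moved b places to the left, past letters of the first component.
    The index is always below r, so the default branch is not taken. *)
Fixpoint gb b : B := if b is b'.+1 then
  if insub (r.-2 - b')%N is Some j then swf j (gb b') else gb b' else s.

Lemma gb_prop b : (b <= a)%N -> [/\ samecnt s (gb b),
  forall i, (i : nat) = (r.-1 - b)%N -> gb b i = s k,
  forall i, (i < r.-1 - b)%N -> gb b i = s i &
  forall i, (r.-1 - b < i)%N -> (r <= gb b i)%N].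
Proof.
elim: b => [|b IH] hb.
  split=> // i hi; first by congr (s _); apply: val_inj; rewrite /= hi; move: hkr; lia.
  by exfalso; have := ltn_ord i; lia.
have [h1 h2 h3 h4] := IH (ltnW hb).
have hj : (r.-2 - b < r)%N by have := ltn_ord k; lia.
have hj1 : (r.-1 - b < r)%N by have := ltn_ord k; lia.
pose j := Ordinal hj; pose j1 := Ordinal hj1.
have hjj : j1 = j.+1 :> nat by rewrite /=; have := ar; lia.
have -> : gb b.+1 = swf j (gb b) by rewrite /= insubT.
have jE : swf j (gb b) j = s k by rewrite ffunE (swpE hjj) tpermL h2.
have j1E : swf j (gb b) j1 = s j by rewrite ffunE (swpE hjj) tpermR h3 //=; have := ar; lia.
have iE i : i != j -> i != j1 -> swf j (gb b) i = gb b i.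
  by move=> i1 i2; rewrite ffunE (swpE hjj) tpermD // eq_sym.
split.
- exact: samecnt_trans h1 (samecnt_sw _ _).
- by move=> i hi; rewrite -jE; congr (swf _ _ _); apply: val_inj; rewrite /= hi; lia.
- move=> i hi; rewrite iE ?h3 //; try (rewrite -val_eqE /=); have := ar; lia.
move=> i hi; case: (eqVneq i j1) => [->|ij1].
  rewrite j1E sresp /=; first by lia.
  by rewrite -val_eqE /=; have := ar; move: hkr; lia.
rewrite iE ?h4 //; first by rewrite -val_eqE /= in ij1; lia.
by rewrite -val_eqE /=; lia.
Qed.

Lemma M_gb b : (b < a)%N -> M (wd (gb b)) = sg b.+1 * M (wd (gb b.+1)).
Proof.
move=> hb; have [_ h2 h3 _] := gb_prop (ltnW hb).
have hj : (r.-2 - b < r)%N by have := ltn_ord k; lia.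
have hj1 : (r.-1 - b < r)%N by have := ltn_ord k; lia.
pose j := Ordinal hj; pose j1 := Ordinal hj1.
have hjj : j1 = j.+1 :> nat by rewrite /=; have := ar; lia.
have gE : gb b.+1 = swf j (gb b) by rewrite /= insubT.
rewrite gE (sg_tk D (k := j)); last by rewrite /=; have := ar; lia.
rewrite (M_sw D hjj) -?wd_swf ?swfK // /wd !ffunE (swpE hjj) tpermL tpermR h2 // h3 /=; last by have := ar; lia.
apply: leq_trans hk _; rewrite sresp /=; first by lia.
by rewrite -val_eqE /=; have := ar; move: hkr; lia.
Qed.

Lemma M_Cup b : (b <= a)%N -> M (wd s) = Cup D b * M (wd (gb b)).
Proof.
elim: b => [|b IH] hb; first by rewrite mul1r.
by rewrite (IH (ltnW hb)) (M_gb hb) mulrA.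
Qed.

Definition loQ t := samecnt s t /\ (r <= t k)%N.
Definition tailQ b t := samecnt s t /\ forall i, (r.-1 - b <= i)%N -> (r <= t i)%N.

Lemma Sp_Cdni b c x : (c <= b)%N -> (b <= a)%N -> Sp (tailQ b) x -> Sp (tailQ b) (Cdni c * x).
Proof.
elim: c x => [|c IH] x hc hb hx; first by rewrite mul1r.
rewrite /= -mulrA; apply: IH => //; first exact: ltnW.
have hj : (r.-2 - c < r)%N by have := ltn_ord k; lia.
have -> : sgi c.+1 = h_qi D *: (tk (Ordinal hj) - (q - 1)%:A).
  by rewrite /sgi (sg_tk D (k := Ordinal hj)) //=; have := ar; lia.
rewrite -scalerAl mulrBl -scalerAl mul1r; apply/Sp_scale/Sp_add; last exact/Sp_opp/Sp_scale.
apply: Sp_tk => //=; first by have := ar; lia.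
move=> t [h1 h2]; split; first exact: samecnt_trans h1 (samecnt_sw _ _).
have hj1 : (r.-1 - c < r)%N by have := ltn_ord k; lia.
have hjj : Ordinal hj1 = (Ordinal hj).+1 :> nat by rewrite /=; have := ar; lia.
move=> i hi; rewrite ffunE (swpE hjj).
by case: tpermP => _ *; apply: h2 => //=; have := ar; lia.
Qed.

(** By telescoping: q times an inverse generator is the generator minus q - 1. The generator undoes
    one move of the letter, and the remainder involves words whose last letter is in the first
    component. *)
Lemma V_Sp b : (b <= a)%N ->
  Sp loQ (q ^+ b *: (Cdni b * M (wd (gb b)) * uu a) - M (wd s) * uu a).
Proof.
elim: b => [|b IH] hb; first by rewrite expr0 scale1r mul1r subrr; exact: Sp_0.
have -> : q ^+ b.+1 *: (Cdni b.+1 * M (wd (gb b.+1)) * uu a) =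
   q ^+ b *: (Cdni b * M (wd (gb b)) * uu a) - q ^+ b *: ((q - 1) *: (Cdni b * vv (gb b.+1))).
  have [g1 _ _ _] := gb_prop hb.
  rewrite (M_gb hb) /vv /mm (samecnt_na g1) exprSr -scalerA -scalerBr; congr (_ *: _).
  rewrite [Cdni b.+1]/= -!mulrA scalerAr scalerAl q_sgi mulrBl mulrBr -scalerAl mul1r.
  by rewrite -scalerAr.
rewrite addrAC; apply: Sp_add; first exact: IH (ltnW hb).
apply/Sp_opp/Sp_scale/Sp_scale.
apply: (@Sp_mono _ _ (tailQ b)) => [t [h1 h2]|].
  by split=> //; apply: h2; move: hkr; lia.
apply: Sp_Cdni => //; first exact: ltnW.
have [g1 _ _ g4] := gb_prop hb; apply: Sp_vv; split=> // i hi; apply: g4.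
by have := ar; lia.
Qed.

(** With the last letter moved to the left, [M] of s is [Cup a] times [M] of [gb a], and T_0 [Cup a]
    = [Cdni a] JM_a. On [uu a], JM_a gives [uu a.+1], of higher key, minus q^a [uu a], which [V_Sp]
    turns into - [vv s] and words of [loQ]. *)
Lemma T0_lo_base : cong (key r (wd s)).+1 loQ (tk k * vv s + vv s).
Proof.
have [g1 g2 g3 g4] := gb_prop (leqnn a).
have rs : resp r a (wd (gb a)).
  move=> i; case: (ltngtP i (r.-1 - a)%N) => hi; rewrite -[wd (gb a) i]/(gb a i : nat).
  - rewrite g3 // sresp; last by rewrite -val_eqE /=; move: hkr; lia.
    by have := ar; lia.
  - by rewrite g4 //; have := ar; lia.
  by rewrite g2 // leqNgt hk; have := ar; lia.
have cm := M_uu D (na_le _ _) (resp_split rs).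
have JU : JM D a * uu a = uu a.+1 - q ^+ a *: uu a.
  rewrite [uu a.+1]/= mulrDr -scalerAr mulr1 addrAC subrr add0r.
  by apply: uu_JM; rewrite leqnn.
have cJ : comm (JM D a) (uu a) by apply: uu_JM; rewrite leqnn.
have S0 : sg 0 * Cup D a = Cdni a * JM D a by rewrite JM_Cup !mulrA (CdniK ar) mul1r.
have E : tk k * vv s = Cdni a * uu a.+1 * M (wd (gb a)) - q ^+ a *: (Cdni a * M (wd (gb a)) * uu a).
  rewrite /vv /mm (M_Cup (leqnn a)) (sg_last hkr) -(mulrA (Cup D a)) cm !mulrA S0 -(mulrA (Cdni a)) JU.
  by rewrite mulrBr mulrBl -scalerAr -scalerAl -!mulrA cm.
rewrite E -addrA; apply: cong_add.
  (* As [wt] is at most r 2^r, one more letter in the first component outweighs any [wt]. *)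
  by apply/cong_Hi/Hi_mulR/Hi_mulL/uu_Hi => //; rewrite /key mulSn [X in (_ <= X)%N]addnC -addnS leq_add2l ltnS wt_le.
by rewrite addrC -opprB; apply/cong_opp/cong_Sp/V_Sp.
Qed.

End Lo.

Lemma T0_lo e k : k.+1 = r -> (e k < r)%N -> cong (key r (wd e)).+1 (loQ e k) (tk k * vv e + vv e).
Proof.
move=> hkr; apply: (head_ind (k := k) (e := e)
  (Q := fun s => (e k < r)%N -> cong (key r (wd e)).+1 (loQ e k) (tk k * vv s + vv s))) => //.
  move=> s es esk ss hk; rewrite -(samecnt_key es).
  apply: cong_mono (T0_lo_base hkr ss _); last by rewrite esk.
  by move=> t [h1 h2]; split=> //; exact: samecnt_trans h1.
move=> s i j hj jk lt es esk IH hk.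
rewrite -(vv_sw D hj lt) mulrA -(tk_comm D (k := i) (l := k)) -?mulrA -?mulrDr; last by rewrite -hj.
apply: cong_tk (IH hk); first by rewrite -hj.
move=> t [h1 h2]; split; first exact: samecnt_trans h1 (samecnt_sw _ _).
rewrite ffunE (swpE hj) tpermD //; apply/eqP => e1; first by move: jk; rewrite hj e1 ltnNge leqnSn.
by move: jk; rewrite e1 ltnn.
Qed.

End SignGenerator.

(** * Spanning by the Murphy elements *)

Section Murphy.
Variables (r : nat) (D : hecke_data r).
Local Notation K := (hK D).
Local Notation q := (h_q D).
Local Notation T := (@hT r D).
Local Notation Tb := (@hTb r D).
Local Notation tk := (tk D).
Local Notation uu := (uu D).
Local Notation M := (M D).
Local Notation mm := (mm D).
Implicit Types (w v d : W r) (i j k p : 'I_r) (J : {set 'I_r}) (x y h : D) (a b m n l : nat).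
Implicit Types (f g : 'I_r -> nat).

Local Notation comm := GRing.comm.
Local Notation vv := (vv D).
Local Notation Sp := (@Sp r D).
Local Notation cong := (@cong r D).
Local Notation B := {ffun 'I_r -> 'I_(r.*2)}.
Implicit Types (e s t : B).

Definition mQ s t := ballot t /\ samecnt s t.

Lemma tk_cong k s : pcont s -> cong (key r (wd s)).+1 (mQ s) (tk k * vv s).
Proof.
move=> ps.
have C t : samecnt s t -> cong (key r (wd s)).+1 (mQ s) (vv t).
  move=> st; rewrite -(samecnt_key st); apply: cong_mono (straighten D (samecnt_pcont st ps)).
  by move=> u [bu [su _] _]; split=> //; exact: samecnt_trans su.
case: (next_ord k) => [[k1 hk]|hk].
  apply: (@cong_bind _ _ _ (samecnt s)); last exact: C.
  apply: cong_Sp; apply: Sp_tk; first by rewrite -hk.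
    by move=> t st; exact: samecnt_trans st (samecnt_sw _ _).
  exact: Sp_vv.
case: (leqP r (s k)) => h; first by rewrite (T0_hi D hk h); apply/cong_scale/C.
rewrite -[tk k * _](addrK (vv s)); apply: cong_add; last exact/cong_opp/C.
by apply: cong_bind (T0_lo D hk h) _ => t [st _]; exact: C.
Qed.

(** Modulo the ideal of larger key, the ballot words with the content of s span a left module, from
    which the cell modules arise. *)
Lemma left_cong h s : pcont s -> cong (key r (wd s)).+1 (mQ s) (h * vv s).
Proof.
move=> ps; move: h; apply: hecke_ind => [x y hx hy|z x hx||k x hx].
- by rewrite mulrDl; exact: cong_add.
- by rewrite -scalerAl; exact: cong_scale.
- rewrite mul1r; apply: cong_mono (straighten D ps).
  by move=> u [bu [su _] _].
rewrite -mulrA; have [y hy hxy] := hx.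
rewrite -[x * _](subrK y) mulrDr; apply: cong_add; first exact/cong_Hi/Hi_mulL.
elim: hy => [|y' z t _ IH [bt st]]; first by rewrite mulr0; exact/cong_Sp/Sp_0.
rewrite mulrDr; apply: cong_add => //; rewrite -scalerAr; apply: cong_scale.
rewrite -(samecnt_key st); apply: cong_mono (tk_cong k (samecnt_pcont st ps)).
by move=> u [bu tu]; split=> //; exact: samecnt_trans tu.
Qed.

Lemma sorted_uniq f g : sorted_word f -> sorted_word g -> (forall th, na th f = na th g) -> f = g.
Proof.
move=> sf sg h; apply: funext => i; have E th : (th <= f i)%N = (th <= g i)%N.
  by rewrite (sorted_resp th sf) (sorted_resp th sg) h.
by apply/eqP; rewrite eqn_leq -E leqnn E leqnn.
Qed.

Lemma samecnt_na_th e s th : samecnt e s -> na th (wd s) = na th (wd e).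
Proof.
move=> h; rewrite /na /wd (sum_cnt s (fun l => th <= l)%N) (sum_cnt e (fun l => th <= l)%N).
by apply: eq_bigr => l _; rewrite h.
Qed.

Lemma lam_ex s : exists e, sorted_word (wd e) /\ rearr (wd e) (wd s).
Proof.
have [g sg srt] := rearr_sorted id (wd s); have [p ep] := rearr_perm sg.
exists [ffun i => s (p i)].
have -> : wd [ffun i => s (p i)] = g by rewrite ep; apply: funext => i; rewrite /wd /= ffunE.
by split=> //; exact: rearr_sym.
Qed.

Definition lam s : B := sval (cid (lam_ex s)).

Lemma lam_sorted s : sorted_word (wd (lam s)).
Proof. by rewrite /lam; case: cid => e []. Qed.

Lemma lam_rearr s : rearr (wd (lam s)) (wd s).
Proof. by rewrite /lam; case: cid => e []. Qed.

Lemma lam_cnt s : samecnt (lam s) s.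
Proof. by move=> l; apply: rearr_cnt; exact: lam_rearr. Qed.

Lemma lam_uniq s e : samecnt e s -> sorted_word (wd e) -> lam s = e.
Proof.
move=> es se; apply: wd_inj; apply: sorted_uniq => // [|th]; first exact: lam_sorted.
by rewrite -(samecnt_na_th th (lam_cnt s)) (samecnt_na_th th es).
Qed.

Lemma Xw_ex s : exists h, vv s = h * vv (lam s).
Proof.
have [h e] := M_rearr D (lam_rearr s).
by exists h; rewrite /vv /mm e (samecnt_na_th _ (lam_cnt s)) mulrA.
Qed.

(** An arbitrary choice; it is only ever used through [XwE]. *)
Definition Xw s : D := sval (cid (Xw_ex s)).

Lemma XwE s : vv s = Xw s * vv (lam s).
Proof. by rewrite /Xw; case: cid. Qed.

Definition mst s t : D := vv s * star (Xw t).

Lemma star_vv e : sorted_word (wd e) -> star (vv e) = vv e.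
Proof. exact: star_mm. Qed.

Lemma mstE s t : samecnt s t -> mst s t = Xw s * star (vv t).
Proof.
move=> st; rewrite [in RHS]XwE [star (_ * _)]starM (star_vv (lam_sorted t)).
rewrite /mst {1}(XwE s) -mulrA; congr (_ * (vv _ * _)).
by apply: lam_uniq; [exact: samecnt_trans (lam_cnt t) (fun l => esym (st l))|exact: lam_sorted].
Qed.

Lemma star_mst s t : samecnt s t -> star (mst s t) = mst t s.
Proof. by move=> st; rewrite (mstE st) starM starK. Qed.

Definition good s t := [/\ ballot s, ballot t & samecnt s t].

Inductive MSp (c : nat) : D -> Prop :=
| MSp_0 : MSp c 0
| MSp_step x (z : K) s t : MSp c x -> good s t -> (c <= key r (wd s))%N -> MSp c (x + z *: mst s t).

Lemma MSp_add c x y : MSp c x -> MSp c y -> MSp c (x + y).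
Proof.
move=> hx; elim=> [|y' z s t _ IH gd le]; first by rewrite addr0.
by rewrite addrA; apply: MSp_step.
Qed.

Lemma MSp_scale c x (z : K) : MSp c x -> MSp c (z *: x).
Proof.
elim=> [|y' z' s t _ IH gd le]; first by rewrite scaler0; exact: MSp_0.
by rewrite scalerDr scalerA; apply: MSp_step.
Qed.

Lemma MSp_mst c s t : good s t -> (c <= key r (wd s))%N -> MSp c (mst s t).
Proof. by move=> g le; rewrite -[mst s t]add0r -[mst s t]scale1r; apply: MSp_step => //; exact: MSp_0. Qed.

Lemma MSp_le c c' x : (c <= c')%N -> MSp c' x -> MSp c x.
Proof.
move=> cc'; elim=> [|y' z' s t _ IH gd le]; first exact: MSp_0.
by apply: MSp_step => //; exact: leq_trans le.
Qed.

(** In each component the letters are renumbered by decreasing multiplicity, those of the first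
    component starting from r. The content becomes a bipartition, while multiplicities and
    threshold, hence the key, are kept. *)
Lemma mm_canon th f : exists e, [/\ sorted_word (wd e), pcont e, key r (wd e) = key th f &
  exists h h', mm th f = h * vv e * h'].
Proof.
pose leT n m := (cnt f m <= cnt f n)%N.
have tot : total leT by move=> n m; exact: leq_total.
pose L (b : bool) := path.sort leT
  (undup [seq f i | i <- enum 'I_r & (th <= f i)%N == b]).
have Lmem (b : bool) l : (l \in L b) = [exists i, ((th <= f i)%N == b) && (f i == l)].
  rewrite mem_sort mem_undup; apply/mapP/existsP => [[i]|[i /andP[h /eqP <-]]].
    by rewrite mem_filter => /andP[h _] ->; exists i; rewrite h eqxx.
  by exists i => //; rewrite mem_filter h mem_enum.
have Lsz (b : bool) : (size (L b) <= r)%N.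
  rewrite size_sort; apply: leq_trans (size_undup _) _; rewrite size_map.
  by rewrite -[X in (_ <= X)%N](size_enum_ord r) size_filter count_size.
have Lf i (b : bool) : (th <= f i)%N = b -> (f i \in L b) /\ (index (f i) (L b) < size (L b))%N.
  by move=> h; rewrite index_mem; split; rewrite Lmem; apply/existsP; exists i; rewrite h !eqxx.
pose rho l := if (th <= l)%N then (r + index l (L true))%N else index l (L false).
have rlt i : (rho (f i) < r.*2)%N.
  rewrite /rho; case: ifP => h; have [_ h2] := Lf _ _ h.
    by have := Lsz true; lia.
  by have := Lsz false; lia.
have rr i : (th <= f i)%N = (r <= rho (f i))%N.
  rewrite /rho; case: ifP => h; first by rewrite leq_addr.
  by have [_ h2] := Lf _ _ h; have := Lsz false; lia.
have rinj i j : rho (f i) = rho (f j) -> f i = f j.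
  move=> e; have : (th <= f i)%N = (th <= f j)%N by rewrite !rr e.
  move: e; rewrite /rho; case: ifP => h1; case: ifP => // h2.
    move/addnI => e _; have [m1 _] := Lf _ _ h1; have [m2 _] := Lf _ _ h2.
    by rewrite -(nth_index 0%N m1) e nth_index.
  move=> e _; have [m1 _] := Lf _ _ h1; have [m2 _] := Lf _ _ h2.
  by rewrite -(nth_index 0%N m1) e nth_index.
have rcnt i : cnt (rho \o f) (rho (f i)) = cnt f (f i).
  by apply: eq_bigr => j _; congr nat_of_bool; apply/eqP/eqP => /= [/rinj|->].
have [g [sg fg hh]] := mm_rename D rinj rr.
have [p ep] := rearr_perm fg.
have glt i : (g i < r.*2)%N by rewrite ep /=.
pose e : B := [ffun i => Ordinal (glt i)].
have we : wd e = g by apply: funext => i; rewrite /wd ffunE.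
exists e; rewrite /vv we; split=> //.
  move=> l hl lr; rewrite we !(rearr_cnt _ fg).
  case: (pselect (exists i, rho (f i) = l.+1)) => [[i ei]|no]; last first.
    rewrite {1}/cnt big1 // => i _; apply/eqP; rewrite eqb0; apply/eqP => ei.
    by apply: no; exists i.
  rewrite -ei rcnt.
  have adj (b : bool) n : (n.+1 < size (L b))%N -> (cnt f (nth 0 (L b) n.+1) <= cnt f (nth 0 (L b) n))%N.
    have := sort_sorted tot (undup [seq f i | i <- enum 'I_r & (th <= f i)%N == b]).
    by move/(sortedP 0%N); apply.
  have fin (b : bool) n : (th <= f i)%N = b -> index (f i) (L b) = n.+1 ->
      (forall j, f j \in L b -> (th <= f j)%N = b -> index (f j) (L b) = n -> rho (f j) = l) ->
      (cnt f (f i) <= cnt (rho \o f) l)%N.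
    move=> hb hn hrho; have [m1 s1] := Lf _ _ hb; rewrite hn in s1.
    have := mem_nth 0%N (ltnW s1); rewrite Lmem => /existsP[j /andP[/eqP jb /eqP ej]].
    have nj : index (f j) (L b) = n by rewrite ej index_uniq ?sort_uniq ?undup_uniq // ltnW.
    have [mj _] := Lf _ _ jb.
    rewrite -(hrho j mj jb nj) rcnt ej -(nth_index 0%N m1) hn; exact: adj.
  move: (ei); rewrite {1}/rho; case: ifP => h en.
    apply: (fin true (l - r)%N h); first by lia.
    by move=> j _ jb nj; rewrite /rho jb nj; lia.
  by apply: (fin false l h) => // j _ jb nj; rewrite /rho jb nj.
rewrite (key_rearr _ fg) /key; congr (_ * _ + _)%N.
  by apply: eq_bigr => i _; rewrite rr.
by apply: eq_bigr => i _; rewrite /= rcnt.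
Qed.

Lemma key_max th f : (key th f <= r * (r * 2 ^ r).+1 + r * 2 ^ r)%N.
Proof. by rewrite leq_add ?wt_le // leq_mul2r na_le orbT. Qed.

(** Downward induction on c, keys being bounded. A generator of key c is reduced to h1 [vv e] h2 by
    [mm_canon]; [left_cong] straightens it from the left and, through [star], from the right, and
    the errors have key above c. *)
Lemma Hi_MSp c x : Hi c x -> MSp c x.
Proof.
pose N := (r * (r * 2 ^ r).+1 + r * 2 ^ r)%N.
move: {2}(N.+1 - c)%N (leqnn (N.+1 - c)) => n; elim: n c x => [|n IH] c x hn.
  elim=> [|y a b th f _ h _ le]; first exact: MSp_0.
  by exfalso; have := key_max th f; rewrite -/N; lia.
elim=> [|y a b th f _ h sf le]; first exact: MSp_0.
apply: MSp_add => //; case: (ltngtP c (key th f)) le => // [lt|ce] _.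
  by apply: (MSp_le (leqnSn c)); apply: IH; [lia|exact: Hi_gen].
have [e [se pe ke [h1 [h2 eh]]]] := mm_canon th f.
have {}IH y' : Hi c.+1 y' -> MSp c y'.
  by move=> hy; apply: (MSp_le (leqnSn c)); apply: IH => //; lia.
have E y' : Hi (key r (wd e)).+1 y' -> MSp c y' by rewrite ke -ce; exact: IH.
have [y1 hy1 hd1] := left_cong (a * h1) pe.
have [y2 hy2 hd2] := left_cong (star (h2 * b)) pe.
rewrite eh !(mulrA a) -(mulrA _ h2) -[_ * vv e](subrK y1) mulrDl.
apply: MSp_add; first exact/E/Hi_mulR.
elim: hy1 => [|y1' z s _ IH1 [bs es]]; first by rewrite mul0r; exact: MSp_0.
rewrite mulrDl; apply: MSp_add => //; rewrite -scalerAl; apply: MSp_scale.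
have ls : lam s = e by exact: lam_uniq.
rewrite XwE ls -mulrA -[vv e * _]starK [star (vv e * _)]starM (star_vv se).
rewrite -[star (h2 * b) * vv e](subrK y2) starD mulrDr.
apply: MSp_add; first exact/E/Hi_mulL/Hi_star.
elim: hy2 => [|y2' z' t _ IH2 [bt et]]; first by rewrite star0 mulr0; exact: MSp_0.
rewrite starD mulrDr; apply: MSp_add => //; rewrite starZ -scalerAr; apply: MSp_scale.
have st : samecnt s t by move=> l; rewrite et es.
rewrite -(mstE st); apply: MSp_mst => //.
by rewrite ce -ke (samecnt_key es).
Qed.

(** The word with distinct increasing letters and empty first component gives the generator 1, so
    the ideal of level 0 is the whole algebra. *)
Lemma Hi_one x : Hi 0 x.
Proof.
suff h : Hi 0 (1 : D) by rewrite -[x]mulr1; exact: Hi_mulL.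
pose f i := (i : nat).
have Uf w : (w \in U f) = (w == 1%g).
  apply/UP/eqP => [[h1 h2]|->].
    apply: Up_all => k; case: (next_ord k) => [[k1 hk]|hk]; last by rewrite (UpB _ hk) h1.
    by rewrite (UpA _ hk) h2 // /f hk.
  by split=> [i|i j]; rewrite !P1.
have Mf : M f = 1 by rewrite /M (eq_bigl _ _ Uf) big_pred1_eq T_one.
have nf : na r f = 0%N by rewrite /na big1 // => i _; rewrite /f leqNgt ltn_ord.
have e1 : (1 : D) = 1 * mm r f * 1 by rewrite /mm Mf nf !mul1r.
by rewrite e1; apply: Hi_gen.
Qed.

End Murphy.

(** * Enumeration of standard bitableaux *)

Section CountShapes.
Local Open Scope nat_scope.
Variable r : nat.
Local Notation N := r.*2.
Local Notation shape := {ffun 'I_N -> nat}.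
Implicit Types (la mu : shape) (l m : 'I_N).

Definition part la : bool :=
  [forall l : 'I_N, forall m : 'I_N, (m == l.+1 :> nat) && (m != r :> nat) ==> (la m <= la l)].

Lemma partP la : reflect (forall l m, m = l.+1 :> nat -> m != r :> nat -> la m <= la l) (part la).
Proof.
apply: (iffP forallP) => [h l m e1 e2|h l].
  by move/forallP: (h l) => /(_ m)/implyP; apply; rewrite e1 eqxx -e1 e2.
by apply/forallP => m; apply/implyP => /andP[/eqP e1 e2]; apply: h.
Qed.

Definition inc la l : shape := [ffun m => la m + (m == l)].
Definition dec la l : shape := [ffun m => la m - (m == l)].

Lemma incK la l : dec (inc la l) l = la.
Proof. by apply/ffunP => m; rewrite !ffunE addnK. Qed.

Lemma decK la l : 0 < la l -> inc (dec la l) l = la.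
Proof. by move=> h; apply/ffunP => m; rewrite !ffunE subnK //; case: eqP => // ->. Qed.

Lemma inc_dec la l m : l != m -> dec (inc la l) m = inc (dec la m) l.
Proof.
move=> lm; apply/ffunP => i; rewrite !ffunE.
case: (eqVneq i m) => [->|_]; rewrite ?subn0 //.
by rewrite eq_sym (negbTE lm) !addn0.
Qed.

(* [ways n la] counts the chains of bipartitions from the empty one to [la]. *)
Fixpoint ways (n : nat) la : nat :=
  if n is n'.+1 then part la * \sum_(l | 0 < la l) ways n' (dec la l)
  else (la == [ffun=> 0]).

Lemma ways_part n la : ways n la != 0 -> part la.
Proof.
case: n => [|n] /=; last by rewrite muln_eq0 negb_or eqb0 negbK => /andP[].
by rewrite eqb0 negbK => /eqP ->; apply/partP => l m _ _; rewrite !ffunE.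
Qed.

Lemma ways_size n la : ways n la != 0 -> \sum_l la l = n.
Proof.
elim: n la => [|n IH] la /=; first by rewrite eqb0 negbK => /eqP ->; rewrite big1 // => l _; rewrite ffunE.
rewrite muln_eq0 negb_or => /andP[_]; rewrite sum_nat_eq0 => /forallPn[l]; rewrite negb_imply => /andP[h0 h].
rewrite -(IH _ h) [LHS](bigD1 l) //= [in RHS](bigD1 l) //= ffunE eqxx -addSn subn1 prednK //; congr (_ + _).
by apply: eq_bigr => m /negPf ml; rewrite ffunE ml subn0.
Qed.

(** [inc la l] and [dec la m] are the join and the meet of la and [inc (dec la m) l], taken row by
    row, and these preserve bipartitions. *)
Lemma part_join la l m : part la -> part (inc (dec la m) l) -> 0 < la m -> l != m ->
  part (inc la l) /\ part (dec la m).
Proof.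
move=> /partP p1 /partP p2 h lm.
have E1 i : inc la l i = maxn (la i) (inc (dec la m) l i).
  rewrite !ffunE; case: (eqVneq i m) => [->|_]; first by rewrite eq_sym (negbTE lm); lia.
  by lia.
have E2 i : dec la m i = minn (la i) (inc (dec la m) l i).
  rewrite !ffunE; case: (eqVneq i m) => [->|_]; first by rewrite eq_sym (negbTE lm); lia.
  by lia.
split; apply/partP => i j ij jr; have := p1 i j ij jr; have := p2 i j ij jr.
  by rewrite (E1 i) (E1 j); lia.
by rewrite (E2 i) (E2 j); lia.
Qed.

Definition nadd la := \sum_l part (inc la l).
Definition nrem la := \sum_(l | 0 < la l) part (dec la l).

(** A nonempty last row would make all r rows of its component nonempty. So with fewer than r boxes
    the bound on the number of rows is no restriction. *)
Lemma part_small la l : part la -> \sum_m la m < r -> l.+1 = r \/ l.+1 = N -> la l = 0.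
Proof.
move=> /partP pl sm hl; apply/eqP; rewrite -leqn0 leqNgt; apply/negP => l0.
have h n (m : 'I_N) : m + n = l -> (r <= m) = (r <= l) -> 0 < la m.
  elim: n m => [|n IH] m; first by rewrite addn0 => e _; have -> : m = l by exact: val_inj.
  move=> e em; have hm : m.+1 < N by have := ltn_ord l; lia.
  have g1 : Ordinal hm + n = l by rewrite /=; lia.
  have g2 : (r <= Ordinal hm) = (r <= l) by move: em => /=; case: (leqP r m) => h1; case: (leqP r l) => h2 // _; lia.
  have g3 : Ordinal hm != r :> nat by move: em => /=; case: (leqP r m) => h1; case: (leqP r l) => h2 // _; lia.
  exact: leq_trans (IH _ g1 g2) (pl m (Ordinal hm) erefl g3).
suff : r <= \sum_m la m by rewrite leqNgt sm.
apply: leq_trans (_ : \sum_(m : 'I_N) ((m <= l) && ((r <= m) == (r <= l))) <= _); last first.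
  apply: leq_sum => m _; case: andP => // -[ml /eqP e]; apply: (h (l - m)) => //; lia.
have e1 : \sum_(m < N) ((m <= l) && ((r <= m) == (r <= l))) = \sum_(0 <= m < N) ((m <= l) && ((r <= m) == (r <= l))).
  by rewrite big_mkord.
rewrite e1 (@big_cat_nat _ _ _ r) //=; last by rewrite -addnn leq_addr.
case: hl => hl.
  apply: leq_trans (leq_addr _ _); rewrite big_nat (eq_bigr (fun=> 1)); last first.
    move=> m /andP[_ mr]; have -> : m <= l by lia.
    have -> : (r <= m) = false by lia.
    by have -> : (r <= l) = false by lia.
  by rewrite -big_nat sum_nat_const_nat muln1 subn0.
apply: leq_trans (leq_addl _ _); rewrite big_nat (eq_bigr (fun=> 1)); last first.
  move=> m /andP[rm mN]; have -> : m <= l by lia.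
  by rewrite rm; have -> : r <= l by lia.
by rewrite -big_nat sum_nat_const_nat muln1; lia.
Qed.

Lemma part_inc la l : part la -> part (inc la l) =
  ((l == 0 :> nat) || (l == r :> nat) || [exists m : 'I_N, (l == m.+1 :> nat) && (la l < la m)]).
Proof.
move=> /partP pl; apply/partP/idP => [h|].
  case: (eqVneq (l : nat) 0) => //= l0; case: (eqVneq (l : nat) r) => //= lr.
  have hm : l.-1 < N by have := ltn_ord l; lia.
  apply/existsP; exists (Ordinal hm) => /=; rewrite prednK ?lt0n // eqxx /=.
  have := h (Ordinal hm) l; rewrite !ffunE eqxx /= prednK ?lt0n // => /(_ erefl lr).
  have -> : (Ordinal hm == l) = false by apply/negbTE; rewrite -val_eqE /=; lia.
  by rewrite addn0 addn1.
move=> h i j ij jr; rewrite !ffunE; case: (eqVneq j l) => [e|jl]; last by rewrite addn0; apply: leq_trans (leq_addr _ _); exact: pl.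
subst j; have -> : (i == l) = false by apply/negbTE; rewrite -val_eqE /= ij; lia.
move: h; rewrite ij /= -ij (negbTE jr) => /existsP[m /andP[/eqP e lt]].
have -> : i = m by apply: val_inj => /=; lia.
by rewrite addn0 addn1.
Qed.

Lemma part_dec la l : part la -> 0 < la l ->
  part (dec la l) = [forall m : 'I_N, (m == l.+1 :> nat) && (m != r :> nat) ==> (la m < la l)].
Proof.
move=> /partP pl l0; apply/partP/forallP => [h m|h i j ij jr].
  apply/implyP => /andP[/eqP e mr]; have := h l m e mr; rewrite !ffunE eqxx.
  have -> : (m == l) = false by apply/negbTE; rewrite -val_eqE /= e; lia.
  by lia.
rewrite !ffunE; case: (eqVneq i l) => [e|il]; last by rewrite subn0; apply: leq_trans (leq_subr _ _) _; exact: pl.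
subst i; have -> : (j == l) = false by apply/negbTE; rewrite -val_eqE /= ij; lia.
by have /implyP := h j; rewrite ij eqxx -ij jr => /(_ isT); lia.
Qed.

(** Within a component, row i + 1 can be lengthened exactly when row i can be shortened; last rows
    are empty by [part_small]. The first row of each component can always be lengthened, whence the
    2. *)
Lemma nadd_nrem la : 0 < r -> part la -> \sum_m la m < r -> nadd la = nrem la + 2.
Proof.
move=> r0 pl sm; rewrite /nadd /nrem.
pose lv (n : nat) := if insub n is Some l then la l else 0.
have lvE l : lv l = la l by rewrite /lv valK.
pose A (n : nat) : nat := (n == 0) || (n == r) || (lv n < lv n.-1).
pose R (n : nat) : nat := (0 < lv n) && ((n.+1 != r) && (n.+1 != N)) && (lv n.+1 < lv n).
have EA l : part (inc la l) = A l :> nat.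
  rewrite part_inc // /A; congr nat_of_bool; case: (eqVneq (l : nat) 0) => //= l0.
  case: eqP => //= lr; apply/existsP/idP => [[m /andP[/eqP e lt]]|lt].
    by rewrite e /= -e !lvE.
  have hm : l.-1 < N by have := ltn_ord l; lia.
  by exists (Ordinal hm); rewrite /= prednK ?lt0n // eqxx -(lvE (Ordinal hm)) -lvE.
have ER : \sum_(l | 0 < la l) part (dec la l) = \sum_(l < N) R l.
  rewrite big_mkcond; apply: eq_bigr => l _; rewrite /R lvE; case: ltnP => //= l0.
  rewrite part_dec //; case: (eqVneq l.+1 r) => [e|lr] /=.
    by have := part_small pl sm (or_introl e); lia.
  case: (eqVneq l.+1 N) => [e|lN] /=; first by have := part_small pl sm (or_intror e); lia.
  have hm : l.+1 < N by have := ltn_ord l; lia.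
  congr nat_of_bool; apply/forallP/idP => [h|lt m].
    by have := implyP (h (Ordinal hm)); rewrite /= eqxx lr -(lvE (Ordinal hm)); apply.
  by apply/implyP => /andP[/eqP e _]; rewrite -lvE e.
rewrite ER (eq_bigr _ (fun l _ => EA l)).
rewrite -(big_mkord xpredT A) -(big_mkord xpredT R).
have -> : N = (N.-1).+1 by lia.
rewrite big_nat_recl // [in RHS]big_nat_recr //=.
have -> : R N.-1 = 0.
  rewrite /R; have -> : N.-1.+1 = N by lia. rewrite eqxx /= !(andbF, andFb). reflexivity.
have -> : A 0 = 1 by [].
have -> : \sum_(0 <= i < N.-1) A i.+1 = \sum_(0 <= i < N.-1) (R i + (i == r.-1)).
  apply: eq_big_nat => i /andP[_ hi]; rewrite /A /R /=.
  case: (eqVneq i.+1 r) => [e|ir] /=; first by rewrite andbF; have -> : i == r.-1 by lia.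
  have -> : (i == r.-1) = false by lia.
  have -> : i.+1 != N by lia.
  by rewrite andbT addn0; congr nat_of_bool; case: (ltnP 0 (lv i)) => //; lia.
rewrite big_split /=; have -> : \sum_(0 <= i < N.-1) (i == r.-1) = 1.
  rewrite (bigD1_seq r.-1) ?iota_uniq ?mem_index_iota //=; last by lia.
  by rewrite eqxx big1 // => i /negPf ->.
by lia.
Qed.

Lemma sum_dec la l : 0 < la l -> (\sum_m dec la l m).+1 = \sum_m la m.
Proof.
move=> l0; rewrite (bigD1 l) // [in RHS](bigD1 l) //= ffunE eqxx -addSn subn1 prednK //; congr (_ + _).
by apply: eq_bigr => m /negPf ml; rewrite ffunE ml subn0.
Qed.

(** Of the moves up and then down, some return to la and the others move a box; [ways_dec_expand]
    finds the same second sum for down and then up. *)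
Lemma ways_inc_expand n la : part la ->
  \sum_l ways n.+1 (inc la l) = nadd la * ways n la +
     \sum_l \sum_(m | (0 < la m) && (m != l)) ways n (inc (dec la m) l).
Proof.
move=> pl; rewrite /nadd big_distrl -big_split; apply: eq_bigr => l _ /=.
rewrite (bigD1 l) /= ?ffunE ?eqxx ?addn1 // incK mulnDr; congr (_ + _).
rewrite big_distrr /=; apply: eq_big => [m|m /andP[hm ml]].
  by rewrite ffunE; case: eqP; rewrite ?addn0 // !andbF.
rewrite ffunE (negbTE ml) addn0 in hm; rewrite inc_dec 1?eq_sym //.
case: (eqVneq (ways n (inc (dec la m) l)) 0) => [->|/ways_part pw]; first by rewrite muln0.
by have [-> _] := part_join pl pw hm (ltac:(by rewrite eq_sym) : l != m); rewrite mul1n.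
Qed.

Lemma ways_dec_expand n la : part la ->
  \sum_(m | 0 < la m) part (dec la m) * \sum_l ways n (inc (dec la m) l) = nrem la * ways n la +
     \sum_l \sum_(m | (0 < la m) && (m != l)) ways n (inc (dec la m) l).
Proof.
move=> pl; rewrite (exchange_big_dep (fun m => 0 < la m)) /=; last by move=> l m _ /andP[].
rewrite /nrem big_distrl -big_split; apply: eq_bigr => m hm /=.
rewrite (bigD1 m) //= decK // mulnDr; congr (_ + _).
rewrite big_distrr /=; apply: eq_big => [l|l lm]; first by rewrite hm eq_sym.
case: (eqVneq (ways n (inc (dec la m) l)) 0) => [->|/ways_part pw]; first by rewrite muln0.
by have [_ ->] := part_join pl pw hm lm; rewrite mul1n.
Qed.

(** With U adding and D removing a box, [nadd_nrem] says D U = U D + 2, and therefore D U^(n+1) = 2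
    (n+1) U^n on the empty bipartition. *)
Lemma sum_ways_inc n la : n < r -> part la -> \sum_l la l = n ->
  \sum_l ways n.+1 (inc la l) = 2 * n.+1 * ways n la.
Proof.
elim: n la => [|n IH] la nr pl sl; rewrite ways_inc_expand //.
  have la0 m : la m = 0 by move/eqP: sl; rewrite sum_nat_eq0 => /forallP/(_ m)/eqP.
  rewrite [X in _ + X]big1 ?addn0 => [|l _]; last by rewrite big1 // => m; rewrite la0.
  rewrite nadd_nrem ?sl // /nrem big1 ?add0n // => m; rewrite la0 //.
have e2 := ways_dec_expand n.+1 pl.
have e3 : \sum_(m | 0 < la m) part (dec la m) * \sum_l ways n.+1 (inc (dec la m) l) =
    2 * n.+1 * ways n.+1 la.
  rewrite [ways n.+1 la]/= pl mul1n big_distrr /=; apply: eq_bigr => m hm.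
  case: (boolP (part (dec la m))) => pd; last first.
    rewrite mul0n; case: (eqVneq (ways n (dec la m)) 0) => [->|/ways_part]; first by rewrite muln0.
    by rewrite (negbTE pd).
  rewrite mul1n (IH (dec la m) (ltnW nr) pd) //.
  by apply: succn_inj; rewrite (sum_dec hm).
rewrite nadd_nrem ?sl //; last by lia.
by move: e2; rewrite e3; lia.
Qed.

Local Notation bshape := {ffun 'I_N -> 'I_r.+1}.
Definition sh (la : bshape) : shape := [ffun l => la l : nat].

(** D is adjoint to U, so one factor U of the norm of U^(n+1) is moved across as D and
    [sum_ways_inc] applies. *)
Lemma sum_ways2 n : n <= r -> \sum_(la : bshape) ways n (sh la) * ways n (sh la) = 2 ^ n * n`!.
Proof.
elim: n => [|n IH] nr.
  rewrite (bigD1 [ffun=> ord0]) //= big1 ?addn0.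
    have -> : sh [ffun=> ord0] = [ffun=> 0] by apply/ffunP => l; rewrite !ffunE.
    by rewrite eqxx.
  move=> la ne; case: eqP => // e; case/eqP: ne; apply/ffunP => l; apply: val_inj.
  by move/ffunP: e => /(_ l); rewrite !ffunE.
have -> : 2 ^ n.+1 * n.+1`! = 2 * n.+1 * (2 ^ n * n`!) by rewrite expnS factS; ring.
rewrite -(IH (ltnW nr)) big_distrr /=.
transitivity (\sum_(mu : bshape) \sum_(l | 0 < mu l) ways n.+1 (sh mu) * ways n (dec (sh mu) l)).
  apply: eq_bigr => mu _.
  transitivity (ways n.+1 (sh mu) * (part (sh mu) * \sum_(l | 0 < sh mu l) ways n (dec (sh mu) l))); first by [].
  case: (boolP (part (sh mu))) => pm.
    by rewrite mul1n big_distrr /=; apply: eq_bigl => l; rewrite ffunE.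
  case: (eqVneq (ways n.+1 (sh mu)) 0) => [->|/ways_part]; last by rewrite (negbTE pm).
  by rewrite mul0n big1.
transitivity (\sum_(la : bshape) \sum_l ways n.+1 (inc (sh la) l) * ways n (sh la)); last first.
  apply: eq_bigr => la _; rewrite -big_distrl /=.
  case: (eqVneq (ways n (sh la)) 0) => [->|h]; first by rewrite !muln0.
  by rewrite sum_ways_inc ?mulnA //; [exact: ways_part h|exact: ways_size].
rewrite (exchange_big_dep xpredT) //= [RHS]exchange_big /=; apply: eq_bigr => l _.
(* Row lengths are bounded by r to have a finite sum; shapes with row l already of length r have too
   many boxes to contribute. *)
pose up (la : bshape) : bshape := [ffun m => inord (la m + (m == l))].
pose dn (la : bshape) : bshape := [ffun m => inord (la m - (m == l))].
rewrite [RHS](bigID (fun la : bshape => la l < r)) /= [X in _ = _ + X]big1 ?addn0; last first.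
  move=> la; rewrite -leqNgt => hl.
  case: (eqVneq (ways n (sh la)) 0) => [->|/ways_size h]; first by rewrite muln0.
  by exfalso; move: h; rewrite (bigD1 l) //= ffunE; move: (val (la l)) hl => x; lia.
have dnE (la : bshape) : sh (dn la) = dec (sh la) l.
  by apply/ffunP => m; rewrite !ffunE inordK // ltnS; apply: leq_trans (leq_subr _ _) _; rewrite -ltnS.
have upE (la : bshape) : la l < r -> sh (up la) = inc (sh la) l.
  move=> h; apply/ffunP => m; rewrite !ffunE inordK // ltnS.
  by case: eqP => [->|_]; rewrite ?addn1 ?addn0 // -ltnS.
have shi : injective sh.
  by move=> a b e; apply/ffunP => m; apply: val_inj; move/ffunP: e => /(_ m); rewrite !ffunE.
have hup (la : bshape) : 0 < up la l -> la l < r.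
  rewrite ffunE eqxx /inord val_insubd; case: ifP => [h _|_]; last by rewrite ltnn.
  by move: h; rewrite addn1 ltnS.
rewrite (reindex_onto up dn) /=.
  apply: eq_big => [la|la /andP[h1 /eqP h2]].
    apply/andP/idP => [[h1 _]|h]; first exact: hup.
    have e1 : dn (up la) = la by apply: shi; rewrite dnE upE // incK.
    by rewrite e1 eqxx !ffunE eqxx inordK ?addn1.
  have hl := hup _ h1.
  by rewrite upE // incK.
move=> mu hm; apply: shi; rewrite upE ?dnE ?decK // ?ffunE // eqxx inordK; first by have := ltn_ord (mu l); lia.
by have := ltn_ord (mu l); lia.
Qed.

End CountShapes.

Section CountWords.
Local Open Scope nat_scope.
Variable r : nat.
Local Notation N := r.*2.
Local Notation shape := {ffun 'I_N -> nat}.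
Local Notation bshape := {ffun 'I_N -> 'I_r.+1}.
Local Notation B := {ffun 'I_r -> 'I_N}.

Definition ct (w : seq 'I_N) : shape := [ffun l => count_mem l w].

(** The list starts with the last letter of the word, so its tails are the initial parts of the
    word. *)
Fixpoint bal (w : seq 'I_N) : bool := if w is l :: w' then part (ct w) && bal w' else true.

Lemma ct_cons l w : ct (l :: w) = inc (ct w) l.
Proof. by apply/ffunP => m; rewrite !ffunE /= addnC eq_sym. Qed.

Lemma bal_ways n (la : shape) : \sum_(t : n.-tuple 'I_N) (bal t && (ct t == la)) = ways n la.
Proof.
elim: n la => [|n IH] la.
  rewrite (bigD1 [tuple]) //= big1 ?addn0 => [|t /eqP[]]; last exact: tuple0.
  have -> : ct [::] = [ffun=> 0] by apply/ffunP => l; rewrite !ffunE.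
  by rewrite eq_sym.
rewrite (reindex (fun p : 'I_N * n.-tuple 'I_N => cons_tuple p.1 p.2)) /=; last first.
  exists (fun t => (thead t, [tuple of behead t])) => [[l t] _|t _] /=.
    by rewrite theadE; congr (_, _); apply: val_inj.
  by rewrite [RHS]tuple_eta; apply: val_inj.
rewrite -(pair_big xpredT xpredT (fun l (t : n.-tuple 'I_N) => (part (ct (l :: t)) && bal t && (ct (l :: t) == la) : nat))) /=.
transitivity (\sum_(l : 'I_N) part la * \sum_(t : n.-tuple 'I_N | 0 < la l) (bal t && (ct t == dec la l))).
  apply: eq_bigr => l _; rewrite big_distrr /= [RHS]big_mkcond; apply: eq_bigr => t _; rewrite ct_cons.
  have -> : (inc (ct t) l == la) = (0 < la l) && (ct t == dec la l).
    apply/eqP/andP => [<-|[h /eqP ->]]; last exact: decK.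
    by rewrite incK eqxx ffunE eqxx addn1.
  case: (ltnP 0 (la l)) => h /=; last by rewrite !andbF.
  case: (eqVneq (ct t) (dec la l)) => [->|_]; rewrite ?andbF ?muln0 // !andbT decK //.
  by case: part; rewrite ?mul1n.
rewrite -big_distrr /=; congr (_ * _); rewrite [RHS]big_mkcond; apply: eq_bigr => l _.
by case: ltnP => h; [rewrite -IH|rewrite big_pred0].
Qed.

Implicit Types (s t : B).

Fixpoint wseq s (n : nat) : seq 'I_N :=
  if n is n'.+1 then (if insub n' is Some i then s i :: wseq s n' else wseq s n') else [::].

Lemma wseqS s (i : 'I_r) : wseq s i.+1 = s i :: wseq s i.
Proof. by rewrite /= valK. Qed.

Lemma ct_wseq s n : n <= r -> ct (wseq s n) = [ffun l : 'I_N => pc s n l].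
Proof.
elim: n => [|n IH] hn; first by apply/ffunP => l; rewrite !ffunE pcE' big1.
rewrite (wseqS s (Ordinal hn)); apply/ffunP => l.
rewrite ct_cons IH 1?ltnW // !ffunE -[n.+1]/((Ordinal hn).+1) pcS /=.
by rewrite -val_eqE eq_sym.
Qed.

Lemma ballot_pc s n l : ballot s -> n <= r -> l.+1 != r -> pc s n l.+1 <= pc s n l.
Proof.
move=> /forallP be + lr; elim: n => [|n IH] nr; first by rewrite !pcE' !big1.
have e1 := pcS s (Ordinal nr); rewrite /= in e1.
rewrite !e1; case: eqP => [h|_]; last by apply: leq_trans (leq_addr _ _); rewrite addn0 IH // ltnW.
have := be (Ordinal nr); rewrite /viol h lr /= -leqNgt => h2.
by apply: leq_trans (leq_addr _ _); rewrite e1 h eqxx in h2.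
Qed.

Lemma bal_wseq s n : ballot s -> n <= r -> bal (wseq s n).
Proof.
move=> bs; elim: n => [|n IH] hn //.
have e := wseqS s (Ordinal hn); rewrite /= in e; rewrite /= e /= -e (IH (ltnW hn)) andbT.
have := ct_wseq s hn; rewrite /= => ->.
by apply/partP => l m hm mr; rewrite !ffunE hm; apply: ballot_pc => //; rewrite -hm.
Qed.

Lemma size_wseq s n : n <= r -> size (wseq s n) = n.
Proof.
elim: n => [|n IH] hn //.
by have e := wseqS s (Ordinal hn); rewrite /= in e; rewrite /= e /= (IH (ltnW hn)).
Qed.

Lemma wseq_inj s t n : n <= r -> wseq s n = wseq t n -> forall i : 'I_r, i < n -> s i = t i.
Proof.
elim: n => [|n IH] hn //.
have e := wseqS s (Ordinal hn); have e' := wseqS t (Ordinal hn); rewrite /= in e e'.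
rewrite /= e e' => -[h1 h2] i; rewrite ltnS leq_eqVlt => /orP[/eqP hi|]; last exact: IH (ltnW hn) h2 i.
by have -> : i = Ordinal hn by apply: val_inj.
Qed.

Definition bc s : bshape := [ffun l : 'I_N => inord (cnt (wd s) l)].

Lemma bcE s l : bc s l = cnt (wd s) l :> nat.
Proof. by rewrite ffunE inordK // ltnS cnt_le. Qed.

Lemma bcP s t : reflect (samecnt s t) (bc s == bc t).
Proof.
apply: (iffP eqP) => [e l|h]; last by apply/ffunP => l; apply: val_inj; rewrite /= !bcE h.
case: (ltnP l N) => hl; first by rewrite -(bcE t (Ordinal hl)) -e bcE.
have z (u : B) : cnt (wd u) l = 0.
  rewrite /cnt big1 // => i _; apply/eqP; rewrite eqb0; apply/eqP => ei.
  by have := ltn_ord (u i); rewrite -[nat_of_ord (u i)]/(wd u i) ei ltnNge hl.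
by rewrite !z.
Qed.

Lemma card_ballot (la : bshape) : #|[set s : B | ballot s && (bc s == la)]| <= ways r (sh la).
Proof.
rewrite -bal_ways.
apply: (@leq_trans #|[set t : r.-tuple 'I_N | bal t && (ct t == sh la)]|); last first.
  by rewrite -sum1_card big_mkcond /=; apply: leq_sum => t _; rewrite inE; case: andP.
have sz s : size (wseq s r) == r by rewrite size_wseq.
pose f s : r.-tuple 'I_N := Tuple (sz s).
have finj : injective f.
  by move=> s t /(congr1 val) /= e; apply/ffunP => i; exact: (wseq_inj (leqnn r) e).
rewrite -(card_imset _ finj); apply: subset_leq_card; apply/fintype.subsetP => _ /imsetP[s + ->].
rewrite !inE => /andP[bs /eqP <-]; rewrite bal_wseq //=; apply/eqP.
by rewrite ct_wseq //; apply/ffunP => l; rewrite !ffunE pc_cnt // inordK // ltnS; exact: cnt_le.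
Qed.

Definition goodb (p : B * B) : bool := [&& ballot p.1, ballot p.2 & bc p.1 == bc p.2].

(** Together with [card_weyl] this bounds the number of Murphy elements by the rank of the Hecke
    algebra. *)
Lemma card_good : #|[set p | goodb p]| <= 2 ^ r * r`!.
Proof.
rewrite -(sum_ways2 (leqnn r)).
apply: leq_trans (_ : \sum_(la : bshape) #|[set s : B | ballot s && (bc s == la)]| * #|[set s : B | ballot s && (bc s == la)]| <= _).
  rewrite -sum1_card (partition_big (fun p : B * B => bc p.1) xpredT) //=.
  apply: leq_sum => la _; rewrite -cardsX sum1_card; apply: subset_leq_card.
  apply/fintype.subsetP => -[s t]; rewrite unfold_in !inE /= => /andP[/and3P[b1 b2 /eqP e1] /eqP e2].
  by rewrite b1 b2 -e1 e2 eqxx.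
by apply: leq_sum => la _; apply: leq_mul; exact: card_ballot.
Qed.

End CountWords.

Lemma mulmx1C_eq (R : comNzRingType) m n (P : 'M[R]_(n, m)) (Q : 'M[R]_(m, n)) :
  m = n -> P *m Q = 1%:M -> Q *m P = 1%:M.
Proof. by move=> e; subst m; exact: mulmx1C. Qed.

Lemma sum_enum_val (V : nmodType) (I : finType) (F : I -> V) :
  \sum_i F i = \sum_(i < #|I|) F (enum_val i).
Proof.
rewrite (reindex (@enum_val I predT)) //; exists enum_rank => [i _|i _]; first exact: enum_valK.
exact: enum_rankK.
Qed.

(** P writes the basis a in terms of b, and Q writes b in terms of a. From P Q = 1 the two families
    have equal size, so the matrices are square and over a commutative ring Q P = 1, which is
    independence of b. *)
Lemma span_basis (R : comNzRingType) (V : lmodType R) (I J : finType) (a : J -> V) (b : I -> V) :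
  is_basis a -> (forall x, exists c : I -> R, x = \sum_i c i *: b i) -> (#|I| <= #|J|)%N -> is_basis b.
Proof.
move=> ha span le.
have [c hc] := choice (fun j => span (a j)).
pose P := \matrix_(j < #|J|, i < #|I|) c (enum_val j) (enum_val i).
pose Q := \matrix_(i < #|I|, j < #|J|) bco ha (b (enum_val i)) (enum_val j).
have PQ : P *m Q = 1%:M.
  apply/matrixP => j k; rewrite !mxE.
  transitivity (bco ha (a (enum_val j)) (enum_val k)); last first.
    by rewrite bco_b (inj_eq enum_val_inj).
  rewrite [a (enum_val j)]hc bco_sum [RHS]sum_enum_val.
  by apply: eq_bigr => i _; rewrite !mxE bcoZ.
have e : #|I| = #|J| by apply/eqP; rewrite eqn_leq le (mulmx1_min PQ).
have QP := mulmx1C_eq e PQ.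
have uniq (d d' : I -> R) : \sum_i d i *: b i = \sum_i d' i *: b i -> d =1 d'.
  move=> edd i.
  pose u (d : I -> R) : 'rV[R]_(#|I|) := \row_k d (enum_val k).
  have uQ (f : I -> R) : u f *m Q = \row_j bco ha (\sum_i f i *: b i) (enum_val j).

    apply/rowP => j; rewrite !mxE bco_sum [RHS]sum_enum_val.
    by apply: eq_bigr => k _; rewrite !mxE bcoZ.
  have : u d = u d'.
    by rewrite -[u d]mulmx1 -[u d']mulmx1 -QP !mulmxA !uQ edd.
  by move/rowP/(_ (enum_rank i)); rewrite !mxE enum_rankK.
move=> x; have [d hd] := span x; exists [ffun i => d i]; split.
  by rewrite [LHS]hd; apply: eq_bigr => i _; rewrite ffunE.
move=> d' hd'; apply/ffunP => i; rewrite ffunE; apply: uniq i.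
by rewrite -hd -hd'.
Qed.

(** * Murphy basis and invariants of parabolic subgroups *)

Section MurphyBasis.
Variables (r : nat) (D : hecke_data r).
Local Notation K := (hK D).
Local Notation q := (h_q D).
Local Notation T := (@hT r D).
Local Notation Tb := (@hTb r D).
Local Notation tk := (tk D).
Local Notation uu := (uu D).
Local Notation M := (M D).
Local Notation mm := (mm D).
Implicit Types (w v d : W r) (i j k p : 'I_r) (J : {set 'I_r}) (x y h : D) (a b m n l : nat).
Implicit Types (f g : 'I_r -> nat).

Local Notation comm := GRing.comm.
Local Notation B := {ffun 'I_r -> 'I_(r.*2)}.
Implicit Types (e s t : B).
Local Notation vv := (vv D).
Local Notation Hi := (@Hi r D).
Local Notation mst := (mst D).
Local Notation star := (star (D := D)).
Local Notation Xw := (Xw D).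

Definition murphy_pair : finType := {p : B * B | goodb p}.
Definition mb (u : murphy_pair) : D := mst (val u).1 (val u).2.

Lemma goodbP s t : reflect (good s t) (goodb (s, t)).
Proof.
by apply: (iffP and3P) => -[b1 b2 h]; split=> //; apply/bcP.
Qed.

Lemma MSp_coef c x : MSp c x -> exists d : murphy_pair -> K,
  x = \sum_u d u *: mb u /\ forall u, d u != 0 -> (c <= key r (wd (val u).1))%N.
Proof.
elim=> [|y z s t _ [d [-> hd]] /goodbP g le].
  by exists (fun=> 0); split=> [|u]; rewrite ?eqxx // big1 // => u _; rewrite scale0r.
pose u0 : murphy_pair := exist _ (s, t) g.
exists (fun u => d u + z * (u == u0)%:R); split.
  under [RHS]eq_bigr => u _ do rewrite scalerDl; rewrite big_split /=; congr (_ + _).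
  rewrite (bigD1 u0) //= eqxx mulr1 big1 ?addr0 // => u /negPf ->.
  by rewrite mulr0 scale0r.
move=> u; case: (eqVneq u u0) => [->//|_]; rewrite mulr0 addr0; exact: hd.
Qed.

Lemma mb_basis : is_basis mb.
Proof.
apply: (span_basis Tb) => [x|].
  by have [d [-> _]] := MSp_coef (Hi_MSp (Hi_one x)); exists d.
by rewrite card_sig; apply: leq_trans (@card_weyl r); apply: leq_trans (card_good r); rewrite cardsE.
Qed.

(** Coefficients on the Murphy basis, extended by 0 so that sums can run over all pairs of words. *)
Definition mc x s t : K :=
  if insub (s, t) is Some u then bco mb_basis x (u : murphy_pair) else 0.

Lemma mc_val x (u : murphy_pair) : mc x (val u).1 (val u).2 = bco mb_basis x u.
Proof. by rewrite /mc -surjective_pairing valK. Qed.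

Lemma mc_good x s t : mc x s t != 0 -> good s t.
Proof. by rewrite /mc; case: insubP => [u /goodbP//|]; rewrite eqxx. Qed.

Lemma mcD x y s t : mc (x + y) s t = mc x s t + mc y s t.
Proof. by rewrite /mc; case: insubP => [u _ _|]; rewrite ?bcoD ?addr0. Qed.

Lemma mcZ (z : K) x s t : mc (z *: x) s t = z * mc x s t.
Proof. by rewrite /mc; case: insubP => [u _ _|]; rewrite ?bcoZ ?mulr0. Qed.

Lemma mc0 s t : mc 0 s t = 0.
Proof. by rewrite -[0 in LHS](scale0r (0 : D)) mcZ mul0r. Qed.

Lemma mcN x s t : mc (- x) s t = - mc x s t.
Proof. by rewrite -scaleN1r mcZ mulN1r. Qed.

Lemma mc_sum (S : Type) (ss : seq S) (R : pred S) (F : S -> D) s t :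
  mc (\sum_(i <- ss | R i) F i) s t = \sum_(i <- ss | R i) mc (F i) s t.
Proof. by apply: (big_morph (fun x => mc x s t)) => [x y|]; rewrite ?mcD ?mc0. Qed.

Lemma mcE x : x = \sum_s \sum_t mc x s t *: mst s t.
Proof.
rewrite pair_big /= (bigID (@goodb r)) /= [X in _ + X]big1 ?addr0; last first.
  move=> [s t] /= h; case: (eqVneq (mc x s t) 0) => [->|/mc_good/goodbP h']; first by rewrite scale0r.
  by rewrite h' in h.
rewrite [LHS](bcoE mb_basis) (reindex_omap (val : murphy_pair -> _) insub) /=; last first.
  by move=> u gu; rewrite insubT.
by apply: eq_big => u; rewrite ?valK ?(valP u) ?eqxx // mc_val.
Qed.

Lemma mc_inj x y : (forall s t, good s t -> mc x s t = mc y s t) -> x = y.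
Proof.
move=> h; apply: (bco_inj (hb := mb_basis)) => u; rewrite -!mc_val; apply: h.
by apply/goodbP; rewrite -surjective_pairing (valP u).
Qed.

Lemma mc_mst s t s' t' : good s t -> mc (mst s t) s' t' = ((s == s') && (t == t'))%:R.
Proof.
move=> /goodbP g; rewrite /mc; case: insubP => [u gu eu|ng].
  rewrite -[mst s t]/(mb (exist _ (s, t) g : murphy_pair)) bco_b.
  by rewrite -val_eqE eu xpair_eqE.
by case: (s =P s') => // es; case: (t =P t') => // et; rewrite -es -et g in ng.
Qed.

Lemma mc_Hi c x s t : Hi c x -> mc x s t != 0 -> (c <= key r (wd s))%N.
Proof.
move=> /Hi_MSp/MSp_coef[d [-> hd]]; rewrite mc_sum => h.
have [u] : exists u, d u * mc (mb u) s t != 0.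
  apply: contrapT => hn; case/eqP: h; rewrite big1 // => u _; rewrite mcZ.
  by apply/eqP/negP => /negP hu; apply: hn; exists u.
case: (eqVneq (d u) 0) => [->|/hd hk]; first by rewrite mul0r eqxx.
rewrite mc_mst; last by apply/goodbP; rewrite -surjective_pairing (valP u).
by case: ((val u).1 =P s) => [<-//|_]; rewrite mulr0 eqxx.
Qed.

Lemma cong_exp n (Q : B -> Prop) y : cong n Q y -> exists k : B -> K,
  (forall s, k s != 0 -> Q s) /\ Hi n (y - \sum_s k s *: vv s).
Proof.
case=> z hz hyz; suff [k [hk ez]] : exists k : B -> K, (forall s, k s != 0 -> Q s) /\ z = \sum_s k s *: vv s.
  by exists k; rewrite -ez.
elim: hz => [|{}y' c s _ [k [hk ->]] Qs].
  by exists (fun=> 0); split=> [s|]; rewrite ?eqxx // big1 // => s _; rewrite scale0r.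
exists (fun u => k u + c * (u == s)%:R); split=> [u|].
  by case: (eqVneq u s) => [->//|_]; rewrite mulr0 addr0; exact: hk.
under [RHS]eq_bigr => u _ do rewrite scalerDl; rewrite big_split /=; congr (_ + _).
rewrite (bigD1 s) //= eqxx mulr1 big1 ?addr0 // => u /negPf ->.
by rewrite mulr0 scale0r.
Qed.

Lemma mc_comb (k : B -> K) t' s t : (forall s', k s' != 0 -> good s' t') ->
  mc ((\sum_s k s *: vv s) * star (Xw t')) s t = k s * (t == t')%:R.
Proof.
move=> hk; rewrite mulr_suml mc_sum (bigD1 s) //= [X in _ + X]big1 ?addr0.
  rewrite -scalerAl mcZ; case: (eqVneq (k s) 0) => [->|/hk g]; first by rewrite !mul0r.
  by rewrite -[_ * _ in X in mc X]/(mst s t') mc_mst // eqxx eq_sym.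
move=> u us; rewrite -scalerAl mcZ; case: (eqVneq (k u) 0) => [->|/hk g]; first by rewrite mul0r.
by rewrite -[_ * _ in X in mc X]/(mst u t') mc_mst // (negPf us) mulr0.
Qed.

Lemma mc_cong n (Q : B -> Prop) y t' s t : cong n Q y -> (forall s', Q s' -> good s' t') ->
  mc (y * star (Xw t')) s t != 0 -> (n <= key r (wd s))%N \/ t = t' /\ Q s.
Proof.
move=> /cong_exp[k [hk hy]] Qg h.
have e : y = (y - \sum_s k s *: vv s) + \sum_s k s *: vv s by rewrite subrK.
move: h; rewrite e mulrDl mcD mc_comb; last by move=> s' /hk/Qg.
case: (eqVneq (mc ((y - \sum_s k s *: vv s) * star (Xw t')) s t) 0) => [->|hn _]; last first.
  by left; exact: mc_Hi (Hi_mulR _ hy) hn.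
rewrite add0r => h; right; case: (t =P t') h => [<-|_]; last by rewrite mulr0 eqxx.
by rewrite mulr1 => /hk.
Qed.

Lemma mc_star x s t : mc (star x) s t = mc x t s.
Proof.
rewrite [in LHS](mcE x) star_sum mc_sum (eq_bigr (fun u => \sum_v mc x u v * ((v == s) && (u == t))%:R)).
  rewrite exchange_big (bigD1 s) //= (bigD1 t) //= !eqxx mulr1 !big1 ?addr0 //.
    by move=> v /negPf vs; rewrite big1 // => u _; rewrite vs mulr0.
  by move=> u /negPf ->; rewrite andbF mulr0.
move=> u _; rewrite star_sum mc_sum; apply: eq_bigr => v _; rewrite starZ mcZ.
case: (eqVneq (mc x u v) 0) => [->|/mc_good g]; first by rewrite !mul0r.
have [b1 b2 g3] := g; rewrite (star_mst D g3) mc_mst //.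
by split=> // l; rewrite g3.
Qed.

End MurphyBasis.

(** * Elements invariant under a parabolic subgroup *)

Section Invariants.
Variables (r : nat) (D : hecke_data r).
Local Notation K := (hK D).
Local Notation q := (h_q D).
Local Notation T := (@hT r D).
Local Notation Tb := (@hTb r D).
Local Notation tk := (tk D).
Local Notation uu := (uu D).
Local Notation M := (M D).
Local Notation mm := (mm D).
Implicit Types (w v d : W r) (i j k p : 'I_r) (J : {set 'I_r}) (x y h : D) (a b m n l : nat).
Implicit Types (f g : 'I_r -> nat).

Local Notation comm := GRing.comm.
Local Notation B := {ffun 'I_r -> 'I_(r.*2)}.
Implicit Types (e s t : B).
Local Notation vv := (vv D).
Local Notation mst := (mst D).
Local Notation star := (star (D := D)).
Local Notation Xw := (Xw D).
Local Notation mc := (mc (D := D)).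

(* The words of semistandard bitableaux of type J: one word in each orbit of those
   whose orbit sum is invariant under J. *)
Definition sst J s : bool := [&& ballot s,
  [forall k : 'I_r, forall k1 : 'I_r, (k \in J) && (k1 == k.+1 :> nat) ==> (s k1 <= s k)%N] &
  [forall k, (k \in J) && (k.+1 == r) ==> (r <= s k)%N]].

Lemma sstP J s : reflect [/\ ballot s, forall k k1 : 'I_r, k \in J -> k1 = k.+1 :> nat -> (s k1 <= s k)%N
  & forall k, k \in J -> k.+1 = r -> (r <= s k)%N] (sst J s).
Proof.
apply: (iffP and3P) => -[bs h1 h2]; split=> //.
- by move=> k k1 kJ /eqP hk; move/forallP: h1 => /(_ k)/forallP/(_ k1)/implyP; apply; rewrite kJ.
- by move=> k kJ /eqP hk; move/forallP: h2 => /(_ k)/implyP; apply; rewrite kJ.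
- by apply/forallP => k; apply/forallP => k1; apply/implyP => /andP[kJ /eqP hk]; exact: h1.
by apply/forallP => k; apply/implyP => /andP[kJ /eqP hk]; exact: h2.
Qed.

Lemma mc_cong0 (Q : B -> Prop) y s s' t t' : cong (key r (wd s')).+1 Q y -> good s' t' ->
  (key r (wd s) <= key r (wd s'))%N -> (forall u, Q u -> ballot u /\ samecnt s' u) -> ~ Q s ->
  mc (y * star (Xw t')) s t = 0.
Proof.
move=> hy [b1 b2 g] le hQ nQ; apply/eqP; apply/negPn/negP => h.
case: (mc_cong hy _ h) => [u /hQ[bu su]|/leq_trans/(_ le)|[]//]; last by rewrite ltnn.
by split=> // l; rewrite g su.
Qed.

Lemma mst_mul h s t : h * mst s t = h * vv s * star (Xw t).
Proof. exact: mulrA. Qed.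

(** Terms arising by straightening are larger, so among the words not below s only s itself can
    contribute. For it T_k gives [swf k s]: another basis word if ballot, and otherwise - [vv s]
    plus larger terms by [straighten_swap]. *)
Lemma low_coef_A k k1 s : k1 = k.+1 :> nat -> (s k < s k1)%N -> forall s' t' t, good s' t' ->
  (key r (wd s) <= key r (wd s'))%N -> (key r (wd s) = key r (wd s') -> phi (wd s) <= phi (wd s'))%N ->
  mc (tk k * mst s' t') s t = - (~~ ballot (swf k s) && (s' == s) && (t' == t))%:R.
Proof.
move=> hk lt s' t' t g le1 le2; have [b1 b2 g3] := g; rewrite mst_mul.
have lt2 u : samecnt s' u -> (phi (wd s') < phi (wd u))%N -> u <> s.
  move=> su h eu; subst u; have := le2 (samecnt_key su).
  by rewrite leqNgt h.
have neq : (s' k1 <= s' k)%N -> (s' == s) = false.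
  by move=> h; apply/eqP => es; move: lt; rewrite -es ltnNge h.
have z0 c : (s' k1 <= s' k)%N -> mc (c *: vv s' * star (Xw t')) s t = 0.
  by move=> h; rewrite -scalerAl mcZ -[_ * _ in X in mc X]/(mst s' t') mc_mst // neq ?mulr0.
case: (ltngtP (s' k) (s' k1)) => [l|l|/val_inj eq].
- rewrite (vv_sw D hk l); case bsw: (ballot (swf k s')).
    rewrite -[_ * _]/(mst (swf k s') t') mc_mst; last first.
      by split=> // u; rewrite g3 (samecnt_sw k s').
    case: eqP => [es|_].
      by move: lt; rewrite -es !ffunE (swpE hk) tpermL tpermR ltnNge (ltnW l).
    by case: (eqVneq s' s) => [<-|_]; rewrite ?bsw ?andbF oppr0.
  rewrite -[vv (swf k s')](addrK (vv s')) mulrBl mcD mcN -[_ * _ in X in - mc X _ _]/(mst s' t') mc_mst //.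
  rewrite (mc_cong0 t (straighten_swap D hk b1 (negbT bsw)) g le1).
  - by case: (eqVneq s' s) => [<-|_]; rewrite ?bsw add0r ?andbF.
  - by move=> u [bu [su _] _].
  by move=> [_ [su _] h]; exact: lt2 su h erefl.
- rewrite (vv_gt D hk l) mulrDl mcD z0 1?ltnW // addr0 neq 1?ltnW // andbF oppr0.
  rewrite -scalerAl mcZ.
  have ps : pcont (swf k s') by apply: samecnt_pcont (ballot_pcont b1); exact: samecnt_sw.
  have := straighten D ps; rewrite (samecnt_key (samecnt_sw k s')) => hc.
  rewrite (mc_cong0 t hc g le1) ?mulr0 // => [u [bu [su _] _]|[_ [su _] h]].
    by split=> // n; rewrite su (samecnt_sw k s').
  apply: (lt2 s) => // [n|]; first by rewrite su (samecnt_sw k s').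
  by have := phi_sw s' hk; lia.
by rewrite (vv_eq D hk eq) z0 ?eq // neq ?eq // andbF oppr0.
Qed.

(** By [T0_lo], T_0 gives - [vv s] and words whose last letter is in the first component, none of
    which is s, nor becomes s by straightening. *)
Lemma low_coef_B k s : k.+1 = r -> (s k < r)%N -> forall s' t' t, good s' t' ->
  (key r (wd s) <= key r (wd s'))%N ->
  mc (tk k * mst s' t') s t = - ((s' == s) && (t' == t))%:R.
Proof.
move=> hk lt s' t' t g le1; have [b1 b2 g3] := g; rewrite mst_mul.
case: (leqP r (s' k)) => [h|h].
  rewrite (T0_hi D hk h) -scalerAl mcZ -[_ * _ in X in mc X]/(mst s' t') mc_mst //.
  case: eqP => [es|_]; first by move: lt; rewrite -es ltnNge h.
  by rewrite mulr0 oppr0.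
rewrite -[tk k * vv s'](addrK (vv s')) mulrBl mcD mcN -[_ * _ in X in - mc X _ _]/(mst s' t') mc_mst //.
have hc : cong (key r (wd s')).+1 (fun u => [/\ ballot u, samecnt s' u & (r <= u k)%N]) (tk k * vv s' + vv s').
  apply: cong_bind (T0_lo D hk h) _ => u [su hu].
  have pu : pcont u by apply: samecnt_pcont su _; exact: ballot_pcont.
  rewrite -(samecnt_key su); apply: cong_mono (straighten D pu) => v [bv [sv1 sv2] _].
  by split=> // [n|]; rewrite ?sv1 ?su // sv2.
rewrite (mc_cong0 t hc g le1) ?add0r // => [u []//|[_ _]].
by rewrite leqNgt lt.
Qed.

(** A bound for [phi], so that [wtt] compares by [key] first and then by [phi]. *)
Let big := (r * (r * r.*2))%N.
Let wtt s := (key r (wd s) * big.+1 + phi (wd s))%N.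

Lemma wtt_le s s' : (wtt s <= wtt s')%N ->
  (key r (wd s) <= key r (wd s'))%N /\ (key r (wd s) = key r (wd s') -> phi (wd s) <= phi (wd s'))%N.
Proof.
have h1 : (phi (wd s) <= big)%N := phi_bound s; have h2 : (phi (wd s') <= big)%N := phi_bound s'.
rewrite /wtt; move: (key r (wd s)) (key r (wd s')) (phi (wd s)) (phi (wd s')) big h1 h2 => a b c d e h1 h2 h.
split; last by move=> ab; rewrite ab leq_add2l in h.
rewrite leqNgt; apply/negP => ba.
have : (b.+1 * e.+1 <= a * e.+1)%N by rewrite leq_mul2r ba orbT.
by rewrite mulSn; lia.
Qed.

(** Let z be a nonzero coefficient at a word s of least [wtt]. If s fails the semistandard condition
    at k, the coefficient of T_k x there is 0 or -z, while invariance makes it q z; so z = 0 because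
    q is invertible and 1 + q is regular. *)
Lemma Linv_sst J x : Linv J x -> (forall s t, sst J s -> mc x s t = 0) -> x = 0.
Proof.
move=> Lx hx; suff h n s t : (wtt s < n)%N -> mc x s t = 0.
  by apply: mc_inj => s t _; rewrite mc0; exact: h (ltnSn _).
elim: n s t => // n IH s t hn; apply/eqP/negPn/negP => nz.
have [bs bt gst] := mc_good nz.
have coef k (e : bool) : k \in J -> (forall s' t', good s' t' -> (wtt s <= wtt s')%N ->
    mc (tk k * mst s' t') s t = - (e && (s' == s) && (t' == t))%:R) -> False.
  move=> kJ hc.
  have : mc (tk k * x) s t = - (e%:R * mc x s t).
    rewrite {1}(mcE x) mulr_sumr mc_sum (eq_bigr (fun s' => \sum_t' - (mc x s' t' * (e && (s' == s) && (t' == t))%:R))); last first.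
      move=> s' _; rewrite mulr_sumr mc_sum; apply: eq_bigr => t' _; rewrite -scalerAr mcZ.
      case: (eqVneq (mc x s' t') 0) => [->|nz']; first by rewrite !mul0r oppr0.
      rewrite hc ?mulrN //; first exact: mc_good nz'.
      by rewrite leqNgt; apply: contra nz' => h; rewrite IH // (leq_trans h).
    rewrite (bigD1 s) //= (bigD1 t) //= !eqxx !andbT !big1 ?addr0.
    - by rewrite mulrC.
    - by move=> s' /negPf es; apply: big1 => t' _; rewrite es andbF /= mulr0 oppr0.
    - by move=> t' /negPf ->; rewrite andbF mulr0 oppr0.
  rewrite (Lx k kJ) mcZ; case: e {hc} => /=; rewrite ?mul1r ?mul0r ?oppr0 => h; case/eqP: nz.
    by apply: (h_reg (h := D)); rewrite h subrr.
  by rewrite -[LHS]mul1r -(h_qqi D) [_ * h_qi D]mulrC -mulrA h mulr0.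
have ns : ~~ sst J s by apply: contra nz => /hx ->.
case/sstP: ns; split=> // [k k1 kJ hk|k kJ hk]; rewrite leqNgt; apply/negP => lt.
  by apply: (coef k (~~ ballot (swf k s))) => // s' t' g /wtt_le[l1 l2]; rewrite (low_coef_A hk lt).
by apply: (coef k true) => // s' t' g /wtt_le[l1 l2]; rewrite (low_coef_B hk lt).
Qed.

End Invariants.

(** * Orbit sums of semistandard words *)

Section OrbitSums.
Variables (r : nat) (D : hecke_data r).
Local Notation K := (hK D).
Local Notation q := (h_q D).
Local Notation T := (@hT r D).
Local Notation Tb := (@hTb r D).
Local Notation tk := (tk D).
Local Notation uu := (uu D).
Local Notation M := (M D).
Local Notation mm := (mm D).
Implicit Types (w v d : W r) (i j k p : 'I_r) (J : {set 'I_r}) (x y h : D) (a b m n l : nat).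
Implicit Types (f g : 'I_r -> nat).

Local Notation comm := GRing.comm.
Local Notation B := {ffun 'I_r -> 'I_(r.*2)}.
Implicit Types (e s t : B).
Local Notation vv := (vv D).
Local Notation mst := (mst D).
Local Notation star := (star (D := D)).
Local Notation Xw := (Xw D).
Local Notation mc := (mc (D := D)).

Definition orb J s : {set B} :=
  [set e | fingraph.connect (fun u v : B => [exists k in J, v == swf k u]) s e].

Lemma orb_refl J s : s \in orb J s. Proof. by rewrite inE fingraph.connect0. Qed.

Lemma orb_ind J s (Q : B -> Prop) : Q s ->
  (forall e k, k \in J -> e \in orb J s -> Q e -> Q (swf k e)) -> forall e, e \in orb J s -> Q e.
Proof.
move=> Qs QS e; rewrite inE => /fingraph.connectP[p]; elim/last_ind: p e => [|p u IH] e /=.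
  by move=> _ ->.
rewrite rcons_path last_rcons => /andP[hp /existsP[k /andP[kJ /eqP hu]]] ->; rewrite hu.
apply: QS => //; last exact: IH.
by rewrite inE; apply/fingraph.connectP; exists p.
Qed.

Lemma orb_swf J s k e : k \in J -> (swf k e \in orb J s) = (e \in orb J s).
Proof.
have h u : k \in J -> u \in orb J s -> swf k u \in orb J s.
  rewrite !inE => kJ /fingraph.connect_trans; apply; apply: fingraph.connect1.
  by apply/existsP; exists k; rewrite kJ eqxx.
by move=> kJ; apply/idP/idP => /(h _ kJ); rewrite ?swfK.
Qed.

Lemma orb_samecnt J s e : e \in orb J s -> samecnt s e.
Proof.
apply: orb_ind => // u k _ _; move/samecnt_trans; apply; exact: samecnt_sw.
Qed.

Definition bid J i : nat := (\sum_(k < r) ((k < i) && (k \notin J)))%N.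

Lemma bidS J k k1 : k1 = k.+1 :> nat -> bid J k1 = (bid J k + (k \notin J))%N.
Proof.
move=> hk; rewrite /bid (bigD1 k) //= [X in _ = (X + _)%N](bigD1 k) //= ltnn hk ltnSn andTb addnC.
congr (_ + _)%N; apply: eq_bigr => i ik; rewrite ltnS leq_eqVlt.
by move: ik; rewrite -val_eqE => /negPf /= ->.
Qed.

Lemma bid_swp J k i : k \in J -> bid J (swp k i) = bid J i.
Proof.
move=> kJ; case: (next_ord k) => [[k1 hk]|hk].
  rewrite (swpE hk); have := bidS J hk; rewrite kJ addn0 => e.
  by case: tpermP => [->|->|].
by rewrite /swp insubN ?perm1 // hk ltnn.
Qed.

(* Weakly increasing exactly when [e] decreases weakly in each block of J. *)
Definition gw J e : 'I_r -> nat := fun i => (bid J i * r.*2 + (r.*2.-1 - e i))%N.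

Lemma gw_swf J k e : k \in J -> gw J (swf k e) = sw k (gw J e).
Proof.
by move=> kJ; rewrite sw_perm; apply: funext => i; rewrite /gw /= ffunE (bid_swp i kJ).
Qed.

Lemma gw_inj J : injective (gw J).
Proof.
move=> e s h; apply/ffunP => i; apply: val_inj; have := congr1 (fun f => f i) h => /addnI /=.
by have := ltn_ord (e i); have := ltn_ord (s i); lia.
Qed.

Lemma gw_desc J e i j : bid J i = bid J j -> (gw J e i <= gw J e j)%N = (e j <= e i)%N.
Proof.
by move=> h; rewrite /gw h leq_add2l; have := ltn_ord (e i); have := ltn_ord (e j); lia.
Qed.

Lemma gw_sst J s : sst J s -> sorted_word (gw J s).
Proof.
case/sstP=> _ h _; apply: sorted_adj => k k1 hk.
case kJ: (k \in J).
  by rewrite gw_desc ?(bidS J hk) ?kJ ?addn0 // h.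
rewrite /gw (bidS J hk) kJ addn1 mulSn; move: (bid J k * r.*2)%N => X.
by have := ltn_ord (s k); lia.
Qed.

Lemma orb_na J s e th : e \in orb J s -> na th (gw J e) = na th (gw J s).
Proof.
move: e; apply: orb_ind => // u k kJ _ <-; rewrite gw_swf //.
exact/na_rearr/rearr_sw/rearr_refl.
Qed.

Lemma orb_sst J s e : sst J s -> sst J e -> e \in orb J s -> e = s.
Proof.
move=> ss se h; apply: (@gw_inj J); apply: sorted_uniq; try exact: gw_sst.
by move=> th; exact: orb_na.
Qed.

Lemma orb_last J s e k : sst J s -> k \in J -> k.+1 = r -> e \in orb J s -> (r <= e k)%N.
Proof.
move=> ss kJ hk he; suff: forall i, bid J i = bid J k -> (r <= e i)%N by apply.
move: e he; apply: orb_ind => [i hi|u k' k'J _ IH i hi].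
  have /sstP[_ _ /(_ k kJ hk) h] := ss; apply: leq_trans h _; rewrite -(gw_desc s hi).
  by apply: (gw_sst ss); have := ltn_ord i; lia.
by rewrite ffunE; apply: IH; rewrite bid_swp.
Qed.

(** Induction on [phi]. Unless e is s, it has an ascent inside a block of J; exchanging it lowers
    [phi] and stays in the orbit, where the word is ballot. If e were not ballot, [viol_swf] would
    turn this ascent of e into a descent. *)
Lemma orb_ballot J s e : sst J s -> e \in orb J s -> ballot e.
Proof.
move=> ss; have /sstP[bs _ _] := ss.
move: {2}(phi (wd e)).+1 (ltnSn (phi (wd e))) => n; elim: n e => // n IH e hn he.
case: (pselect (exists k k1 : 'I_r, k1 = k.+1 :> nat /\ (gw J e k1 < gw J e k)%N)) => [[k [k1 [hk lt]]]|hno].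
  have kJ : k \in J.
    apply/negPn/negP => nJ; move: lt; rewrite /gw (bidS J hk) nJ addn1 mulSn; move: (bid J k * r.*2)%N => X.
    by have := ltn_ord (e k); lia.
  have lt2 : (e k < e k1)%N.
    by rewrite ltnNge -(@gw_desc J) ?(bidS J hk) ?kJ ?addn0 // -ltnNge.
  have be : ballot (swf k e).
    apply: IH; last by rewrite orb_swf.
    by have := phi_sw e hk; lia.
  apply/negPn/negP => ne; rewrite -(swfK k e) in ne.
  have [_ h _] := viol_swf hk be ne; move: h.
  by rewrite !ffunE (swpE hk) tpermL tpermR; lia.
have sg : sorted_word (gw J e).
  apply: sorted_adj => k k1 hk; rewrite leqNgt; apply/negP => lt; apply: hno; by exists k, k1.
suff -> : e = s by [].
apply: (@gw_inj J); apply: sorted_uniq => //; first exact: gw_sst.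
by move=> th; exact: orb_na.
Qed.

Definition csum J s : D := \sum_(e in orb J s) vv e.

(** The exchange by k permutes the orbit. In T_k times the sum, [vv e] receives q in all cases: 1 +
    (q - 1) at a descent of e, and q at an ascent or for equal letters. The sign change is covered
    by [orb_last] and [T0_hi]. *)
Lemma Linv_csum J s : sst J s -> Linv J (csum J s).
Proof.
move=> ss k kJ; rewrite /csum mulr_sumr scaler_sumr.
case: (next_ord k) => [[k1 hk]|hk]; last first.
  by apply: eq_bigr => e he; apply: (T0_hi D hk); exact: orb_last he.
pose c1 e : K := (e k < e k1)%N%:R + q * (e k1 < e k)%N%:R.
pose c2 e : K := q * (e k == e k1)%:R + (q - 1) * (e k1 < e k)%N%:R.
rewrite (eq_bigr (fun e => c1 e *: vv (swf k e) + c2 e *: vv e)); last first.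
  move=> e _; rewrite /c1 /c2; case: (ltngtP (e k) (e k1)) => [lt|lt|/val_inj eq].
  - by rewrite (vv_sw D hk lt) -val_eqE (ltn_eqF lt) !mulr0 !addr0 scale1r scale0r addr0.
  - by rewrite (vv_gt D hk lt) -val_eqE (gtn_eqF lt) !mulr1 !mulr0 !add0r.
  by rewrite (vv_eq D hk eq) eq eqxx !mulr0 mulr1 !addr0 scale0r add0r.
rewrite big_split /= (reindex_inj (inv_inj (@swfK r (r.*2) k))) /=.
rewrite (eq_bigl (mem (orb J s))) => [|e]; last by rewrite orb_swf.
rewrite -big_split /=; apply: eq_bigr => e _; rewrite swfK -scalerDl; congr (_ *: _).
rewrite /c1 /c2 !ffunE (swpE hk) tpermL tpermR.
case: (ltngtP (e k) (e k1)) => [lt|lt|/val_inj eq].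
- by rewrite -val_eqE (ltn_eqF lt) /=; ring.
- by rewrite -val_eqE (gtn_eqF lt) /=; ring.
by rewrite eq eqxx /=; ring.
Qed.

Definition Xsum J t : D := \sum_(e in orb J t) Xw e.
Definition cst J J' s t : D := csum J s * star (Xsum J' t).

Lemma cstE J J' s t : cst J J' s t = \sum_(e in orb J s) \sum_(e' in orb J' t) mst e e'.
Proof.
rewrite /cst /Xsum star_sum mulr_suml; apply: eq_bigr => e _.
by rewrite mulr_sumr.
Qed.

Lemma cst_Linv J J' s t : sst J s -> Linv J (cst J J' s t).
Proof. by move=> ss; apply/LinvM/Linv_csum. Qed.

Lemma orb_good J J' s t e e' : sst J s -> sst J' t -> samecnt s t ->
  e \in orb J s -> e' \in orb J' t -> good e e'.
Proof.
move=> ss st h he he'; split; [exact: orb_ballot he|exact: orb_ballot he'|].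
by move=> n; rewrite (orb_samecnt he') h (orb_samecnt he).
Qed.

Lemma star_cst J J' s t : sst J s -> sst J' t -> samecnt s t -> star (cst J J' s t) = cst J' J t s.
Proof.
move=> ss st h; rewrite !cstE star_sum [RHS]exchange_big /=; apply: eq_bigr => e he.
by rewrite star_sum; apply: eq_bigr => e' he'; have [_ _ g] := orb_good ss st h he he'; exact: star_mst.
Qed.

Lemma csum_mc J s t e e' : sst J s -> good s t ->
  mc (csum J s * star (Xw t)) e e' = (e \in orb J s)%:R * (t == e')%:R.
Proof.
move=> ss [bs bt g].
have -> : csum J s = \sum_e (e \in orb J s)%:R *: vv e.
  by rewrite /csum big_mkcond; apply: eq_bigr => u _; case: ifP; rewrite ?scale1r ?scale0r.
rewrite mc_comb 1?eq_sym // => u; case he: (u \in orb J s); rewrite ?eqxx // => _.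
by split=> // [|n]; [exact: orb_ballot he|rewrite g (orb_samecnt he)].
Qed.

(** Subtract from x the combination of orbit sums with the same coefficients at the semistandard
    words; [Linv_sst] annihilates the difference. *)
Lemma Linv_mc J x e t : Linv J x -> mc x e t = \sum_(s | sst J s) (e \in orb J s)%:R * mc x s t.
Proof.
move=> Lx; pose y := \sum_(s | sst J s) \sum_t mc x s t *: (csum J s * star (Xw t)).
have my u (v : B) : mc y u v = \sum_(s | sst J s) (u \in orb J s)%:R * mc x s v.
  rewrite /y mc_sum; apply: eq_bigr => s ss; rewrite mc_sum (bigD1 v) //= big1 ?addr0.
    rewrite mcZ; case: (eqVneq (mc x s v) 0) => [->|/mc_good g]; first by rewrite mul0r mulr0.
    by rewrite csum_mc // eqxx mulr1 mulrC.
  move=> w /negPf wv; rewrite mcZ; case: (eqVneq (mc x s w) 0) => [->|/mc_good g]; first by rewrite mul0r.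
  by rewrite csum_mc // wv !mulr0.
suff exy : x = y by rewrite -my -exy.
apply/eqP; rewrite -subr_eq0; apply/eqP; apply: (@Linv_sst r D J).
  rewrite -scaleN1r; apply: LinvD => //; apply: LinvZ; apply: Linv_sum => s ss; apply: Linv_sum => u _.
  by apply/LinvZ/LinvM/Linv_csum.
move=> s u ss; rewrite mcD mcN my (bigD1 s) //= orb_refl mul1r big1 ?addr0 ?subrr // => s' /andP[ss' ns].
case h: (s \in orb J s'); rewrite ?mul0r //.
by rewrite (orb_sst ss' ss h) eqxx in ns.
Qed.

Lemma cst_mc J J' s t e e' : sst J s -> sst J' t -> samecnt s t ->
  mc (cst J J' s t) e e' = (e \in orb J s)%:R * (e' \in orb J' t)%:R.
Proof.
move=> ss st h; have [bs _ _] := sstP _ _ ss.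
rewrite /cst /Xsum star_sum mulr_sumr mc_sum.
rewrite (eq_bigr (fun u => (e \in orb J s)%:R * (u == e')%:R)).
  rewrite -mulr_sumr; congr (_ * _); rewrite big_mkcond /= (bigD1 e') //= eqxx big1 ?addr0.
    by case: ifP.
  by move=> u /negPf ->; case: ifP.
move=> u hu; apply: csum_mc => //; split=> // [|n]; first exact: orb_ballot hu.
by rewrite (orb_samecnt hu) h.
Qed.

Lemma Linv2_cst J J' x : Linv J x -> Linv J' (star x) ->
  x = \sum_(s | sst J s) \sum_(t | sst J' t) mc x s t *: cst J J' s t.
Proof.
move=> Lx Lx'; apply: mc_inj => e e' g; rewrite (Linv_mc _ _ Lx) mc_sum; apply: eq_bigr => s ss.
rewrite mc_sum -mc_star (Linv_mc _ _ Lx') mulr_sumr; apply: eq_bigr => t st.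
rewrite mcZ mc_star; case: (eqVneq (mc x s t) 0) => [->|/mc_good [_ _ gst]]; first by rewrite mul0r !mulr0.
by rewrite cst_mc // mulrA mulrC.
Qed.

(** The coefficients k are fixed before J' and t, since h acts on [csum J s] alone: this gives the
    independence demanded of a standard basis. *)
Lemma mul_cst h J s : sst J s -> exists k : {ffun 'I_r -> 'I_(r.*2)} -> K, forall J' t e e',
  sst J' t -> samecnt s t ->
  mc (h * cst J J' s t) e e' != k e * (e' \in orb J' t)%:R ->
  (key r (wd s) < key r (wd e))%N.
Proof.
move=> ss; have [bs _ _] := sstP _ _ ss.
have : cong (key r (wd s)).+1 (mQ s) (h * csum J s).
  rewrite /csum mulr_sumr; apply: cong_sum => u hu; have us := orb_samecnt hu.
  rewrite -(samecnt_key us); apply: cong_mono (left_cong h _).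
    by move=> v [bv uv]; split=> //; exact: samecnt_trans us uv.
  by apply: samecnt_pcont us _; exact: ballot_pcont.
case/cong_exp=> k [hk hH]; exists k => J' t e e' st h'.
have -> : h * cst J J' s t = (h * csum J s - \sum_s k s *: vv s) * star (Xsum J' t) +
    (\sum_s k s *: vv s) * star (Xsum J' t) by rewrite -mulrDl subrK /cst mulrA.
rewrite mcD; set A := mc _ _ _; have -> : mc ((\sum_s k s *: vv s) * star (Xsum J' t)) e e' =
   k e * (e' \in orb J' t)%:R.
  rewrite /Xsum star_sum mulr_sumr mc_sum (eq_bigr (fun u => k e * (e' == u)%:R)); last first.
    move=> u hu; rewrite mc_comb // => v /hk [bv sv]; split=> // [|n]; first exact: orb_ballot hu.
    by rewrite (orb_samecnt hu) h' sv.
  rewrite -mulr_sumr; congr (_ * _); rewrite big_mkcond /= (bigD1 e') //= eqxx big1 ?addr0.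
    by case: ifP.
  by move=> u /negPf; rewrite eq_sym => ->; case: ifP.
case: (eqVneq A 0) => [->|]; first by rewrite add0r eqxx.
by rewrite /A => nA _; apply: mc_Hi nA; exact: Hi_mulR.
Qed.

End OrbitSums.

(** * Standard basis of the Schur algebra *)

Fact tZ_inv_subproof : laurent_pred pred0 (tQ ^- 2).
Proof.
apply/asboolP; exists 1, 1%N, 2%N; split=> //.
by rewrite tofrac1 mul1r mul1r.
Qed.

Lemma tZ_inv : tZ ^+ 2 * (LaurentLoc tZ_inv_subproof : laurent) = 1.
Proof.
apply: val_inj; rewrite rmorphM rmorphXn rmorph1 /= mulfV // expf_neq0 //; exact: tQ_neq0.
Qed.

Lemma tZ_reg (x : laurent) : x + tZ ^+ 2 * x = 0 -> x = 0.
Proof.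
rewrite -[X in X + _]mul1r -mulrDl => /(congr1 val).
rewrite rmorphM rmorphD rmorphXn rmorph1 rmorph0 /= => /eqP.
rewrite mulf_eq0 => /orP[|/eqP h]; last exact: val_inj.
rewrite /tQ -tofracXn -tofrac1 -tofracD tofrac_eq0 addrC => /eqP/(congr1 (fun p : {poly int} => p`_2)).
by rewrite coefD coefXn coef1 coef0.
Qed.

Section SchurMatrices.
Variables (st : schur_type) (n r : nat) (n_gt0 : (0 < n)%N) (r_gt0 : (0 < r)%N) (H : heckeAlg r).
Local Notation S := (schur_alg st H n_gt0).
Local Notation C := (comps st n r).
Implicit Types (nu mu ka : C) (f g : S) (y h : H).

Definition schur_hecke : hecke_data r :=
  HeckeData tZ_inv tZ_reg (@heckeT_basis r H) (@heckeT_mul r H) r_gt0.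
Local Notation D := schur_hecke.

Definition parJ nu : {set 'I_r} := ~: removed nu.

Lemma star_xJ (J : {set 'I_r}) : star (xJ D J) = xJ D J.
Proof.
rewrite /xJ star_sum (reindex_inj invg_inj) /=; apply: eq_big => [w|w _]; first by rewrite groupV.
by rewrite star_T invgK.
Qed.

Fact unit_tens_subproof mu : [ffun nu => if nu == mu then xelt H nu else 0] \in @tens_pred st n r H.
Proof.
apply/asboolP => nu; case e: (nu == mu); rewrite ffunE e; first by exists 1; rewrite mulr1.
by exists 0; rewrite mulr0.
Qed.
Definition unit_tens mu : tens st n H := Tens (unit_tens_subproof mu).

Lemma unit_tensE mu nu : unit_tens mu nu = if nu == mu then xelt H nu else 0.
Proof. by rewrite ffunE. Qed.

Lemma tens_ex (v : tens st n H) nu : exists h, v nu = xelt H nu * h.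
Proof. by case: v => v /= /asboolP. Qed.

(** Since x_mu generates the summand mu, these entries determine f ([mat_inj]). *)
Definition mat f nu mu : H := f (unit_tens mu) nu.

Lemma tens_val0 nu : (0 : tens st n H) nu = 0.
Proof. by rewrite -[tens_val 0]/(val (0 : tens st n H)) raddf0 ffunE. Qed.

Lemma tens_val_sum (I : Type) (s : seq I) (P : pred I) (F : I -> tens st n H) nu :
  (\sum_(i <- s | P i) F i : tens st n H) nu = \sum_(i <- s | P i) F i nu.
Proof. by apply: (big_morph (fun v : tens st n H => v nu)) => [x y|]; rewrite ?tens_valD ?tens_val0. Qed.

Lemma schur_sum f (I : Type) (s : seq I) (P : pred I) (F : I -> tens st n H) :
  f (\sum_(i <- s | P i) F i) = \sum_(i <- s | P i) f (F i).
Proof.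
apply: (big_morph f) => [x y|]; first exact: schurD.
by have := schurZ f 0 0; rewrite !scale0r.
Qed.

Lemma schur_mat f (v : tens st n H) (h : C -> H) : (forall mu, v mu = xelt H mu * h mu) ->
  forall nu, f v nu = \sum_mu mat f nu mu * h mu.
Proof.
move=> hv nu.
have -> : v = \sum_mu tens_act (unit_tens mu) (h mu).
  apply: tensP => mu; rewrite tens_val_sum (bigD1 mu) // big1 ?addr0.
    rewrite tens_actE unit_tensE eqxx hv; exact: (esym (addr0 _)).
  by move=> ka; rewrite andTb => /negPf e; rewrite tens_actE unit_tensE eq_sym e mul0r.
rewrite schur_sum tens_val_sum; apply: eq_bigr => mu _.
by rewrite schur_act tens_actE.
Qed.

Lemma mat_inj f g : (forall nu mu, mat f nu mu = mat g nu mu) -> f = g.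
Proof.
move=> e; apply: schurP => v; apply: tensP => nu.
have [h hv] := choice (fun nu => tens_ex v nu).
by rewrite !(schur_mat _ hv); apply: eq_bigr => mu _; rewrite e.
Qed.

Lemma mat_Linv f nu mu : Linv (D := D) (parJ nu) (mat f nu mu).
Proof. by rewrite /mat; have [h ->] := tens_ex (f (unit_tens mu)) nu; apply/LinvM/Linv_xJ. Qed.

(** Applying [star] to the invariance of x_mu gives x_mu T_k = q x_mu for k in J_mu, and f commutes
    with the right action. *)
Lemma mat_star_Linv f nu mu : Linv (D := D) (parJ mu) (star (D := D) (mat f nu mu)).
Proof.
move=> k kJ; rewrite -[tk D k]star_tk -starM -starZ; congr (star (D := D) _); rewrite /mat.
have e : tens_act (unit_tens mu) (tk D k) = tZ ^+ 2 *: unit_tens mu.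
  apply: tensP => ka; rewrite tens_actE tens_valZ unit_tensE; case: eqP => [->|_]; last by rewrite mul0r scaler0.
  have := Linv_xJ D kJ => /(congr1 (star (D := D))).
  by rewrite starM starZ star_tk star_xJ.
by rewrite -tens_actE -schur_act e schurZ tens_valZ.
Qed.

(** By the second invariance y = h' x_mu. Left multiplication by h' then maps x_mu g to y g, which
    lies in x_nu H by the first invariance. *)
Lemma mat_ex nu mu y : Linv (D := D) (parJ nu) y -> Linv (D := D) (parJ mu) (star (D := D) y) ->
  exists f : S, forall nu' mu', mat f nu' mu' = if (nu' == nu) && (mu' == mu) then y else 0.
Proof.
move=> Ly /Linv_div[h /(congr1 (star (D := D)))]; rewrite starK starM star_xJ; set h' := star h => ey.
have valP v : [ffun nu' => if nu' == nu then h' * tens_val v mu else 0] \in @tens_pred st n r H.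
  apply/asboolP => nu'; rewrite ffunE; case: eqP => [->|_]; last by exists 0; rewrite mulr0.
  have [g ->] := tens_ex v mu; rewrite mulrA -[h' * _]ey.
  have [g' ->] := Linv_div Ly; exists (g' * g); exact/esym/mulrA.
pose F v : tens st n H := Tens (valP v).
have FE v nu' : F v nu' = if nu' == nu then h' * v mu else 0 by rewrite ffunE.
have FD u v : F (u + v) = F u + F v.
  by apply: tensP => nu'; rewrite tens_valD !FE; case: eqP => _; rewrite ?addr0 // tens_valD mulrDr.
have FA (v : tens st n H) (g : H) : F (tens_act v g) = tens_act (F v) g.
  by apply: tensP => nu'; rewrite tens_actE !FE; case: eqP => _; rewrite ?mul0r // tens_actE mulrA.
have FP : F \in @schur_pred st n r H by apply/asboolP; split.
exists (SchurAlg n_gt0 FP) => nu' mu'; rewrite -[LHS]/(F (unit_tens mu') nu') FE unit_tensE [mu == _]eq_sym.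
by case: (nu' == nu) => //=; case: (mu' =P mu) => [_|_]; rewrite ?mulr0.
Qed.

Lemma matD f g nu mu : mat (f + g) nu mu = mat f nu mu + mat g nu mu.
Proof. by rewrite /mat schur_addE tens_valD. Qed.

Lemma matZ (z : laurent) f nu mu : mat (z *: f) nu mu = z *: mat f nu mu.
Proof. by rewrite /mat schur_scaleE tens_valZ. Qed.

(** Matrix multiplication, with the factor x_mu divided out of the entries of g so that it is not
    counted twice. *)
Lemma matM_right g : exists h : C -> C -> H, forall f nu ka,
  mat (f * g) nu ka = \sum_mu mat f nu mu * h mu ka.
Proof.
have /choice[h hh] (p : C * C) : exists h, mat g p.1 p.2 = xelt H p.1 * h by exact: tens_ex.
by exists (fun mu ka => h (mu, ka)) => f nu ka; apply: (schur_mat f (v := g (unit_tens ka)) (h := fun mu => h (mu, ka))) => mu; exact: (hh (mu, ka)).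
Qed.

Lemma matM_left f : exists h : C -> C -> H, forall g nu ka,
  mat (f * g) nu ka = \sum_mu h nu mu * mat g mu ka.
Proof.
have /choice[h hh] (p : C * C) : exists h, mat f p.1 p.2 = h * xelt H p.2.
  have [h /(congr1 (star (D := D)))] := Linv_div (@mat_star_Linv f p.1 p.2).
  by rewrite starK starM star_xJ => ->; exists (star (D := D) h).
exists (fun nu mu => h (nu, mu)) => g nu ka.
have /choice[h' hh'] mu := tens_ex (g (unit_tens ka)) mu.
rewrite [LHS](schur_mat f (v := g (unit_tens ka)) hh'); apply: eq_bigr => mu _.
by rewrite [mat g mu ka]hh' mulrA -(hh (nu, mu)).
Qed.

End SchurMatrices.

Section DualBasis.
Variables (K : comNzRingType) (V : lmodType K) (I : finType) (b : I -> V) (co : I -> V -> K).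
Hypotheses (coD : forall i x y, co i (x + y) = co i x + co i y)
  (coZ : forall i c x, co i (c *: x) = c * co i x)
  (co_b : forall i j, co i (b j) = (j == i)%:R) (co_inj : forall x, (forall i, co i x = 0) -> x = 0).

Lemma dual_co_sum (c : I -> K) i : co i (\sum_j c j *: b j) = c i.
Proof.
have co0 : co i 0 = 0 by rewrite -(scale0r (0 : V)) coZ mul0r.
rewrite (big_morph (co i) (coD i) co0) (bigD1 i) //= coZ co_b eqxx mulr1 big1 ?addr0 // => j /negPf ij.
by rewrite coZ co_b ij mulr0.
Qed.

Lemma dual_coE x : x = \sum_i co i x *: b i.
Proof.
apply/eqP; rewrite -subr_eq0; apply/eqP/co_inj => i.
by rewrite coD -scaleN1r coZ dual_co_sum mulN1r subrr.
Qed.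

Lemma dual_basis : is_basis b.
Proof.
move=> x; exists [ffun i => co i x]; split.
  by rewrite {1}(dual_coE x); apply: eq_bigr => i _; rewrite ffunE.
by move=> c ->; apply/ffunP => i; rewrite ffunE dual_co_sum.
Qed.

End DualBasis.

Definition cell_index (r : nat) : Type := {ffun 'I_(r.*2) -> 'I_r.+1}.
HB.instance Definition _ r := Finite.on (cell_index r).

Section CellOrder.
Variable r : nat.
Local Notation B := {ffun 'I_r -> 'I_(r.*2)}.

(** The key depends on the content only ([cell_keyE]); the value 0 is given to contents of no word,
    whose cells are empty. *)
Definition cell_key (la : cell_index r) : nat :=
  if [pick s : B | bc s == la] is Some s then key r (wd s) else 0%N.

Lemma cell_keyE (s : B) : cell_key (bc s) = key r (wd s).
Proof.
rewrite /cell_key; case: pickP => [t /bcP h|/(_ s)]; last by rewrite eqxx.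
by rewrite (samecnt_key h).
Qed.

Definition cell_lt (la mu : cell_index r) : bool := (cell_key la < cell_key mu)%N.
Fact cell_lt_irr : irreflexive cell_lt. Proof. by move=> la; rewrite /cell_lt ltnn. Qed.
Fact cell_lt_trans : transitive cell_lt. Proof. by move=> la mu nu; exact: ltn_trans. Qed.

Fact cell_display : Order.disp_t. Proof. exact: (Order.Disp tt tt). Qed.
HB.instance Definition _ :=
  Order.Lt_isPOrder.Build cell_display (cell_index r) cell_lt_irr cell_lt_trans.

Lemma cell_ltE (la mu : cell_index r) : (la < mu)%O = (cell_key la < cell_key mu)%N.
Proof. by []. Qed.
End CellOrder.

Section SchurBasis.
Variables (st : schur_type) (n r : nat) (n_gt0 : (0 < n)%N) (r_gt0 : (0 < r)%N) (H : heckeAlg r).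
Local Notation S := (schur_alg st H n_gt0).
Local Notation C := (comps st n r).
Local Notation B := {ffun 'I_r -> 'I_(r.*2)}.
Local Notation D := (schur_hecke r_gt0 H).
Local Notation mat := (@mat st n r n_gt0 H).
Local Notation L := (cell_index r).
Implicit Types (nu mu ka : C) (f g : S) (y h : H) (la : L) (s t e : B).

Definition cellI la : finType := {p : C * B | sst (parJ p.1) p.2 && (bc p.2 == la)}.
Definition cc la (i : cellI la) : C := (val i).1.
Definition cs la (i : cellI la) : B := (val i).2.

Lemma cs_sst la (i : cellI la) : sst (parJ (cc i)) (cs i).
Proof. by case/andP: (valP i). Qed.
Lemma cs_bc la (i : cellI la) : bc (cs i) = la.
Proof. by apply/eqP; case/andP: (valP i). Qed.
Lemma cs_samecnt la (i j : cellI la) : samecnt (cs i) (cs j).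
Proof. by apply/bcP; rewrite !cs_bc. Qed.

Lemma cell_ex la (i j : cellI la) : exists f, forall nu mu,
  mat f nu mu = if (nu == cc i) && (mu == cc j) then cst D (parJ (cc i)) (parJ (cc j)) (cs i) (cs j) else 0.
Proof.
apply: (@mat_ex _ _ _ n_gt0 r_gt0); first by apply: cst_Linv; exact: cs_sst.
rewrite star_cst; [|exact: cs_sst|exact: cs_sst|exact: cs_samecnt].
by apply: cst_Linv; exact: cs_sst.
Qed.

Definition cell_elt la (i j : cellI la) : S := sval (cid (cell_ex i j)).

Lemma cell_eltE la (i j : cellI la) nu mu : mat (cell_elt i j) nu mu =
  if (nu == cc i) && (mu == cc j) then cst D (parJ (cc i)) (parJ (cc j)) (cs i) (cs j) else 0.
Proof. by rewrite /cell_elt; case: cid => f /= ->. Qed.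

Local Notation X := (std_index cellI cellI).

Definition sco (u : X) f : laurent :=
  mc (D := D) (mat f (cc (tagged u).1) (cc (tagged u).2)) (cs (tagged u).1) (cs (tagged u).2).

Lemma scoD u f g : sco u (f + g) = sco u f + sco u g.
Proof. by rewrite /sco matD mcD. Qed.
Lemma scoZ u (z : laurent) f : sco u (z *: f) = z * sco u f.
Proof. by rewrite /sco matZ mcZ. Qed.

Lemma cell_inj la (i i' : cellI la) : cc i = cc i' -> cs i = cs i' -> i = i'.
Proof.
move=> e1 e2; apply: val_inj; rewrite [LHS]surjective_pairing [RHS]surjective_pairing.
by congr (_, _).
Qed.

Lemma orb_cs la la' (i : cellI la) (i' : cellI la') : cc i = cc i' ->
  (cs i \in orb (parJ (cc i')) (cs i')) = (cs i == cs i').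
Proof.
move=> e; apply/idP/eqP => [|->]; last exact: orb_refl.
by apply: orb_sst; rewrite ?cs_sst // -e cs_sst.
Qed.

Lemma sco_std u v : sco u (std_elt cell_elt v) = (v == u)%:R.
Proof.
case: (eqVneq v u) => [->|].
  rewrite /sco /std_elt cell_eltE !eqxx /= cst_mc ?orb_refl ?mul1r //; try exact: cs_sst.
  exact: cs_samecnt.
case: u v => la [i j] [la' [i' j']] ne; rewrite /sco /std_elt /= cell_eltE.
case: ifP => [/andP[/eqP e1 /eqP e2]|_]; last by rewrite mc0.
rewrite cst_mc; [|exact: cs_sst|exact: cs_sst|exact: cs_samecnt].
rewrite !orb_cs //; case: eqP => h1; last by rewrite mul0r.
case: eqP => h2; last by rewrite mulr0.
case/eqP: ne.
have e : la = la' by rewrite -(cs_bc i) -(cs_bc i') h1.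
by subst la'; rewrite (cell_inj e1 h1) (cell_inj e2 h2).
Qed.

Lemma sco_inj f : (forall u, sco u f = 0) -> f = 0.
Proof.
move=> hf; apply: mat_inj => nu mu; have -> : mat 0 nu mu = 0.
  by have := matZ 0 (0 : S) nu mu; rewrite !scale0r.
rewrite [LHS](Linv2_cst (mat_Linv r_gt0 f mu (nu := nu)) (mat_star_Linv r_gt0 f nu (mu := mu))).
apply: big1 => s ss; apply: big1 => t tt.
case: (eqVneq (mc (D := D) (mat f nu mu) s t) 0) => [->|/[dup] /mc_good[_ _ h]]; first by rewrite scale0r.
have ps : sst (parJ (nu, s).1) (nu, s).2 && (bc s == bc s) by rewrite ss eqxx.
have pt : sst (parJ (mu, t).1) (mu, t).2 && (bc t == bc s).
  by rewrite tt; apply/bcP => l; rewrite h.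
have := hf (Tagged (fun la => (cellI la * cellI la)%type)
  (exist _ (nu, s) ps : cellI (bc s), exist _ (mu, t) pt : cellI (bc s))).
by rewrite /sco /= => ->; rewrite eqxx.
Qed.

Lemma in_above_sco la f : (forall u, sco u f != 0 -> (la < tag u)%O) -> in_above cell_elt la f.
Proof.
move=> h; exists (fun u => sco u f); rewrite [LHS](dual_coE scoD scoZ sco_std sco_inj).
rewrite [RHS]big_mkcond; apply: eq_bigr => u _; case: ifP => // hu.
by case: (eqVneq (sco u f) 0) => [->|/h]; rewrite ?scale0r // hu.
Qed.

Lemma sco_sum (I : Type) (ss : seq I) (P : pred I) (F : I -> S) u :
  sco u (\sum_(i <- ss | P i) F i) = \sum_(i <- ss | P i) sco u (F i).
Proof.
apply: (big_morph (sco u) (scoD u)).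
by have := scoZ u 0 0; rewrite scale0r mul0r.
Qed.

Lemma sco_cell la (i j i' j' : cellI la) :
  sco (Tagged (fun la => (cellI la * cellI la)%type) (i, j)) (cell_elt i' j') = ((i' == i) && (j' == j))%:R.
Proof.
have -> : cell_elt i' j' = std_elt cell_elt (Tagged (fun la => (cellI la * cellI la)%type) (i', j')) by [].
by rewrite sco_std eq_Tagged.
Qed.

Lemma sco_cell_neq la la' (i j : cellI la) (i' j' : cellI la') : la' != la ->
  sco (Tagged (fun la => (cellI la * cellI la)%type) (i, j)) (cell_elt i' j') = 0.
Proof.
move=> ne; have -> : cell_elt i' j' = std_elt cell_elt (Tagged (fun la => (cellI la * cellI la)%type) (i', j')) by [].
by rewrite sco_std; case: eqP => // /(congr1 tag) /= e; rewrite e eqxx in ne.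
Qed.

Lemma cell_left_rule f la : exists k : cellI la -> cellI la -> laurent, forall i j u,
  sco u (f * cell_elt i j - \sum_(i' : cellI la) k i' i *: cell_elt i' j) != 0 -> (la < tag u)%O.
Proof.
have [h hf] := matM_left r_gt0 f.
have /choice[k hk] (p : C * cellI la) := mul_cst (h p.1 (cc p.2) : D) (cs_sst p.2).
exists (fun i' i => k (cc i', i) (cs i')) => i j [la' [i' j']] /=.
have E : sco (Tagged (fun la => (cellI la * cellI la)%type) (i', j')) (f * cell_elt i j) =
    (cc j' == cc j)%:R * mc (D := D) (h (cc i') (cc i) * cst D (parJ (cc i)) (parJ (cc j)) (cs i) (cs j)) (cs i') (cs j').
  rewrite /sco /= hf (bigD1 (cc i)) //= big1 ?addr0; last first.
    by move=> mu /negPf ne; rewrite cell_eltE ne mulr0.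
  by rewrite cell_eltE eqxx /=; case: eqP => _; rewrite ?mul1r // mulr0 mc0 mul0r.
have := hk (cc i', i) _ (cs j) (cs i') (cs j') (cs_sst j) (cs_samecnt i j).
rewrite /= -!cell_keyE !cs_bc -cell_ltE => hlt.
rewrite scoD -scaleN1r scoZ sco_sum mulN1r E.
case: (la < la')%O hlt => // hlt; case/eqP.
apply/eqP; rewrite subr_eq0; apply/eqP.
have {}hlt : mc (D := D) (h (cc i') (cc i) * cst D (parJ (cc i)) (parJ (cc j)) (cs i) (cs j)) (cs i') (cs j') =
    k (cc i', i) (cs i') * (cs j' \in orb (parJ (cc j)) (cs j))%:R.
  by apply/eqP/negPn/negP => /hlt.
rewrite hlt; case: (eqVneq la' la) => [e|ne].
  subst la'; rewrite (bigD1 i') //= big1 ?addr0; last first.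
    by move=> i2 /negPf ne; rewrite scoZ sco_cell ne mulr0.
  rewrite scoZ sco_cell eqxx /= mulrCA; congr (_ * _).
  case: (cc j' =P cc j) => [e|ne].
    by rewrite mul1r orb_cs //; congr (nat_of_bool _)%:R; apply/eqP/eqP => [h2|->//]; exact/esym/cell_inj.
  by rewrite mul0r; case: eqP ne => // ->.
(* In a different cell that is not higher, the coefficient vanishes: [cs j'] and [cs j] have
   different contents. *)
rewrite big1; last by move=> i2 _; rewrite scoZ sco_cell_neq ?mulr0 // eq_sym.
case: (cc j' =P cc j) => [e|_]; last by rewrite mul0r.
rewrite orb_cs //; case: eqP => [h2|_]; last by rewrite !mulr0.
by rewrite -(cs_bc j') h2 cs_bc eqxx in ne.
Qed.

Lemma cell_right_rule f la : exists k : cellI la -> cellI la -> laurent, forall i j u,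
  sco u (cell_elt i j * f - \sum_(j' : cellI la) k j' j *: cell_elt i j') != 0 -> (la < tag u)%O.
Proof.
have [h hf] := matM_right f.
have /choice[k hk] (p : C * cellI la) := mul_cst (star (D := D) (h (cc p.2) p.1)) (cs_sst p.2).
exists (fun j' j => k (cc j', j) (cs j')) => i j [la' [i' j']] /=.
have E : sco (Tagged (fun la => (cellI la * cellI la)%type) (i', j')) (cell_elt i j * f) =
    (cc i' == cc i)%:R * mc (D := D) (star (D := D) (h (cc j) (cc j')) * cst D (parJ (cc j)) (parJ (cc i)) (cs j) (cs i)) (cs j') (cs i').
  rewrite /sco /= hf (bigD1 (cc j)) //= big1 ?addr0; last first.
    by move=> mu /negPf ne; rewrite cell_eltE ne andbF mul0r.
  rewrite cell_eltE eqxx andbT; case: eqP => _; last by rewrite mul0r mc0 mul0r.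
  rewrite mul1r -star_cst; [|exact: cs_sst|exact: cs_sst|exact: cs_samecnt].
  by rewrite -[RHS]mc_star; congr (mc (D := D) _ _ _); rewrite [RHS]starM !starK.
have := hk (cc j', j) _ (cs i) (cs j') (cs i') (cs_sst i) (cs_samecnt j i).
rewrite /= -!cell_keyE !cs_bc -cell_ltE => hlt.
rewrite scoD -scaleN1r scoZ sco_sum mulN1r E.
case: (la < la')%O hlt => // hlt; case/eqP.
apply/eqP; rewrite subr_eq0; apply/eqP.
have {}hlt : mc (D := D) (star (D := D) (h (cc j) (cc j')) * cst D (parJ (cc j)) (parJ (cc i)) (cs j) (cs i)) (cs j') (cs i') =
    k (cc j', j) (cs j') * (cs i' \in orb (parJ (cc i)) (cs i))%:R.
  by apply/eqP/negPn/negP => /hlt.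
rewrite hlt; case: (eqVneq la' la) => [e|ne].
  subst la'; rewrite (bigD1 j') //= big1 ?addr0; last first.
    by move=> i2 /negPf ne; rewrite scoZ sco_cell ne andbF mulr0.
  rewrite scoZ sco_cell eqxx andbT mulrCA; congr (_ * _).
  case: (cc i' =P cc i) => [e|ne].
    by rewrite mul1r orb_cs //; congr (nat_of_bool _)%:R; apply/eqP/eqP => [h2|->//]; exact/esym/cell_inj.
  by rewrite mul0r; case: eqP ne => // ->.
rewrite big1; last by move=> i2 _; rewrite scoZ sco_cell_neq ?mulr0 // eq_sym.
case: (cc i' =P cc i) => [e|_]; last by rewrite mul0r.
rewrite orb_cs //; case: eqP => [h2|_]; last by rewrite !mulr0.
by rewrite -(cs_bc i') h2 cs_bc eqxx in ne.
Qed.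

Lemma cell_standard_basis : standard_basis cell_elt.
Proof.
split; first exact: (dual_basis scoD scoZ sco_std sco_inj).
  move=> la; have /choice[k hk] f := cell_left_rule f la.
  by exists k => f i j; apply: in_above_sco => u; exact: hk.
move=> la; have /choice[k hk] f := cell_right_rule f la.
by exists (fun f j j' => k f j' j) => f i j; apply: in_above_sco => u; exact: hk.
Qed.

End SchurBasis.

Lemma schur_standardly_based (st : schur_type) (n r : nat) (n_gt0 : (0 < n)%N) (r_gt0 : (0 < r)%N)
  (H : heckeAlg r) : standardly_based (schur_alg st H n_gt0).
Proof.
exists cell_display, (cell_index r), (@cellI st n r), (@cellI st n r), (@cell_elt st n r n_gt0 r_gt0 H).
exact: cell_standard_basis.
Qed.

(** * Base change of standardly based algebras *)

Record antirep (K : comNzRingType) (A : algType K) (n : nat) := Antirep {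
  ar :> A -> 'M[K]_n;
  ar_linear : forall (z : K) x y, ar (z *: x + y) = z *: ar x + ar y;
  ar1 : ar 1 = 1%:M;
  arM : forall x y, ar (x * y) = ar y *m ar x }.

(* A left module on row vectors, whence the reversed products in [arM]. *)
Definition repmod (K : comNzRingType) (A : algType K) (n : nat) (th : antirep A n) : Type := 'rV[K]_n.

Section Repmod.
Variables (K : comNzRingType) (A : algType K) (n : nat) (th : antirep A n).

Lemma arD x y : th (x + y) = th x + th y.
Proof. by have := ar_linear th 1 x y; rewrite !scale1r. Qed.
Lemma ar0 : th 0 = 0.
Proof. by have := ar_linear th (-1) 0 0; rewrite !scaleN1r !addNr. Qed.
Lemma arZ z x : th (z *: x) = z *: th x.
Proof. by have := ar_linear th z x 0; rewrite ar0 !addr0. Qed.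
Lemma ar_sum (I : Type) (s : seq I) (P : pred I) (F : I -> A) :
  th (\sum_(i <- s | P i) F i) = \sum_(i <- s | P i) th (F i).
Proof. by apply: big_morph; [exact: arD|exact: ar0]. Qed.

HB.instance Definition _ := GRing.Zmodule.on (repmod th).

Definition repmod_scale (a : A) (v : repmod th) : repmod th := v *m th a.

Fact repmod_scaleA a b v : repmod_scale a (repmod_scale b v) = repmod_scale (a * b) v.
Proof. by rewrite /repmod_scale arM mulmxA. Qed.
Fact repmod_scale1 : left_id 1 repmod_scale.
Proof. by move=> v; rewrite /repmod_scale ar1 mulmx1. Qed.
Fact repmod_scaleDr : right_distributive repmod_scale +%R.
Proof. by move=> a v w; rewrite /repmod_scale mulmxDl. Qed.
Fact repmod_scaleDl v : {morph repmod_scale^~ v : a b / a + b}.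
Proof. by move=> a b; rewrite /repmod_scale arD mulmxDr. Qed.

HB.instance Definition _ := GRing.Zmodule_isLmodule.Build A (repmod th)
  repmod_scaleA repmod_scale1 repmod_scaleDr repmod_scaleDl.

Lemma repmodE (a : A) (v : repmod th) : a *: v = (v : 'rV[K]_n) *m th a.
Proof. by []. Qed.
End Repmod.

Section ExtBasis.
Variables (K K' : comNzRingType) (f : {rmorphism K -> K'}) (M : lmodType K) (M' : lmodType K') (i : M -> M').
Hypothesis ext : extension_of_scalars f i.
Variables (I : finType) (e : I -> M) (eb : is_basis e).

Lemma extD x y : i (x + y) = i x + i y.
Proof. by have := ext.1 1 x y; rewrite /= scale1r rmorph1 scale1r. Qed.
Lemma ext0 : i 0 = 0.
Proof. by apply: (@addrI _ (i 0)); rewrite -extD !addr0. Qed.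
Lemma extZ z x : i (z *: x) = f z *: i x.
Proof. by have := ext.1 z x 0; rewrite /= ext0 !addr0. Qed.
Lemma ext_sum (S : Type) (s : seq S) (P : pred S) (F : S -> M) :
  i (\sum_(j <- s | P j) F j) = \sum_(j <- s | P j) i (F j).
Proof. by apply: big_morph; [exact: extD|exact: ext0]. Qed.

(** Taking coordinates and recombining them is a linear endomorphism of M' that agrees with i on M;
    by the uniqueness in the universal property it is the identity. *)
Lemma ext_span y : exists c : I -> K', y = \sum_j c j *: i (e j).
Proof.
pose g (x : M) : {ffun I -> K'^o} := [ffun j => f (bco eb x j)].
have gl : linear_for (f \; *:%R) g.
  by move=> z x x'; apply/ffunP => j; rewrite !ffunE bcoD bcoZ rmorphD rmorphM.
have [h [[hl hi] _]] := ext.2 _ g gl.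
pose psi y : M' := \sum_j (h y j : K') *: i (e j).
have [h' [_ uniq]] := ext.2 _ i ext.1.
have id_h' : h' = id by apply: uniq; split.
have psi_h' : h' = psi.
  apply: uniq; split=> [z x x'|x].
    rewrite /psi hl scaler_sumr -big_split /=; apply: eq_bigr => j _.
    by rewrite !ffunE scalerDl scalerA.
  rewrite /psi hi [in RHS](bcoE eb x) ext_sum; apply: eq_bigr => j _.
  by rewrite ffunE extZ.
by exists (fun j => h y j); rewrite -[LHS]/(id y) -id_h' psi_h'.
Qed.

(** The coordinate functions of M extend to M' by the universal property, and they separate the
    coefficients. *)
Lemma ext_basis : is_basis (i \o e).
Proof.
pose g (x : M) : {ffun I -> K'^o} := [ffun j => f (bco eb x j)].
have gl : linear_for (f \; *:%R) g.
  by move=> z x x'; apply/ffunP => j; rewrite !ffunE bcoD bcoZ rmorphD rmorphM.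
have [h [[hl hi] _]] := ext.2 _ g gl.
have hD x y : h (x + y) = h x + h y by have := hl 1 x y; rewrite !scale1r.
have h0 : h 0 = 0 by have := hl (-1) 0 0; rewrite !scaleN1r !addNr.
have hZ z x : h (z *: x) = z *: h x by have := hl z x 0; rewrite h0 !addr0.
have hsum (c : I -> K') j : h (\sum_k c k *: i (e k)) j = c j.
  rewrite (big_morph h hD h0) sum_ffunE (bigD1 j) //= big1 ?addr0.
    by rewrite hZ hi !ffunE bco_b eqxx rmorph1; exact: mulr1.
  by move=> k /negPf kj; rewrite hZ hi !ffunE bco_b kj rmorph0; exact: mulr0.
move=> y; have [c ey] := ext_span y; exists [ffun j => c j]; split.
  by rewrite ey; apply: eq_bigr => j _; rewrite ffunE.
by move=> c' ec'; apply/ffunP => j; rewrite ffunE -(hsum c) -ey ec' hsum.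
Qed.

Lemma ext_ind (Q : M' -> Prop) : (forall z x y, Q x -> Q y -> Q (z *: x + y)) ->
  (forall x, Q (i x)) -> forall y, Q y.
Proof.
move=> QL Qi y; have Q0 : Q 0 by rewrite -ext0; exact: Qi.
have [c ->] := ext_span y; elim/big_ind: _ => [//|x x' Qx Qx'|j _].
  by rewrite -[x]scale1r; exact: QL.
by rewrite -[c j *: _]addr0; exact: QL.
Qed.
End ExtBasis.

Section StdBasis.
Variables (K : comNzRingType) (A : algType K).
Variables (d : Order.disp_t) (L : finPOrderType d) (I J : L -> finType).
Variable b : forall l, I l -> J l -> A.
Hypothesis hb : standard_basis b.
Local Notation X := (std_index I J).
Local Notation above := (in_above b).
Implicit Types (l m : L) (a x y : A) (u : X).

Lemma std_is_basis : is_basis (std_elt b). Proof. by case: hb. Qed.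
Definition sc x u : K := bco std_is_basis x u.

Definition Xi l (i : I l) (j : J l) : X := Tagged (fun l => (I l * J l)%type) (i, j).

Lemma sc_sum (S : Type) (s : seq S) (P : pred S) (F : S -> A) u :
  sc (\sum_(j <- s | P j) F j) u = \sum_(j <- s | P j) sc (F j) u.
Proof. exact: bco_sum. Qed.

Lemma sc_b l (i : I l) (j : J l) u : sc (b i j) u = (Xi i j == u)%:R.
Proof. by rewrite -[b i j]/(std_elt b (Xi i j)) /sc bco_b. Qed.

Lemma sc_bl l (i i' : I l) (j j' : J l) : sc (b i j) (Xi i' j') = ((i == i') && (j == j'))%:R.
Proof. by rewrite sc_b eq_Tagged. Qed.

Lemma aboveP l x : above l x <-> forall u, ~~ (l < tag u)%O -> sc x u = 0.
Proof.
split=> [[c ->] u nu|h].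
  rewrite sc_sum big1 // => v lv; rewrite /sc bcoZ bco_b.
  by case: eqP => [e|]; rewrite ?mulr0 // -e lv in nu *.
exists (sc x); rewrite [LHS](bcoE std_is_basis) [RHS]big_mkcond; apply: eq_bigr => u _.
by case: ifP => // /negbT/h e; rewrite -/(sc x u) e scale0r.
Qed.

Lemma aboveD l x y : above l x -> above l y -> above l (x + y).
Proof. by move=> /aboveP hx /aboveP hy; apply/aboveP => u nu; rewrite /sc bcoD -!/(sc _ u) hx // hy // addr0. Qed.
Lemma aboveZ l z x : above l x -> above l (z *: x).
Proof. by move=> /aboveP hx; apply/aboveP => u nu; rewrite /sc bcoZ -!/(sc _ u) hx // mulr0. Qed.
Lemma above0 l : above l 0.
Proof. by apply/aboveP => u _; rewrite /sc bco0. Qed.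
Lemma above_sum l (S : Type) (s : seq S) (P : pred S) (F : S -> A) :
  (forall i, P i -> above l (F i)) -> above l (\sum_(i <- s | P i) F i).
Proof. by move=> h; elim/big_ind: _ => //; [exact: above0|exact: aboveD]. Qed.
Lemma above_elt l u : (l < tag u)%O -> above l (std_elt b u).
Proof.
move=> lu; apply/aboveP => v nv; rewrite /sc bco_b; case: eqP => // e.
by rewrite -e lu in nv.
Qed.
Lemma above_trans l m x : (l < m)%O -> above m x -> above l x.
Proof.
move=> lm /aboveP hx; apply/aboveP => u nu; apply: hx; apply: contra nu; exact: Order.POrderTheory.lt_trans.
Qed.

Lemma left_rule l : exists k : A -> I l -> I l -> K, forall a (i : I l) (j : J l),
  above l (a * b i j - \sum_i' k a i' i *: b i' j).
Proof.
by case: hb => _ /(_ l)[k hk] _; exists (fun a i' i => k a i' i) => a i j; exact: hk.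
Qed.

Definition lco l : A -> I l -> I l -> K := sval (cid (left_rule l)).
Lemma lcoP l a (i : I l) (j : J l) : above l (a * b i j - \sum_i' lco a i' i *: b i' j).
Proof. by rewrite /lco; case: cid. Qed.

Lemma right_rule l : exists k : A -> J l -> J l -> K, forall a (i : I l) (j : J l),
  above l (b i j * a - \sum_j' k a j' j *: b i j').
Proof.
by case: hb => _ _ /(_ l)[k hk]; exists (fun a j' j => k a j j') => a i j; exact: hk.
Qed.
Definition rco l : A -> J l -> J l -> K := sval (cid (right_rule l)).
Lemma rcoP l a (i : I l) (j : J l) : above l (b i j * a - \sum_j' rco a j' j *: b i j').
Proof. by rewrite /rco; case: cid. Qed.

Lemma above_mulL l a x : above l x -> above l (a * x).
Proof.
case=> c ->; rewrite mulr_sumr; apply: above_sum => -[m [i j]] lm; rewrite -scalerAr; apply: aboveZ.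
have := lcoP a i j => /(above_trans lm) h; rewrite /std_elt /= -[a * _](subrK (\sum_i' lco a i' i *: b i' j)).
apply: aboveD => //; apply: above_sum => i' _; apply: aboveZ; exact: (@above_elt l (Xi i' j)).
Qed.

Lemma sc_congr l x y u : above l (x - y) -> ~~ (l < tag u)%O -> sc x u = sc y u.
Proof.
by move=> /aboveP h nu; rewrite -[x](subrK y) /sc bcoD -!/(sc _ u) h // add0r.
Qed.

Lemma sc_left l a (i i' : I l) (j j' : J l) : sc (a * b i j) (Xi i' j') = lco a i' i * (j == j')%:R.
Proof.
rewrite (sc_congr (lcoP a i j)) /= ?Order.POrderTheory.ltxx // sc_sum (bigD1 i') //= big1 ?addr0.
  by rewrite /sc bcoZ -!/(sc _ _) sc_bl eqxx.
by move=> k /negPf ki; rewrite /sc bcoZ -!/(sc _ _) sc_bl ki mulr0.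
Qed.

Lemma sc_right l a (i i' : I l) (j j' : J l) : sc (b i j * a) (Xi i' j') = rco a j' j * (i == i')%:R.
Proof.
rewrite (sc_congr (rcoP a i j)) /= ?Order.POrderTheory.ltxx // sc_sum (bigD1 j') //= big1 ?addr0.
  by rewrite /sc bcoZ -!/(sc _ _) sc_bl eqxx andbT.
by move=> k /negPf ki; rewrite /sc bcoZ -!/(sc _ _) sc_bl ki andbF mulr0.
Qed.

Lemma sc_right_neq l m a (i : I l) (j : J l) (i' : I m) (j' : J m) :
  ~~ (l <= m)%O -> sc (b i j * a) (Xi i' j') = 0.
Proof.
move=> nlm; rewrite (sc_congr (rcoP a i j)) /=; last first.
  by apply: contra nlm; exact: Order.POrderTheory.ltW.
rewrite sc_sum big1 // => k _; rewrite /sc bcoZ -/(sc _ _) sc_b; case: eqP => [e|]; rewrite ?mulr0 //.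
by have := congr1 tag e => /= elm; rewrite elm Order.POrderTheory.lexx in nlm.
Qed.

Section CellRep.
Variables (l : L) (j0 : J l).
Local Notation n := #|I l|.

(** The chosen coefficients [lco] are determined by the algebra only if [J l] has an element; j0
    provides one ([lco_sc]). *)
Definition cellmx a : 'M[K]_n := \matrix_(i, i') lco a (enum_val i') (enum_val i).

Lemma lco_sc a i' i : lco a i' i = sc (a * b i j0) (Xi i' j0).
Proof. by rewrite sc_left eqxx mulr1. Qed.

Fact cellmx_linear z x y : cellmx (z *: x + y) = z *: cellmx x + cellmx y.
Proof. by apply/matrixP => i i'; rewrite !mxE !lco_sc mulrDl -scalerAl /sc bcoD bcoZ. Qed.

Fact cellmx1 : cellmx 1 = 1%:M.
Proof. by apply/matrixP => i i'; rewrite !mxE !lco_sc mul1r sc_bl eqxx andbT (inj_eq enum_val_inj). Qed.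

Lemma sum_enum (F : I l -> K) : \sum_i F i = \sum_(i < n) F (enum_val i).
Proof.
rewrite (reindex (@enum_val (I l) predT)) //; exists enum_rank => [i _|i _]; first exact: enum_valK.
exact: enum_rankK.
Qed.

Fact cellmxM x y : cellmx (x * y) = cellmx y *m cellmx x.
Proof.
apply/matrixP => i i'; rewrite !mxE lco_sc -mulrA.
have h : above l (x * (y * b (enum_val i) j0) - x * \sum_i' lco y i' (enum_val i) *: b i' j0).
  by rewrite -mulrBr; apply: above_mulL; exact: lcoP.
rewrite (sc_congr h) /= ?Order.POrderTheory.ltxx // mulr_sumr sc_sum sum_enum; apply: eq_bigr => k _.
by rewrite !mxE -scalerAr /sc bcoZ -/(sc _ _) -lco_sc.
Qed.

Definition cellrep : antirep A n := Antirep cellmx_linear cellmx1 cellmxM.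

(** The bilinear form of the cell: modulo higher cells, b_(i1,j) b_(i,j0) is [gram j i] times
    b_(i1,j0). *)
Definition gram (j : J l) (i : I l) : K := rco (b i j0) j0 j.

Lemma cellrep_b (i1 : I l) j (k k' : 'I_n) :
  cellrep (b i1 j) k k' = gram j (enum_val k) * (enum_val k' == i1)%:R.
Proof. by rewrite mxE lco_sc sc_right eq_sym. Qed.

Lemma cellrep_neq m (i1 : I m) (j : J m) : ~~ (m <= l)%O -> cellrep (b i1 j) = 0.
Proof. by move=> h; apply/matrixP => i i'; rewrite !mxE lco_sc sc_right_neq. Qed.

Lemma cellrep_mul a (v : 'I_n -> K) :
  above l (a * \sum_i v i *: b (enum_val i) j0 - \sum_i (\sum_k v k * cellrep a k i) *: b (enum_val i) j0).
Proof.
have -> : \sum_i (\sum_k v k * cellrep a k i) *: b (enum_val i) j0 =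
    \sum_k v k *: \sum_i' lco a i' (enum_val k) *: b i' j0.
  under eq_bigr => i _ do rewrite scaler_suml.
  rewrite exchange_big /=; apply: eq_bigr => k _.
  rewrite (reindex (@enum_val (I l) predT)) /=; last first.
    by exists enum_rank => [i _|i _]; [exact: enum_valK|exact: enum_rankK].
  by rewrite scaler_sumr; apply: eq_bigr => i _; rewrite scalerA mxE.
rewrite mulr_sumr -sumrB; apply: above_sum => k _.
by rewrite -scalerAr -scalerBr; apply/aboveZ/lcoP.
Qed.
End CellRep.
End StdBasis.

Section StdBaseChange.
Variables (K K' : comNzRingType) (f : {rmorphism K -> K'}) (A : algType K) (A' : algType K').
Variables (io : {rmorphism A -> A'}) (ext : algebra_base_change f io).
Variables (d : Order.disp_t) (L : finPOrderType d) (I J : L -> finType).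
Variable b : forall l, I l -> J l -> A.
Hypothesis hb : standard_basis b.

Definition ext_elt l (i : I l) (j : J l) : A' := io (b i j).

Lemma in_above_ext l x : in_above b l x -> in_above ext_elt l (io x).
Proof.
case=> c ->; exists (fun u => f (c u)); rewrite (ext_sum ext); apply: eq_bigr => u _.
by rewrite (extZ ext).
Qed.

Lemma ext_std_is_basis : is_basis (std_elt ext_elt).
Proof. exact: (ext_basis ext (std_is_basis hb)). Qed.

Let in_above_lin l (z : K') x y : in_above ext_elt l x -> in_above ext_elt l y -> in_above ext_elt l (z *: x + y).
Proof.
case=> c -> [c' ->]; exists (fun u => z * c u + c' u); rewrite scaler_sumr -big_split /=.
by apply: eq_bigr => u _; rewrite scalerDl scalerA.
Qed.

Let left_ex l (a : A') : exists k : I l -> I l -> K', forall (i : I l) (j : J l),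
  in_above ext_elt l (a * ext_elt i j - \sum_i' k i' i *: ext_elt i' j).
Proof.
move: a; apply: (ext_ind ext (std_is_basis hb)) => [z x y [k hk] [k' hk']|x].
  exists (fun i' i => z * k i' i + k' i' i) => i j; have := in_above_lin z (hk i j) (hk' i j).
  rewrite scalerBr addrACA -opprD mulrDl scalerAl scaler_sumr -big_split /=.
  by under eq_bigr => i' _ do rewrite scalerA -scalerDl.
exists (fun i' i => f (lco hb x i' i)) => i j; have := in_above_ext (lcoP hb x i j).
rewrite rmorphB rmorphM (ext_sum ext) /=.
by under eq_bigr => i' _ do rewrite (extZ ext).
Qed.

Let right_ex l (a : A') : exists k : J l -> J l -> K', forall (i : I l) (j : J l),
  in_above ext_elt l (ext_elt i j * a - \sum_j' k j j' *: ext_elt i j').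
Proof.
move: a; apply: (ext_ind ext (std_is_basis hb)) => [z x y [k hk] [k' hk']|x].
  exists (fun i' i => z * k i' i + k' i' i) => i j; have := in_above_lin z (hk i j) (hk' i j).
  rewrite scalerBr addrACA -opprD mulrDr scalerAr scaler_sumr -big_split /=.
  by under eq_bigr => i' _ do rewrite scalerA -scalerDl.
exists (fun j j' => f (rco hb x j' j)) => i j; have := in_above_ext (rcoP hb x i j).
rewrite rmorphB rmorphM (ext_sum ext) /=.
by under eq_bigr => i' _ do rewrite (extZ ext).
Qed.

Lemma ext_standard_basis : standard_basis ext_elt.
Proof.
split; first exact: ext_std_is_basis.
  by move=> l; have [k hk] := choice (@left_ex l); exists k.
by move=> l; have [k hk] := choice (@right_ex l); exists k.
Qed.

Lemma ext_sc x u : sc ext_standard_basis (io x) u = f (sc hb x u).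
Proof.
apply: (@bco_uniq _ _ _ _ _ _ (fun u => f (sc hb x u))); rewrite {1}(bcoE (std_is_basis hb) x) (ext_sum ext).
by apply: eq_bigr => v _; rewrite (extZ ext).
Qed.

Lemma ext_cellrep l (j0 : J l) x :
  cellrep ext_standard_basis j0 (io x) = map_mx f (cellrep hb j0 x).
Proof. by apply/matrixP => i i'; rewrite !mxE !(lco_sc _ j0) -ext_sc rmorphM. Qed.

End StdBaseChange.

Lemma standardly_based_ext (K K' : comNzRingType) (f : {rmorphism K -> K'}) (A : algType K)
  (A' : algType K') (io : {rmorphism A -> A'}) :
  algebra_base_change f io -> standardly_based A -> standardly_based A'.
Proof.
move=> ext [d [L [I [J [b hb]]]]]; exists d, L, I, J, (ext_elt io b).
exact: (ext_standard_basis ext hb).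
Qed.

Section RepBaseChange.
Variables (K K' : comNzRingType) (f : {rmorphism K -> K'}) (A : algType K) (A' : algType K').
Variables (io : {rmorphism A -> A'}) (ext : algebra_base_change f io).
Variables (I : finType) (e : I -> A) (eb : is_basis e).

Lemma ext_antirep n (th : antirep A n) : exists th' : antirep A' n, forall x, th' (io x) = map_mx f (th x).
Proof.
pose g x : 'M[K']_n := map_mx f (th x).
have gl : linear_for (f \; *:%R) g.
  by move=> z x y; rewrite /g ar_linear map_mxD map_mxZ.
have [h [[hl hi] _]] := ext.2 _ g gl.
have hD x y : h (x + y) = h x + h y by have := hl 1 x y; rewrite !scale1r.
have h0 : h 0 = 0 by have := hl (-1) 0 0; rewrite !scaleN1r !addNr.
have hZ z x : h (z *: x) = z *: h x by have := hl z x 0; rewrite h0 !addr0.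
have h1 : h 1 = 1%:M by rewrite -(rmorph1 io) hi /g ar1 map_mx1.
have hM x y : h (x * y) = h y *m h x.
  move: y; apply: (ext_ind ext eb) => [z y y' IH IH'|y].
    by rewrite mulrDr -scalerAr !hl IH IH' mulmxDl scalemxAl.
  move: x; apply: (ext_ind ext eb) => [z x x' IH IH'|x].
    by rewrite mulrDl -scalerAl !hl IH IH' mulmxDr scalemxAr.
  by rewrite -rmorphM !hi /g arM map_mxM.
by exists (Antirep hl h1 hM).
Qed.

(** For a module given by matrices, extension of scalars is entrywise; this lets reductions of
    lattices be compared through characteristic polynomials. *)
Lemma ext_repmod n (th : antirep A n) (th' : antirep A' n) :
  (forall x, th' (io x) = map_mx f (th x)) ->
  extension_of_scalars io (fun v : repmod th => map_mx f v : repmod th').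
Proof.
move=> hth; split=> [a v w|N g gl]; first by rewrite map_mxD [_ *: v]repmodE map_mxM -hth.
have gD v w : g (v + w) = g v + g w by have := gl 1 v w; rewrite /= rmorph1 !scale1r.
have g0 : g 0 = 0 by apply: (@addrI _ (g 0)); rewrite -gD !addr0.
have gA a v : g (a *: v) = io a *: g v by have := gl a v 0; rewrite /= g0 !addr0.
pose dv k : repmod th := delta_mx 0 k.
have gE v : g v = \sum_k (f (v 0 k))%:A *: g (dv k).
  rewrite {1}[v]row_sum_delta (big_morph g gD g0); apply: eq_bigr => k _.
  have -> : v 0 k *: delta_mx 0 k = (v 0 k)%:A *: dv k :> repmod th.
    by rewrite repmodE arZ ar1 -scalemxAr mulmx1.
  by rewrite gA (extZ ext) rmorph1.
pose h (y : repmod th') : N := \sum_k (y 0 k)%:A *: g (dv k).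
have hD y y' : h (y + y') = h y + h y'.
  by rewrite /h -big_split /=; apply: eq_bigr => k _; rewrite mxE !scalerDl.
have hg v : h (map_mx f v : repmod th') = g v.
  by rewrite /h gE; apply: eq_bigr => k _; rewrite mxE.
have hZ z y : h (z *: (y : 'rV[K']_n) : repmod th') = z%:A *: h y.
  by rewrite /h scaler_sumr; apply: eq_bigr => k _; rewrite mxE scalerA -scalerAl mul1r scalerA.
have h0 : h 0 = 0 by rewrite /h big1 // => k _; rewrite mxE !scale0r.
have yE (y : repmod th') : y = \sum_k y 0 k *: map_mx f (dv k).
  by rewrite {1}[y]row_sum_delta; apply: eq_bigr => k _; rewrite map_delta_mx.
have hA a y : h (a *: y) = a *: h y.
  move: a; apply: (ext_ind ext eb) => [z a a' IH IH'|a].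
    rewrite !scalerDl hD IH'; congr (_ + _).
    have -> : (z *: a) *: y = z *: ((a *: y : repmod th') : 'rV_n) :> repmod th'.
      by rewrite !repmodE arZ scalemxAr.
    by rewrite hZ IH scalerA -scalerAl mul1r.
  have -> : io a *: y = \sum_k y 0 k *: map_mx f ((a *: dv k : repmod th) : 'rV_n) :> 'rV_n.
    rewrite repmodE {1}[y]yE mulmx_suml; apply: eq_bigr => k _.
    by rewrite hth -scalemxAl -map_mxM.
  rewrite (big_morph h hD h0) /h scaler_sumr; apply: eq_bigr => k _.
  rewrite [LHS]hZ hg gA !scalerA; congr (_ *: _).
  by rewrite -scalerAl mul1r -scalerAr mulr1.
exists h; split; first by split=> // a y y'; rewrite hD hA.
move=> h' [h'l h'g]; apply: funext => y.
have h'D x x' : h' (x + x') = h' x + h' x' by have := h'l 1 x x'; rewrite !scale1r.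
have h'0 : h' 0 = 0 by have := h'l (-1) 0 0; rewrite !scaleN1r !addNr.
have h'A a x : h' (a *: x) = a *: h' x by have := h'l a x 0; rewrite h'0 !addr0.
rewrite [y in RHS]yE (big_morph h' h'D h'0); apply: eq_bigr => k _.
have -> : y 0 k *: map_mx f (dv k) = (y 0 k)%:A *: (map_mx f (dv k) : repmod th') :> repmod th'.
  by rewrite repmodE arZ ar1 -scalemxAr mulmx1.
by rewrite h'A h'g.
Qed.
End RepBaseChange.

(** * Composition multiplicities *)

Section Eig1.
Variable F : fieldType.

Definition eig1 n (M : 'M[F]_n) : nat := mup 1 (char_poly M).

Lemma char_poly_neq0 n (M : 'M[F]_n) : char_poly M != 0.
Proof. exact/monic_neq0/char_poly_monic. Qed.

(** The determinant of the bordered matrix N computed in two ways, by eliminating one or the other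
    of its off-diagonal blocks. *)
Lemma char_poly_outer n (u : 'cV[F]_n) (v : 'rV[F]_n) :
  'X * char_poly (u *m v) = ('X - ((v *m u) 0 0)%:P) * 'X^n.
Proof.
pose uP := map_mx polyC u; pose vP := map_mx polyC v.
pose N : 'M[{poly F}]_(1 + n) := block_mx 1%:M vP uP ('X%:M).
have dN : \det N = char_poly (u *m v).
  have -> : N = block_mx 1%:M 0 uP 1%:M *m block_mx 1%:M vP 0 (char_poly_mx (u *m v)).
    rewrite mulmx_block !(mul1mx, mulmx1, mul0mx, mulmx0, addr0) /char_poly_mx map_mxM.
    by rewrite addrC subrK.
  by rewrite det_mulmx det_lblock det_ublock !det1 !mul1r.
have h : \det (block_mx 'X%:M (- vP) 0 1%:M *m N) = ('X - ((v *m u) 0 0)%:P) * 'X^n.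
  rewrite mulmx_block !(mul1mx, mulmx1, mul0mx, add0r) mul_scalar_mx mul_mx_scalar.
  rewrite scalerN subrr det_lblock det_scalar; congr (_ * _).
  by rewrite mulNmx -map_mxM det_mx11 !mxE eqxx mulr1n.
by rewrite -h det_mulmx det_ublock det1 mulr1 det_scalar1 dN.
Qed.

Lemma eig1_outer n (u : 'cV[F]_n) (v : 'rV[F]_n) : eig1 (u *m v) = ((v *m u) 0 0 == 1).
Proof.
have nX m : ~~ root ('X^m : {poly F}) 1 by rewrite /root hornerXn expr1n oner_eq0.
have := congr1 (mup 1) (char_poly_outer u v).
rewrite mupMr ?(nX 1%N) // mupMl ?nX // -/(eig1 _) => ->.
by rewrite -['X - _]expr1 mup_XsubCX eq_sym; case: eqP.
Qed.

Lemma eig1_0 n : eig1 (0 : 'M[F]_n) = 0%N.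
Proof.
by rewrite -(mulmx0 n (0 : 'cV_n)) (eig1_outer 0 0) mulmx0 mxE eq_sym oner_eq0.
Qed.

Lemma char_poly_conj m n (P : 'M[F]_(m, n)) (Q : 'M[F]_(n, m)) (M : 'M[F]_n) :
  P *m Q = 1%:M -> Q *m P = 1%:M -> char_poly (P *m M *m Q) = char_poly M.
Proof.
move=> PQ QP; have e : m = n by apply/eqP; rewrite eqn_leq (mulmx1_min PQ) (mulmx1_min QP).
subst m; have -> : char_poly (P *m M *m Q) = \det (map_mx polyC P *m char_poly_mx M *m map_mx polyC Q).
  congr (\det _); rewrite /char_poly_mx mulmxBr mulmxBl !map_mxM; congr (_ - _).
  by rewrite -scalemx1 -scalemxAr -scalemxAl mulmx1 -map_mxM PQ map_mx1.
rewrite !det_mulmx mulrAC -det_mulmx -map_mxM PQ map_mx1 det1 mul1r //.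
Qed.

Lemma char_poly_lblock m n (A : 'M[F]_m) (C : 'M[F]_(n, m)) (B : 'M[F]_n) :
  char_poly (block_mx A 0 C B) = char_poly A * char_poly B.
Proof.
rewrite /char_poly -(det_lblock _ (- map_mx polyC C)); congr (\det _).
rewrite /char_poly_mx map_block_mx scalar_mx_block opp_block_mx add_block_mx.
by rewrite map_mx0 oppr0 !add0r.
Qed.
End Eig1.

Section Splitting.
Variables (F : fieldType) (A : algType F).

Definition stable n (th : antirep A n) m (U : 'M[F]_(m, n)) := forall a, (U *m th a <= U)%MS.

(** In a basis formed by a basis of U and a lift of a basis of the quotient, th is block triangular,
    so characteristic polynomials multiply and [eig1] adds. *)
Lemma rep_split n (th : antirep A n) (U : 'M[F]_n) : stable th U ->
  exists (th1 : antirep A (\rank U)) (th2 : antirep A (\rank (cokermx U)))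
    (io : 'M[F]_(\rank U, n)) (io' : 'M[F]_(n, \rank U))
    (pi : 'M[F]_(n, \rank (cokermx U))) (pi' : 'M[F]_(\rank (cokermx U), n)),
    [/\ [/\ (forall a, io *m th a = th1 a *m io), (io *m io' = 1%:M) & (io :=: U)%MS],
        [/\ (forall a, th a *m pi = pi *m th2 a), (pi' *m pi = 1%:M) & (kermx pi :=: U)%MS]
      & forall a, eig1 (th a) = (eig1 (th1 a) + eig1 (th2 a))%N].
Proof.
move=> sU.
have [io [io' [ioU i1]]] : exists (io : 'M[F]_(\rank U, n)) io', (io :=: U)%MS /\ io *m io' = 1%:M.
  exists (row_base U), (pinvmx (row_base U)); split; first exact: eq_row_base.
  by apply: mulmxVp; exact: row_base_free.
have [pi [pi' [kU p1]]] : exists (pi : 'M[F]_(n, \rank (cokermx U))) pi', (kermx pi :=: U)%MS /\ pi' *m pi = 1%:M.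
  exists (col_base (cokermx U)), (pinvmx (col_base (cokermx U))); split; last by apply: mulVpmx; exact: col_base_full.
  apply/eqmxP/andP; split; last first.
    apply/sub_kermxP; have : U *m cokermx U = 0 by exact: mulmx_coker.
    rewrite -{1}(mulmx_base (cokermx U)) mulmxA => /(congr1 (mulmx^~ (pinvmx (row_base (cokermx U))))).
    by rewrite -mulmxA mulmxVp ?row_base_free // mulmx1 mul0mx.
  have e := congr1 (mulmx (kermx (col_base (cokermx U)))) (mulmx_base (cokermx U)).
  by rewrite submxE -e mulmxA mulmx_ker mul0mx.
have iopi : io *m pi = 0 by apply/sub_kermxP; rewrite kU ioU.
pose f1 a := io *m th a *m io'; pose f2 a := pi' *m th a *m pi.
have c1 a : io *m th a = f1 a *m io.
  have /submxP[B e] : (io *m th a <= io)%MS by rewrite ioU (submx_trans _ (sU a)) // submxMr // ioU.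
  by rewrite /f1 e -(mulmxA B) i1 mulmx1.
have c2 a : th a *m pi = pi *m f2 a.
  have : ((1%:M - pi *m pi') *m th a <= kermx pi)%MS.
    rewrite kU; apply: submx_trans (sU a); apply: submxMr.
    by rewrite -kU; apply/sub_kermxP; rewrite mulmxBl mul1mx -mulmxA p1 mulmx1 subrr.
  by move/sub_kermxP; rewrite mulmxBl mul1mx mulmxBl => /eqP; rewrite subr_eq0 => /eqP ->; rewrite /f2 !mulmxA.
have l1 z x y : f1 (z *: x + y) = z *: f1 x + f1 y.
  by rewrite /f1 ar_linear mulmxDr mulmxDl -scalemxAr -scalemxAl.
have l2 z x y : f2 (z *: x + y) = z *: f2 x + f2 y.
  by rewrite /f2 ar_linear mulmxDr mulmxDl -scalemxAr -scalemxAl.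
have o1 : f1 1 = 1%:M by rewrite /f1 ar1 mulmx1.
have o2 : f2 1 = 1%:M by rewrite /f2 ar1 mulmx1.
have m1 x y : f1 (x * y) = f1 y *m f1 x.
  by rewrite [f1 x]/f1 !mulmxA -c1 /f1 arM !mulmxA.
have m2 x y : f2 (x * y) = f2 y *m f2 x.
  by rewrite [f2 y]/f2 -mulmxA -c2 /f2 arM !mulmxA.
exists (Antirep l1 o1 m1), (Antirep l2 o2 m2), io, io', pi, pi'; split=> // a /=.
(* The retraction io' corrected to vanish on the lift pi', so that P and Q below are inverse to each
   other. *)
pose ka := io' - pi *m pi' *m io'.
pose P := col_mx io (pi'); pose Q := row_mx ka pi.
have PQ : P *m Q = 1%:M.
  rewrite mul_col_row /ka !mulmxBr !mulmxA i1 iopi !mul0mx subr0 p1 mul1mx subrr.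
  by rewrite -scalar_mx_block.
have e : (\rank U + \rank (cokermx U))%N = n by rewrite mxrank_coker subnKC // rank_leq_col.
have QP := mulmx1C_eq (esym e) PQ.
rewrite /eig1 -(char_poly_conj (th a) PQ QP) -mupM ?char_poly_neq0 // -(char_poly_lblock _ (pi' *m th a *m ka)).
congr (mup _ (char_poly _)).
rewrite mul_col_mx mul_col_row; congr block_mx.
- have iok : io *m ka = 1%:M by rewrite /ka !mulmxBr !mulmxA i1 iopi !mul0mx subr0.
  by rewrite c1 -mulmxA iok mulmx1.
- by rewrite c1 -mulmxA iopi mulmx0.
Qed.

Lemma rep_iso_char_poly m n (th : antirep A m) (th' : antirep A n) :
  module_iso (repmod th) (repmod th') -> forall a, char_poly (th a) = char_poly (th' a).
Proof.
case=> f [g fK gK] a.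
have gl : linear g.
  by move=> z x y; apply: (can_inj fK); rewrite gK linearP !gK.
have fZ (z : F) (v : 'rV_m) : f ((z *: v : 'rV_m) : repmod th) = z *: (f (v : repmod th) : 'rV_n).
  have -> : (z *: v : 'rV_m) = z%:A *: (v : repmod th) :> repmod th by rewrite repmodE arZ ar1 -scalemxAr mulmx1.
  by rewrite linearZ /= repmodE arZ ar1 -scalemxAr mulmx1.
have gD x y : g (x + y) = g x + g y by have := gl 1 x y; rewrite !scale1r.
have g0 : g 0 = 0 by apply: (@addrI _ (g 0)); rewrite -gD !addr0.
have gA b x : g (b *: x) = b *: g x by have := gl b x 0; rewrite g0 !addr0.
have gZ (z : F) (v : 'rV_n) : g ((z *: v : 'rV_n) : repmod th') = z *: (g (v : repmod th') : 'rV_m).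
  have -> : (z *: v : 'rV_n) = z%:A *: (v : repmod th') :> repmod th' by rewrite repmodE arZ ar1 -scalemxAr mulmx1.
  by rewrite gA repmodE arZ ar1 -scalemxAr mulmx1.
pose P : 'M_(m, n) := \matrix_i (f (delta_mx 0 i) : 'rV_n).
pose Q : 'M_(n, m) := \matrix_i (g (delta_mx 0 i) : 'rV_m).
have fP (v : 'rV_m) : f v = v *m P.
  rewrite {1}[v]row_sum_delta (raddf_sum f) mulmx_sum_row; apply: eq_bigr => i _.
  by rewrite rowK; exact: (fZ (v 0 i) (delta_mx 0 i)).
have gQ (v : 'rV_n) : g v = v *m Q.
  rewrite {1}[v]row_sum_delta (big_morph g gD g0) mulmx_sum_row; apply: eq_bigr => i _.
  by rewrite rowK; exact: (gZ (v 0 i) (delta_mx 0 i)).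
have PQ : P *m Q = 1%:M by apply/row_matrixP => i; rewrite row_mul !rowE -fP -gQ fK mulmx1.
have QP : Q *m P = 1%:M by apply/row_matrixP => i; rewrite row_mul !rowE -gQ -fP gK mulmx1.
rewrite -(char_poly_conj (th' a) PQ QP); congr char_poly.
apply/row_matrixP => i; rewrite !rowE !mulmxA -fP -gQ.
by rewrite -[RHS]/(g (a *: f (delta_mx 0 i : repmod th))) -linearZ fK.
Qed.

Lemma rep_iso m n (th : antirep A m) (th' : antirep A n) : module_iso (repmod th) (repmod th') ->
  forall a, eig1 (th a) = eig1 (th' a).
Proof. by move=> iso a; rewrite /eig1 (rep_iso_char_poly iso). Qed.
End Splitting.

Section Preimages.
Variables (A : pzRingType) (X Y : lmodType A) (p : {linear X -> Y}).
Hypothesis p_surj : forall y, exists x, p x = y.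
Implicit Types (P Q : set X) (R : set Y).

Definition simple_step (M : lmodType A) (P P' : set M) : Prop :=
  [/\ (P `<=` P')%classic, P <> P' & forall Q : set M, submodule Q ->
     (P `<=` Q)%classic -> (Q `<=` P')%classic -> Q = P \/ Q = P'].

Definition pre R : set X := [set x | R (p x)]%classic.

Lemma submoduleB (M : lmodType A) (P : set M) x y : submodule P -> P x -> P y -> P (x - y).
Proof. by case=> _ h Px Py; rewrite addrC -scaleN1r; exact: h. Qed.

Lemma pre_submodule R : submodule R -> submodule (pre R).
Proof.
case=> R0 RD; split=> [|a x y]; rewrite /pre /=; first by rewrite linear0.
by rewrite linearP; exact: RD.
Qed.

Lemma pre_inj R R' : pre R = pre R' -> R = R'.
Proof.
move=> e; apply/seteqP; split=> y Ry; have [x ex] := p_surj y; subst y.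
  by have : pre R x by []; rewrite e.
by have : pre R' x by []; rewrite -e.
Qed.

Lemma pre_step R R' : submodule R -> submodule R' -> simple_step R R' -> simple_step (pre R) (pre R').
Proof.
move=> sR sR' [sub ne max]; split; first by move=> x; exact: sub.
  by move/pre_inj.
move=> Q sQ RQ QR'.
pose R2 : set Y := [set y | exists2 x, Q x & p x = y]%classic.
have sR2 : submodule R2.
  split; first by exists 0; [case: sQ|rewrite linear0].
  move=> a _ _ [x Qx <-] [y Qy <-]; exists (a *: x + y); last by rewrite linearP.
  by case: sQ => _; apply.
have eQ : Q = pre R2.
  apply/seteqP; split=> x /=; first by move=> Qx; exists x.
  move=> [x' Qx' e]; have [_ h] := sQ; rewrite -[x](subrK x').
  have := h 1 (x - x') x'; rewrite scale1r; apply=> //; apply: RQ; rewrite /pre /= linearB /= e subrr.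
  by case: sR.
rewrite eQ; have [||->|->] := max R2 sR2; try by [left|right].
- by move=> y Ry; have [x ex] := p_surj y; exists x => //; apply: RQ; rewrite /pre /= ex.
- by move=> _ [x /QR' h <-].
Qed.

Lemma pre_subquotient R R' (N : lmodType A) : submodule R -> submodule R' -> (R `<=` R')%classic ->
  subquotient_iso (pre R) (pre R') N <-> subquotient_iso R R' N.
Proof.
move=> sR sR' sub; have [s sK] := choice p_surj; split=> -[g [gl gs gk]]; last first.
  exists (g \o p); split=> [a x y Px Py|z|x Px] /=.
  - by rewrite linearP gl.
  - by have [y Ry gy] := gs z; have [x ex] := p_surj y; exists x; rewrite /pre /= ex.
  - exact: gk.
have gD x y : pre R' x -> pre R' y -> g (x + y) = g x + g y.
  by move=> Px Py; have := gl 1 x y Px Py; rewrite !scale1r.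
have gE x y : pre R' x -> pre R' y -> p x = p y -> g x = g y.
  move=> Px Py e; have Pxy : pre R (x - y) by rewrite /pre /= linearB /= e subrr; case: sR.
  have P'xy : pre R' (x - y) by apply: sub; exact: Pxy.
  by rewrite -[x](subrK y) gD // (proj2 (gk _ P'xy) Pxy) add0r.
exists (g \o s); split=> [a x y Rx Ry|z|y Ry] /=.
- rewrite -gl /pre /= ?sK //; apply: gE; rewrite /pre /= ?linearP /= ?sK //.
    by case: sR' => _; apply.
  by case: sR' => _; apply.
- have [x Px gx] := gs z; exists (p x) => //; rewrite -gx; apply: gE => //; rewrite /pre /= ?sK //.
- have h : pre R' (s y) by rewrite /pre /= sK.
  have := gk _ h; by rewrite /pre /= sK.
Qed.

End Preimages.

Section Multiplicity.
Variable A : pzRingType.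

Lemma submodule0 (M : lmodType A) : submodule ([set 0]%classic : set M).
Proof. by split=> // a x y /= -> ->; rewrite scaler0 addr0. Qed.

Lemma comp_series_sub (M : lmodType A) k (c : nat -> set M) i : composition_series k c -> (i < k)%N ->
  [/\ submodule (c i), submodule (c i.+1) & simple_step (c i) (c i.+1)].
Proof. by case=> _ _ h1 h2 ik; split; [apply: h1; exact: ltnW|exact: h1|exact: h2]. Qed.

Lemma multiplicity_iso (X Y N : lmodType A) m : module_iso X Y -> multiplicity Y N m -> multiplicity X N m.
Proof.
case=> f [g fK gK] [k [c [hc ->]]].
have fs y : exists x, f x = y by exists (g y).
exists k, (fun i => pre f (c i)); split; last first.
  apply: eq_card => i; rewrite !finset.inE; apply: asbool_equiv_eq.
  have [s1 s2 [s3 _ _]] := comp_series_sub hc (ltn_ord i); exact: iff_sym (pre_subquotient fs N s1 s2 s3).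
have [c0 ck cs _] := hc; split.
- rewrite c0; apply/seteqP; split=> x /=; rewrite /pre /= => h; last by rewrite h linear0.
  by apply: (can_inj fK); rewrite linear0.
- by rewrite ck.
- by move=> i ik; apply/pre_submodule/cs.
- by move=> i ik; have [s1 s2 s3] := comp_series_sub hc ik; exact: pre_step.
Qed.

(** The series of Y pulled back to X, with 0 put in front: the first factor is the kernel of p. *)
Definition ext_series (X Y : lmodType A) (p : X -> Y) (c : nat -> set Y) (i : nat) : set X :=
  if i is i'.+1 then [set x | c i' (p x)]%classic else [set 0]%classic.

Lemma ext_series_comp (X Y : lmodType A) (p : {linear X -> Y}) k c :
  (forall y, exists x, p x = y) -> simple_step [set 0]%classic (pre p [set 0]%classic) ->
  composition_series k c -> composition_series k.+1 (ext_series p c).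
Proof.
move=> ps st hc; have [c0 ck cs _] := hc; split=> [//|||].
- by rewrite /= ck.
- by case=> [|i] ik /=; [exact: submodule0|exact/pre_submodule/cs].
- case=> [|i] ik /=; first by rewrite c0.
  by have [s1 s2 s3] := comp_series_sub hc ik; exact: pre_step.
Qed.

Lemma ext_series_count (X Y N : lmodType A) (p : {linear X -> Y}) k c :
  (forall y, exists x, p x = y) -> composition_series k c ->
  #|[set i : 'I_k.+1 | `[< subquotient_iso (ext_series p c i) (ext_series p c i.+1) N >]]| =
  (`[< subquotient_iso ([set 0%R]%classic : set X) (pre p [set 0%R]%classic) N >] +
   #|[set i : 'I_k | `[< subquotient_iso (c i) (c i.+1) N >]]|)%N.
Proof.
move=> ps hc; rewrite !cardsE -!sum1_card !big_mkcond big_ord_recl /=; congr (_ + _)%N.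
  by rewrite unfold_in /=; have [-> _ _ _] := hc; case: asboolP.
rewrite [RHS]big_mkcond; apply: eq_bigr => i _; rewrite !unfold_in /=; congr (if _ then _ else _); apply: asbool_equiv_eq.
by have [s1 s2 [s3 _ _]] := comp_series_sub hc (ltn_ord i); exact: (pre_subquotient ps N s1 s2 s3).
Qed.
End Multiplicity.

Section ModuleIso.
Variable A : pzRingType.

Lemma linear_ex (M N : lmodType A) (f : M -> N) : linear f -> exists F : {linear M -> N}, F =1 f.
Proof.
move=> fl; pose m := GRing.isLinear.Build A M N *:%R f fl.
by exists (HB.pack_for {linear M -> N} f m).
Qed.

Lemma module_iso_of (M N : lmodType A) (f : M -> N) : linear f -> bijective f -> module_iso M N.
Proof.
move=> /linear_ex[F hF] fb; exists F; exact: eq_bij fb _ (fun x => esym (hF x)).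
Qed.

Lemma inj_surj_bij (S T : Type) (f : S -> T) : injective f -> (forall y, exists x, f x = y) -> bijective f.
Proof.
move=> fi /choice[g gK]; exists g => [x|//]; exact: fi.
Qed.

Lemma module_iso_sym (M N : lmodType A) : module_iso M N -> module_iso N M.
Proof.
case=> f [g fK gK]; apply: (@module_iso_of _ _ g); last by exists f.
by move=> a x y; apply: (can_inj fK); rewrite linearP !gK.
Qed.

Lemma module_iso_trans (M N P : lmodType A) : module_iso M N -> module_iso N P -> module_iso M P.
Proof.
case=> f fb [g gb]; apply: (@module_iso_of _ _ (g \o f)); last exact: bij_comp.
by move=> a x y /=; rewrite !linearP.
Qed.

Lemma iso_irreducible (M N : lmodType A) : module_iso M N -> irreducible_module N -> irreducible_module M.
Proof.
move=> MN; have [f [g fK gK]] := module_iso_sym MN; case=> -[y y0] hN; split.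
  exists (f y); apply: contraNneq y0 => e; by rewrite -(fK y) e -(fK 0) linear0.
move=> P sP; have sQ := pre_submodule f sP.
have fs x : exists y, f y = x by exists (g x).
case: (hN _ sQ) => e; [left|right]; apply: (pre_inj fs); rewrite e; apply/seteqP; split=> x //=; rewrite /pre /=.
  by move=> ->; rewrite linear0.
by move=> h; apply: (can_inj fK); rewrite linear0.
Qed.
End ModuleIso.

Section Composition.
Variables (F : fieldType) (A : algType F).

Lemma repmodZ n (th : antirep A n) (z : F) (v : repmod th) : z%:A *: v = (z *: (v : 'rV_n) : 'rV_n) :> 'rV_n.
Proof. by rewrite repmodE arZ ar1 -scalemxAr mulmx1. Qed.

(** U is a matrix of maximal rank among those with row space inside P. *)
Lemma submod_mx n (th : antirep A n) (P : set (repmod th)) : submodule P ->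
  exists2 U : 'M[F]_n, stable th U & forall v, P v <-> (v <= U)%MS.
Proof.
move=> sP; have [P0 PD] := sP.
pose good (U : 'M[F]_n) := forall v : 'rV_n, (v <= U)%MS -> P v.
have g0 : good 0 by move=> v /submx0null ->.
pose R k := `[< exists U, good U /\ \rank U = k >].
have ex : exists k, R k by exists 0%N; apply/asboolP; exists 0; rewrite mxrank0.
have ub k : R k -> (k <= n)%N by move=> /asboolP[U [_ <-]]; exact: rank_leq_row.
case: (ex_maxnP ex ub) => k /asboolP[U [gU rU]] max.
have hU v : P v <-> (v <= U)%MS.
  split; last exact: gU.
  move=> Pv; apply/negPn/negP => nv.
  have g' : good (U + v)%MS.
    move=> w /sub_addsmxP[[a b] /= ->]; rewrite addrC.
    have -> : b *m (v : 'rV_n) = (b 0 0)%:A *: (v : repmod th).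
      by rewrite repmodZ [b]mx11_scalar mul_scalar_mx mxE eqxx mulr1n.
    by apply: PD => //; apply: gU; exact: submxMl.
  have := max (\rank (U + v)%MS); rewrite leqNgt => /(_ _)/negP; apply.
    by apply/asboolP; exists (U + v)%MS.
  by rewrite -rU; apply: rank_ltmx; rewrite ltmxE addsmxSl addsmx_sub submx_refl (negPf nv).
exists U => // a; apply/row_subP => i; rewrite row_mul; apply/hU.
have := PD a (row i U : repmod th) 0; rewrite addr0 repmodE; apply=> //.
by apply/hU; exact: row_sub.
Qed.

Variables (T : finType) (dim : T -> nat) (N : forall t, antirep A (dim t)).
Hypothesis N_exh : forall n (th : antirep A n), irreducible_module (repmod th) ->
  exists t, module_iso (repmod th) (repmod (N t)).
Hypothesis N_inj : forall s t, module_iso (repmod (N s)) (repmod (N t)) -> s = t.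

(** Induction on the dimension: a nonzero stable subspace of least rank is irreducible, hence
    isomorphic to one of the N t, and the series of the quotient is pulled back above it. *)
Lemma comp_series_ex n (th : antirep A n) : exists k (c : nat -> set (repmod th)),
  composition_series k c /\ forall a, eig1 (th a) =
   (\sum_t #|[set i : 'I_k | `[< subquotient_iso (c i) (c i.+1) (repmod (N t)) >]]| * eig1 (N t a))%N.
Proof.
move: {2}n.+1 (ltnSn n) => b; elim: b n th => // b IH n th hn.
case: (posnP n) => [n0|n_gt0].
  subst n; exists 0%N, (fun=> setT); split.
    by split=> //; apply/seteqP; split=> v // _; rewrite /= (thinmx0 v).
  move=> a; rewrite (flatmx0 (th a)) eig1_0 big1 // => t _.
  by rewrite (eq_card0 (A := [set _ | _])) // => -[].
have ex : exists k, `[< exists U : 'M[F]_n, [/\ stable th U, \rank U = k & (0 < k)%N] >].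
  exists n; apply/asboolP; exists 1%:M; split=> //; last by rewrite mxrank1.
  by move=> a; rewrite mul1mx; exact: submx1.
case: (ex_minnP ex) => k /asboolP[U [sU rU k0]] min; subst k.
have [th1 [th2 [io [io' [pi [pi' [[c1 i1 ioU] [c2 p1 kU] eigD]]]]]]] := rep_split sU.
have pl : linear (fun v : repmod th => (v *m pi : repmod th2)).
  by move=> a v w; rewrite mulmxDl !repmodE -!mulmxA c2.
have [p hp] := linear_ex pl.
have ps (y : repmod th2) : exists x, p x = y.
  by exists (y *m pi'); rewrite hp -mulmxA p1 mulmx1.
have preE (v : repmod th) : pre p [set 0]%classic v <-> (v <= U)%MS.
  rewrite /pre /= hp -kU; split; first by move/sub_kermxP.
  by move=> h; apply/sub_kermxP.
have st : simple_step ([set 0]%classic : set (repmod th)) (pre p [set 0]%classic).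
  split; first by move=> v /= ->; rewrite /pre /= linear0.
    move=> e; move: k0; rewrite lt0n mxrank_eq0 => /eqP; apply; apply/row_matrixP => i.
    have : pre p [set 0]%classic (row i U : repmod th) by apply/preE; exact: row_sub.
    by rewrite -e row0 /=.
  move=> Q sQ _ QU; have [V sV hV] := submod_mx sQ.
  have VU : (V <= U)%MS.
    by apply/row_subP => i; apply/preE/QU/hV; exact: row_sub.
  case: (posnP (\rank V)) => rV.
    left; apply/seteqP; split=> v /=.
      by move/hV; move/eqP: rV; rewrite mxrank_eq0 => /eqP -> /submx0null.
    by move=> ->; case: sQ.
  right; apply/seteqP; split=> v; first exact: QU.
  move/preE => h; apply/hV; apply: submx_trans h _.
  suff /eqmxP : (V == U)%MS by move=> ->.
  rewrite -(mxrank_leqif_eq VU) eqn_leq mxrankS //=; apply: min.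
  by apply/asboolP; exists V.
have inK (w : 'rV_(\rank U)) : pre p [set 0]%classic (w *m io : repmod th).
  by apply/preE; rewrite -ioU; exact: submxMl.
have ofK (v : repmod th) : pre p [set 0]%classic v -> v = v *m io' *m io.
  by move/preE; rewrite -ioU => /submxP[B ->]; rewrite -(mulmxA B) i1 mulmx1.
have io_inj (w w' : 'rV_(\rank U)) : w *m io = w' *m io -> w = w'.
  by move/(congr1 (mulmx^~ io')); rewrite -!mulmxA i1 !mulmx1.
have irr1 : irreducible_module (repmod th1).
  split.
    exists (delta_mx 0 (Ordinal k0)); apply/eqP => /rowP/(_ (Ordinal k0)).
    by rewrite !mxE !eqxx => /eqP; rewrite oner_eq0.
  move=> P sP; pose Q : set (repmod th) := [set v | exists2 w, P w & v = w *m io]%classic.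
  have sQ : submodule Q.
    have [P0 PD] := sP; split; first by exists 0; rewrite ?mul0mx.
    move=> a _ _ [w Pw ->] [w' Pw' ->]; exists (a *: w + w'); first exact: PD.
    by rewrite mulmxDl !repmodE -!mulmxA c1.
  have [_ _ max] := st; case: (max Q sQ).
  - by move=> v /= ->; exists 0; [case: sP|rewrite mul0mx].
  - by move=> _ [w _ ->]; exact: inK.
  - move=> e; left; apply/seteqP; split=> w /=; last by move=> ->; case: sP.
    move=> Pw; have : Q (w *m io) by exists w.
    by rewrite e /= => h; apply: io_inj; rewrite h mul0mx.
  - move=> e; right; apply/seteqP; split=> w // _.
    have : Q (w *m io) by rewrite e; exact: inK.
    by case=> w' Pw' /io_inj ->.
have [t0 iso0] := N_exh irr1.
have subq t : subquotient_iso ([set 0]%classic : set (repmod th)) (pre p [set 0]%classic) (repmod (N t)) <-> t = t0.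
  split=> [[g [gl gs gk]]|->].
    apply: N_inj; apply: module_iso_trans iso0; apply: module_iso_sym.
    pose h (w : repmod th1) := g (w *m io).
    have hl : linear h.
      move=> a w w'; rewrite /h -gl; [|exact: inK|exact: inK].
      by rewrite mulmxDl !repmodE -!mulmxA c1.
    apply: (@module_iso_of _ _ _ h hl); apply: inj_surj_bij => [w w' e|y].
      have h0 : h (w - w') = 0.
        by have := hl (-1) w' w; rewrite !scaleN1r e addNr => <-; congr h; exact: addrC.
      have /(_ h0) := proj1 (gk _ (inK (w - w'))); rewrite /= => e0.
      by apply/eqP; rewrite -subr_eq0; apply/eqP/io_inj; rewrite e0 mul0mx.
    by have [v Kv gv] := gs y; exists (v *m io'); rewrite /h -(ofK v Kv).
  have [f [f' fK f'K]] := iso0; exists (fun v => f (v *m io')); split.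
  - move=> a v w /ofK ev /ofK ew; rewrite -linearP; congr (f _).
    by rewrite mulmxDl; congr (_ + _); rewrite !repmodE {1}ev -(mulmxA _ io) c1 -!mulmxA i1 mulmx1.
  - by move=> z; exists (f' z *m io); [exact: inK|rewrite -mulmxA i1 mulmx1 f'K].
  - move=> v Kv; split=> [|->]; last by rewrite mul0mx linear0.
    rewrite -(linear0 f) => /(can_inj fK) h; by rewrite /= (ofK v Kv) h mul0mx.
have lt2 : (\rank (cokermx U) < b)%N.
  by rewrite mxrank_coker; apply: (@leq_trans n); rewrite ?ltn_subrL ?k0.
have [k [c [hc hcount]]] := IH _ th2 lt2.
exists k.+1, (ext_series p c); split; first exact: ext_series_comp.
move=> a; rewrite eigD hcount (rep_iso iso0).
rewrite [RHS](eq_bigr (fun t => (t == t0) * eig1 (N t a) + #|[set i : 'I_k | `[< subquotient_iso (c i) (c i.+1) (repmod (N t)) >]]| * eig1 (N t a)))%N.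
  rewrite [RHS]big_split /=; congr (_ + _)%N; rewrite (bigD1 t0) //= eqxx mul1n big1 ?addn0 // => t /negPf ->.
  by rewrite mul0n.
move=> t _; rewrite -mulnDl; congr (_ * _)%N; rewrite (ext_series_count (repmod (N t)) ps hc).
by congr (nat_of_bool _ + _)%N; apply/asboolP/eqP => /subq.
Qed.
End Composition.

(** * Simple modules and decomposition numbers *)

Lemma quot_iso (A : pzRingType) (X M N : lmodType A) (f : {linear X -> M}) (p : {linear X -> N}) :
  (forall y, exists x, f x = y) -> (forall y, exists x, p x = y) -> (forall x, f x = 0 <-> p x = 0) ->
  module_iso M N.
Proof.
move=> /choice[s fs] ps ker.
have E x y : f x = f y <-> p x = p y.
  split=> /eqP; rewrite -subr_eq0 -linearB => /eqP/ker e; apply/eqP; rewrite -subr_eq0 -linearB; exact/eqP.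
apply: (@module_iso_of _ _ _ (p \o s)).
  by move=> a x y /=; rewrite -linearP; apply/E; rewrite linearP !fs.
apply: inj_surj_bij => [x y /= /E|y]; first by rewrite !fs.
by have [x <-] := ps y; exists (f x) => /=; apply/E; rewrite fs.
Qed.

Section Simples.
Variables (F : fieldType) (A : algType F).
Variables (d : Order.disp_t) (L : finPOrderType d) (I J : L -> finType).
Variable b : forall l, I l -> J l -> A.
Hypothesis hb : standard_basis b.
Local Notation above := (in_above b).

(** The bilinear form of the cell is not zero: the diagonal coefficient of b_ij at i is a value of
    the form ([cellrep_outer]). In these terms no index j0 has to be chosen. *)
Definition live (l : L) : bool := [exists p : I l * J l, lco hb (b p.1 p.2) p.1 p.1 != 0].

Section OneCell.
Variables (l : L) (j0 : J l).
Local Notation n := #|I l|.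
Local Notation Dl := (cellrep hb j0).

Definition gm (j : J l) : 'cV[F]_n := \col_k lco hb (b (enum_val k) j) (enum_val k) (enum_val k).

Lemma cellrep_outer (i : I l) (j : J l) : Dl (b i j) = gm j *m delta_mx 0 (enum_rank i).
Proof.
have gE j' i1 : gram hb j0 j' i1 = lco hb (b i1 j') i1 i1.
  by have := cellrep_b hb j0 i1 j' (enum_rank i1) (enum_rank i1); rewrite mxE !enum_rankK eqxx mulr1.
apply/matrixP => k k'; rewrite cellrep_b gE mxE big_ord1 !mxE !eqxx /=.
by congr (_ * (nat_of_bool _)%:R); rewrite -(inj_eq enum_val_inj) enum_rankK.
Qed.

Lemma cellrep_above x : above l x -> Dl x = 0.
Proof.
case=> c ->; rewrite ar_sum big1 // => -[m [i j]] lm; rewrite arZ -[std_elt _ _]/(b i j) cellrep_neq ?scaler0 //.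
by apply/negP => ml; have := Order.POrderTheory.lt_le_trans lm ml; rewrite Order.POrderTheory.ltxx.
Qed.

Definition rad : 'M[F]_n := (\bigcap_j kermx (gm j))%MS.

Lemma radP (v : 'rV_n) : reflect (forall j, v *m gm j = 0) (v <= rad)%MS.
Proof.
apply: (iffP idP) => [h j|h]; first by apply/sub_kermxP; apply: submx_trans h _; exact: bigcapmx_inf.
by apply/sub_bigcapmxP => j _; apply/sub_kermxP.
Qed.

Lemma mul_cellrep_b (v : 'rV_n) i j : v *m Dl (b i j) = (v *m gm j) 0 0 *: delta_mx 0 (enum_rank i).
Proof. by rewrite cellrep_outer mulmxA {1}[v *m gm j]mx11_scalar mul_scalar_mx. Qed.

(** Applying b_ij after a is applying b_ij a, which modulo higher cells is a combination of the
    b_ij'; these annihilate the radical, and higher cells act as 0. *)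
Lemma rad_stable : stable Dl rad.
Proof.
move=> a; apply/row_subP => k; rewrite row_mul; set v := row k rad.
have /radP hv : (v <= rad)%MS by exact: row_sub.
apply/radP => j; have vb (i : I l) (j' : J l) : v *m Dl (b i j') = 0 by rewrite mul_cellrep_b hv mxE scale0r.
case: (posnP n) => [n0|n_gt0].
  have -> : gm j = 0 by apply/matrixP => k1; have := ltn_ord k1; rewrite [X in (_ < X)%N]n0.
  by rewrite mulmx0.
pose i : I l := enum_val (Ordinal n_gt0).
have : v *m Dl a *m Dl (b i j) = 0.
  rewrite -mulmxA -arM -[b i j * a](subrK (\sum_j' rco hb a j' j *: b i j')) arD (cellrep_above (rcoP hb a i j)) add0r.
  by rewrite ar_sum mulmx_sumr big1 // => j' _; rewrite arZ -scalemxAr vb scaler0.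
rewrite mul_cellrep_b => /rowP/(_ (enum_rank i)); rewrite [LHS]mxE [X in _ * X]mxE !eqxx mulr1 [RHS]mxE => e.
by apply/matrixP => x y; rewrite !ord1 e [RHS]mxE.
Qed.

Variables (i0 : I l) (j1 : J l).
Local Notation g := (lco hb (b i0 j1) i0 i0).
Hypothesis g0 : g != 0.

Lemma eig1_cell : eig1 (Dl (g^-1 *: b i0 j1)) = 1%N.
Proof.
rewrite arZ cellrep_outer scalemxAl eig1_outer -rowE !mxE enum_rankK mulVf // eqxx.
by [].
Qed.

(** A vector outside the radical is sent by a suitable b_ij, for fixed j and every i, to a nonzero
    multiple of the i-th unit vector, so it generates the quotient. As b_ij annihilates the radical,
    its eigenvalue 1 on the cell survives in the quotient. *)
Lemma simple_ex : exists nt (th : antirep A nt) (p : {linear repmod Dl -> repmod th}),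
  [/\ irreducible_module (repmod th), forall y, exists x, p x = y,
      forall v, p v = 0 <-> (v <= rad)%MS, eig1 (th (g^-1 *: b i0 j1)) = 1%N
    & forall m (i : I m) (j : J m) z, ~~ (m <= l)%O -> eig1 (th (z *: b i j)) = 0%N].
Proof.
have [th1 [th2 [io [io' [pi [pi' [[c1 i1 ioU] [c2 p1 kU] eigD]]]]]]] := rep_split rad_stable.
have pl : linear (fun v : repmod Dl => (v *m pi : repmod th2)).
  by move=> a v w; rewrite mulmxDl !repmodE -!mulmxA c2.
have [p hp] := linear_ex pl.
have ps (y : repmod th2) : exists x, p x = y.
  by exists (y *m pi'); rewrite hp -mulmxA p1 mulmx1.
have pk v : p v = 0 <-> (v <= rad)%MS.
  rewrite hp -kU; split; first by move/sub_kermxP.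
  by move=> h; apply/sub_kermxP.
have th2E a : th2 a = pi' *m Dl a *m pi by rewrite -mulmxA c2 mulmxA p1 mul1mx.
exists _, th2, p; split=> //.
- split.
    exists (p (delta_mx 0 (enum_rank i0))); apply/eqP => /pk/radP/(_ j1).
    by rewrite -rowE => /matrixP/(_ 0 0); rewrite !mxE enum_rankK => /eqP; apply/negP.
  move=> P sP; case: (pselect (exists2 y, P y & y != 0)) => [[y Py y0]|h]; last first.
    left; apply/seteqP; split=> y /=; last by move=> ->; case: sP.
    by move=> Py; apply: contrapT => /eqP y0; apply: h; exists y.
  right; apply/seteqP; split=> // z _; have [v ev] := ps y; subst y.
  have [j hj] : exists j, v *m gm j != 0.
    apply: contrapT => hn; case/eqP: y0; apply/pk/radP => j; apply/eqP/negPn/negP => h.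
    by apply: hn; exists j.
  have [P0 PD] := sP.
  have Pe i : P (p (delta_mx 0 (enum_rank i))).
    have c0 : (v *m gm j) 0 0 != 0.
      by apply: contraNneq hj => e; rewrite [v *m gm j]mx11_scalar e raddf0.
    have := PD (((v *m gm j) 0 0)^-1 *: b i j) (p v) 0 Py P0; rewrite addr0 -linearZ /=.
    by rewrite repmodE arZ -scalemxAr mul_cellrep_b scalerA mulVf // scale1r.
  have [w <-] := ps z; have -> : w = \sum_k (w 0 k)%:A *: (delta_mx 0 k : repmod Dl).
    by rewrite {1}[w]row_sum_delta; apply: eq_bigr => k _; rewrite repmodZ.
  rewrite (big_morph p (linearD p) (linear0 p)); elim/big_ind: _ => //.
    by move=> x y Px Py'; have := PD 1 x y Px Py'; rewrite scale1r.
  move=> k _; rewrite linearZ /=; have := PD ((w 0 k)%:A) (p (delta_mx 0 k)) 0; rewrite addr0; apply=> //.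
  by have := Pe (enum_val k); rewrite enum_valK.
- have := eigD (g^-1 *: b i0 j1); rewrite eig1_cell; suff -> : th1 (g^-1 *: b i0 j1) = 0 by rewrite eig1_0.
  rewrite -[th1 _]mulmx1 -i1 mulmxA -c1.
  suff -> : io *m Dl (g^-1 *: b i0 j1) = 0 by rewrite mul0mx.
  apply/row_matrixP => k; rewrite row_mul arZ -scalemxAr mul_cellrep_b row0.
  have /radP -> : (row k io <= rad)%MS by apply: submx_trans (row_sub _ _) _; rewrite ioU.
  by rewrite mxE scale0r scaler0.
- move=> m i j z ml; rewrite th2E arZ cellrep_neq // scaler0 mulmx0 mul0mx; exact: eig1_0.
Qed.

End OneCell.
End Simples.

Section Exhaustive.
Variables (F : fieldType) (A : algType F).
Variables (d : Order.disp_t) (L : finPOrderType d) (I J : L -> finType).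
Variable b : forall l, I l -> J l -> A.
Hypothesis hb : standard_basis b.
Local Notation above := (in_above b).
Variables (M : lmodType A) (irrM : irreducible_module M).

(** Among the cells acting nontrivially on M, one with the largest number of smaller cells; the
    cells above it have more and act as 0. *)
Lemma top_cell : exists l, (forall x, above l x -> forall y : M, x *: y = 0) /\
  exists (i : I l) (j : J l) (y : M), b i j *: y != 0.
Proof.
have [[x0 nx0] _] := irrM.
pose S l := `[< exists (i : I l) (j : J l) (y : M), b i j *: y != 0 >].
have [l Sl] : exists l, S l.
  apply: contrapT => hn; case/eqP: nx0.
  rewrite -[x0]scale1r (bcoE (std_is_basis hb) 1) scaler_suml big1 // => -[l [i j]] _.
  rewrite -[_ *: std_elt _ _]mul1r -scalerAr scalerAl -scalerA.
  case: (eqVneq (b i j *: x0) 0) => [e|e]; first by rewrite -[std_elt _ _]/(b i j) e scaler0.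
  by case: hn; exists l; apply/asboolP; exists i, j, x0.
pose h (m : L) := #|[set m' | (m' < m)%O]|.
case: (@arg_maxnP _ l S h Sl) => m /asboolP Sm max; exists m; split=> // x [c ->] y.
rewrite scaler_suml big1 // => -[m' [i j]] mm'.
rewrite -[_ *: std_elt _ _]mul1r -scalerAr scalerAl -scalerA.
case: (eqVneq (b i j *: y) 0) => [e|e]; first by rewrite -[std_elt _ _]/(b i j) e scaler0.
have Sm' : S m' by apply/asboolP; exists i, j, y.
have lt : (h m < h m')%N.
  apply: proper_card; rewrite properE; apply/andP; split.
    by apply/fintype.subsetP => z; rewrite !finset.inE => zm; exact: Order.POrderTheory.lt_trans zm mm'.
  by apply/fintype.subsetPn; exists m; rewrite finset.inE // Order.POrderTheory.ltxx.
by have := leq_trans lt (max _ Sm'); rewrite ltnn.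
Qed.

Variables (l : L) (j0 : J l).
Hypothesis aboveM : forall x, above l x -> forall y : M, x *: y = 0.
Variables (i : I l) (j : J l) (y : M).
Hypothesis bij : b i j *: y != 0.
Local Notation Dl := (cellrep hb j0).

(** The vector v, read as an element of the j-th column of the cell, applied to y; a module map
    because the higher cells annihilate M. *)
Let phi (v : repmod Dl) : M := \sum_k (v 0 k)%:A *: (b (enum_val k) j *: y).

Let phi_linear : linear phi.
Proof.
have pD v w : phi (v + w) = phi v + phi w.
  by rewrite /phi -big_split /=; apply: eq_bigr => k _; rewrite mxE !scalerDl.
move=> a v w; rewrite pD; congr (_ + _).
have := cellrep_mul hb j a (fun k => v 0 k) => /aboveM/(_ y)/eqP.
rewrite scalerBl subr_eq0 => /eqP e.
have E (u : 'I_#|I l| -> F) : (\sum_k u k *: b (enum_val k) j) *: y = \sum_k (u k)%:A *: (b (enum_val k) j *: y).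
  by rewrite scaler_suml; apply: eq_bigr => k _; rewrite scalerA -scalerAl mul1r.
rewrite [in RHS]/phi -E scalerA e E /phi; apply: eq_bigr => k _; congr (_%:A *: _).
by rewrite repmodE mxE.
Qed.

Let phi_e (i' : I l) : phi (delta_mx 0 (enum_rank i')) = b i' j *: y.
Proof.
rewrite /phi (bigD1 (enum_rank i')) //= mxE !eqxx scale1r scale1r enum_rankK big1 ?addr0 // => k /negPf nk.
by rewrite mxE nk andbF scale0r scale0r.
Qed.

Let phi_sub : submodule (range phi).
Proof.
split; first by exists 0 => //; rewrite /phi big1 // => k _; rewrite mxE scale0r scale0r.
by move=> a _ _ [v _ <-] [w _ <-]; exists (a *: v + w) => //; rewrite phi_linear.
Qed.

Lemma phi_surj z : exists v, phi v = z.
Proof.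
have [_ /(_ _ phi_sub)[e|e]] := irrM; last first.
  have : range phi z by rewrite e.
  by case=> v _ <-; exists v.
have : range phi (b i j *: y) by exists (delta_mx 0 (enum_rank i)); rewrite ?phi_e.
by rewrite e /= => h; move: bij; rewrite h eqxx.
Qed.

Let b_phi (i' : I l) (j' : J l) v : b i' j' *: phi v = (((v : 'rV_ _) *m gm hb j') 0 0)%:A *: (b i' j *: y).
Proof.
have [f hf] := linear_ex phi_linear.
rewrite -hf -linearZ repmodE (mul_cellrep_b hb j0) -phi_e -hf -linearZ; congr (f _).
by rewrite repmodZ.
Qed.

Lemma phi_live : live hb l.
Proof.
have [v hv] := phi_surj y; apply/existsP; apply: contrapT => hn.
have g0 : gm hb j = 0.
  apply/matrixP => k x; rewrite !mxE; apply/eqP/negPn/negP => h; apply: hn; by exists (enum_val k, j).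
by case/negP: bij; rewrite -{1}hv b_phi g0 mulmx0 mxE !scale0r.
Qed.

(** If [phi v] = 0, then b_ij' acts on it by the value of the form times b_ij y, so all values
    vanish. Conversely, the elements of M annihilated by the whole cell form a submodule without y,
    which is 0 and contains [phi v] for v in the radical. *)
Lemma phi_ker v : phi v = 0 <-> (v <= rad hb l)%MS.
Proof.
split=> [pv|/radP hv].
  apply/radP => j'; apply/eqP/negPn/negP => nz.
  have c0 : ((v : 'rV_ _) *m gm hb j') 0 0 != 0.
    by apply: contraNneq nz => e; rewrite [X in X == _]mx11_scalar e raddf0.
  have inv (c : F) (m : M) : c != 0 -> c%:A *: m = 0 -> m = 0.
    move=> hc e; have -> : m = c^-1%:A *: (c%:A *: m).
      by rewrite scalerA -scalerAl mul1r scalerA mulVf // !scale1r.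
    by rewrite e scaler0.
  by have := b_phi i j' v; rewrite pv scaler0 => /esym/(inv _ _ c0) e; case/negP: bij; apply/eqP.
pose W : set M := [set m | forall (i' : I l) (j' : J l), b i' j' *: m = 0]%classic.
have sW : submodule W.
  split=> [i' j'|a m m' Wm Wm' i' j']; first by rewrite scaler0.
  rewrite scalerDr (Wm' i' j') addr0 scalerA -[b i' j' * a](subrK (\sum_j2 rco hb a j2 j' *: b i' j2)).
  rewrite scalerDl (aboveM (rcoP hb a i' j')) add0r scaler_suml big1 // => j2 _.
  by rewrite -[b i' j2]mul1r scalerAl -scalerA Wm scaler0.
have [_ /(_ _ sW)[e|e]] := irrM; last first.
  have : W y by rewrite e.
  by move=> /(_ i j) h; case/negP: bij; apply/eqP.
have : W (phi v) by move=> i' j'; rewrite b_phi hv mxE !scale0r.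
by rewrite e.
Qed.

Lemma phi_ex : exists f : {linear repmod Dl -> M}, (forall z, exists v, f v = z) /\
  forall v, f v = 0 <-> (v <= rad hb l)%MS.
Proof.
have [f hf] := linear_ex phi_linear; exists f; split=> [z|v]; last by rewrite hf; exact: phi_ker.
by have [v <-] := phi_surj z; exists v.
Qed.

End Exhaustive.

Section SimplesEx.
Variables (F : fieldType) (A : algType F).
Variables (d : Order.disp_t) (L : finPOrderType d) (I J : L -> finType).
Variable b : forall l, I l -> J l -> A.
Hypothesis hb : standard_basis b.

Definition live_index : finType := {l : L | live hb l}.

Theorem simples_ex : exists (dim : live_index -> nat) (N : forall t, antirep A (dim t)) (a : live_index -> A),
  [/\ forall t, irreducible_module (repmod (N t)),
      forall M : lmodType A, irreducible_module M -> exists t, module_iso M (repmod (N t)),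
      forall t t', (eig1 (N t' (a t)) != 0)%N -> (val t <= val t')%O,
      forall t, eig1 (N t (a t)) = 1%N
    & forall t l (j0 : J l), (eig1 (cellrep hb j0 (a t)) != 0 -> (val t <= l)%O)%N /\
       (l = val t -> eig1 (cellrep hb j0 (a t)) = 1%N)].
Proof.
have H (t : live_index) : exists (S : {n : nat & antirep A n}) (a : A),
  [/\ irreducible_module (repmod (tagged S)),
      forall M : lmodType A, irreducible_module M ->
        (forall x, in_above b (val t) x -> forall y : M, x *: y = 0) ->
        (exists (i : I (val t)) (j : J (val t)) (y : M), b i j *: y != 0) -> module_iso M (repmod (tagged S)),
      eig1 (tagged S a) = 1%N,
      (exists z (i : I (val t)) (j : J (val t)), a = z *: b i j /\ forall j0 : J (val t), eig1 (cellrep hb j0 a) = 1%N)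
    & forall m (i : I m) (j : J m) z, ~~ (m <= val t)%O -> eig1 (tagged S (z *: b i j)) = 0%N].
  case: t => l /existsP[[i0 j1] /= g0].
  have [nt [th [p [irr ps pk e1 e0]]]] := simple_ex j1 g0.
  exists (Tagged _ th), ((lco hb (b i0 j1) i0 i0)^-1 *: b i0 j1); split=> //= [M irrM aM [i [j [y hy]]]|].
    have [f [fs fk]] := phi_ex hb irrM j1 aM hy.
    by apply: (quot_iso fs ps) => x; rewrite fk pk.
  by exists (lco hb (b i0 j1) i0 i0)^-1, i0, j1; split=> // j0; exact: eig1_cell.
have [S hS] := choice H; have [a ha] := choice hS.
exists (fun t => tag (S t)), (fun t => tagged (S t)), a; split.
- by move=> t; have [] := ha t.
- move=> M irrM; have [l [aM hy]] := top_cell hb irrM; have [i [j [y hb0]]] := hy.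
  have ll : live hb l := phi_live hb irrM j aM hb0.
  exists (exist _ l ll); have [_ h _ _ _] := ha (exist _ l ll); exact: h.
- move=> t t'; apply: contraR => h; have [_ _ _ [z [i [j [-> _]]]] _] := ha t.
  by have [_ _ _ _ e0] := ha t'; rewrite e0.
- by move=> t; have [] := ha t.
- move=> t l j0; have [_ _ _ [z [i [j [-> h]]]] _] := ha t; split.
    by apply: contraR => nl; rewrite arZ cellrep_neq // scaler0 eig1_0.
  by move=> e; subst l; exact: h.
Qed.
End SimplesEx.

(** * Cell modules of a semisimple algebra *)

Section Semisimple.
Variables (F : fieldType) (A : algType F).
Variables (d : Order.disp_t) (L : finPOrderType d) (I J : L -> finType).
Variable b : forall l, I l -> J l -> A.
Hypothesis hb : standard_basis b.
Hypothesis ss : semisimple_ring A.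
Local Notation above := (in_above b).

(* An element z of the left ideal attached to the radical lies in A z + A^(>l),
   and a complement of this left ideal gives z = z y with y in it, whence z is
   in A^(>l) because z A z is. *)
Lemma semisimple_rad l (j0 : J l) (v : 'rV[F]_#|I l|) : (v <= rad hb l)%MS -> v = 0.
Proof.
move=> hv; pose zz (u : 'rV[F]_#|I l|) : A := \sum_k u 0 k *: b (enum_val k) j0.
have mulz a u : above l (a * zz u - zz (u *m cellrep hb j0 a)).
  have := cellrep_mul hb j0 a (fun k => u 0 k); rewrite -/(zz u).
  by congr (above l (_ - _)); apply: eq_bigr => k _; rewrite mxE.
have z_rad u u' : (u' <= rad hb l)%MS -> above l (zz u * zz u').
  move=> hu'; rewrite {1}/zz mulr_suml; apply: above_sum => // k _; rewrite -scalerAl; apply: aboveZ => //.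
  have := mulz (b (enum_val k) j0) u'; rewrite mul_cellrep_b.
  rewrite (elimT (radP hb _) hu') mxE scale0r.
  by have -> : zz 0 = 0; [rewrite /zz big1 // => i _; rewrite mxE scale0r|rewrite subr0].
pose z := zz v.
pose P : set A^o := [set x | exists a w, above l w /\ x = a * z + w]%classic.
have sP : submodule P.
  split; first by exists 0, 0; split; [exact: above0|rewrite mul0r addr0].
  move=> c _ _ [a [w [hw ->]]] [a' [w' [hw' ->]]]; exists (c * a + a'), (c * w + w'); split.
    by apply: aboveD => //; exact: above_mulL.
  by rewrite -[_ *: _]/(c * (a * z + w)) mulrDr mulrDl mulrA addrACA.
have [P' [sP' PP' dec]] := ss sP.
have [y [y' [Py Py' e1]]] := dec 1.
have Pz : P z by exists 1, 0; split; [exact: above0|rewrite mul1r addr0].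
have zy' : z * y' = 0.
  have : (P `&` P')%classic (z * y').
    split; last by have [P0 PD] := sP'; have := PD z y' 0 Py' P0; rewrite addr0.
    have -> : z * y' = z - z * y by rewrite -[X in X - _]mulr1 {1}e1 mulrDr addrC addKr.
    have [P0 PD] := sP; have Pzy : P (z * y) by have := PD z y 0 Py P0; rewrite addr0.
    exact: (submoduleB sP Pz Pzy).
  by rewrite PP'.
have ez : z = z * y by rewrite -[LHS]mulr1 e1 mulrDr zy' addr0.
have [a [w [hw ey]]] := Py.
have az : above l z.
  rewrite ez ey mulrDr; apply: aboveD => //; last exact: above_mulL.
  rewrite -[a * z](subrK (zz (v *m cellrep hb j0 a))) mulrDr; apply: aboveD => //.
    by apply: above_mulL => //; exact: mulz.
  by apply: z_rad; apply: submx_trans (rad_stable hb j0 a); exact: submxMr.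
apply/rowP => k; rewrite mxE; move/(aboveP hb): az => /(_ (Xi (enum_val k) j0)).
rewrite /= Order.POrderTheory.ltxx => /(_ isT).
rewrite sc_sum (bigD1 k) //= /sc bcoZ -/(sc hb _ _) sc_bl !eqxx mulr1 big1 ?addr0 // => i /negPf ik.
by rewrite bcoZ -/(sc hb _ _) sc_bl (inj_eq enum_val_inj) ik mulr0.
Qed.

Lemma semisimple_live l (i : I l) (j : J l) : live hb l.
Proof.
apply/existsP; apply: contrapT => hn.
have : delta_mx 0 (enum_rank i) = 0 :> 'rV[F]_#|I l|.
  apply: (semisimple_rad j); apply/(radP hb) => j'; apply/matrixP => k k'.
  rewrite mxE big1 ?mxE // => x _; rewrite mxE.
  suff -> : gm hb j' x k' = 0 by rewrite mulr0.
  by rewrite mxE; apply/eqP/negPn/negP => h; apply: hn; exists (enum_val x, j').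
by move/rowP/(_ (enum_rank i)); rewrite !mxE !eqxx => /eqP; rewrite oner_eq0.
Qed.

Lemma cell_irreducible l (i : I l) (j0 : J l) : irreducible_module (repmod (cellrep hb j0)).
Proof.
have /existsP[[i0 j1] /= g0] := semisimple_live i j0.
have [nt [th [p [irr ps pk _ _]]]] := simple_ex j0 g0.
apply: iso_irreducible irr; have [f hf] := linear_ex (f := @id (repmod (cellrep hb j0))) (fun _ _ _ => erefl).
apply: (quot_iso (f := f) (p := p)) => // [y|v]; first by exists y.
rewrite pk hf; split=> [->|]; first exact: sub0mx.
exact: semisimple_rad.
Qed.

Lemma cell_exhaustive (M : lmodType A) : irreducible_module M ->
  exists l (i : I l) (j : J l), forall j0 : J l, module_iso M (repmod (cellrep hb j0)).
Proof.
move=> irr; have [l [aM [i [j [y hy]]]]] := top_cell hb irr; exists l, i, j => j0.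
have [f [fs fk]] := phi_ex hb irr j0 aM hy.
have [f' hf] := linear_ex (f := @id (repmod (cellrep hb j0))) (fun _ _ _ => erefl).
apply: (quot_iso (f := f) (p := f')) => // [x|v]; first by exists x.
rewrite fk hf; split=> [|->]; [exact: semisimple_rad|exact: sub0mx].
Qed.

(** The element a t of the cell l has eigenvalue 1 only on cells at or above l, so isomorphic cell
    modules give l <= l' and l' <= l. *)
Lemma cell_iso_eq l l' (i : I l) (j0 : J l) (i' : I l') (j0' : J l') :
  module_iso (repmod (cellrep hb j0)) (repmod (cellrep hb j0')) -> l = l'.
Proof.
move=> iso; have [dim [N [a [_ _ _ _ h]]]] := simples_ex hb.
have e x := rep_iso iso x.
apply/eqP; rewrite Order.POrderTheory.eq_le; apply/andP; split.
  have [+ _] := h (exist _ l (semisimple_live i j0)) l' j0'; apply.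
  by rewrite -e; have [_ ->] := h (exist _ l (semisimple_live i j0)) l j0.
have [+ _] := h (exist _ l' (semisimple_live i' j0')) l j0; apply.
by rewrite e; have [_ ->] := h (exist _ l' (semisimple_live i' j0')) l' j0'.
Qed.
End Semisimple.

Lemma ext_unique (A A' : pzRingType) (f : {rmorphism A -> A'}) (M1 M2 : lmodType A) (N1 N2 : lmodType A')
  (i1 : M1 -> N1) (i2 : M2 -> N2) :
  extension_of_scalars f i1 -> extension_of_scalars f i2 -> module_iso M1 M2 -> module_iso N1 N2.
Proof.
move=> e1 e2 iso; have [s [s' sK s'K]] := iso.
have s'l : linear s' by move=> a x y; apply: (can_inj sK); rewrite linearP !s'K.
have g1 : linear_for (f \; *:%R) (i2 \o s) by move=> a x y; rewrite /= linearP; exact: e2.1.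
have g2 : linear_for (f \; *:%R) (i1 \o s') by move=> a x y; rewrite /= s'l; exact: e1.1.
have [h1 [[l1 c1] _]] := e1.2 _ _ g1; have [h2 [[l2 c2] _]] := e2.2 _ _ g2.
have h21 : h2 \o h1 = id.
  have [h [_ u]] := e1.2 _ _ e1.1; transitivity h; last by apply: u; split.
  apply/esym/u; split=> [a x y|x] /=; first by rewrite l1 l2.
  by rewrite c1 /= c2 /= sK.
have h12 : h1 \o h2 = id.
  have [h [_ u]] := e2.2 _ _ e2.1; transitivity h; last by apply: u; split.
  apply/esym/u; split=> [a x y|x] /=; first by rewrite l2 l1.
  by rewrite c2 /= c1 /= s'K.
apply: (@module_iso_of _ _ _ h1 l1); exists h2 => x.
  exact: (congr1 (fun g => g x) h21).
exact: (congr1 (fun g => g x) h12).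
Qed.

Lemma free_repmod (R : comNzRingType) (B : algType R) n (th : antirep B n) : free_over_base (repmod th).
Proof.
have sE (c : R) (v : repmod th) : c%:A *: v = (c *: (v : 'rV_n) : 'rV_n) :> 'rV_n.
  by rewrite repmodE arZ ar1 -scalemxAr mulmx1.
exists n, (fun k => delta_mx 0 k) => x; exists [ffun k => (x : 'rV_n) 0 k]; split.
  by rewrite {1}[x]row_sum_delta; apply: eq_bigr => k _; rewrite ffunE sE.
move=> c ex; apply/ffunP => k; rewrite ffunE ex.
under eq_bigr => j _ do rewrite sE.
rewrite summxE (bigD1 k) //= !mxE !eqxx mulr1 big1 ?addr0 // => j /negPf jk.
by rewrite !mxE eq_sym jk andbF mulr0.
Qed.

Lemma free_over_base_rep (R : comNzRingType) (B : algType R) (X : lmodType B) : free_over_base X ->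
  exists n (th : antirep B n), module_iso X (repmod th).
Proof.
case=> n [e he]; have /choice[co hco] x := he x.
have coE x : x = \sum_i (co x i)%:A *: e i by case: (hco x).
have coU x (c : 'I_n -> R) : x = \sum_i (c i)%:A *: e i -> forall i, co x i = c i.
  move=> ec i; have [_ /(_ [ffun i => c i]) ->] := hco x; first by rewrite ffunE.
  by rewrite ec; apply: eq_bigr => j _; rewrite ffunE.
have coD x y i : co (x + y) i = co x i + co y i.
  apply: (coU _ (fun i => co x i + co y i)); rewrite {1}[x]coE {1}[y]coE -big_split /=.
  by apply: eq_bigr => j _; rewrite !scalerDl.
have co0 i : co 0 i = 0 by apply: (coU _ (fun=> 0)); rewrite big1 // => j _; rewrite !scale0r.
have coZ c x i : co (c%:A *: x) i = c * co x i.
  apply: (coU _ (fun i => c * co x i)); rewrite {1}[x]coE scaler_sumr.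
  by apply: eq_bigr => j _; rewrite scalerA -scalerAl mul1r scalerA.
have coS (S : Type) (s : seq S) (F : S -> X) i : co (\sum_(j <- s) F j) i = \sum_(j <- s) co (F j) i.
  by apply: (big_morph (fun x => co x i)) => [x y|]; rewrite ?coD ?co0.
have coe i j : co (e i) j = (i == j)%:R.
  apply: (coU _ (fun j => (i == j)%:R)); rewrite (bigD1 i) //= eqxx !scale1r big1 ?addr0 // => k.
  by rewrite eq_sym => /negPf ->; rewrite !scale0r.
pose f b : 'M[R]_n := \matrix_(i, j) co (b *: e i) j.
pose s x : 'rV[R]_n := \row_i co x i.
have fs b x : s (b *: x) = s x *m f b.
  apply/rowP => j; rewrite !mxE {1}[x]coE scaler_sumr coS; apply: eq_bigr => i _.
  rewrite !mxE -coZ; congr (co _ _); rewrite !scalerA; congr (_ *: _).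
  by rewrite -scalerAr mulr1 -scalerAl mul1r.
have fl z x y : f (z *: x + y) = z *: f x + f y.
  apply/matrixP => i j; rewrite !mxE scalerDl coD -coZ; congr (co _ _ + _).
  by rewrite scalerA -scalerAl mul1r.
have f1 : f 1 = 1%:M by apply/matrixP => i j; rewrite !mxE scale1r coe.
have fM x y : f (x * y) = f y *m f x.
  apply/row_matrixP => i; rewrite row_mul; transitivity (s ((x * y) *: e i)).
    by apply/rowP => j; rewrite !mxE.
  by rewrite -scalerA fs; congr (_ *m _); apply/rowP => j; rewrite !mxE.
exists n, (Antirep fl f1 fM); apply: (@module_iso_of _ X (repmod (Antirep fl f1 fM)) s).
  by move=> a x y; rewrite repmodE -fs; apply/rowP => j; rewrite !mxE coD.
apply: inj_surj_bij => [x y e1|v].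
  by rewrite [x]coE [y]coE; apply: eq_bigr => i _; have /rowP/(_ i) := e1; rewrite !mxE => ->.
exists (\sum_i ((v : 'rV_n) 0 i)%:A *: e i); apply/rowP => j; rewrite mxE; exact: (coU _ (fun i => v 0 i)).
Qed.

(** * Decomposition numbers of the cell modules *)

Section Decomposition.
Variables (R : idomainType) (B : algType R) (BQ : algType {fraction R}) (jQ : {rmorphism B -> BQ}).
Variables (F : fieldType) (pi : {rmorphism R -> F}) (BF : algType F) (jF : {rmorphism B -> BF}).
Hypotheses (eQ : algebra_base_change (@tofrac R) jQ) (eF : algebra_base_change pi jF).
Hypotheses (pi_surj : forall y, exists x, pi x = y) (ssQ : semisimple_ring BQ).
Variables (d : Order.disp_t) (L : finPOrderType d) (I J : L -> finType).
Variable b : forall l, I l -> J l -> B.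
Hypothesis hB : standard_basis b.
Let hQ := ext_standard_basis eQ hB.
Let hF := ext_standard_basis eF hB.

Lemma jF_surj y : exists x, jF x = y.
Proof.
move: y; apply: (ext_ind eF (std_is_basis hB)) => [z _ _ [x <-] [y <-]|x]; last by exists x.
have [r <-] := pi_surj z; exists (r *: x + y).
by rewrite rmorphD; congr (_ + _); exact: (extZ eF).
Qed.

(* Reduction modulo the maximal ideal preserves the characteristic polynomials,
   which do not depend on the lattice. *)
Lemma lattice_eig1 n n' (th : antirep B n) (th' : antirep B n')
  (thQ : antirep BQ n) (thQ' : antirep BQ n') (thF : antirep BF n) (thF' : antirep BF n') :
  (forall x, thQ (jQ x) = map_mx (@tofrac R) (th x)) -> (forall x, thQ' (jQ x) = map_mx (@tofrac R) (th' x)) ->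
  (forall x, thF (jF x) = map_mx pi (th x)) -> (forall x, thF' (jF x) = map_mx pi (th' x)) ->
  module_iso (repmod thQ) (repmod thQ') -> forall a, eig1 (thF a) = eig1 (thF' a).
Proof.
move=> hq hq' hf hf' iso a; have [x <-] := jF_surj a; rewrite /eig1 hf hf' -!map_char_poly; congr (mup _ (map_poly _ _)).
have := rep_iso_char_poly iso (jQ x); rewrite hq hq' -!map_char_poly.
by apply: map_inj_poly; [move=> r r' /eqP; rewrite tofrac_eq => /eqP|exact: rmorph0].
Qed.

Let T := live_index hF.
Variables (dim : T -> nat) (N : forall t, antirep BF (dim t)) (a : T -> BF).
Hypotheses (N_irr : forall t, irreducible_module (repmod (N t)))
  (N_exh : forall M : lmodType BF, irreducible_module M -> exists t, module_iso M (repmod (N t)))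
  (N_le : forall t t', (eig1 (N t' (a t)) != 0)%N -> (val t <= val t')%O)
  (N_1 : forall t, eig1 (N t (a t)) = 1%N)
  (N_cell : forall t l (j0 : J l), (eig1 (cellrep hF j0 (a t)) != 0 -> (val t <= l)%O)%N /\
       (l = val t -> eig1 (cellrep hF j0 (a t)) = 1%N)).

Lemma N_inj t t' : module_iso (repmod (N t)) (repmod (N t')) -> t = t'.
Proof.
move=> iso; have e := rep_iso iso; apply/val_inj/eqP; rewrite Order.POrderTheory.eq_le.
by rewrite !N_le // ?e ?N_1 // -e N_1.
Qed.

(** The multiplicities together with the linear system they satisfy, which determines them by
    [mults_uniq]. *)
Definition mults n (th : antirep BF n) (x : T -> nat) :=
  (forall t, multiplicity (repmod th) (repmod (N t)) (x t)) /\
  forall c, eig1 (th c) = (\sum_t x t * eig1 (N t c))%N.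

Lemma mults_ex n (th : antirep BF n) : exists x, mults th x.
Proof.
have [k [c [hc e]]] := comp_series_ex (fun n' th' => @N_exh (repmod th')) N_inj th.
by eexists; split; [move=> t; exists k, c; split; [exact: hc|reflexivity]|exact: e].
Qed.

Let ht (l : L) := #|[set m | (m < l)%O]|.
Lemma ht_lt l m : (l < m)%O -> (ht l < ht m)%N.
Proof.
move=> lm; apply: proper_card; rewrite properE; apply/andP; split.
  by apply/fintype.subsetP => z; rewrite !finset.inE => zl; exact: Order.POrderTheory.lt_trans zl lm.
by apply/fintype.subsetPn; exists l; rewrite finset.inE // Order.POrderTheory.ltxx.
Qed.

Lemma sum_at (x : T -> nat) t : (\sum_t' x t' * eig1 (N t' (a t)) =
  x t + \sum_(t' | (val t < val t')%O) x t' * eig1 (N t' (a t)))%N.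
Proof.
rewrite (bigD1 t) //= N_1 muln1; congr (_ + _)%N; rewrite big_mkcond [RHS]big_mkcond; apply: eq_bigr => t' _.
rewrite Order.POrderTheory.lt_neqAle (inj_eq val_inj) [t' == t]eq_sym; case: (t == t') => //=.
case: (boolP (val t <= val t')%O) => // nle; suff -> : eig1 (N t' (a t)) = 0%N by rewrite muln0.
by apply/eqP; apply: contraNT nle; exact: N_le.
Qed.

(** At c = a t the system gives x t plus terms of strictly larger cells, so it is solved by
    descending induction on the height. *)
Lemma mults_uniq n n' (th : antirep BF n) (th' : antirep BF n') x x' :
  (forall c, eig1 (th c) = eig1 (th' c)) -> mults th x -> mults th' x' -> x =1 x'.
Proof.
move=> e [_ ex] [_ ex'] t.
move: {2}(#|L| - ht (val t)).+1%N (ltnSn (#|L| - ht (val t))%N) => k; elim: k t => // k IH t hk.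
have := e (a t); rewrite ex ex' !sum_at.
rewrite (eq_bigr (fun t' => x' t' * eig1 (N t' (a t)))%N); first by move/addIn.
move=> t' lt; rewrite IH //; apply: (@leq_trans (#|L| - ht (val t))%N); last by rewrite -ltnS.
apply: ltn_sub2l (ht_lt lt); exact: leq_trans (ht_lt lt) (max_card _).
Qed.

(** A nonzero x t makes [eig1] of a t nonzero on the cell l, so val t <= l. When l = val t that
    [eig1] is 1, and no strictly larger simple can contribute, which leaves x t = 1. *)
Lemma mults_cell l (j0 : J l) x t : mults (cellrep hF j0) x ->
  (x t != 0 -> (val t <= l)%O)%N /\ (l = val t -> x t = 1%N).
Proof.
case=> _ ex; have le t' : (x t' != 0)%N -> (val t' <= l)%O.
  move=> nx; apply: (N_cell t' j0).1; rewrite ex sum_at; move: nx; by case: (x t').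
split; first exact: le.
move=> e; have := (N_cell t j0).2 e; rewrite ex sum_at big1 ?addn0 // => t' lt.
case: (eqVneq (x t') 0%N) => [->//|/le].
by rewrite e => le'; have := Order.POrderTheory.lt_le_trans lt le'; rewrite Order.POrderTheory.ltxx.
Qed.

(** The cell module over B is one lattice. Any other lattice has a reduction with the same [eig1]
    for all elements ([lattice_eig1]), hence with the same multiplicities. *)
Lemma cell_decomposition_number l (j0 : J l) x t : mults (cellrep hF j0) x ->
  decomposition_number jQ jF (repmod (N t)) (repmod (cellrep hQ j0)) (x t).
Proof.
move=> hx; split.
  exists (repmod (cellrep hB j0)), (map_mx (@tofrac R)); split; first exact: free_repmod.
  apply: (ext_repmod eQ (std_is_basis hB)) => y; exact: (ext_cellrep eQ hB j0 y).
move=> X i XF j fX eX eXF.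
have [n [th iso]] := free_over_base_rep fX.
have [thQ hq] := ext_antirep eQ (std_is_basis hB) th.
have [thF hf] := ext_antirep eF (std_is_basis hB) th.
have isoF := ext_unique eXF (ext_repmod eF (std_is_basis hB) hf) iso.
have isoQ := ext_unique eX (ext_repmod eQ (std_is_basis hB) hq) iso.
apply: multiplicity_iso isoF _; have [x' hx'] := mults_ex thF.
rewrite (mults_uniq _ hx hx'); first exact: hx'.1.
apply: lattice_eig1 isoQ => // y; first exact: (ext_cellrep eQ hB j0 y).
exact: (ext_cellrep eF hB j0 y).
Qed.

End Decomposition.

Theorem decomposition_unitriangular (R : idomainType) (B : algType R) (BQ : algType {fraction R})
  (jQ : {rmorphism B -> BQ}) (F : fieldType) (pi : {rmorphism R -> F}) (BF : algType F)
  (jF : {rmorphism B -> BF}) :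
  standardly_based B -> algebra_base_change (@tofrac R) jQ -> algebra_base_change pi jF ->
  (forall y, exists x, pi x = y) -> semisimple_ring BQ ->
  exists (p q : nat) (D : 'M[nat]_(p, q)), decomposition_matrix jQ jF D /\ unitriangular D.
Proof.
move=> [d [L [I [J [b hB]]]]] eQ eF pi_surj ssQ.
pose hQ := ext_standard_basis eQ hB; pose hF := ext_standard_basis eF hB.
have [dim [N [a [N_irr N_exh N_le N_1 N_cell]]]] := simples_ex hF.
pose T := live_index hF.
(* The nonempty cells: over the fraction field these give all the irreducible modules, by
   semisimplicity. *)
pose QI : finType := {l : L | [exists i : I l, true] && [exists j : J l, true]}.
have j0 (x : QI) : J (val x).
  by have /cid[j _] : exists j : J (val x), true by apply/existsP; case/andP: (valP x).
have i0 (x : QI) : I (val x).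
  by have /cid[i _] : exists i : I (val x), true by apply/existsP; case/andP: (valP x).
have live_ne (t : T) : [exists i : I (val t), true] && [exists j : J (val t), true].
  case/existsP: (valP t) => -[i j] _; apply/andP; split; apply/existsP; by [exists i|exists j].
pose toQ (t : T) : QI := exist _ (val t) (live_ne t).
have toQ_inj : injective toQ by move=> t t' /(congr1 val) /= /val_inj.
pose ht (l : L) := #|[set m | (m < l)%O]|.
(* Sorting by the number of smaller cells extends the partial order to a linear one. *)
have [rows [rows_all rows_uniq rows_sorted]] : exists rows : seq T, [/\ forall t, t \in rows,
    uniq rows & sorted (fun t t' : T => ht (val t) <= ht (val t'))%N rows].
  exists (sort (fun t t' : T => ht (val t) <= ht (val t'))%N (enum T)).
  split=> [t||]; rewrite ?mem_sort ?mem_enum ?sort_uniq ?enum_uniq //.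
  by apply: sort_sorted => t t'; exact: leq_total.
(* Live cells over the residue field are nonempty, so they also label columns; these come first and
   in the order of the rows, which puts the ones on the diagonal. *)
have [cols ecols] : exists cols, cols = map toQ rows ++ [seq x <- enum QI | x \notin map toQ rows] by eexists.
have cols_all x : x \in cols by rewrite ecols mem_cat mem_filter mem_enum andbT orbN.
have cols_uniq : uniq cols.
  rewrite ecols cat_uniq map_inj_uniq // rows_uniq filter_uniq ?enum_uniq // andbT /=.
  by apply/hasPn => x; rewrite mem_filter => /andP[].
pose row (i : 'I_(size rows)) : T := tnth (in_tuple rows) i.
pose col (j : 'I_(size cols)) : QI := tnth (in_tuple cols) j.
have row_inj : injective row by apply/tuple_uniqP.
have col_inj : injective col by apply/tuple_uniqP.
have /choice[x hx] (u : QI) := mults_ex N_exh N_le N_1 (cellrep hF (j0 u)).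
exists (size rows), (size cols), (\matrix_(i, j) x (col j) (row i)); split.
  exists (fun i => repmod (N (row i))), (fun j => repmod (cellrep hQ (j0 (col j)))); split.
  - split=> [i|i i' /(N_inj N_le N_1)/row_inj//|M /N_exh[t iso]]; first exact: N_irr.
    by have /(tnthP (in_tuple rows))[i ei] := rows_all t; exists i; rewrite /row -ei.
  - split=> [j|j j' iso|M /(cell_exhaustive hQ ssQ)[l [i [j iso]]]].
    + by apply: (cell_irreducible hQ ssQ (i0 (col j))).
    + apply/col_inj/val_inj; exact: (cell_iso_eq ssQ (i0 _) (i0 _) iso).
    have ne : [exists i : I l, true] && [exists j : J l, true].
      by apply/andP; split; apply/existsP; [exists i|exists j].
    have /(tnthP (in_tuple cols))[k ek] := cols_all (exist _ l ne); exists k.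
    by rewrite /col -ek; exact: (iso (j0 (exist _ l ne))).
  by move=> i j; rewrite mxE; exact: (cell_decomposition_number eQ pi_surj N_exh N_le N_1 (row i) (hx (col j))).

have size_le : (size rows <= size cols)%N by rewrite ecols size_cat size_map leq_addr.
have col_row (i : 'I_(size rows)) (j : 'I_(size cols)) : i = j :> nat -> col j = toQ (row i).
  move=> e; rewrite /col /row !(tnth_nth (toQ (row i))) /= -e ecols nth_cat size_map ltn_ord.
  by rewrite (nth_map (row i)) // (tnth_nth (row i)).
split=> // i j; rewrite mxE; split=> [ji|ij]; last first.
  by apply: ((mults_cell N_le N_1 N_cell (row i) (hx (col j))).2); rewrite (col_row i j ij).
have jr : (j < size rows)%N := ltn_trans ji (ltn_ord i).
pose i' := Ordinal jr; have e := col_row i' j erefl.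
(* A nonzero entry below the diagonal would put the cell of row i strictly below that of the earlier
   row j, against the sorting. *)
apply/eqP/negPn/negP => nx; have le := (mults_cell N_le N_1 N_cell (row i) (hx (col j))).1 nx.
rewrite e /= in le; have ne : row i != row i'.
  by rewrite (inj_eq row_inj) -val_eqE /= gtn_eqF.
have lt : (val (row i) < val (row i'))%O by rewrite Order.POrderTheory.lt_neqAle le andbT (inj_eq val_inj).
have : (ht (val (row i')) <= ht (val (row i)))%N.
  have tr : transitive (fun t t' : T => ht (val t) <= ht (val t'))%N by move=> t t' t''; exact: leq_trans.
  have nthE k : row k = nth (row i) rows k by rewrite {1}/row (tnth_nth (row i)).
  rewrite (nthE i') {2}(nthE i).
  exact: (sorted_ltn_nth tr (row i) rows_sorted _ _ jr (ltn_ord i) ji).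
by rewrite leqNgt (ht_lt lt).
Qed.

Theorem theorem5p4p4
    (n r : nat) (n_gt0 : (0 < n)%N) (r_gt0 : (0 < r)%N)
    (H : heckeAlg r) (st : schur_type)
    (Snat : algType (Znat r)) (iS : {rmorphism schur_alg st H n_gt0 -> Snat})
    (hS : algebra_base_change (@laurent_incl (bad_primes r)) iS) :
  standardly_based Snat /\
  forall (R : idomainType) (phi : {rmorphism Znat r -> R})
    (m : set R) (k : nat) (F : fieldType) (pi : {rmorphism R -> F})
    (B : algType R) (iB : {rmorphism Snat -> B})
    (BQ : algType {fraction R}) (jQ : {rmorphism B -> BQ})
    (BF : algType F) (jF : {rmorphism B -> BF}),
    regular_local m k -> (k <= 2)%N -> residue_field m pi ->
    algebra_base_change phi iB ->
    algebra_base_change (@tofrac R) jQ ->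
    algebra_base_change pi jF ->
    semisimple_ring BQ ->
    exists (p q : nat) (D : 'M[nat]_(p, q)),
      decomposition_matrix jQ jF D /\ unitriangular D.
Proof.
have stdS : standardly_based Snat := standardly_based_ext hS (schur_standardly_based st n_gt0 r_gt0 H).
split=> // R phi m k F pi B iB BQ jQ BF jF _ _ [pi_surj _] eB eQ eF ssQ.
apply: (decomposition_unitriangular _ eQ eF pi_surj ssQ).
exact: standardly_based_ext eB stdS.
Qed.
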